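(* Assume that one of the following holds: (SSC1) case (C1) holds and $|c_0|<\min\left(\frac{\sqrt a}{c_2-c_1},\frac{1}{c_2-c_1}\right)$; (C2) case (C2) holds; (SSC3) case (C3) holds, $a=1$, and $|c_0|<\frac{1}{c_2-c_1}$. Then the $C_0$-semigroup of contractions $(e^{t\mathcal{A}})_{t\ge0}$ generated by $\mathcal{A}$ is strongly stable in $\mathcal{H}$; i.e. for all $U_0\in\mathcal{H}$, the solution $U(t)=e^{t\mathcal{A}}U_0$ of $U_t=\mathcal{A}U$, $U(0)=U_0$, satisfies $\lim_{t\to+\infty}\|e^{t\mathcal{A}}U_0\|_{\mathcal{H}}=0$.
   Context: All functions are complex valued. Let $L>0$ and $a>0$ be constants, let $b_0,d_0>0$ and $c_0\in\mathbb{R}\setminus\{0\}$, and let $\chi_{(\alpha,\beta)}$ denote the indicator function of the interval $(\alpha,\beta)$. The three cases for the coefficients are: (C1) $b=b_0\chi_{(b_1,b_2)}$, $c=c_0\chi_{(c_1,c_2)}$, $d=d_0\chi_{(d_1,d_2)}$ with $0<b_1<b_2<c_1<c_2<d_1<d_2<L$. (C2) $b=b_0\chi_{(b_1,b_2)}$, $c=c_0\chi_{(c_1,c_2)}$, $d=d_0\chi_{(d_1,d_2)}$ with $0<b_1<b_2<d_1<d_2<c_1<c_2<L$. (C3) $b=b_0\chi_{(b_1,b_2)}$, $c=c_0\chi_{(c_1,c_2)}$, $d=0$ with $0<b_1<b_2<c_1<c_2<L$. The energy space is $\mathcal{H}=(H_0^1(0,L)\times L^2(0,L))^2$ with inner product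 $(U,U_1)_{\mathcal{H}}=\int_0^L v\overline{v_1}\,dx+a\int_0^L u_x\overline{(u_1)_x}\,dx+\int_0^L z\overline{z_1}\,dx+\int_0^L y_x\overline{(y_1)_x}\,dx$ for $U=(u,v,y,z)^\top$, $U_1=(u_1,v_1,y_1,z_1)^\top$. The operator $\mathcal{A}$ has domain $D(\mathcal{A})=\{(u,v,y,z)^\top\in\mathcal{H}: v,z\in H_0^1(0,L),\ (au_x+bv_x)_x\in L^2(0,L),\ (y_x+dz_x)_x\in L^2(0,L)\}$ and is given by $\mathcal{A}(u,v,y,z)^\top=(v,\ (au_x+bv_x)_x-cz,\ z,\ (y_x+dz_x)_x+cv)^\top$; it generates a $C_0$-semigroup of contractions on $\mathcal{H}$. *)

(* Defs.v *)
From mathcomp Require Import all_boot all_order all_algebra.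
From mathcomp Require Import all_classical all_reals all_analysis.
From mathcomp Require Import complex.

Set Implicit Arguments.
Unset Strict Implicit.
Unset Printing Implicit Defensive.

Import Order.TTheory GRing.Theory Num.Theory.
Import numFieldNormedType.Exports.

Local Open Scope classical_set_scope.
Local Open Scope ring_scope.
Local Open Scope complex_scope.

(* [X] is a set of representatives, [N] a seminorm on it, and two
   representatives x, y denote the same vector when N (x - y) = 0; this is how
   a Hilbert space of almost-everywhere classes is handled below.  Every
   equation between vectors is therefore an equation modulo N. *)
Section Semigroup.
Variables (R : realType) (V : lmodType R[i]) (X : set V) (N : V -> R).

Definition C0_semigroup_of_contractions (T : R -> V -> V) : Prop :=
  [/\ (forall t x, 0 <= t -> X x -> X (T t x)),
      (forall t k x y, 0 <= t -> X x -> X y ->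
         N (T t (k *: x + y) - (k *: T t x + T t y)) = 0),
      (forall t x, 0 <= t -> X x -> N (T t x) <= N x) &
      [/\ (forall x, X x -> N (T 0 x - x) = 0),
          (forall s t x, 0 <= s -> 0 <= t -> X x ->
             N (T (s + t) x - T s (T t x)) = 0) &
          (forall x, X x -> N (T t x - x) @[t --> 0^'+] --> (0 : R))]].

(* The graph of [A] on the domain [D] is the graph of the infinitesimal
   generator x |-> lim_(h -> 0+) (T h x - x) / h. *)
Definition generated_by (T : R -> V -> V) (D : set V) (A : V -> V) : Prop :=
  forall x y, X x -> X y ->
    (D x /\ N (A x - y) = 0) <->
    (N ((h^-1)%:C *: (T h x - x) - y) @[h --> 0^'+] --> (0 : R)).

Definition strongly_stable (T : R -> V -> V) : Prop :=
  forall x, X x -> N (T t x) @[t --> +oo] --> (0 : R).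

End Semigroup.

(* Functions on (0, L) are represented by functions on R whose values outside
   `]0, L[ are never inspected. *)
Section Sobolev.
Variables (R : realType) (L : R).
Notation mu := (@lebesgue_measure R).
Notation I := (`]0%R, L[%classic : set R).

Definition cintegral (f : R -> R[i]) : R[i] :=
  (\int[mu]_(x in I) complex.Re (f x)) +i* (\int[mu]_(x in I) complex.Im (f x)).

Definition L2 (f : R -> R[i]) : Prop :=
  [/\ measurable_fun I (@complex.Re R \o f), measurable_fun I (@complex.Im R \o f) &
      (\int[mu]_(x in I) ((Normc.normc (f x)) ^+ 2)%:E < +oo)%E].

Definition L2norm (f : R -> R[i]) : R :=
  Num.sqrt (\int[mu]_(x in I) (Normc.normc (f x)) ^+ 2).

Definition C1 (f : R -> R) : Prop :=
  (forall x, derivable f x 1) /\ continuous (derive1 f).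

(* C^1 functions with compact support in (0, L), extended by zero. *)
Definition test_function (phi : R -> R[i]) : Prop :=
  [/\ C1 (@complex.Re R \o phi), C1 (@complex.Im R \o phi) &
      exists K : set R, [/\ compact K, K `<=` I &
                            forall x, ~ K x -> phi x = 0]].

Definition cderive (phi : R -> R[i]) (x : R) : R[i] :=
  (derive1 (@complex.Re R \o phi) x) +i* (derive1 (@complex.Im R \o phi) x).

Definition weak_derivative (f g : R -> R[i]) : Prop :=
  forall phi, test_function phi ->
    cintegral (fun x => f x * cderive phi x) =
    - cintegral (fun x => g x * phi x).

Definition has_L2_derivative (f : R -> R[i]) : Prop :=
  exists g, L2 g /\ weak_derivative f g.

(* An L^2 weak derivative of [f] (unique almost everywhere on (0, L)) when
   there is one, and 0 otherwise. *)
Definition wderiv (f : R -> R[i]) : R -> R[i] :=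
  xget (fun=> 0) [set g | L2 g /\ weak_derivative f g].

Definition H1 (f : R -> R[i]) : Prop := L2 f /\ has_L2_derivative f.

Definition H1norm (f : R -> R[i]) : R :=
  Num.sqrt (L2norm f ^+ 2 + L2norm (wderiv f) ^+ 2).

(* Closure of the test functions in H^1(0, L). *)
Definition H10 (f : R -> R[i]) : Prop :=
  H1 f /\ forall e : R, 0 < e ->
    exists2 phi, test_function phi & H1norm (f \- phi) < e.

End Sobolev.

Section WaveSystem.
Variables (R : realType) (L a : R).

(* Quadruples (u, v, y, z). *)
Definition state : lmodType R[i] :=
  ((R -> R[i]) * (R -> R[i]) * (R -> R[i]) * (R -> R[i]))%type.

Definition energy_space : set state := fun U =>
  let: (u, v, y, z) := U in [/\ H10 L u, L2 L v, H10 L y & L2 L z].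

Definition energy_inner (U U1 : state) : R[i] :=
  let: (u, v, y, z) := U in
  let: (u1, v1, y1, z1) := U1 in
  cintegral L (fun x => v x * (v1 x)^*) +
  a%:C * cintegral L (fun x => wderiv L u x * (wderiv L u1 x)^*) +
  cintegral L (fun x => z x * (z1 x)^*) +
  cintegral L (fun x => wderiv L y x * (wderiv L y1 x)^*).

Definition energy_norm (U : state) : R :=
  Num.sqrt (complex.Re (energy_inner U U)).

Variables b c d : R -> R.

(* a u_x + b v_x *)
Definition flux1 (u v : R -> R[i]) (x : R) : R[i] :=
  a%:C * wderiv L u x + (b x)%:C * wderiv L v x.

(* y_x + d z_x *)
Definition flux2 (y z : R -> R[i]) (x : R) : R[i] :=
  wderiv L y x + (d x)%:C * wderiv L z x.

Definition wave_domain : set state := fun U =>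
  let: (u, v, y, z) := U in
  [/\ energy_space U, H10 L v, H10 L z,
      has_L2_derivative L (flux1 u v) & has_L2_derivative L (flux2 y z)].

Definition wave_operator (U : state) : state :=
  let: (u, v, y, z) := U in
  (v,
   (fun x => wderiv L (flux1 u v) x - (c x)%:C * z x),
   z,
   (fun x => wderiv L (flux2 y z) x + (c x)%:C * v x)).

Definition step (k alpha beta : R) : R -> R := fun x => k * \1_(`]alpha, beta[%classic) x.

Variables b0 c0 d0 b1 b2 c1 c2 d1 d2 : R.

Definition caseC1 : Prop :=
  [/\ b = step b0 b1 b2, c = step c0 c1 c2, d = step d0 d1 d2 &
      [/\ 0 < b1, b1 < b2, b2 < c1 & c1 < c2] /\
      [/\ c2 < d1, d1 < d2 & d2 < L]].

Definition caseC2 : Prop :=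
  [/\ b = step b0 b1 b2, c = step c0 c1 c2, d = step d0 d1 d2 &
      [/\ 0 < b1, b1 < b2, b2 < d1 & d1 < d2] /\
      [/\ d2 < c1, c1 < c2 & c2 < L]].

Definition caseC3 : Prop :=
  [/\ b = step b0 b1 b2, c = step c0 c1 c2, d = (fun=> 0) &
      [/\ 0 < b1, b1 < b2 & b2 < c1] /\ (c1 < c2 /\ c2 < L)].

Definition SSC1 : Prop :=
  caseC1 /\ `|c0| < Num.min (Num.sqrt a / (c2 - c1)) (1 / (c2 - c1)).

Definition SSC3 : Prop :=
  [/\ caseC3, a = 1 & `|c0| < 1 / (c2 - c1)].

End WaveSystem.

(* Main.v *)
(* A contraction semigroup on a Hilbert space is strongly stable as soon as its
   generator A satisfies, for every real lam, a resolvent estimate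
   N U <= C(lam) N (i lam U - A U) on D(A).  For U in D(A), Parseval's identity
   on a long discretised orbit, cut off by a tent, turns these estimates into a
   bound for the mean of N (T t U)^2 which tends to 0; N (T t U) is
   nonincreasing and D(A) is dense.

   For the wave system at frequency lam <> 0 write U = (u, v, y, z) and
   s = a u' + b v', t = y' + d z'.  The dissipation controls u' and s on
   (b1, b2), and cutting off the multiplier u controls u and s at a point there;
   Gronwall for |u|^2 + |s|^2 propagates this up to c1.  In (C2) the same works
   for y and t on (d1, d2), and Gronwall for the full system covers (0, L).  In
   (C1) the Rellich multipliers (x - c2) u' and (x - c1) y' bound both components
   on (c1, c2), where smallness of c0 absorbs the coupling.  In (C3) the quantity
   Im (s ybar - u tbar) vanishes at L and has derivative lam c (|y|^2 - |u|^2)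
   when a = 1, so y is as large as u in mean on (c1, c2), and the multiplier
   (x - c2) u' bounds both.  At lam = 0 Poincare's inequality suffices. *)
Require Import Defs.
From mathcomp Require Import all_boot all_order all_algebra.
From mathcomp Require Import all_classical all_reals all_analysis.
From mathcomp Require Import complex.
From mathcomp Require Import measurable_realfun.
From mathcomp Require Import zify cyclic separable cyclotomic.
From mathcomp Require Import ring lra.

Set Implicit Arguments.
Unset Strict Implicit.
Unset Printing Implicit Defensive.

Import Order.TTheory GRing.Theory Num.Theory.
Import numFieldNormedType.Exports.

Local Open Scope classical_set_scope.
Local Open Scope ring_scope.

(** * Semi-inner product spaces *)

(** Only a priori bounds on [i lam - A] are proved. They suffice because the transform of a windowed
    orbit is a finite combination of orbit points: it stays in the domain and solves a resolvent
    equation up to errors of the window and of the mesh. The order of choices matters: a frequency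
    cutoff from [N (A x)], the uniform constant below it, the time span, and last the mesh. On the
    side of the equations the coefficients jump, so u' may jump, whereas the flux s is absolutely
    continuous. Energies are therefore written in (u, s), and g = u' is recovered algebraically from
    (a + i lam b) g = s + b p, where |a + i lam b| >= a. The bound [S] on the data also contains the
    dissipation integrals. These equal Re (F, U) with F = i lam U - A U, hence are at most |F| |U|;
    the resulting bound of |U|^2 by |F|^2 and |F| |U| closes by absorption. *)

Lemma normc_ge0 (R : realType) (k : R[i]) : 0 <= Normc.normc k.
Proof. by case: k => a b; exact: sqrtr_ge0. Qed.

Lemma normc_Re (R : realType) (k : R[i]) : Normc.normc k ^+ 2 = complex.Re k ^+ 2 + complex.Im k ^+ 2.
Proof. by case: k => a b /=; rewrite sqr_sqrtr// addr_ge0 ?sqr_ge0. Qed.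

Lemma ReZ (R : realType) (r : R) (z : R[i]) :
  complex.Re (r%:C%C * z) = r * complex.Re z.
Proof. by case: z => a b /=; rewrite mul0r subr0. Qed.

(** Linear in the first argument and conjugate-linear in the second. The form is only semidefinite:
    functions that differ on a null set are distinct elements at distance zero. *)
Record semi_inner_space (R : realType) (V : lmodType R[i]) (X : set V)
    (ip : V -> V -> R[i]) (N : V -> R) : Prop := SemiInnerSpace {
  si_zero : X 0;
  si_lin : forall k x y, X x -> X y -> X (k *: x + y);
  si_ipl : forall k x y z, X x -> X y -> X z ->
    ip (k *: x + y) z = k * ip x z + ip y z;
  si_ipC : forall x y, X x -> X y -> ip y x = (ip x y)^*%C;
  si_ge0 : forall x, X x -> 0 <= complex.Re (ip x x);
  si_norm : forall x, N x = Num.sqrt (complex.Re (ip x x)) }.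

Section SemiInner.
Variables (R : realType) (V : lmodType R[i]) (X : set V) (ip : V -> V -> R[i]) (N : V -> R).
Hypothesis Hsi : semi_inner_space X ip N.
Let X0 := si_zero Hsi.
Let X_lin := si_lin Hsi.
Let ipl := si_ipl Hsi.
Let ipC := si_ipC Hsi.
Let ip_ge0 := si_ge0 Hsi.
Let NE := si_norm Hsi.

Lemma XZ k x : X x -> X (k *: x).
Proof. by move=> Xx; rewrite -[_ *: _]addr0; apply: X_lin. Qed.
Lemma XD x y : X x -> X y -> X (x + y).
Proof. by move=> Xx Xy; rewrite -[x]scale1r; apply: X_lin. Qed.
Lemma XN x : X x -> X (- x).
Proof. by move=> Xx; rewrite -scaleN1r; apply: XZ. Qed.
Lemma XB x y : X x -> X y -> X (x - y).
Proof. by move=> Xx Xy; apply: XD => //; apply: XN. Qed.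
Lemma Xsum n (f : nat -> V) : (forall i, (i < n)%N -> X (f i)) -> X (\sum_(i < n) f i).
Proof.
elim: n => [|n IH] Xf; first by rewrite big_ord0.
rewrite big_ord_recr; apply: XD; last exact: Xf.
by apply: IH => i lti; apply: Xf; apply: ltnW.
Qed.

Lemma N_ge0 x : 0 <= N x. Proof. by rewrite NE sqrtr_ge0. Qed.
Lemma N_sqr x : X x -> N x ^+ 2 = complex.Re (ip x x).
Proof. by move=> Xx; rewrite NE sqr_sqrtr// ip_ge0. Qed.

Lemma ipZl k x z : X x -> X z -> ip (k *: x) z = k * ip x z.
Proof.
move=> Xx Xz; have ip0 : ip 0 z = 0.
  have := @ipl 1 0 0 z X0 X0 Xz; rewrite scaler0 add0r mul1r => /eqP.
  by rewrite -subr_eq0 opprD addNKr oppr_eq0 => /eqP.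
by rewrite -[k *: x]addr0 ipl// ip0 addr0.
Qed.
Lemma ipDl x y z : X x -> X y -> X z -> ip (x + y) z = ip x z + ip y z.
Proof. by move=> Xx Xy Xz; rewrite -[x in LHS]scale1r ipl// mul1r. Qed.
Lemma ipZr k x z : X x -> X z -> ip z (k *: x) = k^*%C * ip z x.
Proof. by move=> Xx Xz; rewrite (ipC (XZ k Xx) Xz) ipZl// (ipC Xx Xz); exact: rmorphM. Qed.
Lemma ipDr x y z : X x -> X y -> X z -> ip z (x + y) = ip z x + ip z y.
Proof. by move=> Xx Xy Xz; rewrite (ipC (XD Xx Xy) Xz) ipDl// (ipC Xx Xz) (ipC Xy Xz); exact: rmorphD. Qed.

Lemma Re_ipC x y : X x -> X y -> complex.Re (ip y x) = complex.Re (ip x y).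
Proof. by move=> Xx Xy; rewrite ipC//; case: (ip x y). Qed.

Lemma NZ k x : X x -> N (k *: x) = Normc.normc k * N x.
Proof.
move=> Xx; rewrite !NE ipZl ?ipZr//; last exact: XZ.
rewrite mulrA; have -> : k * k^*%C = (Normc.normc k ^+ 2)%:C%C.
  case: k => a b; rewrite normc_Re/=; apply/eqP; rewrite eq_complex/=; apply/andP; split; apply/eqP; ring.
rewrite ReZ sqrtrM ?sqr_ge0// sqrtr_sqr ger0_norm//.
by case: k => a b /=; rewrite sqrtr_ge0.
Qed.

Lemma N_sqrD x y : X x -> X y ->
  N (x + y) ^+ 2 = N x ^+ 2 + N y ^+ 2 + 2 * complex.Re (ip x y).
Proof.
move=> Xx Xy; rewrite !N_sqr//; last exact: XD.
rewrite ipDl ?ipDr//; last exact: XD.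
by rewrite !raddfD/= (Re_ipC Xx Xy); ring.
Qed.

(** The norm of x + t y is nonnegative for every real t; when both norms are positive, t = - N x / N
    y yields the claim. Degenerate vectors get their own t, since [N y = 0] does not force y to
    vanish. *)
Lemma N_CS x y : X x -> X y -> complex.Re (ip x y) <= N x * N y.
Proof.
move=> Xx Xy.
have H (t : R) : 0 <= N x ^+ 2 + t ^+ 2 * N y ^+ 2 + 2 * t * complex.Re (ip x y).
  have := sqr_ge0 (N (x + t%:C%C *: y)).
  rewrite N_sqrD//; last exact: XZ.
  rewrite NZ// ipZr//.
  have -> : t%:C^*%C = t%:C%C :> R[i] by rewrite /= oppr0.
  by rewrite ReZ/= expr0n addr0 sqrtr_sqr exprMn real_normK ?num_real// mulrA.
have [y0|y0] := eqVneq (N y) 0.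
  rewrite y0 mulr0 leNgt; apply/negP => r0.
  (* With N y = 0 the expression is affine in t, and this t gives it the value -1. *)
  have := H (- (N x ^+ 2 + 1) / (2 * complex.Re (ip x y))).
  rewrite y0 expr0n mulr0 addr0.
  have -> : 2 * (- (N x ^+ 2 + 1) / (2 * complex.Re (ip x y))) * complex.Re (ip x y)
    = - (N x ^+ 2 + 1) by field; rewrite gt_eqF.
  by rewrite opprD addrA subrr sub0r leNgt ltrN10.
have yp : 0 < N y by rewrite lt_def y0 N_ge0.
have := H (- (N x / N y)).
have -> : N x ^+ 2 + (- (N x / N y)) ^+ 2 * N y ^+ 2 + 2 * - (N x / N y) * complex.Re (ip x y) = 2 * (N x / N y) * (N x * N y - complex.Re (ip x y)) by field.
have [x0|x0] := eqVneq (N x) 0.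
  move=> _; rewrite x0 mul0r leNgt; apply/negP => r0.
  have := H (- (complex.Re (ip x y) / N y ^+ 2)).
  have -> : N x ^+ 2 + (- (complex.Re (ip x y) / N y ^+ 2)) ^+ 2 * N y ^+ 2 + 2 * - (complex.Re (ip x y) / N y ^+ 2) * complex.Re (ip x y) = - (complex.Re (ip x y) / N y) ^+ 2 by rewrite x0; field.
  by rewrite oppr_ge0 leNgt exprn_gt0// divr_gt0.
have xp : 0 < N x by rewrite lt_def x0 N_ge0.
by rewrite pmulr_rge0 ?subr_ge0// mulr_gt0// divr_gt0.
Qed.

Lemma ND x y : X x -> X y -> N (x + y) <= N x + N y.
Proof.
move=> Xx Xy; rewrite -(@ler_pXn2r _ 2)// ?nnegrE ?addr_ge0 ?N_ge0//.
rewrite N_sqrD// sqrrD; have := N_CS Xx Xy; lra.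
Qed.
Lemma NN x : X x -> N (- x) = N x.
Proof. by move=> Xx; rewrite -scaleN1r NZ//= oppr0 expr0n addr0 sqrrN expr1n sqrtr1 mul1r. Qed.
Lemma NB x y : X x -> X y -> N (x - y) <= N x + N y.
Proof. by move=> Xx Xy; rewrite -(NN Xy) ND//; exact: XN. Qed.
Lemma Ndist x y : X x -> X y -> N (x - y) = N (y - x).
Proof. by move=> Xx Xy; rewrite -NN ?opprB//; exact: XB. Qed.
Lemma N0 : N 0 = 0.
Proof. by rewrite -(scale0r 0) NZ//= !expr0n addr0 sqrtr0 mul0r. Qed.
Lemma Ntri z x y : X x -> X y -> X z -> N (x - y) <= N (x - z) + N (z - y).
Proof. by move=> Xx Xy Xz; rewrite -[x - y](subrKA z) ND//; exact: XB. Qed.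
Lemma Nle x y : X x -> X y -> N x <= N y + N (x - y).
Proof. by move=> Xx Xy; rewrite -{1}[x](subrK y) addrC ND//; exact: XB. Qed.
(** The device for rewriting under a norm with an equation that holds modulo [N]. *)
Lemma N_eq x y : X x -> X y -> N (x - y) = 0 -> N x = N y.
Proof.
move=> Xx Xy H; apply/eqP; rewrite eq_le.
have := Nle Xx Xy; have := Nle Xy Xx; rewrite (Ndist Xy Xx) H !addr0 => -> ->//.
Qed.
Lemma Nsum_le n (f : nat -> V) : (forall i, (i < n)%N -> X (f i)) ->
  N (\sum_(i < n) f i) <= \sum_(i < n) N (f i).
Proof.
elim: n => [|n IH] Xf; first by rewrite !big_ord0 N0.
rewrite !big_ord_recr/=; apply: le_trans (ND _ _) _.
- by apply: Xsum => i lti; apply: Xf; apply: ltnW.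
- exact: Xf.
- by rewrite lerD2r IH// => i lti; apply: Xf; apply: ltnW.
Qed.

Lemma ip_suml n (f : nat -> V) z : (forall i, (i < n)%N -> X (f i)) -> X z ->
  ip (\sum_(i < n) f i) z = \sum_(i < n) ip (f i) z.
Proof.
move=> + Xz; elim: n => [|n IH] Xf.
  by rewrite !big_ord0 -(scale0r 0) ipZl// mul0r.
have Xf' i : (i < n)%N -> X (f i) by move=> lti; apply: Xf; apply: ltnW.
rewrite !big_ord_recr/= ipDl ?IH//; [exact: Xsum | exact: Xf].
Qed.
Lemma ip_sumr n (f : nat -> V) z : (forall i, (i < n)%N -> X (f i)) -> X z ->
  ip z (\sum_(i < n) f i) = \sum_(i < n) ip z (f i).
Proof.
move=> Xf Xz; rewrite ipC//; last exact: Xsum.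
rewrite ip_suml// [LHS]rmorph_sum; apply: eq_bigr => i _; symmetry.
by apply: ipC => //; exact: Xf.
Qed.

Lemma prim_root_conj n (z : R[i]) : n.-primitive_root z -> z * z^*%C = 1.
Proof.
move=> pz; have n0 := prim_order_gt0 pz.
have : `|z| ^+ n = 1 by rewrite -normrX (prim_expr_order pz) normr1.
move=> /eqP; rewrite pexpr_eq1// => /eqP z1.
have := sqr_normc z; rewrite z1 expr1n => -> //.
Qed.

(** Expanding the squares and summing over k first, the pair (i, j) is weighted by a geometric sum
    of ratio q = z^i conj(z)^j. Here q^n = 1, and q differs from 1 off the diagonal, so only the
    diagonal terms survive. *)
Lemma parseval n (z : R[i]) (y : nat -> V) : n.-primitive_root z ->
  (forall i, (i < n)%N -> X (y i)) ->
  \sum_(k < n) N (\sum_(j < n) z ^+ (j * k) *: y j) ^+ 2 = n%:R * \sum_(j < n) N (y j) ^+ 2.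
Proof.
move=> pz Xy; have zc := prim_root_conj pz.
have Xzy k i : (i < n)%N -> X (z ^+ (i * k) *: y i) by move=> lti; apply: XZ; apply: Xy.
have NS k : N (\sum_(j < n) z ^+ (j * k) *: y j) ^+ 2 =
    complex.Re (\sum_(i < n) \sum_(j < n) z ^+ (i * k) * ((z ^+ (j * k))^*%C * ip (y i) (y j))).
  have XS := @Xsum n (fun j => z ^+ (j * k) *: y j) (Xzy k).
  rewrite N_sqr//; congr complex.Re.
  rewrite (@ip_suml n (fun j => z ^+ (j * k) *: y j))//; last exact: (Xzy k).
  apply: eq_bigr => i _.
  rewrite (@ip_sumr n (fun j => z ^+ (j * k) *: y j))//; [|exact: (Xzy k)|exact: Xzy].
  apply: eq_bigr => j _.
  by rewrite ipZl ?ipZr//; [exact: Xy|exact: Xy|exact: Xy|exact: Xzy].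
rewrite (eq_bigr _ (fun (k : 'I_n) _ => NS k)).
rewrite -raddf_sum exchange_big/=.
rewrite (eq_bigr (fun i : 'I_n => n%:R * ip (y i) (y i))); last first.
  move=> i _; rewrite exchange_big/= [LHS](bigD1 i)//= [X in _ + X]big1 ?addr0; last first.
    move=> j ji.
    pose q := z ^+ i * z^*%C ^+ j.
    transitivity ((\sum_(k < n) q ^+ k) * ip (y i) (y j)).
      rewrite mulr_suml; apply: eq_bigr => k _.
      by rewrite /q mulrA; congr (_ * _); rewrite exprMn -!exprM rmorphXn.
    have qn : q ^+ n = 1.
      rewrite /q exprMn -!exprM mulnC exprM (prim_expr_order pz) expr1n mul1r.
      by rewrite mulnC exprM -rmorphXn (prim_expr_order pz) rmorph1 expr1n.
    have q1 : q - 1 != 0.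
      rewrite subr_eq0; apply/eqP => q1.
      have : z ^+ i == z ^+ j.
        apply/eqP; rewrite -[LHS]mulr1 -(expr1n _ j) -zc exprMn mulrCA mulrC -/q.
        by rewrite q1 mul1r.
      rewrite (eq_prim_root_expr pz) !modn_small// => /eqP ij.
      by move/eqP: ji; apply; apply/val_inj.
    apply/eqP; rewrite mulf_eq0; apply/orP; left.
    have := subrX1 q n; rewrite qn subrr => /esym/eqP; rewrite mulf_eq0 (negbTE q1)/=.
    by move=> /eqP H; apply/eqP; rewrite -[RHS]H.
  transitivity (\sum_(k < n) ip (y i) (y i)); last by rewrite sumr_const card_ord mulr_natl.
  apply: eq_bigr => k _; rewrite mulrA rmorphXn -exprMn zc expr1n mul1r//.
rewrite -mulr_sumr; have -> : (n%:R : R[i]) = (n%:R : R)%:C%C by rewrite rmorph_nat.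
rewrite ReZ; congr (_ * _); rewrite raddf_sum.
by apply: eq_bigr => i _; rewrite N_sqr//; exact: Xy.
Qed.

End SemiInner.

Lemma cvg_at_right0P (R : realType) (f : R -> R) : (forall h, 0 <= f h) ->
  (f @ 0^'+ --> (0 : R)) <->
  (forall e, 0 < e -> exists2 d, 0 < d & forall h, 0 < h -> h < d -> f h < e).
Proof.
move=> f0; split.
- move=> /cvgrPdist_lt H e e0; have := H e e0.
  rewrite /at_right near_withinE => /nbhs_ballP[d /= d0 Hd].
  exists d => // h h0 hd; have := Hd h; rewrite /ball/= sub0r normrN gtr0_norm// => /(_ hd h0).
  by rewrite sub0r normrN ger0_norm.
- move=> H; apply/cvgrPdist_lt => e e0; have [d d0 Hd] := H e e0.
  rewrite /at_right near_withinE; apply/nbhs_ballP; exists d => //= h.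
  rewrite /ball/= sub0r normrN => + h0; rewrite gtr0_norm// => hd.
  by rewrite sub0r normrN ger0_norm// Hd.
Qed.

Lemma sum_le_const (R : realType) n (f : nat -> R) c :
  (forall i, (i < n)%N -> f i <= c) -> \sum_(i < n) f i <= n%:R * c.
Proof.
move=> H; apply: (@le_trans _ _ (\sum_(i < n) c)).
  by apply: ler_sum => i _; exact: H.
by rewrite sumr_const card_ord mulr_natl.
Qed.

Lemma subr_subBB (V : zmodType) (x y z : V) : (x - z) - (y - z) = x - y.
Proof. by rewrite opprB addrA subrK. Qed.

(** * Contraction semigroups and their generators *)

Section SemiGroup.
Variables (R : realType) (V : lmodType R[i]) (X : set V) (ip : V -> V -> R[i]) (N : V -> R).
Hypothesis Hsi : semi_inner_space X ip N.
Variables (T : R -> V -> V).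
Hypothesis Tsg : C0_semigroup_of_contractions X N T.

Lemma TX (t : R) x : 0 <= t -> X x -> X (T t x).
Proof. by case: Tsg => H _ _ _; exact: H. Qed.

Ltac inX := repeat first [ assumption | exact: (si_zero Hsi) |
  progress (intros) |
  apply: (XB Hsi) | apply: (XZ Hsi) | apply: (XD Hsi) | apply: TX |
  apply: addr_ge0 | solve [auto] ].

Lemma Tle (t : R) x : 0 <= t -> X x -> N (T t x) <= N x.
Proof. by case: Tsg => _ _ H _; exact: H. Qed.
Lemma Tlin (t : R) k x y : 0 <= t -> X x -> X y ->
  N (T t (k *: x + y) - (k *: T t x + T t y)) = 0.
Proof. by case: Tsg => _ H _ _; exact: H. Qed.
Lemma Tid x : X x -> N (T 0 x - x) = 0.
Proof. by case: Tsg => _ _ _ [H _ _]; exact: H. Qed.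
Lemma Tadd (s t : R) x : 0 <= s -> 0 <= t -> X x -> N (T (s + t) x - T s (T t x)) = 0.
Proof. by case: Tsg => _ _ _ [_ H _]; exact: H. Qed.

Lemma eqN_trans x y z : X x -> X y -> X z -> N (x - y) = 0 -> N (y - z) = 0 -> N (x - z) = 0.
Proof.
move=> Xx Xy Xz H1 H2; apply/eqP; rewrite eq_le (N_ge0 Hsi) andbT.
by apply: le_trans (Ntri Hsi (z := y) Xx Xz Xy) _; rewrite H1 H2 addr0.
Qed.
Lemma eqN_sym x y : X x -> X y -> N (x - y) = 0 -> N (y - x) = 0.
Proof. by move=> Xx Xy; rewrite (Ndist Hsi). Qed.

Lemma T_zero (t : R) : 0 <= t -> N (T t 0) = 0.
Proof.
move=> t0; apply/eqP; rewrite eq_le (N_ge0 Hsi) andbT.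
by rewrite -(N0 Hsi); apply: Tle => //; inX.
Qed.

Lemma Tdist (t : R) x y : 0 <= t -> X x -> X y -> N (T t x - T t y) <= N (x - y).
Proof.
move=> t0 Xx Xy; have E := Tlin (-1) t0 Xy Xx; rewrite !scaleN1r in E.
rewrite addrC (addrC x) -(N_eq Hsi _ _ E).
- by apply: Tle => //; rewrite addrC; inX.
- by rewrite addrC; inX.
- by rewrite addrC; inX.
Qed.

Lemma Tsum (t : R) n (a : nat -> R[i]) (x : nat -> V) : 0 <= t ->
  (forall i, (i < n)%N -> X (x i)) ->
  N (T t (\sum_(i < n) a i *: x i) - \sum_(i < n) a i *: T t (x i)) = 0.
Proof.
move=> t0; elim: n => [|n IH] Xx.
  by rewrite !big_ord0 subr0 T_zero.
have Xx' i : (i < n)%N -> X (x i) by move=> lti; apply: Xx; apply: ltnW.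
have XS := Xsum Hsi (f := fun i => a i *: x i) (fun i lti => XZ Hsi (a i) (Xx' i lti)).
have XS' := Xsum Hsi (f := fun i => a i *: T t (x i)) (fun i lti => XZ Hsi (a i) (TX t0 (Xx' i lti))).
have Xn := Xx _ (ltnSn n).
rewrite !big_ord_recr/= addrC [X in _ - X]addrC.
apply: eqN_trans (Tlin (a n) t0 Xn XS) _; [by inX..|].
by rewrite opprD addrACA subrr add0r IH.
Qed.

Lemma Tcont (e : R) x : 0 < e -> X x ->
  exists2 d, 0 < d & forall s, 0 <= s -> s <= d -> N (T s x - x) <= e.
Proof.
move=> e0 Xx; case: Tsg => _ _ _ [_ _ /(_ x Xx)].
rewrite cvg_at_right0P => [/(_ e e0)[d d0 Hd]|h]; last exact: (N_ge0 Hsi).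
exists (d / 2); first by rewrite divr_gt0.
move=> s; rewrite le_eqVlt => /predU1P[<- _|s0 sd]; first by rewrite Tid// ltW.
by apply/ltW/Hd => //; apply: le_lt_trans sd _; rewrite ltr_pdivrMr// ltr_pMr// ltr1n.
Qed.

Lemma Tshift (s k : R) x : 0 <= s -> 0 <= k -> X x -> N (T (s + k) x - T s x) <= N (T k x - x).
Proof.
move=> s0 k0 Xx; apply: le_trans (Ntri Hsi (z := T s (T k x)) _ _ _) _; [by inX..|].
by rewrite Tadd// add0r Tdist//; inX.
Qed.

(** The mesh factor is left out: [h] times this is a Riemann sum for the integral of the orbit over
    [0, n h]. It stands in for a vector-valued integral. *)
Definition riemann_sum (h : R) (n : nat) x := \sum_(j < n) T (j%:R * h) x.

Lemma riemann_sumX h n x : 0 <= h -> X x -> X (riemann_sum h n x).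
Proof. by move=> h0 Xx; apply: (Xsum Hsi (f := fun j => T (j%:R * h) x)) => i _; apply: TX => //; rewrite mulr_ge0. Qed.

Lemma sum_mul_split n m (f : nat -> V) :
  \sum_(i < n * m) f i = \sum_(j < n) \sum_(l < m) f (j * m + l)%N.
Proof.
elim: n => [|n IH]; first by rewrite mul0n !big_ord0.
by rewrite mulSn addnC big_split_ord big_ord_recr/= IH.
Qed.

(** Each coarse node is compared with the m fine nodes of its cell. They follow it within time h, so
    contractivity reduces every discrepancy to the continuity bound at time zero. *)
Lemma riemann_refine (e d h : R) n m x : X x -> 0 <= h -> h <= d -> (0 < m)%N ->
  (forall s, 0 <= s -> s <= d -> N (T s x - x) <= e) ->
  N (riemann_sum (h / m%:R) (n * m) x - m%:R *: riemann_sum h n x) <= n%:R * (m%:R * e).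
Proof.
move=> Xx h0 hd m0 He; rewrite /riemann_sum (sum_mul_split n m (fun i => T (i%:R * (h / m%:R)) x)) scaler_sumr -sumrB.
have mR : 0 < m%:R :> R by rewrite ltr0n.
pose f j := \sum_(l < m) T ((j * m + l)%:R * (h / m%:R)) x - m%:R *: T (j%:R * h) x.
have Xl (j l : nat) : X (T ((j * m + l)%:R * (h / m%:R)) x).
  by apply: TX => //; rewrite mulr_ge0// divr_ge0// ltW.
have Xj (j : nat) : X (T (j%:R * h) x) by apply: TX => //; rewrite mulr_ge0.
have Xf j : X (f j).
  apply: (XB Hsi); last exact: (XZ Hsi).
  by apply: (Xsum Hsi (f := fun l => T ((j * m + l)%:R * (h / m%:R)) x)).
apply: le_trans (Nsum_le Hsi (f := f) _) _ => //.
apply: (sum_le_const (f := fun j => N (f j))) => j ltj.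
rewrite /f -[m in X in _ - X]card_ord scaler_nat -sumr_const -sumrB.
pose g (l : nat) := T ((j * m + l)%:R * (h / m%:R)) x - T (j%:R * h) x.
apply: le_trans (Nsum_le Hsi (f := g) _) _; first by move=> l _; apply: (XB Hsi).
apply: (sum_le_const (f := fun j => N (g j))) => l ltl.
rewrite /g; have -> : (j * m + l)%:R * (h / m%:R) = j%:R * h + l%:R * (h / m%:R) :> R.
  by rewrite natrD natrM; field; rewrite gt_eqF.
have lh : 0 <= l%:R * (h / m%:R) by rewrite mulr_ge0// divr_ge0// ltW.
rewrite (le_trans (Tshift _ _ _))// ?mulr_ge0//; apply: He => //.
apply: le_trans hd; rewrite mulrCA ler_piMr// ler_pdivrMr// mul1r ler_nat ltnW//.
Qed.

(** Two ways of splitting the sum over the first q + n indices. *)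
Lemma shift_sum n q (f : nat -> V) :
  \sum_(j < n) f (q + j)%N - \sum_(j < n) f j = \sum_(j < q) (f (n + j)%N - f j).
Proof.
have E : \sum_(j < q) f j + \sum_(j < n) f (q + j)%N
       = \sum_(j < n) f j + \sum_(j < q) f (n + j)%N.
  transitivity (\sum_(j < q + n) f j); first by rewrite big_split_ord.
  by rewrite addnC big_split_ord.
rewrite sumrB; apply/eqP; rewrite subr_eq addrAC [X in X - _]addrC -E.
by rewrite addrAC subrr add0r.
Qed.

Lemma NZr (r : R) x : X x -> N (r%:C%C *: x) = `|r| * N x.
Proof. by move=> Xx; rewrite (NZ Hsi)//= expr0n addr0 sqrtr_sqr. Qed.

Lemma T_riemann (s d : R) n x : X x -> 0 <= s -> 0 <= d ->
  N (T s (riemann_sum d n x) - \sum_(j < n) T (s + j%:R * d) x) = 0.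
Proof.
move=> Xx s0 d0; have jd (j : nat) : 0 <= j%:R * d by rewrite mulr_ge0.
have sjd (j : nat) : 0 <= s + j%:R * d by rewrite addr_ge0.
have Xj (j : nat) : X (T (j%:R * d) x) by apply: TX.
have := Tsum (fun=> 1) (x := fun j => T (j%:R * d) x) s0 (fun j (_ : (j < n)%N) => Xj j).
under eq_bigr do rewrite scale1r.
under [X in _ - X]eq_bigr do rewrite scale1r.
move=> E; apply: eqN_trans E _.
- by apply: TX => //; exact: riemann_sumX.
- by apply: (Xsum Hsi (f := fun j => T s (T (j%:R * d) x))) => i _; inX.
- by apply: (Xsum Hsi (f := fun j => T (s + j%:R * d) x)) => i _; inX.
apply/eqP; rewrite eq_le (N_ge0 Hsi) andbT -sumrB.
apply: le_trans (Nsum_le Hsi (f := fun j => T s (T (j%:R * d) x) - T (s + j%:R * d) x) _) _.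
  by move=> i _; inX.
by rewrite big1// => i _; apply: eqN_sym; [inX|inX|exact: Tadd].
Qed.

(* Telescoping: on the Riemann sums of the orbit, [T k - 1] acts as
   [k / d] times [T h - 1], up to small errors. *)
Lemma riemann_increment (e e' d d' h k : R) (n : nat) x :
  X x -> 0 < h -> (0 < n)%N -> h = n%:R * d -> 0 < d -> 0 < k -> k <= d' ->
  (forall s, 0 <= s -> s <= d -> N (T s x - x) <= e) ->
  (forall s, 0 <= s -> s <= d' -> N (T s (T h x - x) - (T h x - x)) <= e') ->
  N (T k (riemann_sum d n x) - riemann_sum d n x - (Num.truncn (k / d))%:R *: (T h x - x))
    <= n%:R * e + (Num.truncn (k / d))%:R * e'.
Proof.
move=> Xx h0 n0 hE d0 k0 kd' He He'.
(* [q] whole mesh steps fit into [k]. The remainder is at most [d] and costs the error n e. *)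
set S := riemann_sum d n x; set q := Num.truncn (k / d); set w := T h x - x.
have d0' := ltW d0.
have /andP[qk kq] := truncn_itv (divr_ge0 (ltW k0) d0'); rewrite -/q in qk kq.
have jd (j : nat) : 0 <= j%:R * d by rewrite mulr_ge0.
have qdk : q%:R * d <= k by rewrite -ler_pdivlMr.
have r0 : 0 <= k - q%:R * d by rewrite subr_ge0.
have rd : k - q%:R * d <= d.
  by move: kq; rewrite -natr1 ltr_pdivrMr// mulrDl mul1r => /ltW; rewrite lerBlDl.
have XS : X S by apply: riemann_sumX.
have h0' := ltW h0; have k0' := ltW k0.
have Xw : X w by inX.
have Xj (j : nat) : X (T (j%:R * d) x) by inX.
have S1 : N (T k S - T (q%:R * d) S) <= n%:R * e.
  have := Tshift (jd q) r0 XS; rewrite [X in T X _](_ : _ = k); last by rewrite addrC subrK.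
  move=> Hk; apply: le_trans Hk _.
  have E := T_riemann n Xx r0 d0'; rewrite -/S in E.
  have XS' : X (\sum_(j < n) T (k - q%:R * d + j%:R * d) x).
    apply: (Xsum Hsi (f := fun j : nat => T (k - q%:R * d + j%:R * d) x)) => i _.
    by apply: TX => //; rewrite addr_ge0.
  apply: le_trans (Ntri Hsi (z := \sum_(j < n) T (k - q%:R * d + j%:R * d) x) _ _ _) _ => //; first by inX.
  rewrite E add0r -sumrB.
  apply: le_trans (Nsum_le Hsi (f := fun j => T (k - q%:R * d + j%:R * d) x - T (j%:R * d) x) _) _.
    by move=> i _; inX.
  apply: (sum_le_const (f := fun j : nat => N (T (k - q%:R * d + j%:R * d) x - T (j%:R * d) x))) => j ltj.
  by rewrite [X in T X x - _]addrC; apply: le_trans (Tshift _ _ _) _ => //; exact: He.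
(* Shifting by q mesh steps leaves only q pairs of nodes at the two ends. As h = n d, the difference
   in each pair is T (j d) applied to [w]. *)
have S2 : N (T (q%:R * d) S - S - q%:R *: w) <= q%:R * e'.
  have E := T_riemann n Xx (jd q) d0'; rewrite -/S in E.
  have XS' : X (\sum_(j < n) T (q%:R * d + j%:R * d) x).
    apply: (Xsum Hsi (f := fun j : nat => T (q%:R * d + j%:R * d) x)) => i _.
    by apply: TX => //; rewrite addr_ge0.
  apply: le_trans (Nle Hsi (y := \sum_(j < n) T (q%:R * d + j%:R * d) x - S - q%:R *: w) _ _) _; [by inX..|].
  rewrite !subr_subBB E addr0.
  have -> : \sum_(j < n) T (q%:R * d + j%:R * d) x = \sum_(j < n) T ((q + j)%:R * d) x.
    by apply: eq_bigr => j _; rewrite natrD mulrDl.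
  rewrite /S /riemann_sum (shift_sum n q (fun j => T (j%:R * d) x)).
  rewrite -[q in X in _ - X]card_ord scaler_nat -sumr_const -sumrB.
  pose g (j : nat) := T ((n + j)%:R * d) x - T (j%:R * d) x - w.
  apply: le_trans (Nsum_le Hsi (f := g) _) _; first by move=> i _; rewrite /g; inX.
  apply: (sum_le_const (f := fun j => N (g j))) => j ltj.
  have jk : j%:R * d <= d'.
    by apply: le_trans kd'; apply: le_trans qdk; rewrite ler_pM2r// ler_nat ltnW//.
  have A1 := Tadd (jd j) h0' Xx.
  have A2 := Tlin (-1) (jd j) Xx (TX h0' Xx).
  rewrite !scaleN1r [X in T _ X]addrC -/w in A2.
  rewrite /g natrD mulrDl -hE [h + _]addrC.
  apply: le_trans (Nle Hsi (y := T (j%:R * d) (T h x) - T (j%:R * d) x - w) _ _) _; [by inX..|].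
  rewrite !subr_subBB A1 addr0.
  apply: le_trans (Nle Hsi (y := T (j%:R * d) w - w) _ _) _; [by inX..|].
  have A3 : N (T (j%:R * d) (T h x) - T (j%:R * d) x - T (j%:R * d) w) = 0.
    rewrite (Ndist Hsi); [|by inX..].
    by rewrite [T _ (T h x) - _]addrC; exact: A2.
  by rewrite subr_subBB A3 addr0; exact: He'.
apply: le_trans (Nle Hsi (y := T (q%:R * d) S - S - q%:R *: w) _ _) _; [by inX..|].
by rewrite !subr_subBB addrC lerD.
Qed.

End SemiGroup.

(** * Density of the domain of the generator *)

Section Density.
Variables (R : realType) (V : lmodType R[i]) (X : set V) (ip : V -> V -> R[i]) (N : V -> R).
Hypothesis Hsi : semi_inner_space X ip N.
Variables (T : R -> V -> V).
Hypothesis Tsg : C0_semigroup_of_contractions X N T.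
Variables (D : set V) (A : V -> V).
Hypothesis Tgen : generated_by X N T D A.

Ltac inX := repeat first [ assumption | exact: (si_zero Hsi) |
  progress (intros) |
  apply: (XB Hsi) | apply: (XZ Hsi) | apply: (XD Hsi) | apply: (TX Tsg) | apply: (riemann_sumX Hsi Tsg) |
  apply: addr_ge0 | solve [auto] ].

Lemma generator_limP (x y : V) : X x -> X y ->
  (D x /\ N (A x - y) = 0) <->
  (forall e : R, 0 < e -> exists2 d : R, 0 < d & forall h : R, 0 < h -> h < d ->
     N ((h^-1)%:C%C *: (T h x - x) - y) < e).
Proof.
move=> Xx Xy; rewrite (Tgen Xx Xy) cvg_at_right0P//.
by move=> h; exact: (N_ge0 Hsi).
Qed.

Hypothesis X_complete : forall u : nat -> V, (forall n, X (u n)) ->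
  (forall e, 0 < e -> exists n0, forall m n, (n0 <= m)%N -> (n0 <= n)%N -> N (u m - u n) <= e) ->
  exists2 x, X x & forall e, 0 < e -> exists n0, forall n, (n0 <= n)%N -> N (u n - x) <= e.

Lemma subr_subACA (x y z t : V) : (x - y) - (z - t) = (x - z) - (y - t).
Proof. by rewrite !opprD !opprK addrACA. Qed.

Lemma N_perturb a b c a' b' c' : X a -> X b -> X c -> X a' -> X b' -> X c' ->
  N (a' - b' - c') <= N (a - b - c) + N (a' - a) + N (b' - b) + N (c' - c).
Proof.
move=> Xa Xb Xc Xa' Xb' Xc'.
apply: le_trans (Nle Hsi (y := a - b - c) _ _) _; [by inX..|].
have H1 : N (a' - a - (b' - b) - (c' - c)) <= N (a' - a - (b' - b)) + N (c' - c).
  by apply: (NB Hsi); inX.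
have H2 : N (a' - a - (b' - b)) <= N (a' - a) + N (b' - b) by apply: (NB Hsi); inX.
by rewrite (subr_subACA (a' - b')) (subr_subACA a'); lra.
Qed.

(** Discrete version of h^-1 times the integral of T s x over [0, h]. *)
Definition orbit_mean (h : R) (n : nat) x := ((n%:R)^-1)%:C%C *: riemann_sum T (h / n%:R) n x.

Lemma orbit_mean_refine (e d h : R) n m x : X x -> 0 <= h -> (0 < n)%N -> (0 < m)%N ->
  h / n%:R <= d -> (forall s, 0 <= s -> s <= d -> N (T s x - x) <= e) ->
  N (orbit_mean h (n * m) x - orbit_mean h n x) <= e.
Proof.
move=> Xx h0 n0 m0 hd He.
have nR : 0 < n%:R :> R by rewrite ltr0n.
have mR : 0 < m%:R :> R by rewrite ltr0n.
have hn : 0 <= h / n%:R by rewrite divr_ge0// ltW.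
have hnm : 0 <= h / n%:R / m%:R by rewrite divr_ge0// ltW.
have -> : orbit_mean h (n * m) x - orbit_mean h n x =
  ((n%:R * m%:R)^-1)%:C%C *: (riemann_sum T (h / n%:R / m%:R) (n * m) x - m%:R *: riemann_sum T (h / n%:R) n x).
  rewrite /orbit_mean scalerBr scalerA natrM; congr (_ *: riemann_sum T _ _ _ - _ *: _).
    by field; rewrite !gt_eqF.
  rewrite -(rmorph_nat (real_complex R) m) -rmorphM/=; congr (_%:C%C).
  by field; rewrite !gt_eqF.
rewrite (NZr Hsi) ?ger0_norm ?invr_ge0 ?mulr_ge0//; last by inX.
rewrite mulrC ler_pdivrMr ?mulr_gt0// (le_trans (riemann_refine Hsi Tsg n Xx hn hd m0 He))//.
by rewrite mulrA mulrC.
Qed.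

Lemma orbit_mean_dist (e d h : R) n x : X x -> 0 <= h -> (0 < n)%N ->
  h <= d -> (forall s, 0 <= s -> s <= d -> N (T s x - x) <= e) ->
  N (orbit_mean h n x - x) <= e.
Proof.
move=> Xx h0 n0 hd He.
have nR : 0 < n%:R :> R by rewrite ltr0n.
have hn : 0 <= h / n%:R by rewrite divr_ge0// ltW.
have jh (j : nat) : 0 <= j%:R * (h / n%:R) by rewrite mulr_ge0.
have -> : orbit_mean h n x - x = ((n%:R)^-1)%:C%C *: \sum_(j < n) (T (j%:R * (h / n%:R)) x - x).
  rewrite sumrB scalerBr sumr_const card_ord; congr (_ - _).
  rewrite -(scaler_nat n x) scalerA -(rmorph_nat (real_complex R) n) -rmorphM/= mulVf ?scale1r//.
  by rewrite gt_eqF.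
have XS : X (\sum_(j < n) (T (j%:R * (h / n%:R)) x - x)).
  by apply: (Xsum Hsi (f := fun j : nat => T (j%:R * (h / n%:R)) x - x)); inX.
rewrite (NZr Hsi)// ger0_norm ?invr_ge0// ler_pdivrMl//.
apply: le_trans (Nsum_le Hsi (f := fun j => T (j%:R * (h / n%:R)) x - x) _) _; first by inX.
apply: (sum_le_const (f := fun j : nat => N (T (j%:R * (h / n%:R)) x - x))) => j jn.
by apply: He => //; apply: le_trans hd; rewrite mulrCA ler_piMr// ler_pdivrMr// mul1r ler_nat ltnW.
Qed.

Lemma eventually_inv_le (c e : R) : 0 <= c -> 0 < e -> exists n0, forall n, (n0 <= n)%N -> (0 < n)%N -> c / n%:R <= e.
Proof.
move=> c0 e0; exists (Num.truncn (c / e)).+1 => n hn n0.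
rewrite ler_pdivrMr ?ltr0n// -ler_pdivrMl// mulrC.
by apply: ltW; apply: lt_le_trans (truncnS_gt _) _; rewrite ler_nat.
Qed.

(** The orbit means over [0, h] converge, as the mesh is refined, to a vector xh that is close to x
    when h is small. The difference quotients of xh tend to h^-1 (T h x - x), so xh lies in the
    domain. *)
Lemma domain_dense (e : R) x : X x -> 0 < e -> exists2 x', D x' & X x' /\ N (x - x') <= e.
Proof.
move=> Xx e0.
have [h h0 Hh] := Tcont Hsi Tsg (divr_gt0 e0 (ltr0Sn R 1)) Xx.
have h0' := ltW h0.
pose u n := orbit_mean h n.+1 x.
have hn (n : nat) : 0 <= h / n%:R by rewrite divr_ge0.
have Xu n : X (u n) by rewrite /u /orbit_mean; inX.
have [|xh Xxh Hxh] := X_complete Xu.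
  move=> eta eta0; have eta2 : 0 < eta / 2 by rewrite divr_gt0.
  have [d d0 Hd] := Tcont Hsi Tsg eta2 Xx.
  have [n0 Hn0] := eventually_inv_le h0' d0.
  exists n0 => m n mn nn.
  (* Two meshes are compared through their common refinement. *)
  have Xnm : X (orbit_mean h (n.+1 * m.+1) x) by rewrite /orbit_mean; inX.
  apply: le_trans (Ntri Hsi (z := orbit_mean h (n.+1 * m.+1) x) _ _ _) _ => //.
  rewrite [eta]splitr lerD//.
    rewrite (Ndist Hsi)// /u mulnC; apply: orbit_mean_refine Hd => //.
    by apply: Hn0 => //; exact: leqW.
  by apply: orbit_mean_refine Hd => //; apply: Hn0 => //; exact: leqW.
pose w := T h x - x.
have Xw : X w by inX.
exists xh.
  have Xy : X ((h^-1)%:C%C *: w) by inX.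
  suff : D xh /\ N (A xh - (h^-1)%:C%C *: w) = 0 by case.
  apply/(generator_limP Xxh Xy) => e1 e10.
  have e2 : 0 < h * (e1 / 2) by rewrite mulr_gt0// divr_gt0.
  have [d d0 Hd] := Tcont Hsi Tsg e2 Xw.
  exists d => // k k0 kd; have k0' := ltW k0.
  have kh : 0 < k / h by rewrite divr_gt0.
  have -> : (k^-1)%:C%C *: (T k xh - xh) - (h^-1)%:C%C *: w =
    (k^-1)%:C%C *: (T k xh - xh - (k / h)%:C%C *: w).
    rewrite [in RHS]scalerBr scalerA -rmorphM/= mulrA mulVf ?mul1r//.
    by rewrite gt_eqF.
  rewrite (NZr Hsi); last by inX.
  rewrite ger0_norm ?invr_ge0// mulrC ltr_pdivrMr//.
  suff : N (T k xh - xh - (k / h)%:C%C *: w) <= k / h * (h * (e1 / 2)).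
    have -> : k / h * (h * (e1 / 2)) = e1 * k / 2 by field; rewrite gt_eqF.
    by move=> /le_lt_trans; apply; rewrite ltr_pdivrMr// ltr_pMr ?ltr1n// mulr_gt0.
  (* The margin eta is shared by four errors: the mesh, the rounding of k / d', and the replacement
     of xh by the mean u n, once under T k and once outside. *)
  apply/ler_addgt0Pr => eta eta0.
  have eta4 : 0 < eta / 4 by rewrite divr_gt0.
  have [d1 d10 Hd1] := Tcont Hsi Tsg eta4 Xx.
  have [n1 Hn1] := eventually_inv_le h0' d10.
  have [n2 Hn2] := eventually_inv_le (N_ge0 Hsi w) eta4.
  have [n3 Hn3] := Hxh _ eta4.
  pose n := maxn n1 (maxn n2 n3).
  have {}Hn1 := Hn1 n.+1 (leqW (leq_maxl _ _)) isT.
  have {}Hn2 : N w / n.+1%:R <= eta / 4.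
    by apply: Hn2 => //; apply: leqW; rewrite /n !leq_max leqnn orbT.
  have {}Hn3 : N (u n - xh) <= eta / 4 by apply: Hn3; rewrite /n !leq_max leqnn !orbT.
  pose d' := h / n.+1%:R; have d'0 : 0 < d' by rewrite divr_gt0.
  have nR : 0 < n.+1%:R :> R by rewrite ltr0n.
  have hE : h = n.+1%:R * d' by rewrite mulrC divfK// gt_eqF.
  pose S := riemann_sum T d' n.+1 x.
  have XS : X S by apply: (riemann_sumX Hsi Tsg) => //; exact: ltW.
  have He1 s : 0 <= s -> s <= d' -> N (T s x - x) <= eta / 4.
    by move=> s0 sd; apply: Hd1 => //; apply: le_trans sd Hn1.
  have := riemann_increment Hsi Tsg Xx h0 (ltn0Sn n) hE d'0 k0 (ltW kd) He1 Hd.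
  rewrite -/S -/w; set q := Num.truncn _ => Hinc.
  have /andP[qk kq] := truncn_itv (divr_ge0 k0' (ltW d'0)); rewrite -/q in qk kq.
  have uE : u n = ((n.+1%:R)^-1)%:C%C *: S by [].
  pose c := ((n.+1%:R)^-1)%:C%C : R[i].
  have Xun := Xu n.
  have H1 : N (T k (u n) - u n - ((n.+1%:R)^-1 * q%:R)%:C%C *: w) <= eta / 4 + k / h * (h * (e1 / 2)).
    have E := Tlin Tsg c k0' XS (si_zero Hsi); rewrite !addr0 in E.
    have E' : N (T k (u n) - c *: T k S) = 0.
      apply: (eqN_trans Hsi (y := c *: T k S + T k 0)); [by inX..|exact: E|].
      by rewrite addrAC subrr add0r (T_zero Hsi Tsg).
    apply: le_trans (Nle Hsi (y := c *: T k S - u n - ((n.+1%:R)^-1 * q%:R)%:C%C *: w) _ _) _; [by inX..|].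
    rewrite !subr_subBB E' addr0 uE rmorphM/= -scalerA -!scalerBr (NZr Hsi); last by inX.
    rewrite rmorph_nat ger0_norm ?invr_ge0// ler_pdivrMl//; apply: le_trans Hinc _.
    rewrite mulrDr lerD2l [leRHS]mulrA ler_wpM2r ?(ltW e2)//; apply: le_trans qk _.
    by rewrite /d' invf_div mulrCA.
  have H2 : N (((n.+1%:R)^-1 * q%:R)%:C%C *: w - (k / h)%:C%C *: w) <= eta / 4.
    rewrite -scalerBl -rmorphB/= (NZr Hsi)//; apply: le_trans Hn2.
    rewrite mulrC ler_wpM2l ?(N_ge0 Hsi)//.
    have kh' : k / h = n.+1%:R^-1 * (k / d') by rewrite /d' invf_div mulrCA mulKf// gt_eqF.
    rewrite kh' -mulrBr normrM ger0_norm ?invr_ge0// ler_piMr ?invr_ge0//.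
    rewrite distrC ger0_norm ?subr_ge0// lerBlDl natr1; exact: ltW.
  have H3 : N (T k xh - T k (u n)) <= eta / 4.
    by apply: le_trans (Tdist Hsi Tsg _ _ _) _ => //; rewrite (Ndist Hsi).
  have := N_perturb (TX Tsg k0' Xun) Xun (XZ Hsi ((n.+1%:R)^-1 * q%:R)%:C%C Xw)
    (TX Tsg k0' Xxh) Xxh (XZ Hsi (k / h)%:C%C Xw).
  rewrite [N (xh - _)](Ndist Hsi)// [N (_ *: w - _)](Ndist Hsi); [|by inX..].
  by move=> /le_trans; apply; lra.
split=> //.
have [n0 Hn0] := Hxh _ (divr_gt0 e0 (ltr0Sn R 1)).
apply: le_trans (Ntri Hsi (z := u n0) _ _ _) _ => //.
rewrite [e]splitr lerD//; last exact: Hn0.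
by rewrite (Ndist Hsi)//; apply: orbit_mean_dist Hh.
Qed.

End Density.

(** X^n - 1 splits over the algebraically closed field R[i] and is separable in characteristic zero.
    It thus has n distinct roots, and n distinct n-th roots of unity include a primitive one. *)
Lemma prim_root_exists (R : realType) n : (0 < n)%N -> exists z : R[i], n.-primitive_root z.
Proof.
move=> n0; have [rs Ers] := closed_field_poly_normal ('X^n - 1 : {poly R[i]}).
rewrite (monicP (monicXnsubC 1 n0)) scale1r in Ers.
have urs : uniq rs.
  by rewrite -separable_prod_XsubC -Ers separable_Xn_sub_1// pnatr_eq0 -lt0n.
have [] := hasP (has_prim_root n0 (rs := rs) _ urs _).
- by apply/allP => z zrs; rewrite /root_of_unity Ers root_prod_XsubC.
- by rewrite -ltnS -(size_prod_XsubC rs id) -Ers size_XnsubC.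
- by move=> z _ pz; exists z.
Qed.

Lemma conj_unit_norm (R : realType) (q : R[i]) : q * q^*%C = 1 ->
  complex.Re q ^+ 2 + complex.Im q ^+ 2 = 1.
Proof. by case: q => a b /(congr1 (@complex.Re R))/= <-; ring. Qed.

Section Resolvent.
Variables (R : realType) (V : lmodType R[i]) (N : V -> R) (D : set V) (A : V -> V).

(** An a priori estimate: it keeps i lam out of the approximate point spectrum of [A]. *)
Definition resolvent_bound (lam C : R) : Prop :=
  forall U, D U -> N U <= C * N ((0 +i* lam)%C *: U - A U).
End Resolvent.

(** * Strong stability from resolvent bounds *)

Section Stability.
Variables (R : realType) (V : lmodType R[i]) (X : set V) (ip : V -> V -> R[i]) (N : V -> R).
Hypothesis Hsi : semi_inner_space X ip N.
Variables (T : R -> V -> V).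
Hypothesis Tsg : C0_semigroup_of_contractions X N T.
Variables (D : set V) (A : V -> V).
Hypothesis Tgen : generated_by X N T D A.
Hypothesis DX : forall x, D x -> X x.
Hypothesis AX : forall x, D x -> X (A x).

Ltac inX := repeat first [ assumption | exact: (si_zero Hsi) |
  progress (intros) |
  apply: (XB Hsi) | apply: (XZ Hsi) | apply: (XD Hsi) | apply: (TX Tsg) |
  apply: addr_ge0 | solve [auto] ].

Lemma T_comb (t : R) (k : R[i]) u v y : 0 <= t -> X u -> X v -> X y ->
  N (T t (k *: (u - v) - y) - (k *: (T t u - T t v) - T t y)) = 0.
Proof.
move=> t0 Xu Xv Xy.
pose c (i : nat) : R[i] := if i == 0%N then k else if i == 1%N then - k else - 1.
pose x (i : nat) : V := if i == 0%N then u else if i == 1%N then v else y.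
have := Tsum Hsi Tsg (n := 3) c (x := x) t0 _.
rewrite !big_ord_recl !big_ord0/= /c /x /= !scaleN1r !scaleNr !addr0 !addrA -!scalerBr.
by apply => -[|[|[|]]].
Qed.

Section Operator.
Variables (h : R) (n : nat) (a : nat -> R[i]).
Hypothesis h0 : 0 <= h.

Let jh (j : nat) : 0 <= j%:R * h. Proof. by rewrite mulr_ge0. Qed.

Definition orbit_comb y := \sum_(j < n) a j *: T (j%:R * h) y.

Lemma orbit_combX y : X y -> X (orbit_comb y).
Proof. by move=> Xy; apply: (Xsum Hsi (f := fun j : nat => a j *: T (j%:R * h) y)); inX. Qed.

Lemma orbit_comb_le y : X y ->
  N (orbit_comb y) <= (\sum_(j < n) Normc.normc (a j)) * N y.
Proof.
move=> Xy; apply: le_trans (Nsum_le Hsi (f := fun j : nat => a j *: T (j%:R * h) y) _) _; first by inX.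
rewrite mulr_suml; apply: ler_sum => j _; rewrite (NZ Hsi); last by inX.
by apply: ler_wpM2l; [exact: normc_ge0|exact: (Tle Tsg)].
Qed.

(** Modulo [N], taking a fixed combination along the orbit is linear and commutes with T s, hence
    with difference quotients. *)
Lemma orbit_comb_diff (c : R[i]) (s : R) x y : 0 <= s -> X x -> X y ->
  N ((c *: (T s (orbit_comb x) - orbit_comb x) - orbit_comb y)
     - orbit_comb (c *: (T s x - x) - y)) = 0.
Proof.
move=> s0 Xx Xy.
have E1 := Tsum Hsi Tsg a (x := fun j : nat => T (j%:R * h) x) s0 (fun j (_ : (j < n)%N) => TX Tsg (jh j) Xx).
set S1 := \sum_(i < n) _ *: T s _ in E1.
have XS1 : X S1 by apply: (Xsum Hsi (f := fun j : nat => a j *: T s (T (j%:R * h) x))); inX.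
have XO y' (Xy' : X y') := orbit_combX Xy'.
have Xd : X (c *: (T s x - x) - y) by inX.
apply: (eqN_trans Hsi (y := c *: (S1 - orbit_comb x) - orbit_comb y)); [by inX..| |].
  rewrite subr_subBB -scalerBr subr_subBB (NZ Hsi); last by inX.
  by rewrite E1 mulr0.
have -> : c *: (S1 - orbit_comb x) - orbit_comb y - orbit_comb (c *: (T s x - x) - y) =
  \sum_(j < n) a j *: (c *: (T s (T (j%:R * h) x) - T (j%:R * h) x) - T (j%:R * h) y - T (j%:R * h) (c *: (T s x - x) - y)).
  rewrite /S1 /orbit_comb -sumrB scaler_sumr -!sumrB; apply: eq_bigr => j _.
  by rewrite -scalerBr !scalerA [c * _]mulrC -scalerA -!scalerBr.
apply/eqP; rewrite eq_le (N_ge0 Hsi) andbT.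
pose g (j : nat) := a j *: (c *: (T s (T (j%:R * h) x) - T (j%:R * h) x) - T (j%:R * h) y - T (j%:R * h) (c *: (T s x - x) - y)).
apply: le_trans (Nsum_le Hsi (f := g) _) _; first by rewrite /g; inX.
rewrite big1// => j _; rewrite /g (NZ Hsi); last by inX.
suff -> : N (c *: (T s (T (j%:R * h) x) - T (j%:R * h) x) - T (j%:R * h) y - T (j%:R * h) (c *: (T s x - x) - y)) = 0 by rewrite mulr0.
apply: (eqN_trans Hsi (y := c *: (T (j%:R * h) (T s x) - T (j%:R * h) x) - T (j%:R * h) y)); [by inX..| |].
  rewrite subr_subBB -scalerBr subr_subBB (NZ Hsi); last by inX.
  suff -> : N (T s (T (j%:R * h) x) - T (j%:R * h) (T s x)) = 0 by rewrite mulr0.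
  apply: (eqN_trans Hsi (y := T (s + j%:R * h) x)); [by inX..| |].
    by apply: (eqN_sym Hsi); [inX..|exact: (Tadd Tsg)].
  by rewrite [s + _]addrC; exact: (Tadd Tsg).
have := T_comb c (jh j) (TX Tsg s0 Xx) Xx Xy.
by apply: (eqN_sym Hsi); inX.
Qed.

(** The difference quotient of the combination is the combination of the difference quotients, and
    by contractivity the combination is bounded by the sum of the moduli of the [a j]; so it passes
    to the limit. *)
Lemma orbit_comb_domain x : D x ->
  D (orbit_comb x) /\ N (A (orbit_comb x) - orbit_comb (A x)) = 0.
Proof.
move=> Dx; have Xx := DX Dx; have XAx := AX Dx.
have Xo := orbit_combX Xx; have XoA := orbit_combX XAx.
apply/(generator_limP Hsi Tgen Xo XoA) => e e0.
pose K := 1 + \sum_(j < n) Normc.normc (a j).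
have K0 : 0 < K by rewrite ltr_pwDl// sumr_ge0// => j _; exact: normc_ge0.
have [_ +] := generator_limP Hsi Tgen Xx XAx.
have [+ _] := generator_limP Hsi Tgen Xx XAx.
rewrite subrr (N0 Hsi) => /(_ (conj Dx erefl)) H _.
have [d d0 Hd] := H (e / K) (divr_gt0 e0 K0).
exists d => // s s0 sd; have s0' := ltW s0.
have Xd : X ((s^-1)%:C%C *: (T s x - x) - A x) by inX.
rewrite (N_eq Hsi _ _ (orbit_comb_diff (s^-1)%:C%C s0' Xx XAx)); [|by inX|exact: orbit_combX].
apply: le_lt_trans (orbit_comb_le Xd) _.
apply: (@le_lt_trans _ _ (K * N ((s^-1)%:C%C *: (T s x - x) - A x))).
  by rewrite ler_wpM2r ?(N_ge0 Hsi)// /K lerDr.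
by rewrite mulrC -ltr_pdivlMr// Hd.
Qed.

End Operator.

(** * Discrete Fourier transform of a windowed orbit *)

Section DFT.
Variables (h : R) (n : nat) (z : R[i]) (w : nat -> R).
Hypotheses (h0 : 0 <= h) (n0 : (0 < n)%N) (pz : n.-primitive_root z).
Hypotheses (w0 : w 0%N = 0) (wn : w n.-1 = 0).

Let jh (j : nat) : 0 <= j%:R * h. Proof. by rewrite mulr_ge0. Qed.

Definition orbit_dft (u : nat -> R) k := orbit_comb h n (fun j => z ^+ (j * k) * (u j)%:C%C).

Lemma orbit_dft_parseval (u : nat -> R) y : X y ->
  \sum_(k < n) N (orbit_dft u k y) ^+ 2 = n%:R * \sum_(j < n) u j ^+ 2 * N (T (j%:R * h) y) ^+ 2.
Proof.
move=> Xy.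
have := parseval Hsi (y := fun j : nat => (u j)%:C%C *: T (j%:R * h) y) pz _.
under eq_bigr do under eq_bigr do rewrite scalerA.
move=> ->; last by inX.
congr (_ * _); apply: eq_bigr => j _.
by rewrite (NZr Hsi) ?exprMn ?real_normK ?num_real//; inX.
Qed.

Lemma orbit_dft_le (u : nat -> R) y B : X y -> (forall j, (j < n)%N -> u j ^+ 2 <= B) ->
  \sum_(k < n) N (orbit_dft u k y) ^+ 2 <= n%:R * (n%:R * (B * N y ^+ 2)).
Proof.
move=> Xy uB; rewrite orbit_dft_parseval// ler_wpM2l//.
apply: (sum_le_const (f := fun j : nat => u j ^+ 2 * N (T (j%:R * h) y) ^+ 2)) => j jn.
rewrite ler_pM ?sqr_ge0 ?uB//.
by rewrite lerXn2r ?nnegrE ?(N_ge0 Hsi)//; apply: (Tle Tsg).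
Qed.

(** Multiplying by z^k T h moves the weight of node j - 1 to node j. There are no boundary terms
    because the window vanishes at both ends; at j = 0 the index [j.-1] is again 0, where the window
    is zero. *)
Lemma orbit_dft_shift k x : X x ->
  N (z ^+ k *: T h (orbit_dft w k x)
     - (orbit_dft w k x - orbit_dft (fun j => w j - w j.-1) k x)) = 0.
Proof.
move=> Xx; pose g (j : nat) := (z ^+ (j * k) * (w j.-1)%:C%C) *: T (j%:R * h) x.
have -> : orbit_dft w k x - orbit_dft (fun j => w j - w j.-1) k x = \sum_(j < n) g j.
  rewrite /orbit_dft /orbit_comb -sumrB; apply: eq_bigr => j _; rewrite /g -scalerBl.
  by rewrite rmorphB/= mulrBr opprB addrC subrK.
have -> : \sum_(j < n) g j = \sum_(j < n) g j.+1.
  have E : \sum_(j < n.+1) g j = \sum_(j < n.+1) g j by [].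
  rewrite {1}big_ord_recr big_ord_recl/= {2 3}/g/= w0 wn !mulr0 !scale0r addr0 add0r in E.
  exact: E.
pose a j := z ^+ (j * k) * (w j)%:C%C.
have E := Tsum Hsi Tsg (n := n) a (x := fun j : nat => T (j%:R * h) x) h0 (fun j _ => TX Tsg (jh j) Xx).
have -> : \sum_(j < n) g j.+1 = z ^+ k *: \sum_(j < n) a j *: T (j.+1%:R * h) x.
  rewrite scaler_sumr; apply: eq_bigr => j _.
  by rewrite /g /a scalerA mulrA -exprD mulSn.
have Xo : X (orbit_dft w k x) by exact: orbit_combX.
have XS1 : X (\sum_(j < n) a j *: T (j.+1%:R * h) x).
  by apply: (Xsum Hsi (f := fun j : nat => a j *: T (j.+1%:R * h) x)); inX; rewrite mulr_ge0.
have XS2 : X (\sum_(j < n) a j *: T h (T (j%:R * h) x)).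
  by apply: (Xsum Hsi (f := fun j : nat => a j *: T h (T (j%:R * h) x))); inX.
rewrite -scalerBr (NZ Hsi); last by inX.
suff -> : N (T h (orbit_dft w k x) - \sum_(j < n) a j *: T (j.+1%:R * h) x) = 0 by rewrite mulr0.
apply: (eqN_trans Hsi (y := \sum_(j < n) a j *: T h (T (j%:R * h) x))); [by inX..|exact: E|].
apply/eqP; rewrite eq_le (N_ge0 Hsi) andbT -sumrB.
pose f (j : nat) := a j *: T h (T (j%:R * h) x) - a j *: T (j.+1%:R * h) x.
have h1 (j : nat) : 0 <= j.+1%:R * h by rewrite mulr_ge0.
apply: le_trans (Nsum_le Hsi (f := f) _) _; first by rewrite /f; inX.
rewrite big1// => j _; rewrite /f -scalerBr (NZ Hsi); last by inX.
rewrite (Ndist Hsi); [|by inX..].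
by rewrite -natr1 mulrDl mul1r addrC [_ + h]addrC addrC (Tadd Tsg)// mulr0.
Qed.

End DFT.

(** A tent of slope one vanishing at 0 and at n - 1. Its increments are at most 1 while its squares
    add up to order n^3, so the error due to the window becomes negligible on long time spans. *)
Definition hat (n j : nat) : R := (minn j (n.-1 - j))%:R.

Lemma hat_le n j : (j < n)%N -> hat n j ^+ 2 <= n%:R ^+ 2.
Proof.
move=> jn; rewrite lerXn2r ?nnegrE// ler_nat.
by apply: leq_trans (geq_minl _ _) _; exact: ltnW.
Qed.

Lemma hat_lip n j : (j < n)%N -> (hat n j - hat n j.-1) ^+ 2 <= 1.
Proof.
move=> jn; suff : `|hat n j - hat n j.-1| <= 1.
  by move=> H; rewrite -real_normK ?num_real// expr_le1.
rewrite ler_norml /hat.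
have H1 : (minn j (n.-1 - j) <= 1 + minn j.-1 (n.-1 - j.-1))%N by lia.
have H2 : (minn j.-1 (n.-1 - j.-1) <= 1 + minn j (n.-1 - j))%N by lia.
move: H1 H2; rewrite -2!(ler_nat R) !natrD => H1 H2; apply/andP; split; lra.
Qed.

(** Of the 4 m nodes, the middle 2 m have height at least m. *)
Lemma hat_sum m : m%:R ^+ 3 * 2 <= \sum_(j < m + (2 * m + m)) hat (m + (2 * m + m)) j ^+ 2.
Proof.
rewrite big_split_ord big_split_ord/= addrCA.
set a := (X in X + (_ + _)); set b := (X in _ + (X + _)); set c := (X in _ + (_ + X)).
have Ha : m%:R ^+ 3 * 2 <= a.
  have -> : m%:R ^+ 3 * 2 = (2 * m)%:R * m%:R ^+ 2 :> R by rewrite natrM; ring.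
  rewrite /a mulr_natl -[X in _ *+ X <= _](card_ord (2 * m)) -sumr_const.
  apply: ler_sum => j _; rewrite lerXn2r ?nnegrE// ler_nat leq_min leq_addr/=.
  by have := ltn_ord j; lia.
by rewrite (le_trans Ha)// lerDl addr_ge0// sumr_ge0// => j _; exact: sqr_ge0.
Qed.

(* At low frequencies [|mu| <= M] the resolvent bound controls the transform,
   at high frequencies the factor [mu] does. *)
Lemma dft_frequency_split (C M h : R) n z k x w : 0 < M -> 0 <= C -> 0 < h -> C * h * M ^+ 2 <= 1 ->
  (0 < n)%N -> n.-primitive_root z -> w 0%N = 0 -> w n.-1 = 0 -> D x ->
  (forall lam, `|lam| <= M -> resolvent_bound N D A lam C) ->
  N (orbit_dft h n z w k x) ^+ 2 <=
    (8 * C ^+ 2 + 3 / M ^+ 2) * (N (orbit_dft h n z w k ((h^-1)%:C%C *: (T h x - x) - A x)) ^+ 2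
       + h^-1 ^+ 2 * N (orbit_dft h n z (fun j => w j - w j.-1) k x) ^+ 2)
    + 3 / M ^+ 2 * N (orbit_dft h n z w k (A x)) ^+ 2.
Proof.
move=> M0 C0 h0 ChM n0 pz w0 wn Dx HC; have h0' := ltW h0.
have Xx := DX Dx; have XAx := AX Dx.
set S := orbit_dft h n z w k x; set E := orbit_dft h n z _ k x.
set y := _ *: _ - _; have Xy : X y by rewrite /y; inX.
set G := orbit_dft h n z w k y; set B := orbit_dft h n z w k (A x).
have XS : X S by exact: orbit_combX.
have XE : X E by exact: orbit_combX.
have XG : X G by exact: orbit_combX.
have XB' : X B by exact: orbit_combX.
have [DS AS] := orbit_comb_domain n (fun j => z ^+ (j * k) * (w j)%:C%C) h0' Dx.
rewrite -/(orbit_dft h n z w k x) -/(orbit_dft h n z w k (A x)) -/S -/B in DS AS.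
have XAS := AX DS.
have zc : (z^*%C) ^+ k * z ^+ k = 1 by rewrite -exprMn mulrC (prim_root_conj pz) expr1n.
set p := z^*%C ^+ k in zc.
have pp : p * p^*%C = 1 by rewrite /p rmorphXn/= conjcK.
have pN := conj_unit_norm pp.
have Np : Normc.normc p = 1.
  have := normc_Re p; rewrite pN => /eqP.
  by rewrite sqrf_eq1 => /orP[/eqP //|/eqP H]; have := normc_ge0 p; rewrite H ler0N1.
have ThS : N (T h S - p *: (S - E)) = 0.
  have := orbit_dft_shift z h0' w0 wn k Xx; rewrite -/S -/E => H.
  have -> : T h S - p *: (S - E) = p *: (z ^+ k *: T h S - (S - E)).
    by rewrite [in RHS]scalerBr scalerA zc scale1r.
  by rewrite (NZ Hsi) ?H ?mulr0//; inX.
(* [mu] is the symbol of the difference quotient: on the transform, h^-1 (T h - 1) acts as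
   multiplication by [mu], up to the window error. *)
pose mu := (h^-1)%:C%C * (p - 1).
pose Q := (h^-1)%:C%C *: (T h S - S).
have XQ : X Q by rewrite /Q; inX.
have P1 : N (mu *: S - Q) <= h^-1 * N E.
  have -> : mu *: S - Q = (h^-1)%:C%C *: (p *: S - T h S).
    by rewrite /mu /Q -scalerA -scalerBr scalerBl scale1r subr_subBB.
  rewrite (NZr Hsi) ?ger0_norm ?invr_ge0//; last by inX.
  rewrite ler_wpM2l ?invr_ge0//.
  apply: le_trans (Ntri Hsi (z := p *: (S - E)) _ _ _) _; [by inX..|].
  rewrite [X in _ + X](Ndist Hsi) ?ThS ?addr0; [|by inX..].
  by rewrite -scalerBr opprB addrCA subrr addr0 (NZ Hsi)// Np mul1r.
have QBG : N (Q - B - G) = 0 by exact: orbit_comb_diff.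
have P2 : N (Q - A S) <= N G.
  apply: le_trans (Ntri Hsi (z := B) _ _ _) _ => //.
  rewrite [X in _ + X](Ndist Hsi)// AS addr0.
  by have := Nle Hsi (XB Hsi XQ XB') XG; rewrite QBG addr0.
have P3 : N Q <= N G + N B.
  apply: le_trans (Nle Hsi XQ XB') _; rewrite addrC lerD2r.
  by have := Nle Hsi (XB Hsi XQ XB') XG; rewrite QBG addr0.
set g := N G in P2 P3 *; set b := N B in P3 *; set s := N S.
set e := h^-1 * N E in P1.
have g0 : 0 <= g := N_ge0 Hsi _.
have b0 : 0 <= b := N_ge0 Hsi _.
have s0 : 0 <= s := N_ge0 Hsi _.
have e0 : 0 <= e by rewrite mulr_ge0 ?invr_ge0// (N_ge0 Hsi).
rewrite -exprMn -/e.
have i1 : N (mu *: S - A S) <= g + e.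
  by apply: le_trans (Ntri Hsi (z := Q) _ _ _) _; [by inX..|]; rewrite addrC lerD.
have i2 : Normc.normc mu * s <= g + b + e.
  rewrite -(NZ Hsi)//; apply: le_trans (Nle Hsi (XZ Hsi mu XS) XQ) _.
  by rewrite lerD.
have CC : 0 <= 8 * C ^+ 2 by rewrite mulr_ge0// sqr_ge0.
have MM : 0 <= 3 / M ^+ 2 by rewrite divr_ge0// sqr_ge0.
set K := 3 / M ^+ 2 in MM *.
have [muM|muM] := leP (Normc.normc mu) M.
  have Imu : `|complex.Im mu| <= M.
    apply: le_trans muM; rewrite -ler_sqr ?nnegrE ?normc_ge0// real_normK ?num_real//.
    by rewrite normc_Re lerDr sqr_ge0.
  (* Since |p| = 1, the real part of mu is - h |mu|^2 / 2. Below the cutoff mu is thus within h M^2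
     / 2 of the imaginary axis, a deviation that C h M^2 <= 1 allows to absorb into half of s. *)
  have Rmu : `|complex.Re mu| <= h * M ^+ 2 / 2.
    have -> : complex.Re mu = - (h * Normc.normc mu ^+ 2 / 2).
      rewrite normc_Re /mu; move: pN; case: (p) => p1 p2 /= pN.
      rewrite !mul0r subr0 addr0 oppr0 addr0.
      have -> : h * ((h^-1 * (p1 - 1)) ^+ 2 + (h^-1 * p2) ^+ 2) / 2 =
         ((p1 ^+ 2 + p2 ^+ 2) + 1 - 2 * p1) / (2 * h) by field; rewrite gt_eqF.
      by rewrite pN; field; rewrite gt_eqF.
    rewrite normrN ger0_norm; last by rewrite divr_ge0// mulr_ge0// sqr_ge0.
    rewrite ler_pM2r ?invr_gt0// ler_pM2l// lerXn2r ?nnegrE ?normc_ge0// ltW//.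
  have := HC _ Imu _ DS; rewrite -/s => Hs.
  have XlS : X ((0 +i* complex.Im mu)%C *: S) by inX.
  have i3 : N ((0 +i* complex.Im mu)%C *: S - A S) <= g + e + h * M ^+ 2 / 2 * s.
    apply: le_trans (Ntri Hsi (z := mu *: S) _ _ _) _; [by inX..|].
    rewrite addrC lerD// -scalerBl (NZ Hsi)// ler_wpM2r//.
    apply: le_trans Rmu; case: (mu) => m1 m2 /=.
    by rewrite subrr expr0n addr0 sub0r sqrrN sqrtr_sqr.
  have i4 : s <= C * (g + e) + s / 2.
    apply: le_trans Hs _; apply: le_trans (ler_wpM2l C0 i3) _.
    rewrite mulrDr lerD2l.
    have -> : C * (h * M ^+ 2 / 2 * s) = C * h * M ^+ 2 * (s / 2) by field.
    by rewrite -[leRHS]mul1r ler_wpM2r// divr_ge0.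
  have i5 : s <= 2 * C * (g + e) by lra.
  have i6 : s ^+ 2 <= 8 * C ^+ 2 * (g ^+ 2 + e ^+ 2).
    apply: (@le_trans _ _ ((2 * C * (g + e)) ^+ 2)).
      by rewrite lerXn2r ?nnegrE// mulr_ge0 ?addr_ge0// mulr_ge0.
    have -> : (2 * C * (g + e)) ^+ 2 = 4 * C ^+ 2 * (g + e) ^+ 2 by ring.
    have : 0 <= C ^+ 2 * (g - e) ^+ 2 by rewrite mulr_ge0// sqr_ge0.
    lra.
  have j1 : 0 <= K * (g ^+ 2 + e ^+ 2) by rewrite mulr_ge0// addr_ge0 ?sqr_ge0.
  have j2 : 0 <= K * b ^+ 2 by rewrite mulr_ge0// sqr_ge0.
  lra.
have i7 : s <= (g + b + e) / M.
  rewrite ler_pdivlMr// mulrC; apply: le_trans i2; rewrite ler_wpM2r// ltW//.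
have i8 : s ^+ 2 <= K * (g ^+ 2 + b ^+ 2 + e ^+ 2).
  apply: (@le_trans _ _ (((g + b + e) / M) ^+ 2)).
    by rewrite lerXn2r ?nnegrE// divr_ge0 ?addr_ge0// ltW.
  have -> : K * (g ^+ 2 + b ^+ 2 + e ^+ 2) = 3 * (g ^+ 2 + b ^+ 2 + e ^+ 2) / M ^+ 2.
    by rewrite /K mulrAC.
  rewrite expr_div_n ler_wpM2r ?invr_ge0 ?sqr_ge0//.
  have := sqr_ge0 (g - b); have := sqr_ge0 (b - e); have := sqr_ge0 (g - e); lra.
have : 0 <= 8 * C ^+ 2 * (g ^+ 2 + e ^+ 2) by rewrite mulr_ge0// addr_ge0 ?sqr_ge0.
lra.
Qed.

(** The frequency-wise bounds are summed over all n = 4 m frequencies. By Parseval the left side is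
    at least 8 m^4 l^2, the squared tent having sum at least 2 m^3. On the right the tent
    contributes at most n^4 = 256 m^4, and the quotient is the factor 32. The increments of the tent
    contribute n^2 only, which is why [N x] comes divided by the time span. *)
Lemma orbit_key_estimate (l C M h : R) m x : 0 < M -> 0 <= C -> 0 < h -> C * h * M ^+ 2 <= 1 ->
  (0 < m)%N -> D x -> 0 <= l -> (forall t, 0 <= t -> l <= N (T t x)) ->
  (forall lam, `|lam| <= M -> resolvent_bound N D A lam C) ->
  l ^+ 2 <= 32 * ((8 * C ^+ 2 + 3 / M ^+ 2) *
      (N ((h^-1)%:C%C *: (T h x - x) - A x) ^+ 2 + (N x / (h * (4 * m%:R))) ^+ 2)
    + 3 / M ^+ 2 * N (A x) ^+ 2).
Proof.
move=> M0 C0 h0 ChM m0 Dx l0 Hl HC; have h0' := ltW h0.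
have Xx := DX Dx; have XAx := AX Dx.
have Xy : X ((h^-1)%:C%C *: (T h x - x) - A x) by inX.
pose n := (m + (2 * m + m))%N.
have n0 : (0 < n)%N by rewrite /n; lia.
have nE : n%:R = 4 * m%:R :> R by rewrite -natrM; congr (_%:R); rewrite /n; lia.
have mR : 0 < m%:R :> R by rewrite ltr0n.
have [z pz] := prim_root_exists R n0.
have w0 : hat n 0 = 0 by rewrite /hat min0n.
have wn : hat n n.-1 = 0 by rewrite /hat subnn minn0.
have L : n%:R * (m%:R ^+ 3 * 2 * l ^+ 2) <= \sum_(k < n) N (orbit_dft h n z (hat n) k x) ^+ 2.
  rewrite orbit_dft_parseval// ler_wpM2l//.
  apply: (@le_trans _ _ ((\sum_(j < n) hat n j ^+ 2) * l ^+ 2)).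
    by rewrite ler_wpM2r ?sqr_ge0// hat_sum.
  rewrite mulr_suml; apply: ler_sum => j _; rewrite ler_wpM2l ?sqr_ge0//.
  by rewrite lerXn2r ?nnegrE ?(N_ge0 Hsi)// Hl// mulr_ge0.
have UG := orbit_dft_le h0' pz Xy (@hat_le n).
have UA := orbit_dft_le h0' pz XAx (@hat_le n).
have UE := orbit_dft_le h0' pz Xx (@hat_lip n).
set y := _ - A x in UG *.
set K1 := 8 * C ^+ 2 + 3 / M ^+ 2; set K2 := 3 / M ^+ 2.
have K20 : 0 <= K2 by rewrite divr_ge0// sqr_ge0.
have K10 : 0 <= K1 by rewrite addr_ge0// mulr_ge0// sqr_ge0.
have : \sum_(k < n) N (orbit_dft h n z (hat n) k x) ^+ 2 <=
  K1 * (n%:R * (n%:R * (n%:R ^+ 2 * N y ^+ 2)) + h^-1 ^+ 2 * (n%:R * (n%:R * (1 * N x ^+ 2))))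
    + K2 * (n%:R * (n%:R * (n%:R ^+ 2 * N (A x) ^+ 2))).
  apply: (@le_trans _ _ (\sum_(k < n) (K1 * (N (orbit_dft h n z (hat n) k y) ^+ 2 +
     h^-1 ^+ 2 * N (orbit_dft h n z (fun j => hat n j - hat n j.-1) k x) ^+ 2)
     + K2 * N (orbit_dft h n z (hat n) k (A x)) ^+ 2))).
    by apply: ler_sum => k _; exact: (dft_frequency_split k M0 C0 h0 ChM n0 pz w0 wn Dx HC).
  rewrite big_split/= -!mulr_sumr big_split/= -mulr_sumr.
  by rewrite lerD// ler_wpM2l// lerD// ler_wpM2l// sqr_ge0.
move=> U; have {}L := le_trans L U; rewrite nE in L.
have -> : N x / (h * (4 * m%:R)) = N x / (h * m%:R) / 4 by field; rewrite !gt_eqF.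
rewrite -(ler_pM2l (mulr_gt0 (ltr0Sn R 7) (exprn_gt0 4 mR))).
apply: le_trans (le_trans _ L) _; first by rewrite le_eqVlt; apply/orP; left; apply/eqP; ring.
by rewrite le_eqVlt; apply/orP; left; apply/eqP; field; rewrite !gt_eqF.
Qed.

(** A bound with constant C > 0 at one frequency persists with constant 2 C at distance less than 1
    / (2 C), because moving the frequency changes the right side by at most the distance times
    [N U]. Compactness of [-M, M] makes the constant uniform. *)
Lemma resolvent_bound_compact (M : R) : (forall lam, exists C, resolvent_bound N D A lam C) ->
  exists2 C, 0 <= C & forall lam, `|lam| <= M -> resolvent_bound N D A lam C.
Proof.
move=> HC; have cM := @segment_compact R (- M) M.
have /compact_near_coveringP/(_ R (+oo : set_system R) (fun C lam => resolvent_bound N D A lam C) _) := cM.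
case.
  move=> lam _; have [C0 HC0] := HC lam.
  pose C := `|C0| + 1; have Cp : 0 < C by rewrite ltr_wpDl.
  have {}HC0 U : D U -> N U <= C * N ((0 +i* lam)%C *: U - A U).
    move=> DU; apply: le_trans (HC0 U DU) _; rewrite ler_wpM2r ?(N_ge0 Hsi)//.
    by rewrite (le_trans (ler_norm _))// lerDl.
  exists (ball lam (2 * C)^-1, [set c | 2 * C <= c]).
    split; first by apply: nbhsx_ballx; rewrite invr_gt0 mulr_gt0.
    by exists (2 * C); split=> [|c /ltW //]; exact: num_real.
  move=> [lam' c] [/= lamlam' Cc] U DU.
  have XU := DX DU; have XAU := AX DU.
  have XlU l : X ((0 +i* l)%C *: U) by inX.
  have H1 : N ((0 +i* lam)%C *: U - A U) <= N ((0 +i* lam')%C *: U - A U) + (2 * C)^-1 * N U.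
    apply: le_trans (Ntri Hsi (z := (0 +i* lam')%C *: U) _ _ _) _; [by inX..|].
    rewrite addrC lerD2l -scalerBl (NZ Hsi)// ler_wpM2r ?(N_ge0 Hsi)//=.
    by rewrite subrr expr0n add0r sqrtr_sqr; exact: ltW.
  have H2 : N U <= C * N ((0 +i* lam')%C *: U - A U) + N U / 2.
    apply: le_trans (HC0 U DU) _; apply: le_trans (ler_wpM2l (ltW Cp) H1) _.
    rewrite mulrDr lerD2l le_eqVlt; apply/orP; left; apply/eqP; field.
    by rewrite gt_eqF.
  apply: (@le_trans _ _ (2 * C * N ((0 +i* lam')%C *: U - A U))); first by lra.
  by rewrite ler_wpM2r ?(N_ge0 Hsi).
move=> c [_ Hc]; exists (`|c| + 1); first by rewrite addr_ge0.
move=> lam lamM; apply: (Hc (`|c| + 1)).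
  by apply: le_lt_trans (ler_norm _) _; rewrite ltrDl.
by rewrite /= in_itv/= -ler_norml.
Qed.

Hypothesis X_complete : forall u : nat -> V, (forall n, X (u n)) ->
  (forall e, 0 < e -> exists n0, forall m n, (n0 <= m)%N -> (n0 <= n)%N -> N (u m - u n) <= e) ->
  exists2 x, X x & forall e, 0 < e -> exists n0, forall n, (n0 <= n)%N -> N (u n - x) <= e.

(** If the orbit stayed above l, the key estimate would bound l^2 by three terms. The choices of M,
    tau and h make them at most l^2 / 6, l^2 / 4 and 4 l^2 / 25, whose sum is below l^2. *)
Lemma domain_orbit_vanishes (l : R) x : (forall lam, exists C, resolvent_bound N D A lam C) ->
  D x -> 0 < l -> exists2 t, 0 <= t & N (T t x) < l.
Proof.
move=> HC Dx l0; have Xx := DX Dx; have XAx := AX Dx.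
apply: contrapT => noT.
have Hl t : 0 <= t -> l <= N (T t x).
  by move=> t0; rewrite leNgt; apply/negP => Ht; apply: noT; exists t.
have l2 : 0 < l ^+ 2 by rewrite exprn_gt0.
pose M := 1 + 24 * N (A x) / l.
have M0 : 0 < M by rewrite ltr_pwDl// divr_ge0 ?(ltW l0)// mulr_ge0// (N_ge0 Hsi).
have HM : 96 * N (A x) ^+ 2 <= l ^+ 2 / 6 * M ^+ 2.
  have : (24 * N (A x)) ^+ 2 <= (l * M) ^+ 2.
    have -> : l * M = l + 24 * N (A x) by rewrite /M; field; rewrite gt_eqF.
    by have NA := N_ge0 Hsi (A x); rewrite lerXn2r ?nnegrE//; lra.
  by rewrite !exprMn; lra.
have [C C0 HCM] := resolvent_bound_compact M HC.
pose K := 8 * C ^+ 2 + 3 / M ^+ 2.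
have K0 : 0 < K by rewrite ltr_wpDl ?mulr_ge0 ?sqr_ge0// divr_gt0// exprn_gt0.
pose tau := 1 + 200 * K * (N x ^+ 2 + 1) / l ^+ 2.
have tau1 : 1 <= tau.
  rewrite lerDl; apply: divr_ge0; last exact: sqr_ge0.
  by apply: mulr_ge0; [apply: mulr_ge0 => //; exact: ltW|apply: addr_ge0 => //; exact: sqr_ge0].
have tau0 : 0 < tau := lt_le_trans ltr01 tau1.
have Htau : 32 * (K * (N x / tau) ^+ 2) <= l ^+ 2 / 4.
  have -> : 32 * (K * (N x / tau) ^+ 2) = 32 * (K * N x ^+ 2) / tau ^+ 2 by field; rewrite gt_eqF.
  rewrite ler_pdivrMr ?exprn_gt0//.
  apply: (@le_trans _ _ (l ^+ 2 / 4 * tau)).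
    rewrite /tau mulrDr mulr1.
    have -> : l ^+ 2 / 4 * (200 * K * (N x ^+ 2 + 1) / l ^+ 2) = 50 * (K * N x ^+ 2) + 50 * K by field; rewrite gt_eqF.
    have : 0 <= K * N x ^+ 2 by rewrite mulr_ge0 ?sqr_ge0// ltW.
    lra.
  rewrite ler_wpM2l ?divr_ge0 ?sqr_ge0// expr2 ler_peMr// ltW//.
have [+ _] := generator_limP Hsi Tgen Xx XAx.
rewrite subrr (N0 Hsi) => /(_ (conj Dx erefl)) Hgen.
pose eps := Num.sqrt (l ^+ 2 / (200 * K)).
have eps2 : eps ^+ 2 = l ^+ 2 / (200 * K).
  by apply: sqr_sqrtr; apply: divr_ge0; [exact: sqr_ge0|apply: mulr_ge0 => //; exact: ltW].
have eps0 : 0 < eps by rewrite sqrtr_gt0; apply: divr_gt0; [exact: exprn_gt0|exact: mulr_gt0].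
have [d d0 Hd] := Hgen eps eps0.
(* One number collects the demands on the mesh: h q < 1 gives both h < d and C h M^2 <= 1. *)
pose q := 1 + 1 / d + C * M ^+ 2.
have CM0 : 0 <= C * M ^+ 2 by rewrite mulr_ge0 ?sqr_ge0.
have d1 : 0 < 1 / d by rewrite divr_gt0.
have q0 : 0 < q by rewrite /q; lra.
pose m := (Num.truncn (tau * q)).+1.
have mR : 0 < m%:R :> R by rewrite ltr0n.
pose h := tau / (4 * m%:R).
have h0 : 0 < h by rewrite divr_gt0// mulr_gt0.
have hq : h * q < 1.
  rewrite /h mulrAC ltr_pdivrMr ?mulr_gt0// mul1r.
  apply: lt_le_trans (truncnS_gt _) _; rewrite -/m ler_peMl//; lra.
have hd : h < d.
  suff : h * (1 / d) < 1 by rewrite mul1r ltr_pdivrMr// mul1r.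
  by apply: le_lt_trans hq; rewrite ler_wpM2l ?(ltW h0)// /q; lra.
have ChM : C * h * M ^+ 2 <= 1.
  rewrite -mulrA mulrCA; apply: le_trans (ltW hq); rewrite ler_wpM2l ?(ltW h0)// /q; lra.
have := orbit_key_estimate M0 C0 h0 ChM (ltn0Sn (Num.truncn (tau * q))) Dx (ltW l0) Hl HCM.
rewrite -/m -/K; have -> : h * (4 * m%:R) = tau by rewrite /h divfK// gt_eqF// mulr_gt0.
have {}Hd := Hd h h0 hd.
set y := N (_ - A x) in Hd *.
have y2 : K * y ^+ 2 <= l ^+ 2 / 200.
  apply: (@le_trans _ _ (K * eps ^+ 2)).
    by rewrite ler_wpM2l ?(ltW K0)// lerXn2r ?nnegrE ?(N_ge0 Hsi) ?(ltW eps0) ?(ltW Hd).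
  rewrite eps2 le_eqVlt; apply/orP; left; apply/eqP; field; rewrite gt_eqF//.
have A2 : 32 * (3 / M ^+ 2 * N (A x) ^+ 2) <= l ^+ 2 / 6.
  have -> : 32 * (3 / M ^+ 2 * N (A x) ^+ 2) = 96 * N (A x) ^+ 2 / M ^+ 2 by field; rewrite gt_eqF.
  by rewrite ler_pdivrMr// exprn_gt0.
move=> Hfin; have : l ^+ 2 < l ^+ 2 by apply: le_lt_trans Hfin _; lra.
by rewrite ltxx.
Qed.

(* Arendt-Batty-Lyubich-Vu criterion, in the special case of contraction
   semigroups on a Hilbert space without approximate spectrum on the imaginary axis. *)
Theorem strongly_stable_of_resolvent_bounds :
  (forall lam, exists C, resolvent_bound N D A lam C) -> strongly_stable X N T.
Proof.
move=> HC x Xx; apply/cvgrPdist_lt => e e0.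
have [x' Dx' [Xx' xx']] := domain_dense Hsi Tsg Tgen X_complete Xx (divr_gt0 e0 (ltr0Sn R 1)).
have [t t0 Ht] := domain_orbit_vanishes HC Dx' (divr_gt0 e0 (ltr0Sn R 1)).
have XTt := TX Tsg t0 Xx; have XTt' := TX Tsg t0 Xx'.
exists t; split; first exact: num_real.
move=> s ts; rewrite sub0r normrN ger0_norm ?(N_ge0 Hsi)//.
have st : 0 <= s - t by rewrite subr_ge0 ltW.
have -> : s = (s - t) + t by rewrite subrK.
rewrite (N_eq Hsi _ _ (Tadd Tsg st t0 Xx)); [|by inX..].
apply: le_lt_trans (Tle Tsg st XTt) _.
apply: le_lt_trans (Nle Hsi XTt XTt') _.
rewrite [e]splitr ltr_leD//.
by apply: le_trans xx'; exact: (Tdist Hsi Tsg).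
Qed.

End Stability.

(** * Absolutely continuous functions and Gronwall's inequality *)

Section AbsolutelyContinuous.
Context {R : realType}.
Notation mu := (@lebesgue_measure R).
Implicit Types (f g F G : R -> R) (a b x y : R).

Definition Rintegrable (D : set R) (f : R -> R) := mu.-integrable D (EFin \o f).

Lemma RintegrableS (D E : set R) f : measurable D -> measurable E -> E `<=` D ->
  Rintegrable D f -> Rintegrable E f.
Proof. by move=> mD mE ED; apply: integrableS. Qed.

Lemma RintegrableD (D : set R) f g : measurable D -> Rintegrable D f -> Rintegrable D g ->
  Rintegrable D (fun x => f x + g x).
Proof. by move=> mD Hf Hg; exact: (@integrableD _ _ _ mu D mD _ _ Hf Hg). Qed.

Lemma RintegrableZ (D : set R) (k : R) f : measurable D -> Rintegrable D f ->
  Rintegrable D (fun x => k * f x).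
Proof. by move=> mD Hf; exact: (@integrableZl _ _ _ mu D mD k _ Hf). Qed.

Lemma RintegrableN (D : set R) f : measurable D -> Rintegrable D f ->
  Rintegrable D (fun x => - f x).
Proof.
move=> mD Hf; have := RintegrableZ (-1) mD Hf.
by apply: eq_integrable => // x _ /=; rewrite mulN1r.
Qed.

Lemma RintegrableB (D : set R) f g : measurable D -> Rintegrable D f -> Rintegrable D g ->
  Rintegrable D (fun x => f x - g x).
Proof. by move=> mD Hf Hg; apply: RintegrableD => //; exact: RintegrableN. Qed.

Lemma Rintegrable_norm (D : set R) f : measurable D -> Rintegrable D f ->
  Rintegrable D (fun x => `|f x|).
Proof. by move=> mD Hf; exact: (integrable_norm Hf). Qed.

Lemma Rintegrable_meas (D : set R) f : Rintegrable D f -> measurable_fun D f.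
Proof. by move=> /integrableP[/measurable_EFinP]. Qed.

Lemma Rintegrable_dom (D : set R) f g : measurable D -> measurable_fun D f ->
  (forall x, D x -> `|f x| <= g x) -> Rintegrable D g -> Rintegrable D f.
Proof.
move=> mD mf fg Hg; apply: le_integrable Hg => //; first exact/measurable_EFinP.
by move=> x Dx /=; rewrite lee_fin (le_trans (fg x Dx))// ler_norm.
Qed.

Lemma Rintegrable_bmul (D : set R) (k f : R -> R) (M : R) : measurable D -> measurable_fun D k ->
  (forall x, D x -> `|k x| <= M) -> Rintegrable D f -> Rintegrable D (fun x => k x * f x).
Proof.
move=> mD mk kM Hf; apply: (@Rintegrable_dom _ _ (fun x => M * `|f x|)) => //.
- by apply: measurable_funM => //; exact: Rintegrable_meas.
- by move=> x Dx; rewrite normrM ler_wpM2r// kM.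
- by apply: RintegrableZ => //; exact: Rintegrable_norm.
Qed.

Lemma Rintegrable_cst a b (c : R) : Rintegrable `[a, b] (fun=> c).
Proof.
apply: measurable_bounded_integrable => //.
- by rewrite /= lebesgue_measure_itv /=; case: ifPn => // _; rewrite -EFinD ltry.
- by exists `|c|; split; [exact: num_real|move=> M /ltW cM x _ /=].
Qed.

Lemma Rintegrable_continuous a b f : {within `[a, b], continuous f} -> Rintegrable `[a, b] f.
Proof. by move=> cf; apply: continuous_compact_integrable => //; exact: segment_compact. Qed.

Lemma within_continuous_meas a b f : {within `[a, b], continuous f} -> measurable_fun `[a, b] f.
Proof. by move=> cf; apply: Rintegrable_meas; exact: Rintegrable_continuous. Qed.

Lemma within_continuous_bounded a b f : {within `[a, b], continuous f} ->
  exists2 M, 0 <= M & forall x, a <= x -> x <= b -> `|f x| <= M.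
Proof.
move=> cf; have [ab|ba] := leP a b; last first.
  by exists 0 => // x ax xb; move: (le_lt_trans (le_trans ax xb) ba); rewrite ltxx.
have cn : {within `[a, b], continuous (fun x => `|f x|)}.
  by move=> x; apply: (cvg_comp _ _ (cf x)); exact: norm_continuous.
have [c _ Hc] := EVT_max ab cn.
by exists `|f c| => // x ax xb; apply: Hc; rewrite in_itv/= ax xb.
Qed.

Lemma Rintegral_split a b x f : a <= x -> x <= b -> Rintegrable `[a, b] f ->
  \int[mu]_(t in `[a, b]) f t = \int[mu]_(t in `[a, x]) f t + \int[mu]_(t in `[x, b]) f t.
Proof.
move=> ax xb Hf.
have := @Rintegral_itvB R f (BLeft a) (BRight b) x Hf; rewrite !bnd_simp => /(_ ax xb).
rewrite Rintegral_itv_obnd_cbnd.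
  by move=> <-; rewrite addrC subrK.
apply: RintegrableS Hf => //; apply: subset_itvr; rewrite bnd_simp//.
Qed.

Lemma Rintegral_itv_cst a b (c : R) : a <= b -> \int[mu]_(t in `[a, b]) c = c * (b - a).
Proof.
move=> ab; rewrite Rintegral_cst//= lebesgue_measure_itv/=.
move: ab; rewrite le_eqVlt => /predU1P[->|ab]; first by rewrite ltxx subrr.
by rewrite lte_fin ab.
Qed.

Lemma sub_itv a b x y : a <= x -> y <= b -> `[x, y] `<=` `[a, b].
Proof. by move=> ax yb; apply: subset_itvScc. Qed.

(* A named integral, so that [lra] treats it as an atom. *)
Definition itg a b f : R := \int[mu]_(t in `[a, b]) f t.

Lemma itgD a b f g : Rintegrable `[a, b] f -> Rintegrable `[a, b] g ->
  itg a b (fun t => f t + g t) = itg a b f + itg a b g.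
Proof. by move=> Hf Hg; rewrite /itg RintegralD. Qed.

Lemma itgB a b f g : Rintegrable `[a, b] f -> Rintegrable `[a, b] g ->
  itg a b (fun t => f t - g t) = itg a b f - itg a b g.
Proof. by move=> Hf Hg; rewrite /itg RintegralB. Qed.

Lemma itgZ a b (k : R) f : Rintegrable `[a, b] f -> itg a b (fun t => k * f t) = k * itg a b f.
Proof. by move=> Hf; rewrite /itg RintegralZl. Qed.

Lemma itg_ge0 a b f : (forall t, a <= t -> t <= b -> 0 <= f t) -> 0 <= itg a b f.
Proof. by move=> H; apply: Rintegral_ge0 => t /=; rewrite in_itv/= => /andP[]; exact: H. Qed.

Lemma itg_le a b f g : Rintegrable `[a, b] f -> Rintegrable `[a, b] g ->
  (forall t, a <= t -> t <= b -> f t <= g t) -> itg a b f <= itg a b g.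
Proof.
move=> Hf Hg fg; apply: le_Rintegral => // t /=.
by rewrite in_itv/= => /andP[]; exact: fg.
Qed.

Lemma eq_itg a b f g : (forall t, a <= t -> t <= b -> f t = g t) -> itg a b f = itg a b g.
Proof.
move=> fg; apply: eq_Rintegral => t; rewrite inE/= in_itv/= => /andP[].
exact: fg.
Qed.

Lemma itg_split a b x f : a <= x -> x <= b -> Rintegrable `[a, b] f ->
  itg a b f = itg a x f + itg x b f.
Proof. exact: Rintegral_split. Qed.

Lemma itg_cst a b (c : R) : a <= b -> itg a b (fun=> c) = c * (b - a).
Proof. exact: Rintegral_itv_cst. Qed.

Lemma itg1 a f : itg a a f = 0.
Proof. by rewrite /itg set_itv1 Rintegral_set1. Qed.

(** Absolute continuity with the derivative carried along as data: F is a Lebesgue primitive of the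
    integrable function f. *)
Definition AC a b F f := Rintegrable `[a, b] f /\
  forall x y, a <= x -> x <= y -> y <= b -> F y - F x = itg x y f.

Lemma AC_sub a b a' b' F f : a <= a' -> b' <= b -> AC a b F f -> AC a' b' F f.
Proof.
move=> aa bb [Hf HF]; split; first by apply: RintegrableS Hf => //; exact: sub_itv.
by move=> x y ax xy yb; apply: HF => //; [exact: le_trans ax|exact: le_trans yb _].
Qed.

Lemma AC_cst a b (c : R) : AC a b (fun=> c) (fun=> 0).
Proof.
split; first exact: Rintegrable_cst.
by move=> x y _ xy _; rewrite subrr itg_cst// mul0r.
Qed.

Lemma AC_id a b : AC a b id (fun=> 1).
Proof.
split; first exact: Rintegrable_cst.
by move=> x y _ xy _; rewrite itg_cst// mul1r.
Qed.

Lemma AC_add a b F f G g : AC a b F f -> AC a b G g ->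
  AC a b (fun x => F x + G x) (fun x => f x + g x).
Proof.
move=> [Hf HF] [Hg HG]; split; first exact: RintegrableD.
move=> x y ax xy yb; have S := sub_itv ax yb.
by rewrite opprD addrACA HF// HG// -itgD//; exact: RintegrableS S _.
Qed.

Lemma AC_scale a b (k : R) F f : AC a b F f -> AC a b (fun x => k * F x) (fun x => k * f x).
Proof.
move=> [Hf HF]; split; first exact: RintegrableZ.
move=> x y ax xy yb; have S := sub_itv ax yb.
by rewrite itgZ -?mulrBr ?HF//; exact: RintegrableS S _.
Qed.

Lemma AC_eq a b F f G g : (forall x, a <= x -> x <= b -> F x = G x) ->
  (forall x, a <= x -> x <= b -> f x = g x) -> AC a b F f -> AC a b G g.
Proof.
move=> FG fg [Hf HF]; split.
  apply: eq_integrable Hf => // x /=; rewrite inE/= in_itv/= => /andP[ax xb].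
  by rewrite fg.
move=> x y ax xy yb; rewrite -!FG//; [|exact: le_trans yb|exact: le_trans xy].
rewrite HF//; apply: eq_itg => t xt ty.
by rewrite fg//; [exact: le_trans xt|exact: le_trans yb].
Qed.

Lemma AC_opp a b F f : AC a b F f -> AC a b (fun x => - F x) (fun x => - f x).
Proof.
by move=> /(AC_scale (-1)); apply: AC_eq => x _ _; rewrite mulN1r.
Qed.

Lemma AC_within_continuous a b F f : a <= b -> AC a b F f -> {within `[a, b], continuous F}.
Proof.
move=> ab [Hf HF].
have := parameterized_integral_continuous ab Hf => cP.
have : {within `[a, b], continuous (fun x => F a + parameterized_integral mu a x f)}.
  by move=> x; apply: cvgD; [exact: cvg_cst|exact: cP].
apply: subspace_eq_continuous => x; rewrite inE/= in_itv/= => /andP[ax xb].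
by rewrite /from_subspace/= /parameterized_integral -/(itg a x f) -HF// addrC subrK.
Qed.

Lemma norm_AC_increment a b x y F f : AC a b F f -> a <= x -> x <= y -> y <= b ->
  `|F y - F x| <= itg x y (fun t => `|f t|).
Proof.
move=> [Hf HF] ax xy yb; rewrite HF//; apply: le_normr_Rintegral => //.
by apply: RintegrableS Hf => //; exact: sub_itv.
Qed.

Lemma itgS a b x y f : a <= x -> x <= y -> y <= b -> Rintegrable `[a, b] f ->
  (forall t, 0 <= f t) -> itg x y f <= itg a b f.
Proof.
move=> ax xy yb Hf f0.
rewrite (itg_split ax _ Hf); last exact: le_trans yb.
rewrite (@itg_split x b y)//; last by apply: RintegrableS Hf => //; exact: sub_itv.
by rewrite addrCA lerDl addr_ge0// itg_ge0.
Qed.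

(** The defect [d x y] of the product rule is additive over adjacent intervals and at most K^2,
    where K is the integral of |f| + |g|. Cutting at a point that halves K replaces K^2 by 2 (K /
    2)^2, so n bisections bound the defect by K^2 / 2^n. *)
Lemma AC_mul a b F f G g : a <= b -> AC a b F f -> AC a b G g ->
  AC a b (fun x => F x * G x) (fun x => F x * g x + f x * G x).
Proof.
move=> ab AF AG; have cF := AC_within_continuous ab AF; have cG := AC_within_continuous ab AG.
have [MF MF0 HMF] := within_continuous_bounded cF.
have [MG MG0 HMG] := within_continuous_bounded cG.
have [If _] := AF; have [Ig _] := AG.
have IFg : Rintegrable `[a, b] (fun x => F x * g x).
  apply: (@Rintegrable_bmul _ _ _ MF) => //; first exact: within_continuous_meas.
  by move=> x /=; rewrite in_itv/= => /andP[]; exact: HMF.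
have IfG : Rintegrable `[a, b] (fun x => f x * G x).
  have : Rintegrable `[a, b] (fun x => G x * f x).
    apply: (@Rintegrable_bmul _ _ _ MG) => //; first exact: within_continuous_meas.
    by move=> x /=; rewrite in_itv/= => /andP[]; exact: HMG.
  by apply: eq_integrable => // x _ /=; rewrite mulrC.
have IH : Rintegrable `[a, b] (fun x => F x * g x + f x * G x) by exact: RintegrableD.
split=> // x0 y0 ax0 xy0 yb0.
pose k t := `|f t| + `|g t|.
have k0 t : 0 <= k t by rewrite addr_ge0.
have Ik : Rintegrable `[a, b] k by apply: RintegrableD => //; exact: Rintegrable_norm.
pose d x y := F y * G y - F x * G x - itg x y (fun t => F t * g t + f t * G t).
pose K x y := itg x y k.
have K_ge0 x y : 0 <= K x y by apply: itg_ge0.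
suff key n x y : a <= x -> x <= y -> y <= b -> `|d x y| <= K x y ^+ 2 / 2 ^+ n.
  apply/eqP; rewrite -subr_eq0 -/(d x0 y0) -normr_eq0 eq_le normr_ge0 andbT.
  apply/ler_addgt0Pr => e e0; rewrite add0r.
  pose n := Num.truncn (K x0 y0 ^+ 2 / e).
  apply: le_trans (key n.+1 _ _ ax0 xy0 yb0) _.
  rewrite ler_pdivrMr ?exprn_gt0// -ler_pdivrMl// mulrC; apply: ltW.
  apply: lt_le_trans (truncnS_gt _) _.
  by rewrite -natrX ler_nat ltnW// ltn_expl.
elim: n x y => [|n IHn] x y ax xy yb.
  have S := sub_itv ax yb; rewrite expr0 divr1.
  have -> : d x y = itg x y (fun t => (F y - F t) * g t + f t * (G x - G t)).
    rewrite /d; have -> : F y * G y - F x * G x = F y * (G y - G x) + (F y - F x) * G x by ring.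
    rewrite AG.2// AF.2//.
    have Ify : Rintegrable `[x, y] f by apply: RintegrableS S _.
    have Igy : Rintegrable `[x, y] g by apply: RintegrableS S _.
    rewrite -itgZ// [itg x y f * _]mulrC -itgZ// -itgD//; last 2 first.
    - exact: RintegrableZ.
    - exact: RintegrableZ.
    rewrite -itgB//; last 2 first.
    - by apply: RintegrableD => //; exact: RintegrableZ.
    - exact: RintegrableS S _.
    by apply: eq_itg => t _ _; ring.
  have Ixy : Rintegrable `[x, y] (fun t => (F y - F t) * g t + f t * (G x - G t)).
    have : Rintegrable `[x, y] (fun t => F y * g t + G x * f t - (F t * g t + f t * G t)).
      apply: RintegrableB => //; last exact: RintegrableS S _.
      by apply: RintegrableD => //; apply: RintegrableZ => //; exact: RintegrableS S _.
    by apply: eq_integrable => // t _ /=; congr EFin; ring.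
  apply: le_trans (le_normr_Rintegral _ _) _ => //.
  have Iky : Rintegrable `[x, y] k by apply: RintegrableS S _.
  rewrite expr2 {1}/K -/k -itgZ//.
  apply: itg_le => //; [exact: Rintegrable_norm|exact: RintegrableZ|].
  move=> t xt ty.
  apply: le_trans (ler_normD _ _) _; rewrite !normrM /k mulrDr addrC lerD//.
    rewrite mulrC ler_wpM2r// distrC.
    apply: le_trans (norm_AC_increment AG ax xt (le_trans ty yb)) _.
    have Igx : Rintegrable `[x, t] (fun t => `|g t|).
      apply: Rintegrable_norm => //; apply: RintegrableS (sub_itv ax (le_trans ty yb)) _ => //.
    apply: (@le_trans _ _ (K x t)).
      apply: itg_le => //; last by move=> s _ _; rewrite lerDr.
      by apply: RintegrableS Ik => //; apply: sub_itv => //; exact: le_trans yb.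
    by apply: (itgS _ _ _ Iky).
  rewrite ler_wpM2r//.
  apply: le_trans (norm_AC_increment AF (le_trans ax xt) ty yb) _.
  have Ify : Rintegrable `[t, y] (fun t => `|f t|).
    by apply: Rintegrable_norm => //; apply: RintegrableS (sub_itv (le_trans ax xt) yb) _.
  apply: (@le_trans _ _ (K t y)).
    apply: itg_le => //; last by move=> s _ _; rewrite lerDl.
    by apply: RintegrableS Ik => //; apply: sub_itv => //; exact: le_trans xt.
  by apply: (itgS _ _ _ Iky).
have S := sub_itv ax yb.
have Iky : Rintegrable `[x, y] k by apply: RintegrableS S _.
(* The halving point comes from the intermediate value theorem, the integral of k from x to t being
   continuous in t. *)
pose P t := parameterized_integral mu x t k.
have Hv : Num.min (P x) (P y) <= K x y / 2 <= Num.max (P x) (P y).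
  rewrite /P /parameterized_integral/= set_itv1 Rintegral_set1 -/(itg x y k) -/(K x y) min_l// max_r//.
  by rewrite divr_ge0//= ler_pdivrMr// ler_peMr// ler1n.
have [m] := IVT xy (parameterized_integral_continuous xy Iky) Hv.
rewrite in_itv/= => /andP[xm my]; rewrite /P /parameterized_integral -/(itg x m k) -/(K x m) => Kxm.
have Kmy : K m y = K x y / 2.
  have : K x y = K x m + K m y by exact: itg_split.
  rewrite Kxm; lra.
have -> : d x y = d x m + d m y.
  rewrite /d (itg_split xm my); first by ring.
  exact: RintegrableS S _.
have H1 := IHn x m ax xm (le_trans my yb).
have H2 := IHn m y (le_trans ax xm) my yb.
apply: le_trans (ler_normD _ _) _; apply: le_trans (lerD H1 H2) _.
rewrite Kxm Kmy (exprS 2 n) expr_div_n; set q := 2 ^+ n; have q0 : 0 < q by rewrite exprn_gt0.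
by rewrite le_eqVlt; apply/orP; left; apply/eqP; field; rewrite gt_eqF.
Qed.

Lemma AC_C1 a b F f : (forall x, is_derive x 1 F (f x)) -> continuous f -> AC a b F f.
Proof.
move=> dF cf.
have wcf x y : {within `[x, y], continuous f} by apply: continuous_subspaceT.
split; first exact: Rintegrable_continuous.
move=> x y ax + yb; rewrite le_eqVlt => /predU1P[->|xy].
  by rewrite subrr itg1.
have cF : continuous F.
  by move=> t; apply/differentiable_continuous/derivable1_diffP; case: (dF t).
rewrite /itg /Rintegral (@continuous_FTC2 _ f F x y xy)//.
- split => [t _||]; first by case: (dF t).
  + exact: (cvg_at_right_filter (cF x)).
  + exact: (cvg_at_left_filter (cF y)).
- by move=> t _; rewrite derive1E; have [_ ->] := dF t.
Qed.

Lemma AC_expR a b (k : R) : AC a b (fun x => expR (k * x)) (fun x => k * expR (k * x)).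
Proof.
apply: AC_C1 => [x|x].
  have dk : is_derive x 1 (fun x : R => k * x) k.
    by have := is_deriveZ k (is_derive_id x (1 : R)); rewrite /GRing.scale/= mulr1.
  have := is_derive1_comp (is_derive_expR (k * x)) dk.
  by rewrite mulrC.
have ck := @mulrl_continuous R k.
exact: (continuous_comp (continuous_comp (ck x) (@continuous_expR R _)) (ck _)).
Qed.

Lemma AC_le a b F f g x y : AC a b F f -> a <= x -> x <= y -> y <= b ->
  Rintegrable `[x, y] g -> (forall t, x <= t -> t <= y -> f t <= g t) ->
  F y - F x <= itg x y g.
Proof.
move=> [If HF] ax xy yb Ig fg; rewrite HF//; apply: itg_le => //.
by apply: RintegrableS If => //; exact: sub_itv.
Qed.

Lemma AC_ge a b F f g x y : AC a b F f -> a <= x -> x <= y -> y <= b ->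
  Rintegrable `[x, y] g -> (forall t, x <= t -> t <= y -> g t <= f t) ->
  itg x y g <= F y - F x.
Proof.
move=> [If HF] ax xy yb Ig fg; rewrite HF//; apply: itg_le => //.
by apply: RintegrableS If => //; exact: sub_itv.
Qed.

(** The hypothesis bounds [de] from both sides, so the estimate runs in both directions from [x0]:
    the integrating factor is exp (- K t) to the right and exp (K t) to the left. *)
Lemma gronwall a b e de rho (K : R) x0 x : AC a b e de -> Rintegrable `[a, b] rho ->
  0 <= K -> (forall t, 0 <= e t) -> (forall t, 0 <= rho t) ->
  (forall t, a <= t -> t <= b -> `|de t| <= K * e t + rho t) ->
  a <= x0 -> x0 <= b -> a <= x -> x <= b ->
  e x <= expR (K * (b - a)) * (e x0 + itg a b rho).
Proof.
move=> Ae Irho K0 e0 rho0 He ax0 x0b ax xb.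
have ab : a <= b by exact: le_trans x0b.
have I0 : 0 <= itg a b rho by apply: itg_ge0.
have A1 (k : R) := AC_mul ab (AC_expR a b k) Ae.
have [xx0|xx0] := leP x0 x.
  have S := sub_itv ax0 xb.
  have Ir : Rintegrable `[x0, x] rho by apply: RintegrableS S _.
  have Hd t : x0 <= t -> t <= x ->
      expR (- K * t) * de t + - K * expR (- K * t) * e t <= expR (- K * x0) * rho t.
    move=> xt tx.
    have -> : expR (- K * t) * de t + - K * expR (- K * t) * e t = expR (- K * t) * (de t - K * e t) by ring.
    apply: (@le_trans _ _ (expR (- K * t) * rho t)).
      rewrite ler_wpM2l ?expR_ge0//.
      have := He t (le_trans ax0 xt) (le_trans tx xb); rewrite ler_norml => /andP[_]; lra.
    by rewrite ler_wpM2r// ler_expR !mulNr lerN2 ler_wpM2l.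
  have := AC_le (A1 (- K)) ax0 xx0 xb (RintegrableZ (expR (- K * x0)) (measurable_itv _) Ir) Hd.
  rewrite itgZ// => H.
  have I1 := itgS ax0 xx0 xb Irho rho0.
  have H1 : expR (- K * x) * e x <= expR (- K * x0) * (e x0 + itg a b rho).
    have : expR (- K * x0) * itg x0 x rho <= expR (- K * x0) * itg a b rho.
      by rewrite ler_wpM2l ?expR_ge0.
    lra.
  have -> : e x = expR (K * x) * (expR (- K * x) * e x).
    by rewrite mulrA -expRD mulNr subrr expR0 mul1r.
  apply: le_trans (ler_wpM2l (expR_ge0 _) H1) _.
  rewrite mulrA -expRD ler_wpM2r ?addr_ge0// ler_expR mulNr -mulrBr ler_wpM2l//.
  lra.
have {}xx0 := ltW xx0; have S := sub_itv ax x0b.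
have Ir : Rintegrable `[x, x0] rho by apply: RintegrableS S _.
have Hd t : x <= t -> t <= x0 ->
    - expR (K * x0) * rho t <= expR (K * t) * de t + K * expR (K * t) * e t.
  move=> xt tx.
  have -> : expR (K * t) * de t + K * expR (K * t) * e t = expR (K * t) * (de t + K * e t) by ring.
  apply: (@le_trans _ _ (- (expR (K * t) * rho t))).
    rewrite mulNr lerN2 ler_wpM2r// ler_expR ler_wpM2l//.
  rewrite -mulrN ler_wpM2l ?expR_ge0//.
  have := He t (le_trans ax xt) (le_trans tx x0b); rewrite ler_norml => /andP[+ _]; lra.
have := AC_ge (A1 K) ax xx0 x0b (RintegrableZ (- expR (K * x0)) (measurable_itv _) Ir) Hd.
rewrite itgZ// => H.
have I1 := itgS ax xx0 x0b Irho rho0.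
have H1 : expR (K * x) * e x <= expR (K * x0) * (e x0 + itg a b rho).
  have : expR (K * x0) * itg x x0 rho <= expR (K * x0) * itg a b rho.
    by rewrite ler_wpM2l ?expR_ge0.
  lra.
have -> : e x = expR (- K * x) * (expR (K * x) * e x).
  by rewrite mulrA -expRD mulNr addNr expR0 mul1r.
apply: le_trans (ler_wpM2l (expR_ge0 _) H1) _.
rewrite mulrA -expRD ler_wpM2r ?addr_ge0// ler_expR mulNr -mulrN -mulrDr ler_wpM2l//.
lra.
Qed.

(** The point is where the continuous function attains its minimum, which is at most the mean. *)
Lemma exists_le_mean a b f (A : R) : a < b -> {within `[a, b], continuous f} ->
  itg a b f <= A -> exists2 x, a <= x /\ x <= b & f x <= A / (b - a).
Proof.
move=> ab cf HA; have [c + Hc] := EVT_min (ltW ab) cf.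
rewrite in_itv/= => /andP[ac cb]; exists c => //.
rewrite ler_pdivlMr ?subr_gt0// -(itg_cst _ (ltW ab)); apply: le_trans HA.
apply: itg_le => //; [exact: Rintegrable_cst|exact: Rintegrable_continuous|].
by move=> t ac' cb'; apply: Hc; rewrite in_itv/= ac' cb'.
Qed.

End AbsolutelyContinuous.

(** * One damped wave equation with a source *)

Section HalfSystem.
Context {R : realType}.

(** Real and imaginary parts, suffixed 1 and 2, of a component u, its derivative g, its flux s, and
    the data p and r of the resolvent equation. *)
Record half := Half { hu1 : R -> R; hu2 : R -> R; hg1 : R -> R; hg2 : R -> R;
  hs1 : R -> R; hs2 : R -> R; hp1 : R -> R; hp2 : R -> R; hr1 : R -> R; hr2 : R -> R }.

Definition usq U x := hu1 U x ^+ 2 + hu2 U x ^+ 2.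
Definition ssq U x := hs1 U x ^+ 2 + hs2 U x ^+ 2.
Definition gsq U x := hg1 U x ^+ 2 + hg2 U x ^+ 2.
Definition forcing U x := hp1 U x ^+ 2 + hp2 U x ^+ 2 + hr1 U x ^+ 2 + hr2 U x ^+ 2.
(** [vx1] and [vx2] are the real and imaginary parts of i lam g - p, the space derivative of the
    velocity. *)
Definition vx1 lam U x := - lam * hg2 U x - hp1 U x.
Definition vx2 lam U x := lam * hg1 U x - hp2 U x.
Definition damping (lam : R) (b : R -> R) U x := b x * (vx1 lam U x ^+ 2 + vx2 lam U x ^+ 2).

(* The wave equation for one component, at frequency [lam], in real and
   imaginary parts: u' = g, w = i lam g - p, s = a g + b w,
   s' = - lam^2 u + i lam c y - r, where y is the first entry of [Y]. *)
Record half_solution (L a lam : R) (b c : R -> R) (S : R) (U Y : half) : Prop := HalfSolution {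
  hs_u1 : AC 0 L (hu1 U) (hg1 U);
  hs_u2 : AC 0 L (hu2 U) (hg2 U);
  hs_s1 : AC 0 L (hs1 U) (fun x => - lam ^+ 2 * hu1 U x - lam * c x * hu2 Y x - hr1 U x);
  hs_s2 : AC 0 L (hs2 U) (fun x => - lam ^+ 2 * hu2 U x + lam * c x * hu1 Y x - hr2 U x);
  hs_rel1 : forall x, 0 <= x -> x <= L -> hs1 U x = a * hg1 U x + b x * vx1 lam U x;
  hs_rel2 : forall x, 0 <= x -> x <= L -> hs2 U x = a * hg2 U x + b x * vx2 lam U x;
  hs_left1 : hu1 U 0 = 0; hs_left2 : hu2 U 0 = 0;
  hs_right1 : hu1 U L = 0; hs_right2 : hu2 U L = 0;
  hs_forcing_int : Rintegrable `[0, L] (forcing U);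
  hs_damping_int : Rintegrable `[0, L] (damping lam b U);
  hs_forcing : itg 0 L (forcing U) <= S;
  hs_damping : itg 0 L (damping lam b U) <= S }.

Definition en U x := usq U x + ssq U x.

Lemma usq_ge0 U x : 0 <= usq U x. Proof. by rewrite addr_ge0 ?sqr_ge0. Qed.
Lemma ssq_ge0 U x : 0 <= ssq U x. Proof. by rewrite addr_ge0 ?sqr_ge0. Qed.
Lemma gsq_ge0 U x : 0 <= gsq U x. Proof. by rewrite addr_ge0 ?sqr_ge0. Qed.
Lemma en_ge0 U x : 0 <= en U x. Proof. by rewrite addr_ge0 ?usq_ge0 ?ssq_ge0. Qed.
Lemma forcing_ge0 U x : 0 <= forcing U x. Proof. by rewrite !addr_ge0 ?sqr_ge0. Qed.
Lemma damping_ge0 lam b U x : 0 <= b x -> 0 <= damping lam b U x.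
Proof. by move=> b0; rewrite mulr_ge0// addr_ge0 ?sqr_ge0. Qed.

Ltac nneg := repeat match goal with
  | |- is_true (0 <= _ ^+ 2) => exact: sqr_ge0
  | |- is_true (0 <= _ ^+ 4) => by rewrite exprn_even_ge0
  | |- is_true (0 <= usq _ _) => exact: usq_ge0
  | |- is_true (0 <= ssq _ _) => exact: ssq_ge0
  | |- is_true (0 <= gsq _ _) => exact: gsq_ge0
  | |- is_true (0 <= en _ _) => exact: en_ge0
  | |- is_true (0 <= forcing _ _) => exact: forcing_ge0
  | |- is_true (0 <= expR _) => exact: expR_ge0
  | |- is_true (0 <= _%:R) => exact: ler0n
  | |- is_true (0 <= _ + _) => apply: addr_ge0
  | |- is_true (0 <= _ * _) => apply: mulr_ge0
  | |- is_true (0 <= _^-1) => rewrite invr_ge0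
  | |- is_true (0 <= _) => first [done | by apply: ltW]
  end.

Lemma young (k x y : R) : 0 < k -> 2 * (x * y) <= k * x ^+ 2 + y ^+ 2 / k.
Proof.
move=> k0; have : 0 <= (k * x - y) ^+ 2 / k by rewrite divr_ge0 ?sqr_ge0 ?ltW.
have -> : (k * x - y) ^+ 2 / k = k * x ^+ 2 - 2 * (x * y) + y ^+ 2 / k by field; rewrite gt_eqF.
by lra.
Qed.

Lemma young_abs (k x y : R) : 0 < k -> 2 * `|x * y| <= k * x ^+ 2 + y ^+ 2 / k.
Proof.
move=> k0; have := young x y k0; have := young x (- y) k0; rewrite mulrN sqrrN.
by case: (ger0P (x * y)) => _; lra.
Qed.

Section Estimates.
Variables (L a lam b0 c0 S : R) (b c : R -> R) (U Y : half).
Hypotheses (L0 : 0 < L) (a0 : 0 < a).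
Hypotheses (b_ge0 : forall x, 0 <= b x) (b_le : forall x, b x <= b0).
Hypotheses (c_le : forall x, `|c x| <= c0).
Hypothesis sol : half_solution L a lam b c S U Y.

(** Substituting w = i lam g - p into the flux gives (a + i lam b) g = s + b p, and the factor on
    the left has modulus at least a, whatever the value of b. *)
Lemma gsq_le (x : R) : 0 <= x -> x <= L -> gsq U x <= 2 / a ^+ 2 * (ssq U x + b0 ^+ 2 * forcing U x).
Proof.
move=> x0 xL; rewrite mulrAC ler_pdivlMr ?exprn_gt0//.
have E1 := hs_rel1 sol x0 xL; have E2 := hs_rel2 sol x0 xL.
have E : (a ^+ 2 + lam ^+ 2 * b x ^+ 2) * gsq U x =
   (hs1 U x + b x * hp1 U x) ^+ 2 + (hs2 U x + b x * hp2 U x) ^+ 2.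
  by rewrite E1 E2 /gsq /vx1 /vx2; ring.
have H1 : gsq U x * a ^+ 2 <= (a ^+ 2 + lam ^+ 2 * b x ^+ 2) * gsq U x.
  have : 0 <= lam ^+ 2 * b x ^+ 2 * gsq U x.
    by nneg.
  lra.
apply: le_trans H1 _; rewrite E /ssq /forcing.
have bb : b x ^+ 2 <= b0 ^+ 2 by rewrite lerXn2r ?nnegrE// (le_trans (b_ge0 x)).
have B1 : b x ^+ 2 * (hp1 U x ^+ 2 + hp2 U x ^+ 2) <= b0 ^+ 2 * (hp1 U x ^+ 2 + hp2 U x ^+ 2).
  by rewrite ler_wpM2r// addr_ge0 ?sqr_ge0.
have B2 : 0 <= b0 ^+ 2 * (hr1 U x ^+ 2 + hr2 U x ^+ 2) by nneg.
have := sqr_ge0 (hs1 U x - b x * hp1 U x); have := sqr_ge0 (hs2 U x - b x * hp2 U x); lra.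
Qed.

Definition den x := 2 * (hu1 U x * hg1 U x + hu2 U x * hg2 U x
  + hs1 U x * (- lam ^+ 2 * hu1 U x - lam * c x * hu2 Y x - hr1 U x)
  + hs2 U x * (- lam ^+ 2 * hu2 U x + lam * c x * hu1 Y x - hr2 U x)).

Lemma AC_en : AC 0 L (en U) den.
Proof.
have L0' := ltW L0.
have := AC_add (AC_add (AC_mul L0' (hs_u1 sol) (hs_u1 sol)) (AC_mul L0' (hs_u2 sol) (hs_u2 sol)))
  (AC_add (AC_mul L0' (hs_s1 sol) (hs_s1 sol)) (AC_mul L0' (hs_s2 sol) (hs_s2 sol))).
by apply: AC_eq => x _ _; rewrite /en /usq /ssq /den; ring.
Qed.

(** Coefficients of the differential inequality for [en]: the 3 comes from squaring the three terms
    of s', and 2 / a^2 from [gsq_le]. *)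
Definition rateE := 1 + 3 * lam ^+ 4 + 2 / a ^+ 2.
Definition rateF := 3 + 2 / a ^+ 2 * b0 ^+ 2.

Lemma rateE_ge0 : 0 <= rateE.
Proof. by rewrite /rateE; nneg. Qed.
Lemma rateF_ge0 : 0 <= rateF.
Proof. by rewrite /rateF; nneg. Qed.

Lemma den_le (x : R) : 0 <= x -> x <= L ->
  `|den x| <= rateE * en U x + 3 * lam ^+ 2 * c x ^+ 2 * usq Y x + rateF * forcing U x.
Proof.
move=> x0 xL; have G := gsq_le x0 xL.
set A1 := - lam ^+ 2 * hu1 U x - lam * c x * hu2 Y x - hr1 U x.
set A2 := - lam ^+ 2 * hu2 U x + lam * c x * hu1 Y x - hr2 U x.
have H1 : A1 ^+ 2 <= 3 * (lam ^+ 4 * hu1 U x ^+ 2 + lam ^+ 2 * c x ^+ 2 * hu2 Y x ^+ 2 + hr1 U x ^+ 2).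
  have := sqr_ge0 (lam ^+ 2 * hu1 U x - lam * c x * hu2 Y x).
  have := sqr_ge0 (lam ^+ 2 * hu1 U x - hr1 U x).
  have := sqr_ge0 (lam * c x * hu2 Y x - hr1 U x); rewrite /A1; lra.
have H2 : A2 ^+ 2 <= 3 * (lam ^+ 4 * hu2 U x ^+ 2 + lam ^+ 2 * c x ^+ 2 * hu1 Y x ^+ 2 + hr2 U x ^+ 2).
  have := sqr_ge0 (lam ^+ 2 * hu2 U x + lam * c x * hu1 Y x).
  have := sqr_ge0 (lam ^+ 2 * hu2 U x - hr2 U x).
  have := sqr_ge0 (lam * c x * hu1 Y x + hr2 U x); rewrite /A2; lra.
have D : `|den x| <= usq U x + gsq U x + ssq U x + (A1 ^+ 2 + A2 ^+ 2).
  rewrite /den -/A1 -/A2 /usq /gsq /ssq ler_norml; apply/andP; split.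
    have := sqr_ge0 (hu1 U x + hg1 U x); have := sqr_ge0 (hu2 U x + hg2 U x).
    have := sqr_ge0 (hs1 U x + A1); have := sqr_ge0 (hs2 U x + A2); lra.
  have := sqr_ge0 (hu1 U x - hg1 U x); have := sqr_ge0 (hu2 U x - hg2 U x).
  have := sqr_ge0 (hs1 U x - A1); have := sqr_ge0 (hs2 U x - A2); lra.
have Q : 0 <= 2 / a ^+ 2 by rewrite divr_ge0 ?sqr_ge0.
have l4 : 0 <= lam ^+ 4 by rewrite exprn_even_ge0.
have F1 : hr1 U x ^+ 2 + hr2 U x ^+ 2 <= forcing U x.
  by rewrite /forcing -addrA lerDr addr_ge0 ?sqr_ge0.
have P1 : 0 <= 3 * lam ^+ 4 * ssq U x by nneg.
have P2 : 0 <= 2 / a ^+ 2 * usq U x by nneg.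
move: Q G P2; rewrite /rateE /rateF /en; set q := 2 / a ^+ 2 => Q G P2.
apply: le_trans D _; rewrite /usq in H1 H2 P2 *; rewrite /usq; lra.
Qed.

(** On an interval free of coupling the other component drops out, so the energy of U alone is
    carried from any point to any other. *)
Lemma en_gronwall (al be x0 x : R) : 0 <= al -> be <= L -> (forall x, al <= x -> x <= be -> c x = 0) ->
  al <= x0 -> x0 <= be -> al <= x -> x <= be ->
  en U x <= expR (rateE * L) * (en U x0 + rateF * S).
Proof.
move=> al0 beL cz alx0 x0be alx xbe.
have albe : al <= be by exact: le_trans x0be.
have IF : Rintegrable `[al, be] (forcing U).
  by apply: RintegrableS (hs_forcing_int sol) => //; exact: sub_itv.
have := gronwall (AC_sub al0 beL AC_en) (RintegrableZ rateF (measurable_itv _) IF) rateE_ge0 (en_ge0 U) _ _ alx0 x0be alx xbe.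
have H1 t : 0 <= rateF * forcing U t by rewrite mulr_ge0 ?rateF_ge0 ?forcing_ge0.
have H2 t : al <= t -> t <= be -> `|den t| <= rateE * en U t + rateF * forcing U t.
  move=> alt tbe; have := den_le (le_trans al0 alt) (le_trans tbe beL).
  by rewrite cz// expr0n mulr0 mul0r addr0.
move=> /(_ H1 H2) /le_trans; apply.
have I1 := itgS al0 albe beL (hs_forcing_int sol) (forcing_ge0 U).
rewrite itgZ//; apply: ler_pM.
- exact: expR_ge0.
- apply: addr_ge0; first exact: en_ge0.
  by apply: mulr_ge0; [exact: rateF_ge0|apply: itg_ge0 => t _ _; exact: forcing_ge0].
- rewrite ler_expR ler_wpM2l ?rateE_ge0//; lra.
- by rewrite lerD2l ler_wpM2l ?rateF_ge0// (le_trans I1)// (hs_forcing sol).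
Qed.

(* On a damped interval the flux and u' are controlled, since i lam g = w + p. *)
Lemma damped_pointwise (beta x : R) : lam != 0 -> 0 < beta -> 0 <= x -> x <= L -> b x = beta ->
  gsq U x <= 2 / lam ^+ 2 * (damping lam b U x / beta + forcing U x) /\
  ssq U x <= (4 * a ^+ 2 / lam ^+ 2 + 2 * beta ^+ 2) * (damping lam b U x / beta + forcing U x).
Proof.
move=> l0 be0 x0 xL bx.
have E1 := hs_rel1 sol x0 xL; have E2 := hs_rel2 sol x0 xL.
have D : damping lam b U x / beta = vx1 lam U x ^+ 2 + vx2 lam U x ^+ 2.
  by rewrite /damping bx mulrC mulKf// gt_eqF.
have l2 : 0 < lam ^+ 2 by rewrite exprn_even_gt0.
have G1 : lam ^+ 2 * gsq U x = (vx2 lam U x + hp2 U x) ^+ 2 + (vx1 lam U x + hp1 U x) ^+ 2.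
  by rewrite /gsq /vx1 /vx2; ring.
have G : gsq U x <= 2 / lam ^+ 2 * (damping lam b U x / beta + forcing U x).
  rewrite mulrAC ler_pdivlMr// mulrC G1 D /forcing.
  have := sqr_ge0 (vx2 lam U x - hp2 U x); have := sqr_ge0 (vx1 lam U x - hp1 U x).
  have := sqr_ge0 (hr1 U x); have := sqr_ge0 (hr2 U x); lra.
split => //; set Q := _ + forcing U x in G *.
have Q2 : vx1 lam U x ^+ 2 + vx2 lam U x ^+ 2 <= Q by rewrite /Q D lerDl forcing_ge0.
have S1 : ssq U x <= 2 * a ^+ 2 * gsq U x + 2 * beta ^+ 2 * (vx1 lam U x ^+ 2 + vx2 lam U x ^+ 2).
  rewrite /ssq E1 E2 bx /gsq.
  have := sqr_ge0 (a * hg1 U x - beta * vx1 lam U x); have := sqr_ge0 (a * hg2 U x - beta * vx2 lam U x); lra.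
apply: le_trans S1 _; rewrite [leRHS]mulrDl lerD//; last by rewrite ler_wpM2l// mulr_ge0// sqr_ge0.
have -> : 4 * a ^+ 2 / lam ^+ 2 * Q = 2 * a ^+ 2 * (2 / lam ^+ 2 * Q) by field.
by rewrite ler_wpM2l// mulr_ge0// sqr_ge0.
Qed.

(** A polynomial cut-off. It is used squared, so that in Young's inequality each of u and s receives
    one factor, [bump] or its derivative. *)
Definition bump (al be x : R) := (x - al) * (be - x).

Lemma AC_bump2 (al be A B : R) : A <= B ->
  AC A B (fun x => bump al be x ^+ 2) (fun x => 2 * bump al be x * (al + be - 2 * x)).
Proof.
move=> AB.
have A1 : AC A B (bump al be) (fun x => al + be - 2 * x).
  have := AC_mul AB (AC_add (AC_id A B) (AC_cst A B (- al))) (AC_add (AC_cst A B be) (AC_opp (AC_id A B))).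
  by apply: AC_eq => x _ _; rewrite /bump; ring.
by have := AC_mul AB A1 A1; apply: AC_eq => x _ _; ring.
Qed.

Lemma bump_le (al be x : R) : al <= x -> x <= be -> 0 <= bump al be x <= (be - al) ^+ 2.
Proof.
move=> H1 H2; rewrite /bump mulr_ge0 ?subr_ge0//= expr2 ler_pM ?subr_ge0//; lra.
Qed.

Lemma bump_deriv_le (al be x : R) : al <= x -> x <= be -> (al + be - 2 * x) ^+ 2 <= (be - al) ^+ 2.
Proof.
move=> H1 H2; rewrite -[leLHS]real_normK ?num_real// lerXn2r ?nnegrE//; first lra.
by rewrite ler_norml; apply/andP; split; lra.
Qed.

(* The cut-off flux multiplier [q Re (s ubar)], q = bump^2 vanishing at both ends. *)
Definition cutoff_flux al be x := bump al be x ^+ 2 * (hs1 U x * hu1 U x + hs2 U x * hu2 U x).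
Definition cutoff_flux' al be x :=
  2 * bump al be x * (al + be - 2 * x) * (hs1 U x * hu1 U x + hs2 U x * hu2 U x)
  + bump al be x ^+ 2 * (- lam ^+ 2 * usq U x + lam * c x * (hu2 U x * hu1 Y x - hu1 U x * hu2 Y x)
     - (hr1 U x * hu1 U x + hr2 U x * hu2 U x) + (hs1 U x * hg1 U x + hs2 U x * hg2 U x)).

Lemma AC_cutoff_flux (al be : R) : 0 <= al -> al <= be -> be <= L ->
  AC al be (cutoff_flux al be) (cutoff_flux' al be).
Proof.
move=> al0 albe beL; have sub F f := @AC_sub R 0 L al be F f al0 beL.
have := AC_mul albe (AC_bump2 al be albe) (AC_add
  (AC_mul albe (sub _ _ (hs_s1 sol)) (sub _ _ (hs_u1 sol)))
  (AC_mul albe (sub _ _ (hs_s2 sol)) (sub _ _ (hs_u2 sol)))).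
apply: AC_eq => x _ _; first by [].
by rewrite /cutoff_flux' /usq; ring.
Qed.

Lemma cutoff_flux_end al be : cutoff_flux al be al = 0 /\ cutoff_flux al be be = 0.
Proof. by rewrite /cutoff_flux /bump !subrr mulr0 mul0r expr0n !mul0r. Qed.

Lemma itg_cutoff_flux (al be : R) : 0 <= al -> al <= be -> be <= L ->
  itg al be (cutoff_flux' al be) = 0.
Proof.
move=> al0 albe beL; have [_ H] := AC_cutoff_flux al0 albe beL.
by rewrite -(H al be)//; have [-> ->] := cutoff_flux_end al be; rewrite subrr.
Qed.

Lemma dot_young (k x1 x2 y1 y2 : R) : 0 < k ->
  2 * `|x1 * y1 + x2 * y2| <= k * (x1 ^+ 2 + x2 ^+ 2) + (y1 ^+ 2 + y2 ^+ 2) / k.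
Proof.
move=> k0; have := young_abs x1 y1 k0; have := young_abs x2 y2 k0.
have := ler_normD (x1 * y1) (x2 * y2); rewrite !mulrDl; lra.
Qed.

Lemma continuous_usq (A B : R) : 0 <= A -> A <= B -> B <= L -> {within `[A, B], continuous (usq U)}.
Proof.
move=> A0 AB BL; have sub F f := @AC_sub R 0 L A B F f A0 BL.
have := AC_add (AC_mul AB (sub _ _ (hs_u1 sol)) (sub _ _ (hs_u1 sol))) (AC_mul AB (sub _ _ (hs_u2 sol)) (sub _ _ (hs_u2 sol))).
by move=> /(AC_within_continuous AB).
Qed.

Lemma continuous_ssq (A B : R) : 0 <= A -> A <= B -> B <= L -> {within `[A, B], continuous (ssq U)}.
Proof.
move=> A0 AB BL; have sub F f := @AC_sub R 0 L A B F f A0 BL.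
have := AC_add (AC_mul AB (sub _ _ (hs_s1 sol)) (sub _ _ (hs_s1 sol))) (AC_mul AB (sub _ _ (hs_s2 sol)) (sub _ _ (hs_s2 sol))).
by move=> /(AC_within_continuous AB).
Qed.

Lemma continuous_bump2 (al be A B : R) : A <= B -> {within `[A, B], continuous (fun x => bump al be x ^+ 2)}.
Proof. by move=> AB; apply: (AC_within_continuous AB (AC_bump2 al be AB)). Qed.

(** The mean is taken over the middle half of the interval, where both factors of [bump] are at
    least a quarter of the length; this is the origin of 256. *)
Lemma pick_middle (al be : R) (f : R -> R) (A : R) : al < be -> {within `[al, be], continuous f} -> (forall x, 0 <= f x) ->
  itg al be f <= A -> exists2 x, al <= x /\ x <= be &
    f x <= A / ((be - al) / 2) /\ (be - al) ^+ 4 / 256 <= bump al be x ^+ 2.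
Proof.
move=> albe cf f0 HA; pose l := be - al; have l0 : 0 < l by rewrite subr_gt0.
pose al' := al + l / 4; pose be' := be - l / 4.
have ab' : al' < be' by rewrite /al' /be' /l; rewrite /l in l0; lra.
have aa : al <= al' by rewrite /al'; lra.
have bb : be' <= be by rewrite /be'; lra.
have I := Rintegrable_continuous cf.
have cf' : {within `[al', be'], continuous f}.
  by apply: continuous_subspaceW cf; exact: sub_itv.
have HA' : itg al' be' f <= A by apply: le_trans HA; apply: itgS => //; exact: ltW.
have [x [ax xb] fx] := exists_le_mean ab' cf' HA'.
exists x; first by split; [exact: le_trans ax|exact: le_trans bb].
split; first by move: fx; rewrite (_ : be' - al' = (be - al) / 2)// /be' /al' /l; field.
have H : l ^+ 2 / 16 <= bump al be x.
  have -> : l ^+ 2 / 16 = l / 4 * (l / 4) by field.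
  rewrite /bump ler_pM//; rewrite ?divr_ge0 ?(ltW l0)//; rewrite /al' /be' in ax xb *; lra.
have -> : (be - al) ^+ 4 / 256 = (l ^+ 2 / 16) ^+ 2 by rewrite /l; field.
by rewrite lerXn2r ?nnegrE//; [nneg|apply: le_trans H; nneg].
Qed.

(** [Cg] and [Cs] bound |g|^2 and |s|^2 on a damped interval, [Cq] bounds the localised energy
    density, and [Cd] the energy at a point of the middle half; l is the length of the interval. *)
Definition Cg := 2 / lam ^+ 2.
Definition Cs beta := 4 * a ^+ 2 / lam ^+ 2 + 2 * beta ^+ 2.
Definition Cq beta l := 2 / lam ^+ 2 * ((4 * l ^+ 2 / lam ^+ 2 + l ^+ 4 / 2) * Cs beta
  + 2 * l ^+ 4 / lam ^+ 2 + l ^+ 4 / 2 * Cg) + Cs beta.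
Definition Cd beta l := (256 / l ^+ 4 + 1) * (Cq beta l * (beta^-1 + 1) / (l / 2)).

(** The derivative of the cut-off flux contains - lam^2 bump^2 |u|^2, and each of its other terms
    has a factor s, g or r, which damping and forcing control. Left on the right-hand side, the
    derivative disappears upon integration. *)
Lemma damped_cutoff_pointwise (beta al be x : R) : lam != 0 -> 0 < beta -> 0 <= al -> be <= L ->
  al <= x -> x <= be -> b x = beta -> c x = 0 ->
  bump al be x ^+ 2 * usq U x + ssq U x <=
    - (2 / lam ^+ 2) * cutoff_flux' al be x + Cq beta (be - al) * (beta^-1 * damping lam b U x + forcing U x).
Proof.
move=> l0 be0 al0 beL alx xbe bx cx.
have x0 := le_trans al0 alx; have xL := le_trans xbe beL.
have [G Sq] := damped_pointwise l0 be0 x0 xL bx; rewrite -/Cg -/(Cs beta) in G Sq.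
have l2 : 0 < lam ^+ 2 by rewrite exprn_even_gt0.
rewrite [damping _ _ _ _ / _]mulrC in G Sq; set Q := _ + forcing U x in G Sq *.
have FQ : forcing U x <= Q by rewrite /Q lerDr mulr_ge0 ?invr_ge0 ?(ltW be0)// damping_ge0.
set l := be - al; set m := bump al be x; set m' := al + be - 2 * x.
have [m0 ml] := andP (bump_le alx xbe); rewrite -/m -/l in m0 ml.
have m'l := bump_deriv_le alx xbe; rewrite -/m' -/l in m'l.
have m2l : m ^+ 2 <= l ^+ 4.
  by rewrite (_ : l ^+ 4 = (l ^+ 2) ^+ 2); [rewrite lerXn2r ?nnegrE//; exact: sqr_ge0|rewrite -exprM].
(* With this Young parameter the two products containing u cost less than half of lam^2 m^2
   |u|^2. *)
have k4 : 0 < lam ^+ 2 / 4 by rewrite divr_gt0.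
have Y1 := @dot_young (lam ^+ 2 / 4) (m * hu1 U x) (m * hu2 U x) (m' * hs1 U x) (m' * hs2 U x) k4.
have Y2 := @dot_young (lam ^+ 2 / 4) (m * hu1 U x) (m * hu2 U x) (m * hr1 U x) (m * hr2 U x) k4.
have Y3 := @dot_young 1 (hs1 U x) (hs2 U x) (hg1 U x) (hg2 U x) ltr01.
have E : cutoff_flux' al be x = 2 * (m * hu1 U x * (m' * hs1 U x) + m * hu2 U x * (m' * hs2 U x))
   - lam ^+ 2 * (m ^+ 2 * usq U x) - (m * hu1 U x * (m * hr1 U x) + m * hu2 U x * (m * hr2 U x))
   + m ^+ 2 * (hs1 U x * hg1 U x + hs2 U x * hg2 U x).
  by rewrite /cutoff_flux' cx /usq -/m -/m'; ring.
set z1 := _ + _ in Y1 E; set z2 := _ + _ in Y2 E; set z3 := _ + _ in Y3 E.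
have U1 : (m * hu1 U x) ^+ 2 + (m * hu2 U x) ^+ 2 = m ^+ 2 * usq U x by rewrite /usq; ring.
have U2 : (m' * hs1 U x) ^+ 2 + (m' * hs2 U x) ^+ 2 = m' ^+ 2 * ssq U x by rewrite /ssq; ring.
have U3 : (m * hr1 U x) ^+ 2 + (m * hr2 U x) ^+ 2 = m ^+ 2 * (hr1 U x ^+ 2 + hr2 U x ^+ 2) by ring.
rewrite U1 U2 in Y1; rewrite U1 U3 in Y2; rewrite -/(ssq U x) -/(gsq U x) divr1 mul1r in Y3.
have r1 : hr1 U x ^+ 2 + hr2 U x ^+ 2 <= Q.
  by apply: le_trans FQ; rewrite /forcing -addrA lerDr addr_ge0 ?sqr_ge0.
have Q0 : 0 <= Q by apply: le_trans FQ; exact: forcing_ge0.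
have V1 : m' ^+ 2 * ssq U x / (lam ^+ 2 / 4) <= 4 * l ^+ 2 / lam ^+ 2 * (Cs beta * Q).
  have -> : m' ^+ 2 * ssq U x / (lam ^+ 2 / 4) = 4 / lam ^+ 2 * (m' ^+ 2 * ssq U x) by field.
  have -> : 4 * l ^+ 2 / lam ^+ 2 * (Cs beta * Q) = 4 / lam ^+ 2 * (l ^+ 2 * (Cs beta * Q)) by field.
  by rewrite ler_wpM2l ?divr_ge0 ?sqr_ge0// ler_pM ?sqr_ge0 ?ssq_ge0.
have V2 : m ^+ 2 * (hr1 U x ^+ 2 + hr2 U x ^+ 2) / (lam ^+ 2 / 4) <= 4 * l ^+ 4 / lam ^+ 2 * Q.
  have -> : m ^+ 2 * (hr1 U x ^+ 2 + hr2 U x ^+ 2) / (lam ^+ 2 / 4) = 4 / lam ^+ 2 * (m ^+ 2 * (hr1 U x ^+ 2 + hr2 U x ^+ 2)) by field.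
  have -> : 4 * l ^+ 4 / lam ^+ 2 * Q = 4 / lam ^+ 2 * (l ^+ 4 * Q) by field.
  by rewrite ler_wpM2l ?divr_ge0 ?sqr_ge0// ler_pM ?sqr_ge0// addr_ge0 ?sqr_ge0.
have V3 : m ^+ 2 * (2 * `|z3|) <= l ^+ 4 * (Cs beta * Q + Cg * Q).
  apply: ler_pM; [exact: sqr_ge0|by apply: mulr_ge0|exact: m2l|].
  by apply: le_trans Y3 _; rewrite lerD.
have n1 := ler_norm z1; have n2 := ler_norm (- z2); rewrite normrN in n2.
have n3 : m ^+ 2 * (2 * z3) <= m ^+ 2 * (2 * `|z3|).
  by rewrite ler_wpM2l ?sqr_ge0// ler_wpM2l// ler_norm.
have key : lam ^+ 2 / 2 * (m ^+ 2 * usq U x) <= - cutoff_flux' al be x +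
    ((4 * l ^+ 2 / lam ^+ 2 + l ^+ 4 / 2) * Cs beta + 2 * l ^+ 4 / lam ^+ 2 + l ^+ 4 / 2 * Cg) * Q.
  have mu0 : 0 <= lam ^+ 2 * (m ^+ 2 * usq U x) by nneg.
  rewrite E; lra.
have -> : bump al be x ^+ 2 * usq U x = 2 / lam ^+ 2 * (lam ^+ 2 / 2 * (m ^+ 2 * usq U x)) by rewrite /m; field.
apply: le_trans (lerD (ler_wpM2l _ key) Sq) _; first by nneg.
by rewrite /Cq -/l; lra.
Qed.

(** Integrating the pointwise bound removes the flux, which vanishes at both ends. At a mean-value
    point of the middle half the cut-off is bounded below, so u itself is controlled there. *)
Lemma damped_start (beta al be : R) : lam != 0 -> 0 < beta -> 0 <= al -> al < be -> be <= L ->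
  (forall x, al <= x -> x <= be -> b x = beta) -> (forall x, al <= x -> x <= be -> c x = 0) ->
  exists2 x, al <= x /\ x <= be & en U x <= Cd beta (be - al) * S.
Proof.
move=> l0 be0 al0 albe beL Hb Hc; have albe' := ltW albe.
have l2 : 0 < lam ^+ 2 by rewrite exprn_even_gt0.
pose f x := bump al be x ^+ 2 * usq U x + ssq U x.
have cf : {within `[al, be], continuous f}.
  move=> x; apply: cvgD; last exact: continuous_ssq.
  by apply: cvgM; [exact: continuous_bump2|exact: continuous_usq].
have f0 x : 0 <= f x by rewrite /f; nneg.
have Ic := (AC_cutoff_flux al0 albe' beL).
have ID : Rintegrable `[al, be] (damping lam b U).
  by apply: RintegrableS (hs_damping_int sol) => //; exact: sub_itv.
have IF : Rintegrable `[al, be] (forcing U).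
  by apply: RintegrableS (hs_forcing_int sol) => //; exact: sub_itv.
have IQ : Rintegrable `[al, be] (fun x => beta^-1 * damping lam b U x + forcing U x).
  by apply: RintegrableD => //; exact: RintegrableZ.
have Cs0 : 0 <= Cs beta by rewrite /Cs; nneg.
have Cg0 : 0 <= Cg by rewrite /Cg; nneg.
have Cq0 l : 0 <= Cq beta l by rewrite /Cq; nneg.
have HA : itg al be f <= Cq beta (be - al) * (beta^-1 + 1) * S.
  apply: (@le_trans _ _ (itg al be (fun x => - (2 / lam ^+ 2) * cutoff_flux' al be x +
      Cq beta (be - al) * (beta^-1 * damping lam b U x + forcing U x)))).
    apply: itg_le; first exact: Rintegrable_continuous.
      by apply: RintegrableD => //; apply: RintegrableZ => //; case: Ic.
    move=> x alx xbe; apply: damped_cutoff_pointwise => //; [exact: Hb|exact: Hc].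
  rewrite itgD; [|by apply: RintegrableZ => //; case: Ic|exact: RintegrableZ].
  rewrite !itgZ//; last by case: Ic.
  rewrite itg_cutoff_flux// mulr0 add0r.
  rewrite -mulrA ler_wpM2l// itgD//; last exact: RintegrableZ.
  rewrite itgZ// mulrDl mul1r lerD// ?ler_wpM2l ?invr_ge0 ?(ltW be0)//.
    apply: le_trans (hs_damping sol); apply: itgS (hs_damping_int sol) _ => //.
    by move=> t; exact: damping_ge0.
  apply: le_trans (hs_forcing sol); apply: itgS (hs_forcing_int sol) _ => //.
  by move=> t; exact: forcing_ge0.
have [x Hx [fx bx]] := pick_middle albe cf f0 HA.
exists x => //; set l := be - al in fx bx *; have lp : 0 < l by rewrite subr_gt0.
have l4 : 0 < l ^+ 4 by rewrite exprn_gt0.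
have U1 : usq U x <= 256 / l ^+ 4 * f x.
  rewrite -[leLHS]mul1r -[X in X * usq U x](_ : 256 / l ^+ 4 * (l ^+ 4 / 256) = 1); last by field; rewrite gt_eqF.
  rewrite -[leLHS]mulrA; apply: ler_wpM2l; first by nneg.
  apply: (@le_trans _ _ (bump al be x ^+ 2 * usq U x)); first by rewrite ler_wpM2r// usq_ge0.
  by rewrite /f lerDl ssq_ge0.
have U2 : ssq U x <= f x by rewrite /f lerDr; nneg.
apply: (@le_trans _ _ ((256 / l ^+ 4 + 1) * f x)).
  by rewrite /en mulrDl mul1r lerD.
have -> : Cd beta l * S = (256 / l ^+ 4 + 1) * (Cq beta l * (beta^-1 + 1) * S / (l / 2)).
  by rewrite /Cd; field; rewrite ?gt_eqF.
by apply: ler_wpM2l => //; nneg.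
Qed.

(* Rellich multiplier (x - e) u'. *)
Definition rellich e x := (x - e) * (a^-1 * ssq U x + lam ^+ 2 * usq U x).
Definition rellich' e x := a^-1 * ssq U x + lam ^+ 2 * usq U x
  + (x - e) * (2 / a * (lam * c x * (hs2 U x * hu1 Y x - hs1 U x * hu2 Y x)
      - (hr1 U x * hs1 U x + hr2 U x * hs2 U x))).

(** Where b = 0 one has g = s / a, and the contributions of lam^2 u in the derivatives of |s|^2 / a
    and of lam^2 |u|^2 cancel. Only coupling and forcing remain next to the factor x - e. *)
Lemma AC_rellich (al be e : R) : 0 <= al -> al <= be -> be <= L ->
  (forall x, al <= x -> x <= be -> b x = 0) -> AC al be (rellich e) (rellich' e).
Proof.
move=> al0 albe beL Hb; have sub F f := @AC_sub R 0 L al be F f al0 beL.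
have := AC_mul albe (AC_add (AC_id al be) (AC_cst al be (- e)))
  (AC_add (AC_scale a^-1 (AC_add (AC_mul albe (sub _ _ (hs_s1 sol)) (sub _ _ (hs_s1 sol)))
                            (AC_mul albe (sub _ _ (hs_s2 sol)) (sub _ _ (hs_s2 sol)))))
     (AC_scale (lam ^+ 2) (AC_add (AC_mul albe (sub _ _ (hs_u1 sol)) (sub _ _ (hs_u1 sol)))
                            (AC_mul albe (sub _ _ (hs_u2 sol)) (sub _ _ (hs_u2 sol)))))).
apply: AC_eq => x alx xbe; first by rewrite /rellich /usq /ssq.
have E1 := hs_rel1 sol (le_trans al0 alx) (le_trans xbe beL).
have E2 := hs_rel2 sol (le_trans al0 alx) (le_trans xbe beL).
rewrite Hb// mul0r addr0 in E1; rewrite Hb// mul0r addr0 in E2.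
have G1 : hg1 U x = a^-1 * hs1 U x by rewrite E1 mulKf// gt_eqF.
have G2 : hg2 U x = a^-1 * hs2 U x by rewrite E2 mulKf// gt_eqF.
by rewrite /rellich' /ssq /usq G1 G2; ring.
Qed.

(** The energy term of the derivative has a sign. The coupling is charged to |s|^2 / a and lam^2
    |y|^2 with the factor c0 (be - al) / sqrt a each, the quantity that the smallness assumptions
    keep below 1; the forcing is charged to |s|^2 / a with the free parameter del. *)
Lemma rellich_estimate (al be e del : R) : 0 <= al -> al < be -> be <= L -> 0 < del ->
  al <= e -> e <= be -> (forall x, al <= x -> x <= be -> b x = 0) ->
  {within `[al, be], continuous (usq Y)} ->
  (1 - c0 * (be - al) / Num.sqrt a - del) * itg al be (fun x => a^-1 * ssq U x)
    + itg al be (fun x => lam ^+ 2 * usq U x)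
    - c0 * (be - al) / Num.sqrt a * itg al be (fun x => lam ^+ 2 * usq Y x)
  <= rellich e be - rellich e al + (be - al) ^+ 2 / (a * del) * S.
Proof.
move=> al0 albe beL del0 ale ebe Hb cY; have albe' := ltW albe.
have A := AC_rellich e al0 albe' beL Hb.
set l := be - al; have l0 : 0 < l by rewrite subr_gt0.
pose sa := Num.sqrt a; have sa0 : 0 < sa by rewrite sqrtr_gt0.
have saa : sa ^+ 2 = a by rewrite sqr_sqrtr// ltW.
have c00 : 0 <= c0 by apply: le_trans (c_le 0).
set th := c0 * l / Num.sqrt a; rewrite -/sa in th *.
have IF : Rintegrable `[al, be] (forcing U).
  by apply: RintegrableS (hs_forcing_int sol) => //; exact: sub_itv.
have Is : Rintegrable `[al, be] (fun x => a^-1 * ssq U x).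
  by apply: RintegrableZ => //; apply: Rintegrable_continuous; exact: continuous_ssq.
have Iu : Rintegrable `[al, be] (fun x => lam ^+ 2 * usq U x).
  by apply: RintegrableZ => //; apply: Rintegrable_continuous; exact: continuous_usq.
have Iy : Rintegrable `[al, be] (fun x => lam ^+ 2 * usq Y x).
  by apply: RintegrableZ => //; apply: Rintegrable_continuous.
have HS : itg al be (forcing U) <= S.
  apply: le_trans (hs_forcing sol); apply: itgS (hs_forcing_int sol) _ => //.
  by move=> t; exact: forcing_ge0.
rewrite A.2//.
have -> : (1 - th - del) * itg al be (fun x => a^-1 * ssq U x) +
    itg al be (fun x => lam ^+ 2 * usq U x) - th * itg al be (fun x => lam ^+ 2 * usq Y x) =
  itg al be (fun x => (1 - th - del) * (a^-1 * ssq U x) + lam ^+ 2 * usq U x - th * (lam ^+ 2 * usq Y x)).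
  rewrite itgB; [|by apply: RintegrableD => //; exact: RintegrableZ|exact: RintegrableZ].
  rewrite itgD//; last exact: RintegrableZ.
  by congr (_ + _ - _); rewrite [RHS]itgZ.
apply: (@le_trans _ _ (itg al be (fun x => rellich' e x + l ^+ 2 / (a * del) * forcing U x))); last first.
  rewrite itgD; [|by case: A|exact: RintegrableZ].
  rewrite itgZ// lerD2l ler_wpM2l// divr_ge0 ?sqr_ge0// mulr_ge0// ltW//.
apply: itg_le.
- apply: RintegrableB => //; last exact: RintegrableZ.
  by apply: RintegrableD => //; exact: RintegrableZ.
- by apply: RintegrableD => //; [case: A|exact: RintegrableZ].
move=> x alx xbe.
have xe : `|x - e| <= l by rewrite ler_norml /l; apply/andP; split; lra.
set z1 := hs2 U x * hu1 Y x - hs1 U x * hu2 Y x.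
set z2 := hr1 U x * hs1 U x + hr2 U x * hs2 U x.
(* The weight sqrt a balances the two sides: after multiplication by c0 l / a, both |s|^2 / a and
   lam^2 |y|^2 carry the same factor [th]. *)
have Y1 : 2 * `|lam * z1| <= ssq U x / sa + sa * (lam ^+ 2 * usq Y x).
  have := @dot_young sa (lam * hu1 Y x) (- (lam * hu2 Y x)) (hs2 U x) (hs1 U x) sa0.
  rewrite (_ : lam * hu1 Y x * hs2 U x + - (lam * hu2 Y x) * hs1 U x = lam * z1); last by rewrite /z1; ring.
  by rewrite (_ : (lam * hu1 Y x) ^+ 2 + (- (lam * hu2 Y x)) ^+ 2 = lam ^+ 2 * usq Y x) ?[hs2 U x ^+ 2 + _]addrC -/(ssq U x); [lra|rewrite /usq; ring].
have B1 : `|(x - e) * (2 / a * (lam * c x * z1))| <= th * (a^-1 * ssq U x) + th * (lam ^+ 2 * usq Y x).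
  have -> : (x - e) * (2 / a * (lam * c x * z1)) = (x - e) * c x / a * (2 * (lam * z1)) by ring.
  rewrite normrM (_ : th * _ + _ = c0 * l / a * (ssq U x / sa + sa * (lam ^+ 2 * usq Y x))); last first.
    by rewrite /th -saa; field; rewrite gt_eqF.
  have -> : `|2 * (lam * z1)| = 2 * `|lam * z1| by rewrite normrM [X in X * _]ger0_norm.
  apply: ler_pM => //.
  rewrite !normrM normfV (gtr0_norm a0) ler_pM2r ?invr_gt0// mulrC ler_pM//.
have k0 : 0 < del / l by rewrite divr_gt0.
have Y2 := @dot_young (del / l) (hs1 U x) (hs2 U x) (hr1 U x) (hr2 U x) k0.
have B2 : `|(x - e) * (2 / a * z2)| <= del * (a^-1 * ssq U x) + l ^+ 2 / (a * del) * forcing U x.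
  have -> : (x - e) * (2 / a * z2) = (x - e) / a * (2 * z2) by ring.
  rewrite normrM.
  have -> : `|2 * z2| = 2 * `|z2| by rewrite normrM [X in X * _]ger0_norm.
  apply: (@le_trans _ _ (l / a * (del / l * ssq U x + forcing U x / (del / l)))).
    apply: ler_pM => //.
      by rewrite normrM normfV (gtr0_norm a0) ler_pM2r ?invr_gt0.
    rewrite /z2 [hr1 U x * _]mulrC [hr2 U x * _]mulrC; apply: le_trans Y2 _.
    rewrite lerD2l ler_pM2r ?invr_gt0// /forcing -addrA lerDr addr_ge0 ?sqr_ge0//.
  by rewrite le_eqVlt; apply/orP; left; apply/eqP; field; rewrite !gt_eqF.
have n1 := ler_norm (- ((x - e) * (2 / a * (lam * c x * z1)))); rewrite normrN in n1.
have n2 := ler_norm ((x - e) * (2 / a * z2)).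
rewrite /rellich' -/z1 -/z2 (mulrBr (2 / a)) (mulrBr (x - e)); lra.
Qed.

Definition Cc l := 2 * a * l ^+ 2 + l ^+ 4 * (lam ^+ 2 * (1 + c0 ^+ 2) + 1).

(** Without damping the derivative of the cut-off flux contains a^-1 bump^2 |s|^2, so the flux is
    bounded in the interior by u, y and the forcing. The Young parameter 1 / (2 a) leaves half of
    that term. *)
Lemma caccioppoli (al be : R) : 0 <= al -> al < be -> be <= L ->
  (forall x, al <= x -> x <= be -> b x = 0) -> {within `[al, be], continuous (usq Y)} ->
  itg al be (fun x => bump al be x ^+ 2 * ssq U x) <=
    2 * a * (Cc (be - al) * (itg al be (usq U) + itg al be (usq Y) + S)).
Proof.
move=> al0 albe beL Hb cY; have albe' := ltW albe.
have A := AC_cutoff_flux al0 albe' beL.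
set l := be - al.
have c00 : 0 <= c0 by apply: le_trans (c_le 0).
have Cc0 : 0 <= Cc l by rewrite /Cc; nneg.
have IF : Rintegrable `[al, be] (forcing U).
  by apply: RintegrableS (hs_forcing_int sol) => //; exact: sub_itv.
have Iu : Rintegrable `[al, be] (usq U) by apply: Rintegrable_continuous; exact: continuous_usq.
have Iy : Rintegrable `[al, be] (usq Y) by apply: Rintegrable_continuous.
have Is : Rintegrable `[al, be] (fun x => bump al be x ^+ 2 * ssq U x).
  apply: Rintegrable_continuous => x.
  by apply: cvgM; [exact: continuous_bump2|exact: continuous_ssq].
have HS : itg al be (forcing U) <= S.
  apply: le_trans (hs_forcing sol); apply: itgS (hs_forcing_int sol) _ => //.
  by move=> t; exact: forcing_ge0.
have IQ : Rintegrable `[al, be] (fun x => usq U x + usq Y x + forcing U x).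
  by apply: RintegrableD => //; exact: RintegrableD.
have E : itg al be (fun x => usq U x + usq Y x + forcing U x) <= itg al be (usq U) + itg al be (usq Y) + S.
  have Iuy : Rintegrable `[al, be] (fun x => usq U x + usq Y x) by exact: RintegrableD.
  by rewrite itgD// itgD// lerD2l.
apply: le_trans (_ : 2 * a * (Cc l * itg al be (fun x => usq U x + usq Y x + forcing U x)) <= _); last first.
  by apply: ler_wpM2l; [nneg|apply: ler_wpM2l].
have -> : Cc l * itg al be (fun x => usq U x + usq Y x + forcing U x) =
    itg al be (fun x => cutoff_flux' al be x + Cc l * (usq U x + usq Y x + forcing U x)).
  rewrite [RHS]itgD; [|by case: A|exact: RintegrableZ].
  by rewrite itg_cutoff_flux// add0r itgZ.
have IA : Rintegrable `[al, be] (fun x => cutoff_flux' al be x + Cc l * (usq U x + usq Y x + forcing U x)).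
  by apply: RintegrableD => //; [case: A|exact: RintegrableZ].
rewrite -itgZ//; apply: itg_le => //; first exact: RintegrableZ.
move=> x alx xbe.
have x0 := le_trans al0 alx; have xL := le_trans xbe beL.
have E1 := hs_rel1 sol x0 xL; have E2 := hs_rel2 sol x0 xL.
rewrite Hb// mul0r addr0 in E1; rewrite Hb// mul0r addr0 in E2.
have G1 : hg1 U x = a^-1 * hs1 U x by rewrite E1 mulKf// gt_eqF.
have G2 : hg2 U x = a^-1 * hs2 U x by rewrite E2 mulKf// gt_eqF.
set m := bump al be x; set m' := al + be - 2 * x.
have [m0 ml] := andP (bump_le alx xbe); rewrite -/m -/l in m0 ml.
have m'l := bump_deriv_le alx xbe; rewrite -/m' -/l in m'l.
have m2l : m ^+ 2 <= l ^+ 4.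
  by rewrite (_ : l ^+ 4 = (l ^+ 2) ^+ 2); [rewrite lerXn2r ?nnegrE//; exact: sqr_ge0|rewrite -exprM].
have k2 : 0 < (2 * a)^-1 by rewrite invr_gt0 mulr_gt0.
have Y1 := @dot_young (2 * a)^-1 (m * hs1 U x) (m * hs2 U x) (m' * hu1 U x) (m' * hu2 U x) k2.
have Y2 := @dot_young 1 (lam * c x * hu2 U x) (- (lam * c x * hu1 U x)) (hu1 Y x) (hu2 Y x) ltr01.
have Y3 := @dot_young 1 (hr1 U x) (hr2 U x) (hu1 U x) (hu2 U x) ltr01.
have Ec : cutoff_flux' al be x = 2 * (m * hs1 U x * (m' * hu1 U x) + m * hs2 U x * (m' * hu2 U x))
   - lam ^+ 2 * (m ^+ 2 * usq U x)
   + m ^+ 2 * (lam * c x * hu2 U x * hu1 Y x + - (lam * c x * hu1 U x) * hu2 Y x)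
   - m ^+ 2 * (hr1 U x * hu1 U x + hr2 U x * hu2 U x) + a^-1 * (m ^+ 2 * ssq U x).
  by rewrite /cutoff_flux' G1 G2 /usq /ssq -/m -/m'; ring.
set z1 := _ + _ in Y1 Ec; set z2 := _ + _ in Y2 Ec; set z3 := _ + _ in Y3 Ec.
have V1 : 2 * `|z1| <= (2 * a)^-1 * (m ^+ 2 * ssq U x) + 2 * a * l ^+ 2 * usq U x.
  apply: le_trans Y1 _; rewrite [X in _ * X + _](_ : _ = m ^+ 2 * ssq U x); last by rewrite /ssq; ring.
  rewrite lerD2l invrK (_ : _ + _ = m' ^+ 2 * usq U x); last by rewrite /usq; ring.
  have : m' ^+ 2 * usq U x * (2 * a) <= l ^+ 2 * usq U x * (2 * a).
    by apply: ler_wpM2r; [nneg|apply: ler_wpM2r; [exact: usq_ge0|]].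
  lra.
have cc : c x ^+ 2 <= c0 ^+ 2 by rewrite -[leLHS]real_normK ?num_real// lerXn2r ?nnegrE.
have V2 : m ^+ 2 * (2 * `|z2|) <= l ^+ 4 * (lam ^+ 2 * c0 ^+ 2 * usq U x + usq Y x).
  apply: ler_pM; [exact: sqr_ge0|by apply: mulr_ge0|exact: m2l|].
  apply: le_trans Y2 _; rewrite mul1r divr1 -/(usq Y x) lerD2r.
  rewrite (_ : _ + _ = lam ^+ 2 * (c x ^+ 2 * usq U x)); last by rewrite /usq; ring.
  by rewrite -mulrA; apply: ler_wpM2l; [exact: sqr_ge0|apply: ler_wpM2r; [exact: usq_ge0|]].
have V3 : m ^+ 2 * (2 * `|z3|) <= l ^+ 4 * (forcing U x + usq U x).
  apply: ler_pM; [exact: sqr_ge0|by apply: mulr_ge0|exact: m2l|].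
  apply: le_trans Y3 _; rewrite mul1r divr1 -/(usq U x) lerD2r /forcing -addrA lerDr addr_ge0 ?sqr_ge0//.
have V4 : m ^+ 2 * (lam ^+ 2 * usq U x) <= l ^+ 4 * (lam ^+ 2 * usq U x).
  by apply: ler_wpM2r => //; nneg.
have n1 := ler_norm (- z1); rewrite normrN in n1.
have n2 : m ^+ 2 * (2 * - z2) <= m ^+ 2 * (2 * `|z2|).
  by apply: ler_wpM2l; [exact: sqr_ge0|apply: ler_wpM2l => //; rewrite -normrN ler_norm].
have n3 : m ^+ 2 * (2 * z3) <= m ^+ 2 * (2 * `|z3|).
  by apply: ler_wpM2l; [exact: sqr_ge0|apply: ler_wpM2l => //; rewrite ler_norm].
have P1 : 0 <= l ^+ 4 * usq U x by nneg.
have P2 : 0 <= l ^+ 4 * usq Y x by nneg.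
have P3 : 0 <= l ^+ 4 * forcing U x by nneg.
have P4 : 0 <= l ^+ 4 * (lam ^+ 2 * c0 ^+ 2 * usq U x) by nneg.
have P5 : 0 <= 2 * a * l ^+ 2 * usq Y x by nneg.
have P6 : 0 <= 2 * a * l ^+ 2 * forcing U x by nneg.
have P7 : 0 <= l ^+ 4 * (lam ^+ 2 * (1 + c0 ^+ 2)) * usq Y x by nneg.
have P8 : 0 <= l ^+ 4 * (lam ^+ 2 * (1 + c0 ^+ 2)) * forcing U x by nneg.
have Ha : a^-1 * (m ^+ 2 * ssq U x) = 2 * ((2 * a)^-1 * (m ^+ 2 * ssq U x)) by field; rewrite gt_eqF.
have key : (2 * a)^-1 * (m ^+ 2 * ssq U x) <= cutoff_flux' al be x + Cc l * (usq U x + usq Y x + forcing U x).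
  rewrite Ec Ha /Cc; lra.
have -> : m ^+ 2 * ssq U x = 2 * a * ((2 * a)^-1 * (m ^+ 2 * ssq U x)) by field; rewrite gt_eqF.
by apply: ler_wpM2l => //; nneg.
Qed.

End Estimates.
End HalfSystem.

Ltac nneg := repeat match goal with
  | |- is_true (0 <= _ ^+ 2) => exact: sqr_ge0
  | |- is_true (0 <= _ ^+ 4) => by rewrite exprn_even_ge0
  | |- is_true (0 <= usq _ _) => exact: usq_ge0
  | |- is_true (0 <= ssq _ _) => exact: ssq_ge0
  | |- is_true (0 <= gsq _ _) => exact: gsq_ge0
  | |- is_true (0 <= en _ _) => exact: en_ge0
  | |- is_true (0 <= forcing _ _) => exact: forcing_ge0
  | |- is_true (0 <= expR _) => exact: expR_ge0
  | |- is_true (0 <= `|_|) => exact: normr_ge0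
  | |- is_true (0 <= _%:R) => exact: ler0n
  | |- is_true (0 <= 1) => exact: ler01
  | |- is_true (0 <= _ + _) => apply: addr_ge0
  | |- is_true (0 <= _ * _) => apply: mulr_ge0
  | |- is_true (0 <= _^-1) => rewrite invr_ge0
  | |- is_true (0 <= _) => first [done | by apply: ltW]
  end.

Lemma within_continuous_add (R : realType) (A : set R) (f g : R -> R) :
  {within A, continuous f} -> {within A, continuous g} -> {within A, continuous (fun x => f x + g x)}.
Proof. by move=> cf cg x; apply: (@continuousD _ R^o (subspace A)); [exact: cf|exact: cg]. Qed.

Lemma within_continuous_scale (R : realType) (A : set R) (k : R) (f : R -> R) :
  {within A, continuous f} -> {within A, continuous (fun x => k * f x)}.
Proof. by move=> cf x; apply: (@continuousM _ (subspace A)); [exact: cst_continuous|exact: cf]. Qed.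

(** * The coupled system at a fixed frequency *)

Section Coupled.
Context {R : realType}.
Implicit Types (U Y : @half R).

Lemma step_in (k al be x : R) : al < x -> x < be -> step k al be x = k.
Proof. by move=> H1 H2; rewrite /step indicE mem_set ?mulr1//= in_itv/= H1 H2. Qed.

Lemma step_left (k al be x : R) : x <= al -> step k al be x = 0.
Proof.
move=> H; rewrite /step indicE memNset ?mulr0//= in_itv/= => /andP[+ _].
by rewrite ltNge H.
Qed.

Lemma step_right (k al be x : R) : be <= x -> step k al be x = 0.
Proof.
move=> H; rewrite /step indicE memNset ?mulr0//= in_itv/= => /andP[_ +].
by rewrite ltNge H.
Qed.

Lemma step_ge0 (k al be x : R) : 0 <= k -> 0 <= step k al be x.
Proof. by move=> k0; rewrite /step mulr_ge0. Qed.

Lemma step_norm (k al be x : R) : `|step k al be x| <= `|k|.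
Proof.
by rewrite /step normrM ler_piMr// indicE; case: (_ \in _); rewrite ?normr1 ?normr0 ?ler01.
Qed.

Lemma step_le (k al be x : R) : 0 <= k -> step k al be x <= k.
Proof.
move=> k0; have := step_norm k al be x; rewrite (ger0_norm k0) ger0_norm//.
exact: step_ge0.
Qed.

Definition en2 U Y x := en U x + en Y x.

Section Fixed.
Variables (L a lam b0 c0 d0 : R) (b c d : R -> R).
Hypotheses (L0 : 0 < L) (a0 : 0 < a) (l0 : lam != 0).
Hypotheses (b_ge0 : forall x, 0 <= b x) (b_le : forall x, b x <= b0).
Hypotheses (d_ge0 : forall x, 0 <= d x) (d_le : forall x, d x <= d0).
Hypothesis c_le : forall x, `|c x| <= c0.

Definition coupled_solution S U Y :=
  half_solution L a lam b c S U Y /\ half_solution L 1 lam d (fun x => - c x) S Y U.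

Let c_le' x : `|- c x| <= c0. Proof. by rewrite normrN. Qed.

Lemma coupled_S_ge0 S U Y : coupled_solution S U Y -> 0 <= S.
Proof.
move=> [sol _]; apply: le_trans (hs_forcing sol).
by apply: itg_ge0 => x _ _; exact: forcing_ge0.
Qed.

Lemma en2_ge0 U Y x : 0 <= en2 U Y x. Proof. by rewrite addr_ge0 ?en_ge0. Qed.

Definition joint_const :=
  expR ((rateE a lam + rateE 1 lam + 3 * lam ^+ 2 * c0 ^+ 2) * L) * (1 + 2 * (rateF a b0 + rateF 1 d0)).

Lemma joint_const_ge0 : 0 <= joint_const.
Proof.
apply: mulr_ge0; first exact: expR_ge0.
by apply: addr_ge0 => //; apply: mulr_ge0 => //; apply: addr_ge0; exact: rateF_ge0.
Qed.

(** The coupling term of each component is bounded by the energy of the other, so the sum of the two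
    energies obeys a closed differential inequality on the whole of [0, L]. *)
Lemma joint_gronwall S U Y x0 x : coupled_solution S U Y ->
  0 <= x0 -> x0 <= L -> 0 <= x -> x <= L -> en2 U Y x <= joint_const * (en2 U Y x0 + S).
Proof.
move=> sol x00 x0L xx0 xL; have S0 := coupled_S_ge0 sol; have [sU sY] := sol.
set K := rateE a lam + rateE 1 lam + 3 * lam ^+ 2 * c0 ^+ 2.
set F := rateF a b0 + rateF 1 d0.
have E1 : 0 <= rateE a lam := rateE_ge0 a lam.
have E2 : 0 <= rateE 1 lam := rateE_ge0 1 lam.
have F1 : 0 <= rateF a b0 := rateF_ge0 a b0.
have F2 : 0 <= rateF 1 d0 := rateF_ge0 1 d0.
have c00 : 0 <= c0 by apply: le_trans (c_le 0).
have C1 : 0 <= 3 * lam ^+ 2 * c0 ^+ 2 by rewrite mulr_ge0 ?sqr_ge0// mulr_ge0 ?sqr_ge0.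
have K0 : 0 <= K by apply: addr_ge0 => //; exact: addr_ge0.
have F0 : 0 <= F by exact: addr_ge0.
have AE : AC 0 L (en2 U Y) (fun x => den lam c U Y x + den lam (fun x => - c x) Y U x).
  by apply: AC_add; [exact: AC_en L0 sU|exact: AC_en L0 sY].
have IF : Rintegrable `[0, L] (fun x => F * (forcing U x + forcing Y x)).
  by apply: RintegrableZ => //; apply: RintegrableD => //; [exact: hs_forcing_int sU|exact: hs_forcing_int sY].
have Hrho t : 0 <= F * (forcing U t + forcing Y t).
  by apply: mulr_ge0 => //; rewrite addr_ge0 ?forcing_ge0.
have Hde t : 0 <= t -> t <= L -> `|den lam c U Y t + den lam (fun x => - c x) Y U t| <=
    K * en2 U Y t + F * (forcing U t + forcing Y t).
  move=> t0 tL; apply: le_trans (ler_normD _ _) _.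
  have D1 := den_le a0 b_ge0 b_le sU t0 tL.
  have D2 := den_le ltr01 d_ge0 d_le sY t0 tL.
  have cc : c t ^+ 2 <= c0 ^+ 2 by rewrite -[leLHS]real_normK ?num_real// lerXn2r ?nnegrE.
  rewrite sqrrN in D2; apply: le_trans (lerD D1 D2) _.
  have G1 : 3 * lam ^+ 2 * c t ^+ 2 * (usq U t + usq Y t) <= 3 * lam ^+ 2 * c0 ^+ 2 * (en U t + en Y t).
    apply: ler_pM; [|by rewrite addr_ge0 ?usq_ge0| |].
    - by rewrite mulr_ge0 ?sqr_ge0// mulr_ge0 ?sqr_ge0.
    - by apply: ler_wpM2l => //; rewrite mulr_ge0 ?sqr_ge0.
    - by rewrite lerD// /en lerDl ssq_ge0.
  have P2 : 0 <= rateE a lam * en Y t by rewrite mulr_ge0 ?en_ge0.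
  have P3 : 0 <= rateE 1 lam * en U t by rewrite mulr_ge0 ?en_ge0.
  have P4 : 0 <= rateF a b0 * forcing Y t by rewrite mulr_ge0 ?forcing_ge0.
  have P5 : 0 <= rateF 1 d0 * forcing U t by rewrite mulr_ge0 ?forcing_ge0.
  rewrite /K /F /en2; lra.
have := gronwall AE IF K0 (en2_ge0 U Y) Hrho Hde x00 x0L xx0 xL.
move=> /le_trans; apply; rewrite subr0 /joint_const -/K -/F -mulrA.
apply: ler_wpM2l; first exact: expR_ge0.
rewrite itgZ; last by apply: RintegrableD => //; [exact: hs_forcing_int sU|exact: hs_forcing_int sY].
rewrite itgD; [|exact: hs_forcing_int sU|exact: hs_forcing_int sY].
have H1 : F * (itg 0 L (forcing U) + itg 0 L (forcing Y)) <= F * (S + S).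
  by apply: ler_wpM2l => //; rewrite lerD// ?(hs_forcing sU) ?(hs_forcing sY).
have P1 : 0 <= F * en2 U Y x0 by rewrite mulr_ge0 ?en2_ge0.
have := en2_ge0 U Y x0; lra.
Qed.

Definition stable_est := exists2 C, 0 <= C &
  forall S U Y, coupled_solution S U Y -> forall x, 0 <= x -> x <= L -> en2 U Y x <= C * S.

(** The point may depend on the solution: the joint Gronwall inequality spreads the bound from any
    point at a uniform cost. *)
Lemma stable_of_point : (exists2 C, 0 <= C & forall S U Y, coupled_solution S U Y ->
    exists2 x, 0 <= x /\ x <= L & en2 U Y x <= C * S) -> stable_est.
Proof.
move=> [C C0 HC]; exists (joint_const * (C + 1)).
  by rewrite mulr_ge0 ?joint_const_ge0 ?addr_ge0.
move=> S U Y sol x x0 xL; have [y [y0 yL] Hy] := HC S U Y sol.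
apply: le_trans (joint_gronwall sol y0 yL x0 xL) _; rewrite -[leRHS]mulrA.
by apply: ler_wpM2l; [exact: joint_const_ge0|rewrite mulrDl mul1r lerD2r].
Qed.

(** [al, be] is damped and the larger interval [A, B] is free of coupling; the bound found in the
    former is carried along the latter to z. *)
Lemma coupled_U_damped beta al be A B z : 0 < beta -> 0 <= A -> A <= al -> al < be -> be <= B -> B <= L ->
  (forall x, al <= x -> x <= be -> b x = beta) -> (forall x, A <= x -> x <= B -> c x = 0) ->
  A <= z -> z <= B ->
  exists2 C, 0 <= C & forall S U Y, coupled_solution S U Y -> en U z <= C * S.
Proof.
move=> be0 A0 Aal albe beB BL Hb Hc Az zB.
set K := expR (rateE a lam * L); set D := Cd a lam beta (be - al).
have K0 : 0 <= K by exact: expR_ge0.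
exists (K * (`|D| + rateF a b0)).
  by apply: mulr_ge0 => //; apply: addr_ge0 => //; exact: rateF_ge0.
move=> S U Y sol; have S0 := coupled_S_ge0 sol; have [sU _] := sol.
have [|x0 [alx xbe] Hx0] := damped_start b_ge0 sU l0 be0 (le_trans A0 Aal) albe (le_trans beB BL) Hb.
  by move=> x alx xbe; apply: Hc; [exact: le_trans alx|exact: le_trans beB].
have := en_gronwall L0 a0 b_ge0 b_le sU A0 BL Hc (le_trans Aal alx) (le_trans xbe beB) Az zB.
move=> /le_trans; apply; rewrite -/K -[leRHS]mulrA; apply: ler_wpM2l => //.
rewrite [leRHS]mulrDl lerD2r (le_trans Hx0)//; apply: ler_wpM2r => //; exact: ler_norm.
Qed.

Lemma coupled_Y_damped beta al be A B z : 0 < beta -> 0 <= A -> A <= al -> al < be -> be <= B -> B <= L ->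
  (forall x, al <= x -> x <= be -> d x = beta) -> (forall x, A <= x -> x <= B -> c x = 0) ->
  A <= z -> z <= B ->
  exists2 C, 0 <= C & forall S U Y, coupled_solution S U Y -> en Y z <= C * S.
Proof.
move=> be0 A0 Aal albe beB BL Hd Hc Az zB.
set K := expR (rateE 1 lam * L); set D := Cd 1 lam beta (be - al).
have K0 : 0 <= K by exact: expR_ge0.
exists (K * (`|D| + rateF 1 d0)).
  by apply: mulr_ge0 => //; apply: addr_ge0 => //; exact: rateF_ge0.
move=> S U Y sol; have S0 := coupled_S_ge0 sol; have [_ sY] := sol.
have Hc' x : A <= x -> x <= B -> - c x = 0 by move=> Ax xB; rewrite Hc// oppr0.
have [|x0 [alx xbe] Hx0] := damped_start d_ge0 sY l0 be0 (le_trans A0 Aal) albe (le_trans beB BL) Hd.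
  by move=> x alx xbe; apply: Hc'; [exact: le_trans alx|exact: le_trans beB].
have := en_gronwall L0 ltr01 d_ge0 d_le sY A0 BL Hc' (le_trans Aal alx) (le_trans xbe beB) Az zB.
move=> /le_trans; apply; rewrite -/K -[leRHS]mulrA; apply: ler_wpM2l => //.
rewrite [leRHS]mulrDl lerD2r (le_trans Hx0)//; apply: ler_wpM2r => //; exact: ler_norm.
Qed.

Lemma stable_damped_both z : 0 <= z -> z <= L ->
  (exists2 C, 0 <= C & forall S U Y, coupled_solution S U Y -> en U z <= C * S) ->
  (exists2 C, 0 <= C & forall S U Y, coupled_solution S U Y -> en Y z <= C * S) -> stable_est.
Proof.
move=> z0 zL [C1 C10 H1] [C2 C20 H2]; apply: stable_of_point.
exists (C1 + C2); first exact: addr_ge0.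
by move=> S U Y sol; exists z => //; rewrite /en2 [leRHS]mulrDl; apply: lerD; [exact: H1 sol|exact: H2 sol].
Qed.

Section Coupling.
Variables (c1 c2 : R).
Hypotheses (c10 : 0 <= c1) (c12 : c1 < c2) (c2L : c2 <= L).
Hypotheses (bz : forall x, c1 <= x -> x <= c2 -> b x = 0) (dz : forall x, c1 <= x -> x <= c2 -> d x = 0).
Let l := c2 - c1.
Let lgt0 : 0 < l. Proof. by rewrite subr_gt0. Qed.
Let c12' := ltW c12.
Let lam2 : 0 < lam ^+ 2. Proof. by rewrite exprn_even_gt0. Qed.

Let theta := c0 * l / Num.sqrt a.
Let kappa := c0 * l.

(** With the pivot at c2 the boundary term survives only at c1, the end that the damping of the
    first component reaches. *)
Lemma coupled_rellich_U del S U Y : coupled_solution S U Y -> 0 < del ->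
  (1 - theta - del) * itg c1 c2 (fun x => a^-1 * ssq U x) + itg c1 c2 (fun x => lam ^+ 2 * usq U x)
    - theta * itg c1 c2 (fun x => lam ^+ 2 * usq Y x)
  <= l * (a^-1 + lam ^+ 2) * en U c1 + l ^+ 2 / (a * del) * S.
Proof.
move=> [sU sY] del0.
have cY := continuous_usq sY c10 c12' c2L.
have := rellich_estimate a0 c_le sU c10 c12 c2L del0 c12' (lexx c2) bz cY.
move=> /le_trans; apply; rewrite lerD2r /rellich subrr mul0r sub0r -mulNr opprB -/l -mulrA.
apply: ler_wpM2l; first exact: ltW.
have := usq_ge0 U c1; have := ssq_ge0 U c1 => s0 u0.
have P1 : 0 <= a^-1 * usq U c1 by rewrite mulr_ge0// invr_ge0 ltW.
have P2 : 0 <= lam ^+ 2 * ssq U c1 by rewrite mulr_ge0// sqr_ge0.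
rewrite /en; lra.
Qed.

(** Here the pivot is c1, so that the boundary term survives only at c2, on the side from which Y is
    to be controlled. *)
Lemma coupled_rellich_Y del S U Y : coupled_solution S U Y -> 0 < del ->
  (1 - kappa - del) * itg c1 c2 (ssq Y) + itg c1 c2 (fun x => lam ^+ 2 * usq Y x)
    - kappa * itg c1 c2 (fun x => lam ^+ 2 * usq U x)
  <= l * (1 + lam ^+ 2) * en Y c2 + l ^+ 2 / del * S.
Proof.
move=> [sU sY] del0.
have cU := continuous_usq sU c10 c12' c2L.
have := rellich_estimate ltr01 c_le' sY c10 c12 c2L del0 (lexx c1) c12' dz cU.
rewrite sqrtr1 divr1 -/kappa mul1r.
rewrite (@eq_itg _ c1 c2 (fun x => 1^-1 * ssq Y x) (ssq Y)); last by move=> x _ _; rewrite invr1 mul1r.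
move=> /le_trans; apply; rewrite lerD2r /rellich subrr mul0r subr0 -/l invr1 mul1r -mulrA.
apply: ler_wpM2l; first exact: ltW.
have := usq_ge0 Y c2; have := ssq_ge0 Y c2 => s0 u0.
have P2 : 0 <= lam ^+ 2 * ssq Y c2 by rewrite mulr_ge0// sqr_ge0.
rewrite /en; lra.
Qed.

Lemma coupled_itg_ge0 S U Y : coupled_solution S U Y ->
  [/\ 0 <= itg c1 c2 (fun x => a^-1 * ssq U x), 0 <= itg c1 c2 (fun x => lam ^+ 2 * usq U x),
      0 <= itg c1 c2 (ssq Y) & 0 <= itg c1 c2 (fun x => lam ^+ 2 * usq Y x)].
Proof.
move=> _; split; apply: itg_ge0 => x _ _; [|exact: mulr_ge0 (sqr_ge0 lam) (usq_ge0 U x)|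
  exact: ssq_ge0|exact: mulr_ge0 (sqr_ge0 lam) (usq_ge0 Y x)].
by apply: mulr_ge0; [rewrite invr_ge0 ltW|exact: ssq_ge0].
Qed.

(** In the sum of the two Rellich estimates, up to del, the terms in s and y have the coefficient 1
    - theta and the terms in t and u the coefficient 1 - kappa. Positivity of both is the smallness
    condition of (C1). *)
Lemma stable_opposite_ends : theta < 1 -> kappa < 1 ->
  (exists2 C, 0 <= C & forall S U Y, coupled_solution S U Y -> en U c1 <= C * S) ->
  (exists2 C, 0 <= C & forall S U Y, coupled_solution S U Y -> en Y c2 <= C * S) -> stable_est.
Proof.
move=> th1 ka1 [C1 C10 H1] [C2 C20 H2]; apply: stable_of_point.
pose del := Num.min (1 - theta) (1 - kappa) / 2.
have m0 : 0 < Num.min (1 - theta) (1 - kappa) by rewrite lt_min !subr_gt0 th1 ka1.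
have del0 : 0 < del by rewrite divr_gt0.
have d1 : 2 * del <= 1 - theta by rewrite mulrC divfK// ge_min lexx.
have d2 : 2 * del <= 1 - kappa by rewrite mulrC divfK// ge_min lexx orbT.
pose R0 := l * (a^-1 + lam ^+ 2) * C1 + l ^+ 2 / (a * del) + (l * (1 + lam ^+ 2) * C2 + l ^+ 2 / del).
have ai : 0 < a^-1 by rewrite invr_gt0.
have q1 : 0 <= l * (a^-1 + lam ^+ 2) by nneg.
have q2 : 0 <= l * (1 + lam ^+ 2) by nneg.
have q3 : 0 <= l ^+ 2 / (a * del) by nneg.
have q4 : 0 <= l ^+ 2 / del by nneg.
have R00 : 0 <= R0 by rewrite /R0; repeat apply: addr_ge0 => //; exact: mulr_ge0.
exists ((a + 1 + 2 / lam ^+ 2) * (R0 / del / l)).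
  by nneg.
move=> S U Y sol; have S0 := coupled_S_ge0 sol; have [sU sY] := sol.
have E1 := coupled_rellich_U sol del0; have E2 := coupled_rellich_Y sol del0.
have [W1 V1 W2 V2] := coupled_itg_ge0 sol.
set Wu := itg _ _ _ in E1 W1; set Vu := itg _ _ _ in E1 E2 V1; set Vy := itg _ _ _ in E1 E2 V2; set Wy := itg _ _ _ in E2 W2.
have cuU := continuous_usq sU c10 c12' c2L; have cuY := continuous_usq sY c10 c12' c2L.
have csU := continuous_ssq sU c10 c12' c2L; have csY := continuous_ssq sY c10 c12' c2L.
pose f x := a^-1 * ssq U x + lam ^+ 2 * usq U x + (ssq Y x + lam ^+ 2 * usq Y x).
have cf : {within `[c1, c2], continuous f}.
  apply: within_continuous_add; apply: within_continuous_add => //; exact: within_continuous_scale.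
have If : itg c1 c2 f = Wu + Vu + (Wy + Vy).
  have I1 : Rintegrable `[c1, c2] (fun x => a^-1 * ssq U x) by apply: RintegrableZ => //; exact: Rintegrable_continuous.
  have I2 : Rintegrable `[c1, c2] (fun x => lam ^+ 2 * usq U x) by apply: RintegrableZ => //; exact: Rintegrable_continuous.
  have I3 : Rintegrable `[c1, c2] (ssq Y) by exact: Rintegrable_continuous.
  have I4 : Rintegrable `[c1, c2] (fun x => lam ^+ 2 * usq Y x) by apply: RintegrableZ => //; exact: Rintegrable_continuous.
  by rewrite itgD; [rewrite itgD// itgD|exact: RintegrableD|exact: RintegrableD].
have HA : itg c1 c2 f <= R0 / del * S.
  rewrite mulrAC ler_pdivlMr// If.
  have h1 := ler_wpM2l q1 (H1 _ _ _ sol); have h2 := ler_wpM2l q2 (H2 _ _ _ sol).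
  have p1 : 2 * del * Wu <= (1 - theta) * Wu by rewrite ler_wpM2r.
  have p2 : 2 * del * Vu <= (1 - kappa) * Vu by rewrite ler_wpM2r.
  have p3 : 2 * del * Wy <= (1 - kappa) * Wy by rewrite ler_wpM2r.
  have p4 : 2 * del * Vy <= (1 - theta) * Vy by rewrite ler_wpM2r.
  have n1 : 0 <= del * Vu by nneg.
  have n2 : 0 <= del * Vy by nneg.
  have RS : R0 * S = l * (a^-1 + lam ^+ 2) * (C1 * S) + l ^+ 2 / (a * del) * S
      + (l * (1 + lam ^+ 2) * (C2 * S) + l ^+ 2 / del * S).
    by rewrite /R0 [LHS]mulrDl; congr (_ + _); rewrite [LHS]mulrDl; congr (_ + _); rewrite -[LHS]mulrA.
  have E3 := lerD (le_trans E1 (lerD h1 (lexx _))) (le_trans E2 (lerD h2 (lexx _))).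
  rewrite RS; apply: le_trans E3.
  lra.
have [x [c1x xc2] fx] := exists_le_mean c12 cf HA.
exists x; first by split; [exact: le_trans c1x|exact: le_trans c2L].
have u0 := usq_ge0 U x; have s0 := ssq_ge0 U x; have v0 := usq_ge0 Y x; have t0 := ssq_ge0 Y x.
have k1 : 0 <= a^-1 * ssq U x by nneg.
have k2 : 0 <= lam ^+ 2 * usq U x by nneg.
have k3 : 0 <= lam ^+ 2 * usq Y x by nneg.
have f0 : 0 <= f x by rewrite /f; nneg.
have b1 : ssq U x <= a * f x.
  rewrite (_ : ssq U x = a * (a^-1 * ssq U x)); last by field; rewrite gt_eqF.
  by apply: ler_wpM2l; [exact: ltW|rewrite /f; lra].
have b2 : usq U x + usq Y x <= 2 / lam ^+ 2 * f x.
  by rewrite mulrAC ler_pdivlMr// /f; lra.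
have b3 : ssq Y x <= f x by rewrite /f; lra.
have b4 : en2 U Y x <= (a + 1 + 2 / lam ^+ 2) * f x by rewrite /en2 /en; lra.
apply: le_trans b4 _; rewrite -[leRHS]mulrA; apply: ler_wpM2l.
  by nneg.
apply: le_trans fx _; rewrite -/l le_eqVlt; apply/orP; left; apply/eqP; field.
by rewrite !gt_eqF.
Qed.

End Coupling.

End Fixed.
End Coupled.

(** * One damped component and equal wave speeds *)

Section UndampedEnd.
Context {R : realType}.
Notation mu := (@lebesgue_measure R).
Implicit Types (U Y : @half R).

(** A step coefficient has its nonzero value on an open interval only; the endpoints do not change
    the integral. *)
Lemma eq_itg_open (a b : R) (f g : R -> R) : Rintegrable `[a, b] f -> Rintegrable `[a, b] g ->
  (forall t, a < t -> t < b -> f t = g t) -> itg a b f = itg a b g.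
Proof.
move=> If Ig fg; have [ba|ab|->] := ltgtP b a; last by rewrite !itg1.
  apply: eq_itg => t at1 tb; move: (le_lt_trans (le_trans at1 tb) ba); by rewrite ltxx.
have E h : Rintegrable `[a, b] h -> itg a b h = \int[mu]_(t in `]a, b[) h t.
  move=> Ih; rewrite /itg -Rintegral_itv_bndo_bndc; last first.
    by apply: RintegrableS Ih => //; apply: subset_itvl; rewrite bnd_simp.
  rewrite -Rintegral_itv_obnd_cbnd//.
  by apply: RintegrableS Ih => //; apply: subset_itv; rewrite bnd_simp.
rewrite !E//; apply: eq_Rintegral => t; rewrite inE/= in_itv/= => /andP[].
exact: fg.
Qed.

Lemma within_continuousM (A : set R) (f g : R -> R) :
  {within A, continuous f} -> {within A, continuous g} -> {within A, continuous (fun x => f x * g x)}.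
Proof. by move=> cf cg x; apply: (@continuousM _ (subspace A)); [exact: cf|exact: cg]. Qed.

Variables (L lam c0 k c1 c2 : R) (b c d : R -> R).
Hypotheses (L0 : 0 < L) (l0 : lam != 0).
Hypotheses (c10 : 0 <= c1) (c12 : c1 < c2) (c2L : c2 <= L) (k0 : k != 0).
Hypotheses (bz : forall x, c1 <= x -> x <= L -> b x = 0) (dz : forall x, c1 <= x -> x <= L -> d x = 0).
Hypotheses (c_le : forall x, `|c x| <= c0).
Hypotheses (ck : forall x, c1 < x -> x < c2 -> c x = k) (cz : forall x, c2 <= x -> c x = 0).
Hypothesis mc : measurable_fun [set: R] c.
Let l := c2 - c1.
Let lgt0 : 0 < l. Proof. by rewrite subr_gt0. Qed.
Let c12' := ltW c12.
Let c1L := le_trans c12' c2L.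
Let lam2 : 0 < lam ^+ 2. Proof. by rewrite exprn_even_gt0. Qed.

Definition wronskian U Y x :=
  hs2 U x * hu1 Y x - hs1 U x * hu2 Y x - (hu2 U x * hs1 Y x - hu1 U x * hs2 Y x).

(** The part of the derivative of the Wronskian that is due to the data r of the two components. *)
Definition cross_forcing U Y x :=
  hr1 U x * hu2 Y x - hr2 U x * hu1 Y x + (hu2 U x * hr1 Y x - hu1 U x * hr2 Y x).

(* Since both tensions have the same speed, the zeroth-order terms of the
   derivative cancel and only the coupling survives. *)
Lemma AC_wronskian S U Y : coupled_solution L 1 lam b c d S U Y ->
  AC c1 L (wronskian U Y) (fun x => lam * (c x * (usq Y x - usq U x)) + cross_forcing U Y x).
Proof.
move=> [sU sY]; have sub F f := @AC_sub R 0 L c1 L F f c10 (lexx L).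
have M F f G g H1 H2 := @AC_mul R c1 L F f G g c1L (sub _ _ H1) (sub _ _ H2).
have := AC_add (AC_add (M _ _ _ _ (hs_s2 sU) (hs_u1 sY)) (AC_opp (M _ _ _ _ (hs_s1 sU) (hs_u2 sY))))
  (AC_opp (AC_add (M _ _ _ _ (hs_u2 sU) (hs_s1 sY)) (AC_opp (M _ _ _ _ (hs_u1 sU) (hs_s2 sY))))).
apply: AC_eq => x c1x xL; first by [].
have x0 := le_trans c10 c1x.
rewrite (hs_rel1 sU x0 xL) (hs_rel2 sU x0 xL) (hs_rel1 sY x0 xL) (hs_rel2 sY x0 xL) bz// dz//.
by rewrite /cross_forcing /usq; ring.
Qed.

Lemma wronskian_end S U Y : coupled_solution L 1 lam b c d S U Y -> wronskian U Y L = 0.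
Proof.
move=> [sU sY]; rewrite /wronskian (hs_right1 sU) (hs_right2 sU) (hs_right1 sY) (hs_right2 sY).
by rewrite !mulr0 !mul0r !subrr.
Qed.

Lemma wronskian_le eta U Y x : 0 < eta -> `|wronskian U Y x| <= en U x / eta + eta * en Y x.
Proof.
move=> eta0; rewrite ler_norml /wronskian /en /usq /ssq.
have y1 p q := young p q eta0; have E (p q : R) : - (eta * q ^+ 2 + p ^+ 2 / eta) <= 2 * (q * p) <= eta * q ^+ 2 + p ^+ 2 / eta.
  have := y1 q p; have := y1 (- q) p; rewrite sqrrN mulNr => H1 H2; apply/andP; split; lra.
have ei : 0 < eta^-1 by rewrite invr_gt0.
have P (p : R) : 0 <= p ^+ 2 / eta by nneg.
have Q (p : R) : 0 <= eta * p ^+ 2 by nneg.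
have := E (hs2 U x) (hu1 Y x); have := E (hs1 U x) (hu2 Y x).
have := E (hu2 U x) (hs1 Y x); have := E (hu1 U x) (hs2 Y x).
have := P (hs2 U x); have := P (hs1 U x); have := P (hu1 U x); have := P (hu2 U x).
have := Q (hs2 Y x); have := Q (hs1 Y x); have := Q (hu1 Y x); have := Q (hu2 Y x).
move=> q1 q2 q3 q4 p1 p2 p3 p4 /andP[e1 e2] /andP[e3 e4] /andP[e5 e6] /andP[e7 e8].
by apply/andP; split; lra.
Qed.

Lemma cross_forcing_le eta U Y x : 0 < eta ->
  `|cross_forcing U Y x| <= (forcing U x + forcing Y x) / eta + eta * en2 U Y x.
Proof.
move=> eta0; rewrite ler_norml /cross_forcing /en2 /en /usq /ssq /forcing.
have y1 p q := young p q eta0; have E (p q : R) : - (eta * q ^+ 2 + p ^+ 2 / eta) <= 2 * (q * p) <= eta * q ^+ 2 + p ^+ 2 / eta.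
  have := y1 q p; have := y1 (- q) p; rewrite sqrrN mulNr => H1 H2; apply/andP; split; lra.
have ei : 0 < eta^-1 by rewrite invr_gt0.
have P (p : R) : 0 <= p ^+ 2 / eta by nneg.
have Q (p : R) : 0 <= eta * p ^+ 2 by nneg.
have := E (hr1 U x) (hu2 Y x); have := E (hr2 U x) (hu1 Y x).
have := E (hr1 Y x) (hu2 U x); have := E (hr2 Y x) (hu1 U x).
have := P (hp1 U x); have := P (hp2 U x); have := P (hp1 Y x); have := P (hp2 Y x).
have := P (hr1 U x); have := P (hr2 U x); have := P (hr1 Y x); have := P (hr2 Y x).
have := Q (hs2 Y x); have := Q (hs1 Y x); have := Q (hu1 Y x); have := Q (hu2 Y x).
have := Q (hs2 U x); have := Q (hs1 U x); have := Q (hu1 U x); have := Q (hu2 U x).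
move=> q1 q2 q3 q4 q5 q6 q7 q8 p1 p2 p3 p4 p5 p6 p7 p8 /andP[e1 e2] /andP[e3 e4] /andP[e5 e6] /andP[e7 e8].
by apply/andP; split; lra.
Qed.

(** The derivative of the Wronskian is integrated from c1 to L. [B] is a provisional bound of the
    total energy; it comes only with the factor eta, so that it can be absorbed afterwards. *)
Lemma coupling_balance eta B S U Y : coupled_solution L 1 lam b c d S U Y -> 0 < eta ->
  (forall x, 0 <= x -> x <= L -> en2 U Y x <= B) ->
  `|lam * k| * `|itg c1 c2 (usq Y) - itg c1 c2 (usq U)| <=
    en U c1 / eta + eta * B + (2 * S / eta + L * (eta * B)).
Proof.
move=> sol eta0 HB; have [sU sY] := sol; have S0 := coupled_S_ge0 sol.
have A := AC_wronskian sol.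
have IU : Rintegrable `[c1, L] (usq U) by apply: Rintegrable_continuous; exact: (continuous_usq sU c10 c1L (lexx L)).
have IY : Rintegrable `[c1, L] (usq Y) by apply: Rintegrable_continuous; exact: (continuous_usq sY c10 c1L (lexx L)).
have s1 : `[c1, c2] `<=` `[c1, L] by exact: sub_itv.
have IU1 : Rintegrable `[c1, c2] (usq U) by exact: RintegrableS IU.
have IY1 : Rintegrable `[c1, c2] (usq Y) by exact: RintegrableS IY.
have IX : Rintegrable `[c1, L] (cross_forcing U Y).
  have IC : Rintegrable `[c1, L] (fun x => lam * (c x * (usq Y x - usq U x))).
    apply: RintegrableZ => //; apply: (@Rintegrable_bmul R _ c _ c0) => //.
    - exact: (measurable_funS (E := setT)) mc.
    - exact: RintegrableB.
  have := RintegrableB (measurable_itv _) A.1 IC.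
  by apply: eq_integrable => // x _ /=; rewrite addrAC subrr add0r.
have [IA HA] := A.
have B0 : 0 <= B by apply: le_trans (HB 0 (lexx 0) (ltW L0)); exact: en2_ge0.
have E1 : wronskian U Y L - wronskian U Y c2 = itg c2 L (cross_forcing U Y).
  rewrite HA//; apply: eq_itg => t c2t tL; by rewrite cz// mul0r mulr0 add0r.
have E2 : wronskian U Y c2 - wronskian U Y c1 =
    lam * k * (itg c1 c2 (usq Y) - itg c1 c2 (usq U)) + itg c1 c2 (cross_forcing U Y).
  have IX1 : Rintegrable `[c1, c2] (cross_forcing U Y) by exact: RintegrableS IX.
  have ID : Rintegrable `[c1, c2] (fun x => usq Y x - usq U x) by exact: RintegrableB.
  have IZ : Rintegrable `[c1, c2] (fun x => lam * k * (usq Y x - usq U x)) by exact: RintegrableZ.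
  rewrite HA// -itgB// -itgZ// -itgD//; apply: eq_itg_open.
  - exact: RintegrableS IA.
  - exact: RintegrableD.
  - by move=> t t1 t2; rewrite ck// mulrA.
have E3 := itg_split c12' c2L IX.
have E : lam * k * (itg c1 c2 (usq Y) - itg c1 c2 (usq U)) = - wronskian U Y c1 - itg c1 L (cross_forcing U Y).
  by rewrite E3; move: E1 E2; rewrite (wronskian_end sol) => E1 E2; lra.
rewrite -normrM E; apply: le_trans (ler_normB _ _) _; rewrite normrN; apply: lerD.
  apply: le_trans (wronskian_le U Y c1 eta0) _; rewrite lerD2l; apply: ler_wpM2l; first exact: ltW.
  by apply: le_trans (HB c1 c10 c1L); rewrite /en2 lerDr en_ge0.
have IFU : Rintegrable `[0, L] (forcing U) := hs_forcing_int sU.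
have IFY : Rintegrable `[0, L] (forcing Y) := hs_forcing_int sY.
have ei : 0 < eta^-1 by rewrite invr_gt0.
have s2 : `[c1, L] `<=` `[0, L] by exact: sub_itv.
have IF : Rintegrable `[c1, L] (fun x => eta^-1 * (forcing U x + forcing Y x)).
  by apply: RintegrableZ => //; apply: RintegrableD => //; [exact: RintegrableS IFU|exact: RintegrableS IFY].
have IG : Rintegrable `[c1, L] (fun x => eta^-1 * (forcing U x + forcing Y x) + eta * B).
  by apply: RintegrableD => //; exact: Rintegrable_cst.
apply: le_trans (le_normr_Rintegral _ _) _ => //; rewrite -/(itg c1 L _).
apply: (@le_trans _ _ (itg c1 L (fun x => eta^-1 * (forcing U x + forcing Y x) + eta * B))).
  apply: itg_le => //; first exact: Rintegrable_norm.
  move=> t c1t tL; apply: le_trans (cross_forcing_le U Y t eta0) _; rewrite mulrC lerD2l.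
  by apply: ler_wpM2l; [exact: ltW|apply: HB => //; exact: le_trans c1t].
rewrite itgD//; last exact: Rintegrable_cst.
rewrite itg_cst// mulrC; apply: lerD; last first.
  by apply: ler_wpM2r; [nneg|rewrite gerBl].
rewrite itgZ; last by apply: RintegrableD => //; [exact: RintegrableS IFU|exact: RintegrableS IFY].
rewrite [leRHS]mulrC; apply: ler_wpM2l; first exact: ltW.
rewrite itgD; [|exact: RintegrableS IFU|exact: RintegrableS IFY].
have h1 := itgS c10 c1L (lexx L) IFU (forcing_ge0 U); have h2 := itgS c10 c1L (lexx L) IFY (forcing_ge0 Y).
have := hs_forcing sU; have := hs_forcing sY; lra.
Qed.

Lemma le_add4 (p q r s : R) : 0 <= p -> 0 <= q -> 0 <= r -> 0 <= s ->
  [/\ p <= p + q + (r + s), q + r <= p + q + (r + s) & s <= p + q + (r + s)].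
Proof. by move=> *; split; lra. Qed.

(** [Q] measures by how much |u|^2 and |y|^2 differ in mean. Exchanging y for u at this price makes
    the Rellich estimate of U self-contained when c0 l < 1, and so controls u, s and y. The flux of
    Y, for which no multiplier is at hand, comes from the Caccioppoli inequality at a point of the
    middle half. *)
Lemma point_of_balance C1 : 0 <= C1 -> c0 * l < 1 -> exists2 K, 0 <= K & forall S U Y Q,
  coupled_solution L 1 lam b c d S U Y -> en U c1 <= C1 * S -> 0 <= Q ->
  lam ^+ 2 * `|itg c1 c2 (usq Y) - itg c1 c2 (usq U)| <= Q ->
  exists2 x, 0 <= x /\ x <= L & en2 U Y x <= K * (S + Q).
Proof.
move=> C10 ka1; pose del := (1 - c0 * l) / 2.
have del0 : 0 < del by rewrite divr_gt0// subr_gt0.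
have c00 : 0 <= c0 by apply: le_trans (c_le 0).
pose M := l * (1^-1 + lam ^+ 2) * C1 + l ^+ 2 / (1 * del).
have i0 : 0 < (1 * del)^-1 by rewrite mul1r invr_gt0.
have i1 : 0 < (1 : R)^-1 by rewrite invr_gt0.
have M0 : 0 <= M by rewrite /M; nneg.
have Cc0 : 0 <= Cc 1 lam c0 l by rewrite /Cc; nneg.
pose M1 := (M + 1) / del.
have M10 : 0 <= M1 by rewrite /M1; nneg.
pose K1 := 2 * M1 + 1 + 2 * (Cc 1 lam c0 l * ((1 + 2 / lam ^+ 2) * (M1 + 1))).
have K10 : 0 <= K1 by rewrite /K1; nneg.
have bz' x : c1 <= x -> x <= c2 -> b x = 0 by move=> H1 H2; apply: bz => //; exact: le_trans c2L.
have dz' x : c1 <= x -> x <= c2 -> d x = 0 by move=> H1 H2; apply: dz => //; exact: le_trans c2L.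
have l4 : 0 < l ^+ 4 by rewrite exprn_gt0.
exists ((1 + 1 / lam ^+ 2 + 256 / l ^+ 4) * (K1 / (l / 2))).
  by nneg; rewrite ?exprn_ge0 ?ltW.
move=> S U Y Q sol HU Q0 HQ; have S0 := coupled_S_ge0 sol; have [sU sY] := sol.
have cuU := continuous_usq sU c10 c12' c2L; have cuY := continuous_usq sY c10 c12' c2L.
have csU := continuous_ssq sU c10 c12' c2L; have csY := continuous_ssq sY c10 c12' c2L.
have E1 := coupled_rellich_U ltr01 c_le c10 c12 c2L bz' sol del0.
have [W1 V1 W2 V2] := coupled_itg_ge0 ltr01 c1 c2 sol.
rewrite sqrtr1 divr1 -/l in E1.
have EVu : itg c1 c2 (fun x => lam ^+ 2 * usq U x) = lam ^+ 2 * itg c1 c2 (usq U).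
  by apply: itgZ; exact: Rintegrable_continuous.
have EVy : itg c1 c2 (fun x => lam ^+ 2 * usq Y x) = lam ^+ 2 * itg c1 c2 (usq Y).
  by apply: itgZ; exact: Rintegrable_continuous.
have c_le' x : `|- c x| <= c0 by rewrite normrN.
have G := caccioppoli ltr01 c_le' sY c10 c12 c2L dz' cuU; rewrite -/l in G.
have cb : {within `[c1, c2], continuous (fun x => bump c1 c2 x ^+ 2)} by exact: continuous_bump2.
pose f x := 1^-1 * ssq U x + lam ^+ 2 * usq U x + (lam ^+ 2 * usq Y x + bump c1 c2 x ^+ 2 * ssq Y x).
have cg : {within `[c1, c2], continuous (fun x => bump c1 c2 x ^+ 2 * ssq Y x)}.
  exact: within_continuousM.
have cf : {within `[c1, c2], continuous f}.
  by apply: within_continuous_add; apply: within_continuous_add => //; exact: within_continuous_scale.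
have f0 x : 0 <= f x by rewrite /f; nneg.
have If : itg c1 c2 f = itg c1 c2 (fun x => 1^-1 * ssq U x) + itg c1 c2 (fun x => lam ^+ 2 * usq U x) +
    (itg c1 c2 (fun x => lam ^+ 2 * usq Y x) + itg c1 c2 (fun x => bump c1 c2 x ^+ 2 * ssq Y x)).
  have I1 : Rintegrable `[c1, c2] (fun x => 1^-1 * ssq U x) by apply: RintegrableZ => //; exact: Rintegrable_continuous.
  have I2 : Rintegrable `[c1, c2] (fun x => lam ^+ 2 * usq U x) by apply: RintegrableZ => //; exact: Rintegrable_continuous.
  have I3 : Rintegrable `[c1, c2] (fun x => bump c1 c2 x ^+ 2 * ssq Y x) by exact: Rintegrable_continuous.
  have I4 : Rintegrable `[c1, c2] (fun x => lam ^+ 2 * usq Y x) by apply: RintegrableZ => //; exact: Rintegrable_continuous.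
  by rewrite itgD; [rewrite itgD// itgD|exact: RintegrableD|exact: RintegrableD].
have HA : itg c1 c2 f <= K1 * (S + Q).
  rewrite If; move: G E1 W1 V1 V2; rewrite EVu EVy.
  set uY := itg _ _ (usq Y); set uU := itg _ _ (usq U).
  set Wu := itg _ _ (fun x => 1^-1 * ssq U x); set G := itg _ _ (fun x => bump c1 c2 x ^+ 2 * ssq Y x).
  move=> HG E1 W1 V1 V2.
  have HVy : lam ^+ 2 * uY <= lam ^+ 2 * uU + Q.
    rewrite -lerBlDl; apply: le_trans HQ; rewrite -mulrBr; apply: ler_wpM2l; [exact: ltW|exact: ler_norm].
  have HP : Wu + lam ^+ 2 * uU <= M1 * (S + Q).
    rewrite /M1 [leRHS]mulrAC ler_pdivlMr//.
    have h1 : l * (1^-1 + lam ^+ 2) * en U c1 <= l * (1^-1 + lam ^+ 2) * (C1 * S) by apply: ler_wpM2l => //; nneg.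
    have h2 : M * S = l * (1^-1 + lam ^+ 2) * (C1 * S) + l ^+ 2 / (1 * del) * S.
      by rewrite /M [LHS]mulrDl; congr (_ + _); rewrite -[LHS]mulrA.
    have h3 := le_trans E1 (lerD h1 (lexx _)); rewrite -h2 in h3.
    have h4 : c0 * l * (lam ^+ 2 * uY) <= c0 * l * (lam ^+ 2 * uU + Q) by apply: ler_wpM2l => //; nneg.
    have h5 : c0 * l * Q <= Q by rewrite ler_piMl// ltW.
    have h6 : 0 <= M * Q by exact: mulr_ge0.
    have h7 : 1 - c0 * l = 2 * del by rewrite /del; field.
    have h8 : 1 - c0 * l - del = del by rewrite h7; ring.
    rewrite h8 in h3.
    have h9 : 0 <= del * (lam ^+ 2 * uU) := mulr_ge0 (ltW del0) V1.
    have h10 : (1 - c0 * l) * (lam ^+ 2 * uU) = 2 * (del * (lam ^+ 2 * uU)) by rewrite h7 mulrA.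
    lra.
  have HuU : uU <= 1 / lam ^+ 2 * (M1 * (S + Q)).
    by rewrite [leRHS]mulrAC ler_pdivlMr// mul1r mulrC; apply: le_trans HP; rewrite lerDr.
  have HuY : uY <= 1 / lam ^+ 2 * ((M1 + 1) * (S + Q)).
    rewrite [leRHS]mulrAC ler_pdivlMr// mul1r mulrC; apply: le_trans HVy _.
    rewrite mulrDl mul1r; apply: lerD; last by rewrite lerDr.
    by apply: le_trans HP; rewrite lerDr.
  have H3 : uY + uU + S <= (1 + 2 / lam ^+ 2) * ((M1 + 1) * (S + Q)).
    have t1 : 0 <= 1 / lam ^+ 2 * (S + Q) by nneg.
    have t2 : 0 <= M1 * (S + Q) by nneg.
    lra.
  have H4 : Cc 1 lam c0 l * (uY + uU + S) <= Cc 1 lam c0 l * ((1 + 2 / lam ^+ 2) * ((M1 + 1) * (S + Q))).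
    exact: ler_wpM2l.
  have EK : K1 * (S + Q) = 2 * (M1 * (S + Q)) + (S + Q) +
     2 * (Cc 1 lam c0 l * ((1 + 2 / lam ^+ 2) * ((M1 + 1) * (S + Q)))).
    by rewrite /K1; ring.
  rewrite EK; lra.
have [x [c1x xc2] [fx bx]] := pick_middle c12 cf f0 HA.
exists x; first by split; [exact: le_trans c1x|exact: le_trans c2L].
have u0 := usq_ge0 U x; have s0 := ssq_ge0 U x; have v0 := usq_ge0 Y x; have t0 := ssq_ge0 Y x.
have k2 : 0 <= lam ^+ 2 * usq U x by nneg.
have k3 : 0 <= lam ^+ 2 * usq Y x by nneg.
have k4 : 0 <= bump c1 c2 x ^+ 2 * ssq Y x by nneg.
have f1 : 1^-1 * ssq U x = ssq U x by rewrite invr1 mul1r.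
have [a1 a2' a3'] := le_add4 s0 k2 k3 k4; rewrite -f1 -/(f x) f1 in a1 a2' a3'.
have a2 : usq U x + usq Y x <= 1 / lam ^+ 2 * f x.
  by rewrite [leRHS]mulrAC ler_pdivlMr// mul1r mulrC mulrDr.
have a3 : ssq Y x <= 256 / l ^+ 4 * f x.
  rewrite [leRHS]mulrAC ler_pdivlMr//.
  have h : ssq Y x * (l ^+ 4 / 256) <= ssq Y x * bump c1 c2 x ^+ 2 by exact: ler_wpM2l.
  rewrite (_ : ssq Y x * l ^+ 4 = 256 * (ssq Y x * (l ^+ 4 / 256))); last by field.
  by apply: ler_wpM2l => //; apply: le_trans h _; rewrite mulrC.
have a4 : en2 U Y x <= (1 + 1 / lam ^+ 2 + 256 / l ^+ 4) * f x.
  rewrite [leRHS]mulrDl [X in _ <= X + _]mulrDl mul1r; apply: le_trans (lerD (lerD a1 a2) a3).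
  by rewrite /en2 /en le_eqVlt; apply/orP; left; apply/eqP; ring.
apply: le_trans a4 _; rewrite -[leRHS]mulrA; apply: ler_wpM2l.
  by nneg; rewrite ?exprn_ge0 ?ltW.
by apply: le_trans fx _; rewrite -/l [leRHS]mulrAC.
Qed.

(** Let B be the maximum of the energy over [0, L]. The balance, the point it provides and the joint
    Gronwall inequality bound B by a multiple of S plus W eta B. *)
Lemma stable_undamped_end b0 d0 : (forall x, 0 <= b x) -> (forall x, b x <= b0) ->
  (forall x, 0 <= d x) -> (forall x, d x <= d0) -> c0 * l < 1 ->
  (exists2 C, 0 <= C & forall S U Y, coupled_solution L 1 lam b c d S U Y -> en U c1 <= C * S) ->
  stable_est L 1 lam b c d.
Proof.
move=> b_ge0 b_le d_ge0 d_le ka1 [C1 C10 H1].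
have [K K0 HK] := point_of_balance C10 ka1.
set J := joint_const L 1 lam b0 c0 d0.
have J0 : 0 <= J by apply: joint_const_ge0.
pose h := lam ^+ 2 / `|lam * k|.
have lk0 : 0 < `|lam * k| by rewrite normr_gt0 mulf_neq0.
have h0 : 0 < h by rewrite divr_gt0.
pose W := J * (K * (h * (1 + L))).
have W0 : 0 <= W by rewrite /W; nneg.
(* Small enough for W eta <= 1 / 2, so that half of B can be absorbed; W does not depend on eta. *)
pose eta := (2 * (W + 1))^-1.
have eta0 : 0 < eta by rewrite invr_gt0 mulr_gt0// ltr_wpDl.
have Weta : W * eta <= 1 / 2.
  by rewrite /eta ler_pdivrMr ?mulr_gt0 ?ltr_wpDl//; lra.
pose D := J * (K * (1 + h * ((C1 + 2) / eta)) + 1).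
have ei : 0 < eta^-1 by rewrite invr_gt0.
have D0 : 0 <= D by rewrite /D; nneg.
exists (2 * D); first by nneg.
move=> S U Y sol x x0 xL; have S0 := coupled_S_ge0 sol; have [sU sY] := sol.
have cen : {within `[0, L], continuous (en2 U Y)}.
  by apply: within_continuous_add; apply: within_continuous_add;
    by [exact: (continuous_usq sU (lexx 0) (ltW L0) (lexx L))|exact: (continuous_ssq sU (lexx 0) (ltW L0) (lexx L))
       |exact: (continuous_usq sY (lexx 0) (ltW L0) (lexx L))|exact: (continuous_ssq sY (lexx 0) (ltW L0) (lexx L))].
have [m + Hm] := EVT_max (ltW L0) cen; rewrite in_itv/= => /andP[m0 mL].
set B := en2 U Y m in Hm.
have HB t : 0 <= t -> t <= L -> en2 U Y t <= B by move=> t0 tL; apply: Hm; rewrite in_itv/= t0 tL.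
have B0 : 0 <= B by exact: en2_ge0.
pose Q := h * ((C1 + 2) / eta * S + (1 + L) * (eta * B)).
have Q0 : 0 <= Q by rewrite /Q; nneg.
have HQ : lam ^+ 2 * `|itg c1 c2 (usq Y) - itg c1 c2 (usq U)| <= Q.
  rewrite (_ : lam ^+ 2 = h * `|lam * k|); last by rewrite /h divfK// gt_eqF.
  rewrite -mulrA; apply: ler_wpM2l; first exact: ltW.
  apply: le_trans (coupling_balance sol eta0 HB) _.
  have := ler_wpM2r (ltW ei) (H1 _ _ _ sol); lra.
have [y [y0 yL] Hy] := HK S U Y Q sol (H1 _ _ _ sol) Q0 HQ.
have HJ := joint_gronwall L0 ltr01 b_ge0 b_le d_ge0 d_le c_le sol y0 yL m0 mL.
rewrite -/J -/B in HJ.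
have HJ2 : J * (en2 U Y y + S) <= J * (K * (S + Q) + S) by apply: ler_wpM2l => //; rewrite lerD2r.
have EJ : J * (K * (S + Q) + S) = D * S + W * eta * B by rewrite /D /W /Q; ring.
have HW : W * eta * B <= 1 / 2 * B by exact: ler_wpM2r.
apply: le_trans (HB x x0 xL) _; lra.
Qed.

End UndampedEnd.

(** * L^2 bounds at every frequency, zero included *)

Section FrequencyBound.
Context {R : realType}.
Implicit Types (U Y : @half R).

(** The integral of the derivative of x u^2 vanishes, its boundary term at 0 being killed by the
    factor x. Pointwise, u^2 + 2 x u g >= u^2 / 2 - 2 L^2 g^2. *)
Lemma poincare (L : R) (u g : R -> R) : 0 < L -> AC 0 L u g -> u L = 0 ->
  Rintegrable `[0, L] (fun x => g x ^+ 2) ->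
  itg 0 L (fun x => u x ^+ 2) <= 4 * L ^+ 2 * itg 0 L (fun x => g x ^+ 2).
Proof.
move=> L0 A uL Ig; have L0' := ltW L0.
have [Id Hd] := AC_mul L0' (AC_id 0 L) (AC_mul L0' A A).
have cu := AC_within_continuous L0' A.
have Iu : Rintegrable `[0, L] (fun x => u x ^+ 2) by apply: Rintegrable_continuous; exact: within_continuousM.
have := Hd 0 L (lexx _) L0' (lexx _); rewrite uL /= !mulr0 !mul0r subrr => E.
have I1 : Rintegrable `[0, L] (fun x => 1 / 2 * u x ^+ 2) by exact: RintegrableZ.
have I2 : Rintegrable `[0, L] (fun x => 2 * L ^+ 2 * g x ^+ 2) by exact: RintegrableZ.
have : itg 0 L (fun x => 1 / 2 * u x ^+ 2 - 2 * L ^+ 2 * g x ^+ 2) <= 0.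
  rewrite [leRHS]E; apply: itg_le => //; first exact: RintegrableB.
  move=> t t0 tL.
  have h : (t * g t) ^+ 2 <= L ^+ 2 * g t ^+ 2.
    by rewrite exprMn; apply: ler_wpM2r; [exact: sqr_ge0|rewrite lerXn2r ?nnegrE].
  have := sqr_ge0 (u t + 2 * (t * g t)); lra.
by rewrite itgB// !itgZ//; lra.
Qed.

Section Half.
Variables (L a lam b0 S : R) (b c : R -> R) (U Y : @half R).
Hypotheses (L0 : 0 < L) (a0 : 0 < a).
Hypotheses (b_ge0 : forall x, 0 <= b x) (b_le : forall x, b x <= b0).
Hypothesis sol : half_solution L a lam b c S U Y.
Let L0' := ltW L0.

Lemma Rintegrable_usq : Rintegrable `[0, L] (usq U).
Proof. by apply: Rintegrable_continuous; exact: (continuous_usq sol (lexx 0) L0' (lexx L)). Qed.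

Lemma Rintegrable_ssq : Rintegrable `[0, L] (ssq U).
Proof. by apply: Rintegrable_continuous; exact: (continuous_ssq sol (lexx 0) L0' (lexx L)). Qed.

Lemma Rintegrable_g1g2 : Rintegrable `[0, L] (fun x => hg1 U x ^+ 2) /\ Rintegrable `[0, L] (fun x => hg2 U x ^+ 2).
Proof.
have [I1 _] := hs_u1 sol; have [I2 _] := hs_u2 sol.
have D (g : R -> R) : Rintegrable `[0, L] g -> (forall x, g x ^+ 2 <= gsq U x) -> Rintegrable `[0, L] (fun x => g x ^+ 2).
  move=> Ig Hg; apply: (@Rintegrable_dom R _ _ (fun x => 2 / a ^+ 2 * (ssq U x + b0 ^+ 2 * forcing U x))) => //.
  - by apply: measurable_funX; exact: Rintegrable_meas.
  - move=> x /=; rewrite in_itv/= => /andP[x0 xL]; rewrite ger0_norm ?sqr_ge0//.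
    by apply: le_trans (Hg x) _; exact: gsq_le a0 b_ge0 b_le sol _ x0 xL.
  - apply: RintegrableZ => //; apply: RintegrableD => //; first exact: Rintegrable_ssq.
    by apply: RintegrableZ => //; exact: hs_forcing_int sol.
split; apply: D => // x; rewrite /gsq; [rewrite lerDl|rewrite lerDr]; exact: sqr_ge0.
Qed.

Lemma Rintegrable_gsq : Rintegrable `[0, L] (gsq U).
Proof. by have [I1 I2] := Rintegrable_g1g2; exact: RintegrableD. Qed.

Lemma S_ge0 : 0 <= S.
Proof. by apply: le_trans (hs_forcing sol); apply: itg_ge0 => x _ _; exact: forcing_ge0. Qed.

Lemma itg_gsq_le (M : R) : (forall x, 0 <= x -> x <= L -> ssq U x <= M) ->
  itg 0 L (gsq U) <= 2 / a ^+ 2 * (M * L + b0 ^+ 2 * S).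
Proof.
move=> HM; have IF := hs_forcing_int sol.
have k0 : 0 <= 2 / a ^+ 2 by nneg.
have I1 : Rintegrable `[0, L] (fun x => b0 ^+ 2 * forcing U x) by exact: RintegrableZ.
have I2 : Rintegrable `[0, L] (fun x => M + b0 ^+ 2 * forcing U x) by apply: RintegrableD => //; exact: Rintegrable_cst.
apply: (@le_trans _ _ (itg 0 L (fun x => 2 / a ^+ 2 * (M + b0 ^+ 2 * forcing U x)))).
  apply: itg_le; [exact: Rintegrable_gsq|exact: RintegrableZ|] => t t0 tL.
  apply: le_trans (gsq_le a0 b_ge0 b_le sol t0 tL) _; apply: ler_wpM2l => //.
  by rewrite lerD2r HM.
rewrite itgZ//; apply: ler_wpM2l => //; rewrite itgD//; last exact: Rintegrable_cst.
rewrite itg_cst// subr0 itgZ// lerD2l; apply: ler_wpM2l; [exact: sqr_ge0|exact: hs_forcing sol].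
Qed.

Lemma itg_usq_le (M : R) : (forall x, 0 <= x -> x <= L -> usq U x <= M) -> itg 0 L (usq U) <= M * L.
Proof.
move=> HM; rewrite -[L in _ * L](subr0 L) -itg_cst//; apply: itg_le => //; first exact: Rintegrable_usq.
exact: Rintegrable_cst.
Qed.

Lemma poincare_half : itg 0 L (usq U) <= 4 * L ^+ 2 * itg 0 L (gsq U).
Proof.
have [I1 I2] := Rintegrable_g1g2.
have c1 := AC_within_continuous L0' (hs_u1 sol); have c2 := AC_within_continuous L0' (hs_u2 sol).
rewrite /usq /gsq !itgD//; try by apply: Rintegrable_continuous; exact: within_continuousM.
have := poincare L0 (hs_u1 sol) (hs_right1 sol) I1; have := poincare L0 (hs_u2 sol) (hs_right2 sol) I2; lra.
Qed.

(* At frequency zero the two halves decouple and [s ubar] is the multiplier. *)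
Lemma static_bound : lam = 0 ->
  itg 0 L (gsq U) <= 4 / a * ((b0 ^+ 2 / (2 * a) + 4 * L ^+ 2 / a) * S).
Proof.
move=> lam0; have S0 := S_ge0.
have [Id Hd] := AC_add (AC_mul L0' (hs_s1 sol) (hs_u1 sol)) (AC_mul L0' (hs_s2 sol) (hs_u2 sol)).
have := Hd 0 L (lexx _) L0' (lexx _).
rewrite (hs_left1 sol) (hs_left2 sol) (hs_right1 sol) (hs_right2 sol) !mulr0 addr0 subrr => E.
have IF := hs_forcing_int sol; have Ig := Rintegrable_gsq; have Iu := Rintegrable_usq.
pose k := b0 ^+ 2 / (2 * a) + 4 * L ^+ 2 / a.
(* With this weight Poincare's inequality turns the integral of h |u|^2 into at most a / 4 times
   that of |g|^2, half of the a / 2 that Young's inequality has left. *)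
pose h := a / (16 * L ^+ 2).
have J1 : Rintegrable `[0, L] (fun x => a / 2 * gsq U x) by exact: RintegrableZ.
have J2 : Rintegrable `[0, L] (fun x => h * usq U x) by exact: RintegrableZ.
have J3 : Rintegrable `[0, L] (fun x => k * forcing U x) by exact: RintegrableZ.
have J4 : Rintegrable `[0, L] (fun x => a / 2 * gsq U x - h * usq U x) by exact: RintegrableB.
have h0 : 0 < h by rewrite divr_gt0// mulr_gt0// exprn_gt0.
have ai : 0 < a^-1 by rewrite invr_gt0.
have : itg 0 L (fun x => a / 2 * gsq U x - h * usq U x - k * forcing U x) <= 0.
  rewrite [leRHS]E; apply: itg_le => //; first exact: RintegrableB.
  move=> t t0 tL; rewrite (hs_rel1 sol t0 tL) (hs_rel2 sol t0 tL) /vx1 /vx2 lam0.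
  have bb : b t ^+ 2 <= b0 ^+ 2 by rewrite lerXn2r ?nnegrE// (le_trans (b_ge0 t)).
  have B1 (p q : R) : b t * (p * q) <= a / 2 * q ^+ 2 + b0 ^+ 2 / (2 * a) * p ^+ 2.
    have h1 : b t ^+ 2 * p ^+ 2 <= b0 ^+ 2 * p ^+ 2 by apply: ler_wpM2r => //; exact: sqr_ge0.
    have h2 := sqr_ge0 (a * q - b t * p).
    rewrite -(ler_pM2r (_ : 0 < 2 * a)); last by rewrite mulr_gt0.
    rewrite (_ : (a / 2 * q ^+ 2 + b0 ^+ 2 / (2 * a) * p ^+ 2) * (2 * a) = a ^+ 2 * q ^+ 2 + b0 ^+ 2 * p ^+ 2); last by field; rewrite gt_eqF.
    lra.
  have B2 (r u : R) : r * u <= h * u ^+ 2 + 4 * L ^+ 2 / a * r ^+ 2.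
    have h2 := sqr_ge0 (a * u - 8 * L ^+ 2 * r).
    rewrite -(ler_pM2r (_ : 0 < 16 * L ^+ 2 * a)); last by rewrite !mulr_gt0// exprn_gt0.
    rewrite (_ : (h * u ^+ 2 + 4 * L ^+ 2 / a * r ^+ 2) * (16 * L ^+ 2 * a) = a ^+ 2 * u ^+ 2 + 64 * L ^+ 4 * r ^+ 2); last by rewrite /h; field; rewrite !gt_eqF.
    lra.
  have := B1 (hp1 U t) (hg1 U t); have := B1 (hp2 U t) (hg2 U t).
  have := B2 (hr1 U t) (hu1 U t); have := B2 (hr2 U t) (hu2 U t).
  have P1 (x : R) : 0 <= 4 * L ^+ 2 / a * x ^+ 2 by nneg.
  have P2 (x : R) : 0 <= b0 ^+ 2 / (2 * a) * x ^+ 2 by rewrite invfM; nneg.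
  have := P1 (hp1 U t); have := P1 (hp2 U t); have := P2 (hr1 U t); have := P2 (hr2 U t).
  rewrite /k /usq /gsq /forcing.
  move: (4 * L ^+ 2 / a) (b0 ^+ 2 / (2 * a)) => k1 k2; lra.
rewrite itgB// itgB// !itgZ// => E2.
have HP : h * itg 0 L (usq U) <= a / 4 * itg 0 L (gsq U).
  rewrite (_ : a / 4 = h * (4 * L ^+ 2)); last by rewrite /h; field; rewrite gt_eqF.
  by rewrite -mulrA; apply: ler_wpM2l; [exact: ltW|exact: poincare_half].
have k0 : 0 <= k by rewrite /k invfM; nneg.
have HF : k * itg 0 L (forcing U) <= k * S by apply: ler_wpM2l => //; exact: hs_forcing sol.
rewrite -/k [leRHS]mulrAC ler_pdivlMr//; lra.
Qed.

End Half.

Section Both.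
Variables (L a lam b0 c0 d0 : R) (b c d : R -> R).
Hypotheses (L0 : 0 < L) (a0 : 0 < a).
Hypotheses (b_ge0 : forall x, 0 <= b x) (b_le : forall x, b x <= b0).
Hypotheses (d_ge0 : forall x, 0 <= d x) (d_le : forall x, d x <= d0).

Definition L2_stable := exists2 C, 0 <= C & forall S U Y, coupled_solution L a lam b c d S U Y ->
  itg 0 L (usq U) + itg 0 L (gsq U) + (itg 0 L (usq Y) + itg 0 L (gsq Y)) <= C * S.

Lemma L2_stable_of_stable_est : stable_est L a lam b c d -> L2_stable.
Proof.
move=> [C C0 HC].
exists (C * L + 2 / a ^+ 2 * (C * L + b0 ^+ 2) + (C * L + 2 / 1 ^+ 2 * (C * L + d0 ^+ 2))).
  by rewrite expr1n invr1; nneg.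
move=> S U Y sol; have [sU sY] := sol.
have H x : 0 <= x -> x <= L -> [/\ usq U x <= C * S, ssq U x <= C * S, usq Y x <= C * S & ssq Y x <= C * S].
  move=> x0 xL; have := HC S U Y sol x x0 xL; rewrite /en2 /en.
  have := usq_ge0 U x; have := ssq_ge0 U x; have := usq_ge0 Y x; have := ssq_ge0 Y x.
  by split; lra.
have h1 := itg_usq_le L0 sU (fun x x0 xL => let: And4 h _ _ _ := H x x0 xL in h).
have h2 := itg_gsq_le L0 a0 b_ge0 b_le sU (fun x x0 xL => let: And4 _ h _ _ := H x x0 xL in h).
have h3 := itg_usq_le L0 sY (fun x x0 xL => let: And4 _ _ h _ := H x x0 xL in h).
have h4 := itg_gsq_le L0 ltr01 d_ge0 d_le sY (fun x x0 xL => let: And4 _ _ _ h := H x x0 xL in h).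
apply: le_trans (lerD (lerD h1 h2) (lerD h3 h4)) _.
by rewrite le_eqVlt; apply/orP; left; apply/eqP; ring.
Qed.

Lemma L2_stable_static : lam = 0 -> L2_stable.
Proof.
move=> lam0; pose K (e f : R) := 4 / e * (f ^+ 2 / (2 * e) + 4 * L ^+ 2 / e).
have K0 (e f : R) : 0 < e -> 0 <= K e f by move=> e0; rewrite /K invfM; nneg.
exists ((4 * L ^+ 2 + 1) * (K a b0 + K 1 d0)).
  by have k1 := K0 _ b0 a0; have k2 := K0 _ d0 ltr01; apply: mulr_ge0; [nneg|exact: addr_ge0].
move=> S U Y [sU sY].
have h1 := poincare_half L0 a0 b_ge0 b_le sU; have h2 := poincare_half L0 ltr01 d_ge0 d_le sY.
have g1 := static_bound L0 a0 b_ge0 b_le sU lam0; have g2 := static_bound L0 ltr01 d_ge0 d_le sY lam0.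
rewrite [leRHS]mulrA -/(K _ _) in g1; rewrite [leRHS]mulrA -/(K _ _) in g2.
have L2 : 0 <= 4 * L ^+ 2 + 1 by nneg.
have := ler_wpM2l L2 (lerD g1 g2); move: h1 h2; lra.
Qed.

End Both.

End FrequencyBound.

(** * The three configurations of the coefficients *)

Section Cases.
Context {R : realType}.
Variables (L a b0 c0 d0 b1 b2 c1 c2 d1 d2 : R) (b c d : R -> R).
Hypotheses (L0 : 0 < L) (a0 : 0 < a) (b00 : 0 < b0) (c00 : c0 != 0) (d00 : 0 < d0).

(** The estimates on damped intervals ask for a constant coefficient up to the endpoints, but a step
    vanishes at its own ends; a middle third is used instead. *)
Lemma step_interior (k al be : R) : al < be -> exists x y, [/\ al < x, x < y, y < be &
  forall t, x <= t -> t <= y -> step k al be t = k].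
Proof.
move=> albe; exists (al + (be - al) / 3), (be - (be - al) / 3).
split; [lra|lra|lra|move=> t xt ty; apply: step_in; lra].
Qed.

Lemma measurable_step (k al be : R) : measurable_fun [set: R] (step k al be).
Proof. by apply: measurable_funM => //; exact: measurable_indic. Qed.

Definition admissible_coefs := [/\ exists M, forall x, 0 <= b x <= M, exists M, forall x, `|c x| <= M &
  exists M, forall x, 0 <= d x <= M] /\
  [/\ measurable_fun [set: R] b, measurable_fun [set: R] c & measurable_fun [set: R] d].

Definition all_cases := [\/ SSC1 L a b c d b0 c0 d0 b1 b2 c1 c2 d1 d2,
  caseC2 L b c d b0 c0 d0 b1 b2 c1 c2 d1 d2 | SSC3 L a b c d b0 c0 b1 b2 c1 c2].

Lemma admissible_coefs_of_cases : all_cases -> admissible_coefs.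
Proof.
have P (k al be : R) : 0 < k -> exists M, forall x, 0 <= step k al be x <= M.
  by move=> k0; exists k => x; rewrite step_ge0 ?step_le ?ltW.
have Q (k al be : R) : exists M, forall x, `|step k al be x| <= M.
  by exists `|k| => x; exact: step_norm.
rewrite /admissible_coefs => -[[[-> -> -> _] _]|[-> -> -> _]|[[-> -> -> _] _ _]].
- by split; split; [exact: P|exact: Q|exact: P|exact: measurable_step|exact: measurable_step|exact: measurable_step].
- by split; split; [exact: P|exact: Q|exact: P|exact: measurable_step|exact: measurable_step|exact: measurable_step].
- split; split; [exact: P|exact: Q|by exists 0 => x; rewrite lexx|exact: measurable_step|exact: measurable_step|exact: measurable_cst].
Qed.

Lemma L2_stable_of_cases : all_cases -> forall lam, L2_stable L a lam b c d.
Proof.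
move=> cases lam.
have [[[Mb Hb] [Mc Hc] [Md Hd]] [mb mc md]] := admissible_coefs_of_cases cases.
have b_ge0 x : 0 <= b x by case/andP: (Hb x).
have b_le x : b x <= Mb by case/andP: (Hb x).
have d_ge0 x : 0 <= d x by case/andP: (Hd x).
have d_le x : d x <= Md by case/andP: (Hd x).
have [lam0|l0] := eqVneq lam 0; first exact: (L2_stable_static c L0 a0 b_ge0 b_le d_ge0 d_le lam0).
apply: (L2_stable_of_stable_est L0 a0 b_ge0 b_le d_ge0 d_le).
case: cases => [[[Eb Ec Ed [[q1 q2 q3 q4] [q5 q6 q7]]] small]|[Eb Ec Ed [[q1 q2 q3 q4] [q5 q6 q7]]]|[[Eb Ec Ed [[q1 q2 q3] [q4 q5]]] a1 small]].
- have c_le x : `|c x| <= `|c0| by rewrite Ec step_norm.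
  have [x [y [bx xy yb Hxy]]] := step_interior b0 q2.
  have [x' [y' [dx xy' yd Hxy']]] := step_interior d0 q6.
  have l1 : 0 < c2 - c1 by rewrite subr_gt0.
  move: small; rewrite lt_min !ltr_pdivlMr// => /andP[k1 k2].
  apply: (stable_opposite_ends L0 a0 l0 b_ge0 b_le d_ge0 d_le c_le _ q4) => //.
  + lra.
  + lra.
  + by move=> t t1 t2; rewrite Eb step_right//; lra.
  + by move=> t t1 t2; rewrite Ed step_left//; lra.
  + by rewrite ltr_pdivrMr ?sqrtr_gt0// mul1r.
  + apply: (coupled_U_damped d L0 a0 l0 b_ge0 b_le b00 (lexx 0) (al := x) (be := y) (B := c1)) => //;
      [lra|lra|lra|by rewrite Eb|by move=> t _ t1; rewrite Ec step_left|lra].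
  + apply: (coupled_Y_damped a b L0 l0 d_ge0 d_le d00 (A := c2) (al := x') (be := y') (B := L)) => //;
      [lra|lra|lra|by rewrite Ed|by move=> t t1 _; rewrite Ec step_right|lra].
- have c_le x : `|c x| <= `|c0| by rewrite Ec step_norm.
  have [x [y [bx xy yb Hxy]]] := step_interior b0 q2.
  have [x' [y' [dx xy' yd Hxy']]] := step_interior d0 q4.
  (* Both damped intervals lie to the left of c1 and the coupling vanishes up to there, so c1 serves
     both components. *)
  apply: (stable_damped_both L0 a0 b_ge0 b_le d_ge0 d_le c_le (z := c1)) => //; [lra|lra| |].
  + apply: (coupled_U_damped d L0 a0 l0 b_ge0 b_le b00 (lexx 0) (al := x) (be := y) (B := c1)) => //;
      [lra|lra|lra|by rewrite Eb|by move=> t _ t1; rewrite Ec step_left|lra].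
  + apply: (coupled_Y_damped a b L0 l0 d_ge0 d_le d00 (lexx 0) (al := x') (be := y') (B := c1)) => //;
      [lra|lra|lra|by rewrite Ed|by move=> t _ t1; rewrite Ec step_left|lra].
- have c_le x : `|c x| <= `|c0| by rewrite Ec step_norm.
  have [x [y [bx xy yb Hxy]]] := step_interior b0 q2.
  have l1 : 0 < c2 - c1 by rewrite subr_gt0.
  move: small; rewrite ltr_pdivlMr// => k1.
  rewrite a1; apply: (stable_undamped_end L0 l0 _ q4 _ c00 _ _ c_le _ _ mc b_ge0 b_le d_ge0 d_le) => //.
  + lra.
  + lra.
  + by move=> t t1 t2; rewrite Eb step_right//; lra.
  + by move=> t _ _; rewrite Ed.
  + by move=> t t1 t2; rewrite Ec step_in.
  + by move=> t t1; rewrite Ec step_right.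
  + apply: (coupled_U_damped d L0 ltr01 l0 b_ge0 b_le b00 (lexx 0) (al := x) (be := y) (B := c1)) => //;
      [lra|lra|lra|by rewrite Eb|by move=> t _ t1; rewrite Ec step_left|lra].
Qed.

End Cases.

(** * Weak derivatives on an interval *)

Section AlmostEverywhere.
Context {R : realType}.
Notation mu := (@lebesgue_measure R).
Implicit Types (f g h k : R -> R).

Lemma itg0 (a b : R) : itg a b (fun=> 0) = 0.
Proof. by rewrite /itg /Rintegral integral0. Qed.

Lemma ae_imp (P Q : R -> Prop) : (forall x, P x -> Q x) ->
  {ae mu, forall x, P x} -> {ae mu, forall x, Q x}.
Proof.
by move=> PQ [N [mN N0 HN]]; exists N; split=> // x nQ; apply: HN => Px; apply: nQ; exact: PQ.
Qed.

Lemma ae_imp2 (P Q S : R -> Prop) : (forall x, P x -> Q x -> S x) ->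
  {ae mu, forall x, P x} -> {ae mu, forall x, Q x} -> {ae mu, forall x, S x}.
Proof.
move=> PQS aP aQ; apply: (negligibleS _ (negligibleU aP aQ)) => x nS.
by have [Px|] := pselect (P x); [right=> Qx; apply: nS; exact: PQS|left].
Qed.

(** The function spaces live on the open interval and [AC] on the closed one; the endpoints form a
    null set. *)
Lemma Rintegrable_oc (a b : R) f : Rintegrable `]a, b[ f -> Rintegrable `[a, b] f.
Proof.
move=> /integrableP[mf If].
have [ba|ab] := ltP b a.
  rewrite set_itv_ge ?bnd_simp -?ltNge//; exact: integrable_set0.
move: ab; rewrite le_eqVlt => /predU1P[<-|ab].
  rewrite set_itv1; apply/integrableP; split; first exact: measurable_fun_set1.
  by rewrite integral_set1.
have mc : measurable_fun `[a, b] (EFin \o f).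
  rewrite -(@setUitv1 _ _ (BLeft a) b true) ?bnd_simp//; last exact: ltW.
  apply/measurable_funU => //; split; last exact: measurable_fun_set1.
  rewrite -(@setU1itv _ _ (BLeft b) a false) ?bnd_simp//.
  by apply/measurable_funU => //; split=> //; exact: measurable_fun_set1.
apply/integrableP; split=> //.
rewrite (@integral_itv_bndoo _ a b _ true false)//.
by apply: measurableT_comp => //; exact: mf.
Qed.

Lemma itg_oo (a b : R) f : Rintegrable `]a, b[ f -> itg a b f = \int[mu]_(t in `]a, b[) f t.
Proof.
move=> If; have [ba|ab] := ltP b a.
  by rewrite /itg set_itv_ge ?bnd_simp -?ltNge// [in RHS]set_itv_ge// bnd_simp -leNgt ltW.
move: ab; rewrite le_eqVlt => /predU1P[<-|ab].
  by rewrite itg1 set_itv_ge ?Rintegral_set0// bnd_simp -leNgt.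
rewrite /itg -Rintegral_itv_bndo_bndc; last first.
  by apply: RintegrableS (Rintegrable_oc If) => //; apply: subset_itvl; rewrite bnd_simp.
by rewrite -Rintegral_itv_obnd_cbnd.
Qed.

Lemma ae_Rintegral (D : set R) f g : measurable D -> measurable_fun D f -> measurable_fun D g ->
  {ae mu, forall x, D x -> f x = g x} -> \int[mu]_(x in D) f x = \int[mu]_(x in D) g x.
Proof.
move=> mD mf mg fg; rewrite /Rintegral; congr fine; apply: ae_eq_integral => //.
- exact/measurable_EFinP.
- exact/measurable_EFinP.
- by apply: ae_imp fg => x fg Dx; rewrite fg.
Qed.

Lemma ae_itg (L a b : R) f g : 0 <= a -> b <= L -> Rintegrable `[0, L] f -> Rintegrable `[0, L] g ->
  {ae mu, forall x, `]0, L[%classic x -> f x = g x} -> itg a b f = itg a b g.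
Proof.
move=> a0 bL If Ig fg.
have s : `]a, b[ `<=` `[0, L].
  by move=> x; rewrite /= !in_itv/= => /andP[/ltW ax /ltW xb]; rewrite (le_trans a0 ax) (le_trans xb bL).
rewrite !itg_oo; [|by apply: RintegrableS s _|by apply: RintegrableS s _].
apply: ae_Rintegral => //; try by apply: Rintegrable_meas; exact: RintegrableS s _.
apply: ae_imp fg => x fg; rewrite /= in_itv/= => /andP[ax xb]; apply: fg.
by rewrite /= in_itv/= (le_lt_trans a0 ax) (lt_le_trans xb bL).
Qed.

Lemma AC_ae (L : R) F f g : AC 0 L F f -> Rintegrable `[0, L] g ->
  {ae mu, forall x, `]0, L[%classic x -> f x = g x} -> AC 0 L F g.
Proof.
move=> [If HF] Ig fg; split=> // x y x0 xy yL; rewrite HF//.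
exact: (ae_itg x0 yL If Ig fg).
Qed.

Lemma AC_prim (a b : R) f : Rintegrable `[a, b] f -> AC a b (fun x => itg a x f) f.
Proof.
move=> If; split=> // x y ax xy yb.
rewrite (@itg_split _ a y x)//; first by rewrite addrAC subrr add0r.
by apply: RintegrableS If => //; exact: sub_itv.
Qed.

(** By Lebesgue's differentiation theorem k is almost everywhere the derivative of its primitive,
    here identically zero. Extension by zero makes k integrable on the line. *)
Lemma ae_eq0_of_itg (L : R) k : Rintegrable `[0, L] k -> (forall x, 0 < x -> x < L -> itg 0 x k = 0) ->
  {ae mu, forall x, `]0, L[%classic x -> k x = 0}.
Proof.
move=> Ik H0.
have Ik' : mu.-integrable [set: R] (EFin \o k \_ `[0, L]).
  by rewrite -restrict_EFin -integrable_mkcond.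
have lk : locally_integrable [set: R] (k \_ `[0, L]) by apply: integrable_locally.
have := @FTC1 R (k \_ `[0, L]) (BLeft 0) _ lk.
case=> [y|]; first exact: integrableS Ik'.
move=> N [mN N0 HN]; exists N; split=> // x /= /not_implyP[+ kx].
rewrite in_itv/= => /andP[x0 xL]; apply: HN => /=; apply/not_implyP; split; first by rewrite lte_fin.
have kE y : 0 <= y -> y <= L -> (k \_ `[0, L]) y = k y.
  by move=> y0 yL; rewrite patchE mem_set//= in_itv/= y0 yL.
move=> [dF]; rewrite kE ?ltW// => E; apply: kx; rewrite -E derive1E.
rewrite -(@near_eq_derive _ _ _ (cst 0) _ x 1) ?derive_cst//.
near=> y.
have y0 : 0 < y by near: y; exact: lt_nbhsr.
have yL : y < L by near: y; exact: lt_nbhsl.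
apply: etrans (esym (H0 y y0 yL)) _; apply: eq_Rintegral => t; rewrite inE/= in_itv/= => /andP[t0 ty].
by rewrite kE// (le_trans ty (ltW yL)).
Unshelve. all: by end_near.
Qed.

Lemma ae_and (P Q : R -> Prop) : {ae mu, forall x, P x} -> {ae mu, forall x, Q x} ->
  {ae mu, forall x, P x /\ Q x}.
Proof. by apply: ae_imp2. Qed.

(** Real counterpart of a test function, with the compact support expressed by explicit margins at
    both ends. *)
Definition bumpC1 (L : R) (p : R -> R) := C1 p /\
  exists al be, [/\ 0 < al, be < L & forall x, x <= al \/ be <= x -> p x = 0].

Definition weakd (L : R) f g := forall p, bumpC1 L p ->
  itg 0 L (fun x => f x * derive1 p x) = - itg 0 L (fun x => g x * p x).

Lemma AC_bumpC1 (L : R) p : bumpC1 L p -> AC 0 L p (derive1 p).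
Proof.
move=> [[dp cp] _]; apply: AC_C1 => // x; rewrite derive1E.
exact/derivableP/dp.
Qed.

Lemma bumpC1_0 (L : R) p : bumpC1 L p -> p 0 = 0 /\ p L = 0.
Proof.
by move=> [_ [al [be [al0 beL H]]]]; split; apply: H; [left|right]; exact: ltW.
Qed.

Lemma Rintegrable_mul_continuous (a b : R) f p : {within `[a, b], continuous p} ->
  Rintegrable `[a, b] f -> Rintegrable `[a, b] (fun x => f x * p x).
Proof.
move=> cp If; have [M M0 HM] := within_continuous_bounded cp.
have : Rintegrable `[a, b] (fun x => p x * f x).
  apply: (@Rintegrable_bmul _ _ _ _ M) => //; first exact: within_continuous_meas.
  by move=> x; rewrite /= in_itv/= => /andP[]; exact: HM.
by apply: eq_integrable => // x _ /=; rewrite mulrC.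
Qed.

Lemma weakd_AC (L : R) f g : 0 <= L -> AC 0 L f g -> weakd L f g.
Proof.
move=> L0 A p bp; have Ap := AC_bumpC1 bp; have [p0 pL] := bumpC1_0 bp.
have [Id Hd] := AC_mul L0 A Ap.
have := Hd 0 L (lexx _) L0 (lexx _); rewrite p0 pL !mulr0 subrr => E.
have [If _] := A; have [Ip _] := Ap.
have cf := AC_within_continuous L0 A; have cp := AC_within_continuous L0 Ap.
have I1 : Rintegrable `[0, L] (fun x => f x * derive1 p x).
  have := Rintegrable_mul_continuous cf Ip; apply: eq_integrable => // x _ /=; by rewrite mulrC.
have I2 := Rintegrable_mul_continuous cp If.
by move: E; rewrite itgD// => /esym/eqP; rewrite addr_eq0 => /eqP.
Qed.

Section Trapezoid.
Variables (al be del : R).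
Hypotheses (d0 : 0 < del) (ab : al + 2 * del <= be).

(** Continuous approximation of the indicator of [al, be], with slopes of width del. It need not be
    smoother, since test functions are obtained as primitives of combinations of trapezoids. *)
Definition trapezoid x := Num.max 0 (Num.min 1 (Num.min ((x - al) / del) ((be - x) / del))).

Lemma trapezoid_continuous : continuous trapezoid.
Proof.
have cb (c1 c2 : R) : continuous (fun x : R => (c1 + c2 * x) / del).
  by move=> y; apply: cvgM; [apply: cvgD; [exact: cvg_cst|apply: cvgM; [exact: cvg_cst|exact: cvg_id]]|exact: cvg_cst].
have E1 : (fun x => (x - al) / del) = (fun x : R => (- al + 1 * x) / del).
  by apply/funext => y; rewrite mul1r addrC.
have E2 : (fun x => (be - x) / del) = (fun x : R => (be + (-1) * x) / del).
  by apply/funext => y; rewrite mulN1r.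
move=> x; apply: (@continuous_max R R (cst 0) (fun x => Num.min 1 (Num.min ((x - al) / del) ((be - x) / del)))).
  exact: cvg_cst.
apply: (@continuous_min R R (cst 1) (fun x => Num.min ((x - al) / del) ((be - x) / del))); first exact: cvg_cst.
apply: (@continuous_min R R (fun x => (x - al) / del) (fun x => (be - x) / del)).
  by rewrite E1; exact: cb.
by rewrite E2; exact: cb.
Qed.

Lemma trapezoid_range x : 0 <= trapezoid x <= 1.
Proof. by rewrite /trapezoid le_max lexx/= ge_max ler01/= ge_min lexx. Qed.

Lemma trapezoid_out x : x <= al \/ be <= x -> trapezoid x = 0.
Proof.
move=> H; apply/max_idPl; rewrite !ge_min; apply/orP; right.
by case: H => H; apply/orP; [left|right]; rewrite pmulr_lle0 ?invr_gt0// subr_le0.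
Qed.

Lemma trapezoid_in x : al + del <= x -> x <= be - del -> trapezoid x = 1.
Proof.
move=> h1 h2; rewrite /trapezoid; have -> : Num.min 1 (Num.min ((x - al) / del) ((be - x) / del)) = 1.
  by apply/min_idPl; rewrite le_min !ler_pdivlMr// !mul1r; apply/andP; split; lra.
by apply/max_idPr.
Qed.

Lemma trapezoid_itg_gt0 (L : R) : al + 2 * del < be -> 0 < al -> be < L -> 0 < itg 0 L trapezoid.
Proof.
move=> ab' al0 beL; have d0' := d0; have ct : {within `[0, L], continuous trapezoid}.
  exact/continuous_subspaceT/trapezoid_continuous.
have h : al + del <= be - del by lra.
have := @itgS R 0 L (al + del) (be - del) trapezoid.
move=> /(_ _ h _ (Rintegrable_continuous ct)) H.
apply: lt_le_trans (H _ _ _).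
- rewrite (@eq_itg _ _ _ _ (fun=> 1)); last by move=> t; exact: trapezoid_in.
  by rewrite itg_cst// mul1r; lra.
- lra.
- lra.
- by move=> t; case/andP: (trapezoid_range t).
Qed.

(** On [al, be], k and its product with the trapezoid differ only on the two slopes, and there by at
    most |k|. *)
Lemma itg_trapezoid_mul (L : R) k : 0 < al -> be < L -> Rintegrable `[0, L] k ->
  itg 0 L (fun x => k x * trapezoid x) = 0 ->
  `|itg al be k| <= itg al (al + del) (fun x => `|k x|) + itg (be - del) be (fun x => `|k x|).
Proof.
move=> al0 beL Ik E0; have d0' := d0; have ab' := ab.
have s a b : 0 <= a -> b <= L -> `[a, b] `<=` `[0, L] by move=> a0 bL; exact: sub_itv.
have ct a b : {within `[a, b], continuous trapezoid} by exact/continuous_subspaceT/trapezoid_continuous.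
have IT := Rintegrable_mul_continuous (ct 0 L) Ik.
have I1 a b : 0 <= a -> b <= L -> Rintegrable `[a, b] k by move=> a0 bL; apply: RintegrableS Ik => //; exact: s.
have I2 a b : 0 <= a -> b <= L -> Rintegrable `[a, b] (fun x => k x * trapezoid x).
  by move=> a0 bL; apply: RintegrableS IT => //; exact: s.
have I3 a b : 0 <= a -> b <= L -> Rintegrable `[a, b] (fun x => k x - k x * trapezoid x).
  by move=> a0 bL; apply: RintegrableB => //; [exact: I1|exact: I2].
have E1 : itg al be (fun x => k x * trapezoid x) = 0.
  rewrite (@itg_split _ 0 L al) // in E0; try lra.
  rewrite (@itg_split _ al L be) // in E0; try lra.
    have Z a b : (forall t, a <= t -> t <= b -> t <= al \/ be <= t) -> itg a b (fun x => k x * trapezoid x) = 0.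
      move=> H; rewrite (@eq_itg _ _ _ _ (fun=> 0 * 0)); last by move=> t at1 tb; rewrite trapezoid_out ?mulr0//; exact: H.
      by rewrite mulr0 itg0.
    by move: E0; rewrite (Z 0 al) ?(Z be L) ?add0r ?addr0// => t t1 t2; [right|left].
  by apply: I2; lra.
have E2 : itg al be k = itg al be (fun x => k x - k x * trapezoid x).
  by rewrite itgB ?E1 ?subr0//; [apply: I1; lra|apply: I2; lra].
have h : al + del <= be - del by lra.
rewrite E2 (@itg_split _ al be (al + del)); [|lra|lra|by apply: I3; lra].
rewrite (@itg_split _ (al + del) be (be - del)); [|lra|lra|by apply: I3; lra].
rewrite (@eq_itg _ (al + del) (be - del) _ (fun=> 0)); last first.
  by move=> t t1 t2; rewrite trapezoid_in// mulr1 subrr.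
rewrite itg0 add0r.
have B a b : 0 <= a -> b <= L -> `|itg a b (fun x => k x - k x * trapezoid x)| <= itg a b (fun x => `|k x|).
  move=> a0 bL; apply: le_trans (le_normr_Rintegral _ _) _ => //; first exact: I3.
  apply: itg_le; [apply: Rintegrable_norm => //; exact: I3|apply: Rintegrable_norm => //; exact: I1|].
  move=> t _ _; rewrite -[X in X - _]mulr1 -mulrBr normrM ler_piMr//.
  by case/andP: (trapezoid_range t) => h1 h2; rewrite ger0_norm; lra.
by apply: le_trans (ler_normD _ _) _; apply: lerD; apply: B; lra.
Qed.

End Trapezoid.

(** As del tends to 0, the integrals of |k| over the two slopes vanish, by continuity of the
    primitive of |k|. *)
Lemma itg_eq0_of_trapezoid (L al be : R) k : 0 < al -> al < be -> be < L -> Rintegrable `[0, L] k ->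
  (forall del, 0 < del -> al + 2 * del <= be -> itg 0 L (fun x => k x * trapezoid al be del x) = 0) ->
  itg al be k = 0.
Proof.
move=> al0 albe beL Ik H.
have L0 : 0 < L by lra.
have In : Rintegrable `[0, L] (fun x => `|k x|) by exact: Rintegrable_norm.
have AK := AC_prim In; have [_ HK] := AK.
set K := fun x => itg 0 x (fun x => `|k x|) in AK HK.
have cK := AC_within_continuous (ltW L0) AK.
have C x : 0 < x -> x < L -> {for x, continuous K}.
  by move=> x0 xL; apply: (within_continuous_continuous L0 cK); rewrite in_itv/= x0 xL.
apply/eqP; rewrite -normr_eq0 eq_le normr_ge0 andbT; apply/ler_addgt0Pl => e e0; rewrite addr0.
have e2 : 0 < e / 2 by rewrite divr_gt0.
have N1 : \forall x \near al, `|K al - K x| <= e / 2.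
  by have /cvgrPdist_le := C al al0 (lt_trans albe beL); apply.
have N2 : \forall x \near be, `|K be - K x| <= e / 2.
  by have /cvgrPdist_le := C be (lt_trans al0 albe) beL; apply.
have /nbhs_ballP[r1 /= r10 B1] := N1; have /nbhs_ballP[r2 /= r20 B2] := N2.
pose del := Num.min (Num.min r1 r2) (be - al) / 2.
have m0 : 0 < Num.min (Num.min r1 r2) (be - al) by rewrite !lt_min r10 r20 subr_gt0.
have d0 : 0 < del by rewrite divr_gt0.
have d1 : 2 * del <= r1 by rewrite mulrC divfK// !ge_min lexx.
have d2 : 2 * del <= r2 by rewrite mulrC divfK// !ge_min lexx orbT.
have d3 : 2 * del <= be - al by rewrite mulrC divfK// !ge_min lexx !orbT.
have d4 : al + 2 * del <= be by lra.
apply: le_trans (itg_trapezoid_mul d0 d4 al0 beL Ik (H del d0 d4)) _.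
rewrite -(HK al (al + del)); [|lra|lra|lra]; rewrite -(HK (be - del) be); [|lra|lra|lra].
have b1 : `|K al - K (al + del)| <= e / 2.
  by apply: B1; rewrite /ball/= opprD addrA subrr add0r normrN gtr0_norm//; lra.
have b2 : `|K be - K (be - del)| <= e / 2.
  by apply: B2; rewrite /ball/= opprD addrA subrr add0r opprK gtr0_norm//; lra.
have := ler_norm (K be - K (be - del)); have := ler_norm (- (K al - K (al + del))); rewrite normrN; rewrite /K in b1 b2 *; lra.
Qed.

(** Zero mean makes the primitive return to zero beyond B, so that it is supported in [A, B]. *)
Lemma bumpC1_prim (L A B : R) (p : R -> R) : 0 < A -> A < B -> B < L -> continuous p ->
  (forall x, x <= A \/ B <= x -> p x = 0) -> itg 0 L p = 0 ->
  bumpC1 L (fun x => itg 0 x p) /\ derive1 (fun x => itg 0 x p) = p.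
Proof.
move=> A0 AB BL cp p0 Ep.
have I a b : Rintegrable `[a, b] p by apply: Rintegrable_continuous; exact: continuous_subspaceT.
have Z a b : (forall t, a <= t -> t <= b -> t <= A \/ B <= t) -> itg a b p = 0.
  by move=> H; rewrite (@eq_itg _ _ _ _ (fun=> 0)) ?itg0// => t t1 t2; apply: p0; exact: H.
pose F (x : R) : R := itg 0 x p.
have D (x : R) : is_derive x 1 F (p x).
  have [x0|x0] := ltP 0 x.
    have xu : x < x + 1 by rewrite ltrDl.
    have [d1 d2] := continuous_FTC1_closed xu (I _ _) x0 (cp x).
    by apply: DeriveDef; [exact: d1|rewrite -derive1E].
  rewrite p0; last by left; lra.
  apply: (@near_eq_is_derive R R R (cst 0) F x 1 0 _ (is_derive_cst (0 : R) x 1)).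
  near=> y; rewrite /F Z//; move=> t _ ty; left.
  have : y < A by near: y; apply: lt_nbhsl; lra.
  lra.
have E : derive1 F = p.
  by apply/funext => x; rewrite derive1E; have [_ ->] := D x.
split=> //; split.
  by split; [move=> x; have [] := D x|rewrite E].
exists A, B; split=> // x [xA|Bx].
  by apply: Z => t _ tx; left; lra.
have [xL|Lx] := leP x L.
  have x0 : 0 <= x by lra.
  have := itg_split x0 xL (I 0 L); rewrite Ep (Z x L); first by rewrite addr0.
  by move=> t xt _; right; lra.
rewrite (@itg_split _ 0 x L)// ?Ep; [|lra|exact: ltW].
by rewrite add0r; apply: Z => t Lt _; right; lra.
Unshelve. all: by end_near.
Qed.

(** A fixed profile psi corrects every trapezoid to mean zero, and the primitive of the corrected
    function is a legitimate test function. Hence h - C, with C the psi-weighted mean of h, is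
    orthogonal to all trapezoids; its integrals over intervals vanish, and so does h - C almost
    everywhere. *)
Lemma du_bois_reymond (L : R) h : 0 < L -> Rintegrable `[0, L] h -> weakd L h (fun=> 0) ->
  exists C, {ae mu, forall x, `]0, L[%classic x -> h x = C}.
Proof.
move=> L0 Ih W.
pose psi := trapezoid (L / 4) (3 * L / 4) (L / 8).
have e0 : 0 < L / 8 by lra.
have e1 : L / 4 + 2 * (L / 8) <= 3 * L / 4 by lra.
have cpsi : continuous psi by exact: trapezoid_continuous.
have m0 : 0 < itg 0 L psi by apply: trapezoid_itg_gt0; lra.
pose C := itg 0 L (fun x => h x * psi x) / itg 0 L psi.
have Ipsi : Rintegrable `[0, L] psi by apply: Rintegrable_continuous; exact: continuous_subspaceT.
have Ihp : Rintegrable `[0, L] (fun x => h x * psi x).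
  by apply: Rintegrable_mul_continuous => //; exact: continuous_subspaceT.
exists C.
have Ik : Rintegrable `[0, L] (fun x => h x - C) by apply: RintegrableB => //; exact: Rintegrable_cst.
have key al be del : 0 < al -> be < L -> 0 < del -> al + 2 * del <= be ->
    itg 0 L (fun x => (h x - C) * trapezoid al be del x) = 0.
  move=> al0 beL del0 ab; set w := trapezoid al be del.
  have cw : continuous w by exact: trapezoid_continuous.
  have Iw : Rintegrable `[0, L] w by apply: Rintegrable_continuous; exact: continuous_subspaceT.
  have Ihw : Rintegrable `[0, L] (fun x => h x * w x).
    by apply: Rintegrable_mul_continuous => //; exact: continuous_subspaceT.
  pose m := itg 0 L w / itg 0 L psi.
  pose p x := w x - m * psi x.
  have cp : continuous p.
    by move=> x; apply: cvgB; [exact: cw|apply: cvgM; [exact: cvg_cst|exact: cpsi]].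
  have Imp : Rintegrable `[0, L] (fun x => m * psi x) by exact: RintegrableZ.
  have Ep : itg 0 L p = 0 by rewrite /p itgB// itgZ// /m divfK ?subrr// gt_eqF.
  have [||||bp dp] := @bumpC1_prim L (Num.min al (L / 4)) (Num.max be (3 * L / 4)) p _ _ _ cp _ Ep.
  - by rewrite lt_min al0; lra.
  - by rewrite lt_max gt_min; apply/orP; left; apply/orP; left; lra.
  - by rewrite gt_max beL; lra.
  - move=> x H; rewrite /p /w /psi !trapezoid_out ?mulr0 ?subr0//.
    + by case: H; rewrite ?le_min ?ge_max => /andP[? ?]; [left|right].
    + by case: H; rewrite ?le_min ?ge_max => /andP[? ?]; [left|right].
  have := W _ bp; rewrite dp => E.
  have E1 : itg 0 L (fun x => h x * w x) - m * itg 0 L (fun x => h x * psi x) = 0.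
    rewrite -itgZ// -itgB//; last exact: RintegrableZ.
    rewrite (@eq_itg _ _ _ _ (fun x => h x * p x)); last by move=> x _ _; rewrite /p; ring.
    rewrite E (@eq_itg _ _ _ _ (fun=> 0)); last by move=> x _ _; rewrite mul0r.
    by rewrite itg0 oppr0.
  rewrite (@eq_itg _ _ _ _ (fun x => h x * w x - C * w x)); last by move=> x _ _; rewrite mulrBl.
  rewrite itgB// ?itgZ//; last exact: RintegrableZ.
  have -> : C * itg 0 L w = m * itg 0 L (fun x => h x * psi x)
    by rewrite /C /m; field; rewrite gt_eqF.
  exact: E1.
have Z al be : 0 < al -> al < be -> be < L -> itg al be (fun x => h x - C) = 0.
  by move=> al0 albe beL; apply: (@itg_eq0_of_trapezoid L) => // del del0 ab; exact: key.
have AK := AC_prim Ik; have [_ HK] := AK.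
have cK := AC_within_continuous (ltW L0) AK.
have H x : 0 < x -> x < L -> itg 0 x (fun x => h x - C) = 0.
  move=> x0 xL.
  have /(continuous_within_itvP _ L0)[_ + _] := cK; rewrite itg1 => c0.
  have E y : 0 < y -> y <= x -> itg 0 y (fun x => h x - C) = itg 0 x (fun x => h x - C).
    move=> y0; rewrite le_eqVlt => /predU1P[->//|yx].
    by apply/eqP; rewrite eq_sym -subr_eq0 HK ?Z//; lra.
  have c1 : itg 0 y (fun t => h t - C) @[y --> 0^'+] --> itg 0 x (fun t => h t - C).
    apply: cvg_near_cst; near=> y; apply: E; first by near: y; exact: nbhs_right_gt.
    by near: y; exact: nbhs_right_le.
  exact: (norm_cvg_unique c1 c0).
apply: ae_imp (ae_eq0_of_itg Ik H) => x Hx Ix; apply/eqP; rewrite -subr_eq0; apply/eqP; exact: Hx.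
Unshelve. all: by end_near.
Qed.

End AlmostEverywhere.

(** * The space L^2(0, L) *)

Section ComplexL2.
Context {R : realType}.
Notation mu := (@lebesgue_measure R).
Variable L : R.
Hypothesis L0 : 0 < L.
Let L0' := ltW L0.
Implicit Types (f g h : R -> R[i]) (u v : R -> R).

Definition cre f x := complex.Re (f x).
Definition cim f x := complex.Im (f x).

Lemma ReM (z w : R[i]) : complex.Re (z * w) = complex.Re z * complex.Re w - complex.Im z * complex.Im w.
Proof. by case: z; case: w. Qed.
Lemma ImM (z w : R[i]) : complex.Im (z * w) = complex.Re z * complex.Im w + complex.Im z * complex.Re w.
Proof. by case: z => a b; case: w => c d. Qed.

Lemma ReD (z w : R[i]) : complex.Re (z + w) = complex.Re z + complex.Re w.
Proof. by case: z; case: w. Qed.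
Lemma ImD (z w : R[i]) : complex.Im (z + w) = complex.Im z + complex.Im w.
Proof. by case: z; case: w. Qed.

Lemma ReB (z w : R[i]) : complex.Re (z - w) = complex.Re z - complex.Re w.
Proof. by case: z; case: w. Qed.
Lemma ImB (z w : R[i]) : complex.Im (z - w) = complex.Im z - complex.Im w.
Proof. by case: z; case: w. Qed.

Lemma creB f g x : cre (f - g) x = cre f x - cre g x.
Proof. exact: ReB. Qed.
Lemma cimB f g x : cim (f - g) x = cim f x - cim g x.
Proof. exact: ImB. Qed.

Definition rL2 u := measurable_fun `]0, L[ u /\ Rintegrable `]0, L[ (fun x => u x ^+ 2).

Lemma rL2_integrable u : rL2 u -> Rintegrable `]0, L[ u.
Proof.
move=> [mu_ Iu]; apply: (@Rintegrable_dom R _ _ (fun x => 1 + u x ^+ 2)) => //.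
  move=> x _; rewrite -[u x ^+ 2]real_normK ?num_real//.
  have := sqr_ge0 (`|u x| - 1); have := sqr_ge0 (`|u x|); lra.
apply: RintegrableD => //.
by apply: RintegrableS (Rintegrable_cst 0 L 1) => //; apply: subset_itvScc; rewrite bnd_simp.
Qed.

Lemma rL2_mul u v : rL2 u -> rL2 v -> Rintegrable `]0, L[ (fun x => u x * v x).
Proof.
move=> [mu_ Iu] [mv Iv]; apply: (@Rintegrable_dom R _ _ (fun x => u x ^+ 2 + v x ^+ 2)) => //.
- exact: measurable_funM.
- move=> x _; rewrite ler_norml; apply/andP.
  have := sqr_ge0 (u x + v x); have := sqr_ge0 (u x - v x).
  have := sqr_ge0 (u x); have := sqr_ge0 (v x); split; lra.
- exact: RintegrableD.
Qed.

Lemma rL2_lin (k l : R) u v : rL2 u -> rL2 v -> rL2 (fun x => k * u x + l * v x).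
Proof.
move=> Lu Lv; have [mu_ Iu] := Lu; have [mv Iv] := Lv; split.
  by apply: measurable_funD; apply: measurable_funM.
have H := RintegrableD (measurable_itv _) (RintegrableD (measurable_itv _)
  (RintegrableZ (k ^+ 2) (measurable_itv _) Iu) (RintegrableZ (l ^+ 2) (measurable_itv _) Iv))
  (RintegrableZ (2 * k * l) (measurable_itv _) (rL2_mul Lu Lv)).
by apply: eq_integrable H => // x _ /=; congr EFin; ring.
Qed.

Lemma rL2_eq u v : (forall x, u x = v x) -> rL2 u -> rL2 v.
Proof. by move=> /funext ->. Qed.

Lemma rL2_dom u v : measurable_fun `]0, L[ u -> (forall x, 0 < x -> x < L -> `|u x| <= v x) -> rL2 v -> rL2 u.
Proof.
move=> mu_ uv [mv Iv]; split=> //; apply: (@Rintegrable_dom R _ _ (fun x => v x ^+ 2)) => //.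
  exact: measurable_funX.
move=> x; rewrite /= in_itv/= => /andP[x0 xL]; rewrite ger0_norm ?sqr_ge0// -[leLHS]real_normK ?num_real//.
by rewrite lerXn2r ?nnegrE// ?(le_trans _ (uv x x0 xL)) ?uv.
Qed.

Lemma rL2_cst (k : R) : rL2 (fun=> k).
Proof.
split=> //; apply: RintegrableS (Rintegrable_cst 0 L (k ^+ 2)) => //.
by apply: subset_itvScc; rewrite bnd_simp.
Qed.

Lemma rL2_bmul (w : R -> R) (M : R) u : measurable_fun [set: R] w -> (forall x, `|w x| <= M) ->
  rL2 u -> rL2 (fun x => w x * u x).
Proof.
move=> mw wM Lu; have [mu_ _] := Lu.
apply: (@rL2_dom _ (fun x => M * `|u x| + 0 * 0)).
- by apply: measurable_funM => //; exact: (measurable_funS (E := setT)) mw.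
- by move=> x _ _; rewrite mulr0 addr0 normrM ler_wpM2r.
- apply: rL2_lin; last exact: rL2_cst.
  have [m Iu] := Lu; split; first exact: measurableT_comp.
  by apply: eq_integrable Iu => // x _ /=; rewrite real_normK ?num_real.
Qed.

Lemma rL2_continuous u : {within `[0, L], continuous u} -> rL2 u.
Proof.
move=> cu; have s : `]0, L[ `<=` `[0, L] by apply: subset_itvScc; rewrite bnd_simp.
split; first by apply: measurable_funS (within_continuous_meas cu).
by apply: RintegrableS s _ => //; apply: Rintegrable_continuous; exact: within_continuousM.
Qed.

Lemma L2P f : L2 L f <-> rL2 (cre f) /\ rL2 (cim f).
Proof.
have E x : Normc.normc (f x) ^+ 2 = cre f x ^+ 2 + cim f x ^+ 2 by rewrite normc_Re.
split.
- move=> [m1 m2 fi].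
  have I : Rintegrable `]0, L[ (fun x => cre f x ^+ 2 + cim f x ^+ 2).
    apply/integrableP; split.
      by apply/measurable_EFinP; apply: measurable_funD; apply: measurable_funX.
    apply: le_lt_trans fi; rewrite le_eqVlt; apply/orP; left; apply/eqP.
    by apply: eq_integral => x _ /=; rewrite ger0_norm ?E// addr_ge0 ?sqr_ge0.
  split; (split; first by []).
  + apply: (@Rintegrable_dom R _ _ (fun x => cre f x ^+ 2 + cim f x ^+ 2)) => //; first exact: measurable_funX.
    by move=> x _; rewrite ger0_norm ?sqr_ge0// lerDl sqr_ge0.
  + apply: (@Rintegrable_dom R _ _ (fun x => cre f x ^+ 2 + cim f x ^+ 2)) => //; first exact: measurable_funX.
    by move=> x _; rewrite ger0_norm ?sqr_ge0// lerDr sqr_ge0.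
- move=> [[m1 I1] [m2 I2]]; split=> //.
  have /integrableP[_] := RintegrableD (measurable_itv _) I1 I2.
  apply: le_lt_trans; rewrite le_eqVlt; apply/orP; left; apply/eqP.
  by apply: eq_integral => x _ /=; rewrite ger0_norm ?E// addr_ge0 ?sqr_ge0.
Qed.

Definition cintegrable f := Rintegrable `]0, L[ (cre f) /\ Rintegrable `]0, L[ (cim f).

Lemma cintegral_itg f : cintegrable f -> cintegral L f = (itg 0 L (cre f) +i* itg 0 L (cim f))%C.
Proof. by move=> [I1 I2]; rewrite /cintegral !itg_oo. Qed.

Lemma cintegral_lin (k : R[i]) f g : cintegrable f -> cintegrable g ->
  cintegral L (fun x => k * f x + g x) = k * cintegral L f + cintegral L g.
Proof.
move=> [f1 f2] [g1 g2]; rewrite /cintegral; case: k => a b.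
have Z (c : R) u : Rintegrable `]0, L[ u -> Rintegrable `]0, L[ (fun x => c * u x) by move=> ?; exact: RintegrableZ.
apply/eqP; rewrite eq_complex/=; apply/andP; split; apply/eqP.
- rewrite -RintegralZl// -RintegralZl// -RintegralB//; [|exact: Z|exact: Z].
  rewrite -RintegralD//; last by apply: RintegrableB => //; exact: Z.
  by apply: eq_Rintegral => x _ /=; rewrite ReD ReM.
- rewrite -RintegralZl// -RintegralZl// -RintegralD//; [|exact: Z|exact: Z].
  rewrite -RintegralD//; last by apply: RintegrableD => //; exact: Z.
  by apply: eq_Rintegral => x _ /=; rewrite ImD ImM.
Qed.

Lemma ae_cintegral f g : cintegrable f -> cintegrable g ->
  {ae mu, forall x, `]0, L[%classic x -> f x = g x} -> cintegral L f = cintegral L g.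
Proof.
move=> [f1 f2] [g1 g2] fg; rewrite /cintegral; congr (_ +i* _)%C.
  apply: ae_Rintegral => //; try exact: (Rintegrable_meas); by apply: ae_imp fg => x H Ix; rewrite H.
apply: ae_Rintegral => //; try exact: (Rintegrable_meas); by apply: ae_imp fg => x H Ix; rewrite H.
Qed.

Lemma L2_ip f g : L2 L f -> L2 L g -> cintegrable (fun x => f x * (g x)^*%C).
Proof.
move=> /L2P[f1 f2] /L2P[g1 g2]; split.
- have := RintegrableD (measurable_itv _) (rL2_mul f1 g1) (rL2_mul f2 g2).
  by apply: eq_integrable => // x _ /=; congr EFin; rewrite /cre/cim ReM; case: (g x) => p q /=; rewrite mulrN opprK.
- have := RintegrableB (measurable_itv _) (rL2_mul f2 g1) (rL2_mul f1 g2).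
  by apply: eq_integrable => // x _ /=; congr EFin; rewrite /cre/cim ImM; case: (g x) => p q /=; rewrite mulrN addrC.
Qed.

Lemma L2_lin (k : R[i]) f g : L2 L f -> L2 L g -> L2 L (fun x => k * f x + g x).
Proof.
move=> /L2P[f1 f2] /L2P[g1 g2]; apply/L2P; split.
- apply: rL2_eq (rL2_lin 1 1 (rL2_lin (complex.Re k) (- complex.Im k) f1 f2) g1) => x.
  by rewrite /cre/cim ReD ReM; ring.
- apply: rL2_eq (rL2_lin 1 1 (rL2_lin (complex.Re k) (complex.Im k) f2 f1) g2) => x.
  by rewrite /cre/cim ImD ImM; ring.
Qed.

Lemma L2_0 : L2 L (fun=> 0).
Proof. by apply/L2P; split; exact: rL2_cst. Qed.

Lemma cintegral_conj f : cintegrable f -> cintegral L (fun x => (f x)^*%C) = (cintegral L f)^*%C.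
Proof.
move=> [f1 f2]; apply/eqP; rewrite eq_complex/=; apply/andP; split; apply/eqP.
  by apply: eq_Rintegral => x _; case: (f x).
rewrite -mulN1r -RintegralZl//; apply: eq_Rintegral => x _ /=.
by rewrite /cim mulN1r; case: (f x).
Qed.

Lemma Re_mul_conj (z : R[i]) : complex.Re (z * z^*%C) = Normc.normc z ^+ 2.
Proof. by rewrite normc_Re ReM; case: z => a b /=; ring. Qed.

Lemma L2_semi_inner : @semi_inner_space R (R -> R[i]) (L2 L)
  (fun f g => cintegral L (fun x => f x * (g x)^*%C)) (L2norm L).
Proof.
split.
- exact: L2_0.
- by move=> k f g; exact: L2_lin.
- move=> k f g h Lf Lg Lh; rewrite -cintegral_lin; [|exact: L2_ip|exact: L2_ip].
  by congr cintegral; apply/funext => x; rewrite mulrDl mulrA.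
- move=> f g Lf Lg; rewrite -cintegral_conj; last exact: L2_ip.
  by congr cintegral; apply/funext => x; rewrite rmorphM /= mulrC; congr (_ * _); case: (g x) => p q /=; rewrite opprK.
- move=> f Lf /=; apply: Rintegral_ge0 => x _; rewrite Re_mul_conj; exact: sqr_ge0.
- move=> f; rewrite /L2norm; congr Num.sqrt; apply: eq_Rintegral => x _.
  by rewrite Re_mul_conj.
Qed.

Lemma L2norm_sqr f : L2 L f -> L2norm L f ^+ 2 =
  itg 0 L (fun x => cre f x ^+ 2) + itg 0 L (fun x => cim f x ^+ 2).
Proof.
move=> Lf; have /L2P[[m1 I1] [m2 I2]] := Lf.
rewrite (N_sqr L2_semi_inner Lf) /= !itg_oo// -RintegralD//.
by apply: eq_Rintegral => x _; rewrite Re_mul_conj normc_Re.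
Qed.

Lemma L2_integrable f : L2 L f -> Rintegrable `[0, L] (cre f) /\ Rintegrable `[0, L] (cim f).
Proof. by move=> /L2P[/rL2_integrable/Rintegrable_oc I1 /rL2_integrable/Rintegrable_oc I2]. Qed.

End ComplexL2.

(** * Completeness of L^2 *)

Section RieszFischer.
Context {R : realType}.
Notation mu := (@lebesgue_measure R).
Notation I := (`]0%R, _[%classic : set R).

Lemma integral_EFin (D : set R) (f : R -> R) : measurable D -> Rintegrable D f ->
  (\int[mu]_(x in D) (f x)%:E)%E = (\int[mu]_(x in D) f x)%:E.
Proof. by move=> mD If; rewrite /Rintegral fineK//; exact: (@integrable_fin_num _ _ _ mu D mD _ If). Qed.

Lemma limn_einf_le (u : (\bar R)^nat) (M : \bar R) (N : nat) :
  (forall k, (N <= k)%N -> (u k <= M)%E) -> (limn_einf u <= M)%E.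
Proof.
move=> H; rewrite limn_einf_lim; apply: lime_le; first exact: is_cvg_einfs.
apply: nearW => n; apply: (@le_trans _ _ (u (maxn n N))).
  by apply: ereal_inf_lbound; exists (maxn n N) => //=; exact: leq_maxl.
by apply: H; exact: leq_maxr.
Qed.

Lemma measurable_fun_limn_einf (D : set R) (f : nat -> R -> \bar R) :
  (forall n, measurable_fun D (f n)) -> measurable_fun D (fun x => limn_einf (f^~ x)).
Proof.
move=> mf; rewrite (_ : (fun _ => _) = (fun x => - limn_esup (fun k => - f k x))%E).
  apply: (measurableT_comp (@oppe_measurable R setT)); apply: measurable_fun_limn_esup => n.
  exact: (measurableT_comp (@oppe_measurable R setT)).
by apply/funext => x; rewrite -[LHS]oppeK -limn_esupN.
Qed.

Lemma sum_half_le n : \sum_(0 <= k < n) (1 / 2) ^+ k <= 2 :> R.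
Proof.
suff -> : \sum_(0 <= k < n) (1 / 2) ^+ k = 2 - 2 * (1 / 2) ^+ n :> R.
  by rewrite gerBl mulr_ge0// exprn_ge0.
elim: n => [|n IH]; first by rewrite big_nil expr0 mulr1 subrr.
by rewrite big_nat_recr//= IH exprS; field.
Qed.

Lemma cvg_of_abs_series (v : R^nat) (M : R) :
  (forall n, \sum_(0 <= k < n) `|v k.+1 - v k| <= M) -> cvgn v.
Proof.
move=> H; have S : cvgn (series (fun k => v k.+1 - v k)).
  apply: normed_cvg; apply: nondecreasing_is_cvgn.
    apply/nondecreasing_seqP => n.
    rewrite -[leRHS]/(\sum_(0 <= k < n.+1) `|v k.+1 - v k|) big_nat_recr//= lerDl.
    exact: normr_ge0.
  by exists M => _ [n _ <-]; exact: H.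
have E : v = (fun n => v 0%N + series (fun k => v k.+1 - v k) n).
  by apply/funext => n; rewrite /series/= telescope_sumr// addrC subrK.
by rewrite E; apply: is_cvgD => //; exact: is_cvg_cst.
Qed.

Variable L : R.
Hypothesis L0 : 0 < L.
(** Taking the maximum over all earlier thresholds makes the subsequence nondecreasing. *)
Lemma fast_subsequence (P : nat -> nat -> R -> Prop) :
  (forall e : R, 0 < e -> exists n0, forall m n, (n0 <= m)%N -> (n0 <= n)%N -> P m n e) ->
  exists2 phi : nat -> nat, forall k, (phi k <= phi k.+1)%N &
    forall k m n, (phi k <= m)%N -> (phi k <= n)%N -> P m n ((1 / 2) ^+ k ^+ 2).
Proof.
move=> H; have e0 k : 0 < ((1 / 2 : R) ^+ k) ^+ 2 by rewrite !exprn_gt0.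
have /choice[N HN] : forall k : nat, exists n0, forall m n, (n0 <= m)%N -> (n0 <= n)%N -> P m n ((1 / 2) ^+ k ^+ 2).
  by move=> k; exact: H.
exists (fun k => \max_(i < k.+1) N i) => [k|k m n h1 h2].
  by rewrite [leqRHS]big_ord_recr /= leq_maxl.
apply: HN; [apply: leq_trans h1|apply: leq_trans h2]; exact: (leq_bigmax (Ordinal (ltnSn k))).
Qed.

(** Along a subsequence with errors 4^-k the increments are summable in L^1, so the subsequence
    converges almost everywhere; Fatou's lemma then turns the Cauchy estimate into an estimate of
    the distance to the limit. *)
Lemma rL2_complete (u : nat -> R -> R) : (forall n, rL2 L (u n)) ->
  (forall e : R, 0 < e -> exists n0, forall m n, (n0 <= m)%N -> (n0 <= n)%N ->
     itg 0 L (fun x => (u m x - u n x) ^+ 2) <= e) ->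
  exists2 f, rL2 L f & forall e : R, 0 < e -> exists n0, forall n, (n0 <= n)%N ->
     itg 0 L (fun x => (u n x - f x) ^+ 2) <= e.
Proof.
move=> Lu /fast_subsequence[phi phiS Hphi].
have phi_mono k m : (k <= m)%N -> (phi k <= phi m)%N.
  by move=> km; apply: (@homo_leq nat phi leq) => //; exact: leq_trans.
have Lsub m n : rL2 L (fun x => u m x - u n x).
  by apply: rL2_eq (rL2_lin 1 (-1) (Lu m) (Lu n)) => x; ring.
pose d k x := `|u (phi k.+1) x - u (phi k) x|.
have Ld k : Rintegrable `]0, L[ (d k) by apply: Rintegrable_norm => //; exact: rL2_integrable (Lsub _ _).
have d0 k x : 0 <= d k x by exact: normr_ge0.
(* From |z| <= q + z^2 / q with q = 2^-k, integrated over an interval of length L. *)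
have Id k : itg 0 L (d k) <= (1 + L) * (1 / 2) ^+ k.
  set q : R := (1 / 2) ^+ k; have q0 : 0 < q by rewrite exprn_gt0.
  have [_ Isq] := Lsub (phi k.+1) (phi k).
  have I1 := Rintegrable_oc Isq; have I0 := Rintegrable_oc (Ld k).
  have I2 : Rintegrable `[0, L] (fun x => q^-1 * (u (phi k.+1) x - u (phi k) x) ^+ 2) by exact: RintegrableZ.
  have I3 : Rintegrable `[0, L] (fun x => q + q^-1 * (u (phi k.+1) x - u (phi k) x) ^+ 2).
    by apply: RintegrableD => //; exact: Rintegrable_cst.
  apply: (@le_trans _ _ (itg 0 L (fun x => q + q^-1 * (u (phi k.+1) x - u (phi k) x) ^+ 2))).
    apply: itg_le => // x _ _; rewrite /d.
    set z := _ - _; rewrite -[z ^+ 2]real_normK ?num_real//; move: (`|z|) (normr_ge0 z) => w w0.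
    rewrite -(ler_pM2l q0) mulrDr mulrA divff ?mul1r ?gt_eqF//.
    have := sqr_ge0 (q - w); have := mulr_ge0 (ltW q0) w0; lra.
  rewrite itgD//; last exact: Rintegrable_cst.
  rewrite itg_cst; last exact: ltW.
  rewrite subr0 itgZ//.
  have := Hphi k (phi k.+1) (phi k) (phiS k) (leqnn _); rewrite -/q => Hk.
  have qi : 0 <= q^-1 by rewrite invr_ge0 ltW.
  have := ler_wpM2l qi Hk; rewrite [in leRHS]expr2 mulrA mulVf ?gt_eqF// mul1r.
  by move: (q^-1 * _) => w Hw; lra.
have cvu : {ae mu, forall x, `]0, L[%classic x -> cvgn (fun k => u (phi k) x)}.
  have md k : measurable_fun `]0, L[ (fun x => (d k x)%:E).
    by apply/measurable_EFinP; exact: Rintegrable_meas.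
  have dge k x : `]0, L[%classic x -> (0%R <= (d k x)%:E)%E by rewrite lee_fin.
  have IS : mu.-integrable `]0, L[ (fun x => (\big[+%E/0%R]_(0 <= k <oo) (d k x)%:E)%E).
    apply/integrableP; split.
      apply: (@ge0_emeasurable_sum _ _ _ _ (fun k x => (d k x)%:E) xpredT); last by move=> k _; exact: md.
      by move=> k x Ix _; exact: dge.
    have -> : (\int[mu]_(x in `]0%R, L[) `|\big[+%E/0%R]_(0 <= k <oo) (d k x)%:E|)%E =
        (\int[mu]_(x in `]0%R, L[) (\big[+%E/0%R]_(0 <= k <oo) (d k x)%:E))%E.
      by apply: eq_integral => x _; rewrite gee0_abs//; apply: nneseries_ge0 => k _ _; rewrite lee_fin.
    rewrite integral_nneseries//.
    apply: (@le_lt_trans _ _ ((1 + L) * 2)%:E); last exact: ltry.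
    apply: lime_le.
      by apply: is_cvg_nneseries => n _ _; apply: integral_ge0 => x Ix; exact: dge.
    apply: nearW => n.
    have E k : (\int[mu]_(x in `]0%R, L[) (d k x)%:E)%E = (itg 0 L (d k))%:E.
      by rewrite itg_oo// integral_EFin.
    under eq_bigr => k _ do rewrite E.
    rewrite sumEFin lee_fin; apply: (@le_trans _ _ (\sum_(0 <= k < n) (1 + L) * (1 / 2) ^+ k)).
      by apply: ler_sum => k _; exact: Id.
    by rewrite -mulr_sumr; apply: ler_wpM2l; [rewrite addr_ge0 ?ltW|exact: sum_half_le].
  have := @integrable_ae _ _ _ mu `]0, L[ (measurable_itv _) _ IS; apply: ae_imp => x Hx Ix.
  have := Hx Ix; set S := (X in X \is a fin_num) => /fineK ES.
  apply: (@cvg_of_abs_series _ (fine S)) => n.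
  by rewrite -lee_fin ES -sumEFin; apply: nneseries_lim_ge => k _ _; exact: dge.
(* The upper limit is defined and measurable everywhere, and it agrees with the limit wherever the
   sequence converges. *)
pose f x := fine (limn_esup (fun k => (u (phi k) x)%:E)).
have mf : measurable_fun `]0, L[ f.
  have mfine : measurable_fun [set: \bar R] (@fine R) by exact: fine_measurable.
  apply: (measurableT_comp mfine).
  by apply: measurable_fun_limn_esup => k; apply/measurable_EFinP; have [] := Lu (phi k).
have cvf : {ae mu, forall x, `]0, L[%classic x -> (fun k => u (phi k) x) @ \oo --> f x}.
  apply: ae_imp cvu => x Hx Ix; have c := Hx Ix.
  have c' : (fun k => (u (phi k) x)%:E) @ \oo --> (limn (fun k => u (phi k) x))%:E.
    by apply: cvg_EFin => //; exact: nearW.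
  by rewrite /f (cvg_limn_einf_sup c').
have key n j : (phi j <= n)%N -> mu.-integrable `]0, L[ (fun x => ((u n x - f x) ^+ 2)%:E) /\
    (\int[mu]_(x in `]0%R, L[) ((u n x - f x) ^+ 2)%:E <= ((1 / 2) ^+ j ^+ 2)%:E)%E.
  move=> jn.
  have mn : measurable_fun `]0, L[ (fun x => (u n x - f x) ^+ 2).
    by apply: measurable_funX; apply: measurable_funB => //; have [] := Lu n.
  have m k : measurable_fun `]0, L[ (fun x => ((u n x - u (phi k) x) ^+ 2)%:E).
    by apply/measurable_EFinP; apply: measurable_funX; have [] := Lsub n (phi k).
  have H : (\int[mu]_(x in `]0%R, L[) ((u n x - f x) ^+ 2)%:E <= ((1 / 2) ^+ j ^+ 2)%:E)%E.
    rewrite (@ae_eq_integral _ _ _ mu `]0, L[ (fun x => limn_einf (fun k => ((u n x - u (phi k) x) ^+ 2)%:E)))//.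
    - apply: le_trans (fatou mu _ m _) _ => //.
        by move=> k x _; rewrite lee_fin sqr_ge0.
      apply: (@limn_einf_le _ _ j) => k jk.
      have [_ Isq] := Lsub n (phi k).
      rewrite integral_EFin// -itg_oo// lee_fin; apply: Hphi => //; apply: leq_trans (phi_mono _ _ jk).
      exact: leqnn.
    - exact/measurable_EFinP.
    - exact: measurable_fun_limn_einf m.
    - apply: ae_imp cvf => x Hx Ix; have c := Hx Ix; apply/esym.
      have c' : (fun k => ((u n x - u (phi k) x) ^+ 2)%:E) @ \oo --> ((u n x - f x) ^+ 2)%:E.
        apply: cvg_EFin; first exact: nearW.
        by rewrite /=; under eq_fun do rewrite expr2; rewrite expr2; apply: cvgM; apply: cvgB => //; exact: cvg_cst.
      by rewrite (cvg_limn_einf_sup c').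
  split=> //; apply/integrableP; split; first exact/measurable_EFinP.
  under eq_integral => x _ do rewrite gee0_abs ?lee_fin ?sqr_ge0//.
  by apply: le_lt_trans H _; exact: ltry.
have Lf : rL2 L f.
  have [I0 _] := key (phi 0%N) 0%N (leqnn _).
  have [m0 _] := Lu (phi 0%N).
  have Ld0 : rL2 L (fun x => u (phi 0%N) x - f x) by split=> //; exact: measurable_funB.
  by apply: rL2_eq (rL2_lin 1 (-1) (Lu (phi 0%N)) Ld0) => x; ring.
exists f => // e e0.
have [j Hj] : exists j : nat, (1 / 2) ^+ j ^+ 2 <= e.
  have : (1 / 2 : R) ^+ k @[k --> \oo] --> (0 : R) by apply: cvg_expr; rewrite ger0_norm//; lra.
  move=> /cvgrPdist_le /(_ (Num.min e 1)); rewrite lt_min e0 ltr01 => /(_ isT)[j _ Hj].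
  exists j; have := Hj j (leqnn j); rewrite /= sub0r normrN ger0_norm ?exprn_ge0//.
  rewrite le_min => /andP[h1 h2]; apply: le_trans h1; rewrite expr2 ler_piMl// exprn_ge0//.
exists (phi j) => n jn; have [I1 H] := key n j jn.
by apply: le_trans Hj; rewrite itg_oo// -lee_fin -integral_EFin.
Qed.

Lemma L2_complete (u : nat -> R -> R[i]) : (forall n, L2 L (u n)) ->
  (forall e : R, 0 < e -> exists n0, forall m n, (n0 <= m)%N -> (n0 <= n)%N -> L2norm L (u m - u n) <= e) ->
  exists2 f, L2 L f & forall e : R, 0 < e -> exists n0, forall n, (n0 <= n)%N -> L2norm L (u n - f) <= e.
Proof.
move=> Lu Hu; have Si := L2_semi_inner L.
have Lre n : rL2 L (cre (u n)) /\ rL2 L (cim (u n)) by exact/L2P.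
have sqB (f g : R -> R[i]) : L2 L f -> L2 L g -> L2norm L (f - g) ^+ 2 =
    itg 0 L (fun x => (cre f x - cre g x) ^+ 2) + itg 0 L (fun x => (cim f x - cim g x) ^+ 2).
  move=> Lf Lg; rewrite L2norm_sqr//; last exact: (XB Si Lf Lg).
  by congr (itg 0 L _ + itg 0 L _); apply/funext => x; rewrite ?creB ?cimB.
have C e : 0 < e -> exists n0, forall m n, (n0 <= m)%N -> (n0 <= n)%N ->
   itg 0 L (fun x => (cre (u m) x - cre (u n) x) ^+ 2) <= e /\ itg 0 L (fun x => (cim (u m) x - cim (u n) x) ^+ 2) <= e.
  move=> e0; have se0 : 0 < Num.sqrt e by rewrite sqrtr_gt0.
  have [n0 H] := Hu _ se0; exists n0 => m n mn nn; have := H m n mn nn => H1.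
  have := lerXn2r 2 (N_ge0 Si _) (sqrtr_ge0 e) H1; rewrite (sqr_sqrtr (ltW e0)) sqB//.
  have P1 : 0 <= itg 0 L (fun x => (cre (u m) x - cre (u n) x) ^+ 2) by apply: itg_ge0 => x _ _; exact: sqr_ge0.
  have P2 : 0 <= itg 0 L (fun x => (cim (u m) x - cim (u n) x) ^+ 2) by apply: itg_ge0 => x _ _; exact: sqr_ge0.
  by split; lra.
have [|f1 Lf1 H1] := @rL2_complete (fun n => cre (u n)) (fun n => (Lre n).1).
  by move=> e /C[n0 H]; exists n0 => m n mn nn; have [] := H m n mn nn.
have [|f2 Lf2 H2] := @rL2_complete (fun n => cim (u n)) (fun n => (Lre n).2).
  by move=> e /C[n0 H]; exists n0 => m n mn nn; have [] := H m n mn nn.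
pose f x := (f1 x +i* f2 x)%C.
have Lf : L2 L f by apply/L2P.
exists f => // e e0; have e2 : 0 < e ^+ 2 / 2 by rewrite divr_gt0// exprn_gt0.
have [n1 N1] := H1 _ e2; have [n2 N2] := H2 _ e2.
exists (maxn n1 n2) => n; rewrite geq_max => /andP[h1 h2].
rewrite -(@ler_pXn2r _ 2)// ?nnegrE ?(N_ge0 Si) ?(ltW e0)// sqB//.
have := N1 n h1; have := N2 n h2; rewrite /f /cre /cim /=; lra.
Qed.

End RieszFischer.

(** * The space H^1_0(0, L) *)

Section WeakDerivative.
Context {R : realType}.
Notation mu := (@lebesgue_measure R).
Variable L : R.
Hypothesis L0 : 0 < L.
Let L0' := ltW L0.
Implicit Types (u v p q : R -> R).

Lemma bumpC1_lin (k l : R) p q : bumpC1 L p -> bumpC1 L q ->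
  bumpC1 L (fun x => k * p x + l * q x) /\
  derive1 (fun x => k * p x + l * q x) = (fun x => k * derive1 p x + l * derive1 q x).
Proof.
move=> [[dp cp] [a1 [b1 [a10 b1L H1]]]] [[dq cq] [a2 [b2 [a20 b2L H2]]]].
have D (x : R) : is_derive x 1 (fun x => k * p x + l * q x) (k * derive1 p x + l * derive1 q x).
  have d1 : is_derive x 1 p (derive1 p x) by rewrite derive1E; exact/derivableP/dp.
  have d2 : is_derive x 1 q (derive1 q x) by rewrite derive1E; exact/derivableP/dq.
  exact: is_deriveD (is_deriveZ k d1) (is_deriveZ l d2).
have E : derive1 (fun x => k * p x + l * q x) = (fun x => k * derive1 p x + l * derive1 q x).
  by apply/funext => x; rewrite derive1E; have [_ ->] := D x.
split; last exact: E.
split; first split.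
- by move=> x; have [] := D x.
- by rewrite E => x; apply: cvgD; apply: cvgM; try exact: cvg_cst; [exact: cp|exact: cq].
- exists (Num.min a1 a2), (Num.max b1 b2); split.
  + by rewrite lt_min a10 a20.
  + by rewrite gt_max b1L b2L.
  + move=> x H; rewrite H1 ?H2 ?mulr0 ?addr0//; case: H; rewrite ?le_min ?ge_max => /andP[h1 h2];
    by [left|right].
Qed.

Lemma bumpC1_cst0 : bumpC1 L (fun=> 0).
Proof.
split; first split.
- by move=> x; exact: derivable_cst.
- have -> : derive1 (fun=> 0 : R) = (fun=> 0 : R) by apply/funext => x; exact: derive1_cst.
  by move=> x; exact: cvg_cst.
- by have l0 := L0; exists (L / 3), (L / 2); split=> //; lra.
Qed.

Lemma bumpC1_rL2 p : bumpC1 L p -> rL2 L p /\ rL2 L (derive1 p).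
Proof.
move=> bp; split; apply: rL2_continuous.
  by apply: (AC_within_continuous L0' (AC_bumpC1 bp)).
by have [[_ cp] _] := bp; exact: continuous_subspaceT.
Qed.

Lemma within_cst (K : R -> R) (C : R) : {within `[0, L], continuous K} ->
  (forall x, 0 < x -> x < L -> K x = C) -> forall x, 0 <= x -> x <= L -> K x = C.
Proof.
move=> /(continuous_within_itvP _ L0)[_ c0 cL] H x x0 xL.
have h0 : K 0 = C.
  apply/esym; apply: (@norm_cvg_unique _ _ (K y @[y --> 0^'+])) c0.
  apply: cvg_near_cst; near=> y; apply: H; first by near: y; exact: nbhs_right_gt.
  by near: y; exact: nbhs_right_lt.
have hL : K L = C.
  apply/esym; apply: (@norm_cvg_unique _ _ (K y @[y --> L^'-])) cL.
  apply: cvg_near_cst; near=> y; apply: H; last by near: y; exact: nbhs_left_lt.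
  by near: y; exact: nbhs_left_gt.
move: x0; rewrite le_eqVlt => /predU1P[<-//|x0].
by move: xL; rewrite le_eqVlt => /predU1P[->//|xL]; exact: H.
Unshelve. all: by end_near.
Qed.

(** K - C has zero integral over every [0, y]. By continuity K - C is the derivative of this
    integral at interior points, hence zero; the endpoints follow by limits. *)
Lemma ae_cst_within (K : R -> R) (C : R) : {within `[0, L], continuous K} ->
  {ae mu, forall x, `]0, L[%classic x -> K x = C} -> forall x, 0 <= x -> x <= L -> K x = C.
Proof.
move=> cK aK; apply: within_cst => // x x0 xL; apply/eqP; rewrite -subr_eq0; apply/eqP.
pose f y := K y - C.
have cf : {within `[0, L], continuous f} by move=> y; apply: cvgB; [exact: cK|exact: cvg_cst].
have If : Rintegrable `[0, L] f by exact: Rintegrable_continuous.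
have Z y : 0 <= y -> y <= L -> itg 0 y f = 0.
  move=> y0 yL; apply: etrans (itg0 0 y); apply: (ae_itg (lexx 0) yL If (Rintegrable_cst _ _ _)).
  by apply: ae_imp aK => t Ht It; rewrite /f Ht// subrr.
have cfx : {for x, continuous f} by apply: (within_continuous_continuous L0 cf); rewrite in_itv/= x0 xL.
have [dF] := continuous_FTC1_closed xL If x0 cfx.
rewrite derive1E -(@near_eq_derive _ _ _ (cst 0) _ x 1) ?derive_cst//.
near=> y; apply/esym/Z.
  by apply: ltW; near: y; exact: lt_nbhsr.
by apply: ltW; near: y; exact: lt_nbhsl.
Unshelve. all: by end_near.
Qed.

(** The du Bois-Reymond lemma applies to u minus the primitive of v, whose weak derivative is
    zero. *)
Lemma weakd_ae u v : Rintegrable `[0, L] u -> Rintegrable `[0, L] v -> weakd L u v ->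
  exists C, {ae mu, forall x, `]0, L[%classic x -> u x = C + itg 0 x v}.
Proof.
move=> Iu Iv W; have AG := AC_prim Iv.
have cG := AC_within_continuous L0' AG.
have IG : Rintegrable `[0, L] (fun x => itg 0 x v) by exact: Rintegrable_continuous.
have Ih : Rintegrable `[0, L] (fun x => u x - itg 0 x v) by exact: RintegrableB.
have [|C HC] := du_bois_reymond L0 Ih.
  move=> p bp; have [_ [_ Ip']] := bumpC1_rL2 bp.
  have [[_ cp'] _] := bp.
  have cp'' : {within `[0, L], continuous (derive1 p)} by exact: continuous_subspaceT.
  have I1 := Rintegrable_mul_continuous cp'' Iu; have I2 := Rintegrable_mul_continuous cp'' IG.
  rewrite (@eq_itg _ _ _ _ (fun x => u x * derive1 p x - itg 0 x v * derive1 p x)); last by move=> x _ _; rewrite mulrBl.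
  rewrite itgB// W// (weakd_AC L0' AG bp) subrr.
  rewrite (@eq_itg _ _ _ (fun x => 0 * p x) (fun=> 0)) ?itg0 ?oppr0// => x _ _; by rewrite mul0r.
exists C; apply: ae_imp HC => x Hx Ix; by rewrite -(Hx Ix) subrK.
Qed.

(** Zero has the weak derivative v1 - v2, so the primitive of v1 - v2 is constant. It vanishes at 0,
    hence everywhere, and the difference is zero almost everywhere. *)
Lemma weakd_unique u v1 v2 : Rintegrable `[0, L] v1 -> Rintegrable `[0, L] v2 ->
  weakd L u v1 -> weakd L u v2 -> {ae mu, forall x, `]0, L[%classic x -> v1 x = v2 x}.
Proof.
move=> I1 I2 W1 W2.
have Ik : Rintegrable `[0, L] (fun x => v1 x - v2 x) by exact: RintegrableB.
have [|||C HC] := @weakd_ae (fun=> 0) (fun x => v1 x - v2 x).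
- exact: Rintegrable_cst.
- exact: Ik.
- move=> p bp; have Ap := AC_bumpC1 bp; have cp := AC_within_continuous L0' Ap.
  rewrite (@eq_itg _ _ _ (fun x => 0 * _) (fun=> 0)); last by move=> x _ _; rewrite mul0r.
  rewrite (@eq_itg _ _ _ (fun x => (v1 x - v2 x) * p x) (fun x => v1 x * p x - v2 x * p x)); last first.
    by move=> x _ _; rewrite mulrBl.
  rewrite itgB ?itg0; [|exact: Rintegrable_mul_continuous|exact: Rintegrable_mul_continuous].
  by rewrite opprB; have := W1 p bp; rewrite W2// => /eqP; rewrite eqr_opp => /eqP ->; rewrite subrr.
have cK := AC_within_continuous L0' (AC_prim Ik).
have H : forall x, 0 <= x -> x <= L -> itg 0 x (fun x => v1 x - v2 x) = - C.
  apply: (ae_cst_within cK); apply: ae_imp HC => x Hx Ix; apply/eqP; rewrite -addr_eq0 addrC.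
  by rewrite -(Hx Ix).
have C0 : C = 0 by have := H 0 (lexx _) L0'; rewrite itg1 => /eqP; rewrite eq_sym oppr_eq0 => /eqP.
have Z x : 0 < x -> x < L -> itg 0 x (fun x => v1 x - v2 x) = 0.
  by move=> x0 xL; rewrite H ?C0 ?oppr0 ?ltW.
by apply: ae_imp (ae_eq0_of_itg Ik Z) => x Hx Ix; apply/eqP; rewrite -subr_eq0 Hx.
Qed.

Lemma weakd_ae_eq u1 u2 v1 v2 : Rintegrable `[0, L] u1 -> Rintegrable `[0, L] u2 ->
  Rintegrable `[0, L] v1 -> Rintegrable `[0, L] v2 ->
  {ae mu, forall x, `]0, L[%classic x -> u1 x = u2 x} ->
  {ae mu, forall x, `]0, L[%classic x -> v1 x = v2 x} -> weakd L u1 v1 -> weakd L u2 v2.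
Proof.
move=> Iu1 Iu2 Iv1 Iv2 eu ev W p bp; have cp := AC_within_continuous L0' (AC_bumpC1 bp).
have [[_ cp'] _] := bp.
have cp'' : {within `[0, L], continuous (derive1 p)} by exact: continuous_subspaceT.
rewrite -(ae_itg (lexx 0) (lexx L) (Rintegrable_mul_continuous cp'' Iu1) (Rintegrable_mul_continuous cp'' Iu2)); last first.
  by apply: ae_imp eu => x Hx Ix; rewrite Hx.
rewrite -(ae_itg (lexx 0) (lexx L) (Rintegrable_mul_continuous cp Iv1) (Rintegrable_mul_continuous cp Iv2)).
  exact: W.
by apply: ae_imp ev => x Hx Ix; rewrite Hx.
Qed.

(** Cauchy-Schwarz, read off from the nonnegative integral of the square of u minus its mean over
    [0, x]. *)
Lemma itg_sqr_le u x : rL2 L u -> 0 <= x -> x <= L -> itg 0 x u ^+ 2 <= L * itg 0 L (fun t => u t ^+ 2).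
Proof.
move=> Lu; rewrite le_eqVlt => /predU1P[<- _|x0 xL].
  rewrite itg1 expr0n/=; apply: mulr_ge0 => //; apply: itg_ge0 => t _ _; exact: sqr_ge0.
have I2 := Rintegrable_oc Lu.2; have I1 := Rintegrable_oc (rL2_integrable Lu).
have s : `[0, x] `<=` `[0, L] by exact: sub_itv.
have J2 : Rintegrable `[0, x] (fun t => u t ^+ 2) by exact: RintegrableS I2.
have J1 : Rintegrable `[0, x] u by exact: RintegrableS I1.
set U := itg 0 x u.
have : 0 <= itg 0 x (fun t => u t ^+ 2 + (- (2 * (U / x)) * u t + (U / x) ^+ 2)).
  by apply: itg_ge0 => t _ _; have := sqr_ge0 (u t - U / x); lra.
have J3 : Rintegrable `[0, x] (fun t => - (2 * (U / x)) * u t) by exact: RintegrableZ.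
have J4 : Rintegrable `[0, x] (fun t => - (2 * (U / x)) * u t + (U / x) ^+ 2).
  by apply: RintegrableD => //; exact: Rintegrable_cst.
rewrite itgD// itgD//; last exact: Rintegrable_cst.
rewrite itgZ// itg_cst; last exact: ltW.
rewrite -/U subr0 => H.
have H1 : U ^+ 2 <= x * itg 0 x (fun t => u t ^+ 2).
  rewrite mulrC -ler_pdivrMr//.
  have -> : U ^+ 2 / x = - (- (2 * (U / x)) * U + (U / x) ^+ 2 * x) by field; rewrite gt_eqF.
  lra.
apply: le_trans H1 _; apply: ler_pM => //; [exact: ltW|by apply: itg_ge0 => t _ _; exact: sqr_ge0|].
by apply: (itgS (lexx 0) (ltW x0) xL I2) => t; exact: sqr_ge0.
Qed.

Lemma prim_rL2 u : rL2 L u -> rL2 L (fun x => itg 0 x u) /\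
  itg 0 L (fun x => itg 0 x u ^+ 2) <= L ^+ 2 * itg 0 L (fun t => u t ^+ 2).
Proof.
move=> Lu; have I1 := Rintegrable_oc (rL2_integrable Lu).
have c := AC_within_continuous L0' (AC_prim I1).
have Lp := rL2_continuous c; split=> //.
have -> : L ^+ 2 * itg 0 L (fun t => u t ^+ 2) = itg 0 L (fun=> L * itg 0 L (fun t => u t ^+ 2)).
  by rewrite itg_cst// subr0; ring.
apply: itg_le; [exact: Rintegrable_oc Lp.2|exact: Rintegrable_cst|].
by move=> t t0 tL; exact: itg_sqr_le.
Qed.

End WeakDerivative.

(** * Complex weak derivatives and primitives *)

Section H10Space.
Context {R : realType}.
Notation mu := (@lebesgue_measure R).
Variable L : R.
Hypothesis L0 : 0 < L.
Let L0' := ltW L0.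
Let Si := L2_semi_inner L.
Implicit Types (f g h phi : R -> R[i]).

Definition aeq f g := {ae mu, forall x, `]0, L[%classic x -> f x = g x}.

Lemma aeq_refl f : aeq f f.
Proof.
have : {ae mu, forall x : R, True} by exists set0; split=> // x /=; case.
by apply: ae_imp => x _ _.
Qed.

Lemma aeq_sym f g : aeq f g -> aeq g f.
Proof. by apply: ae_imp => x H Ix; rewrite H. Qed.

Lemma aeq_trans f g h : aeq f g -> aeq g h -> aeq f h.
Proof. by apply: ae_imp2 => x H1 H2 Ix; rewrite H1 ?H2. Qed.

Lemma aeq_lin (k : R[i]) f g f' g' : aeq f g -> aeq f' g' ->
  aeq (fun x => k * f x + f' x) (fun x => k * g x + g' x).
Proof. by apply: ae_imp2 => x H1 H2 Ix; rewrite H1 ?H2. Qed.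

Lemma aeqB f g f' g' : aeq f g -> aeq f' g' -> aeq (f - f') (g - g').
Proof.
apply: ae_imp2 => x H1 H2 Ix; have := H1 Ix; have := H2 Ix.
by rewrite -[(f - f') x]/(f x - f' x) -[(g - g') x]/(g x - g' x) => -> ->.
Qed.

Lemma aeq_cre f g : aeq f g -> {ae mu, forall x, `]0, L[%classic x -> cre f x = cre g x}.
Proof. by apply: ae_imp => x H Ix; rewrite /cre H. Qed.

Lemma aeq_cim f g : aeq f g -> {ae mu, forall x, `]0, L[%classic x -> cim f x = cim g x}.
Proof. by apply: ae_imp => x H Ix; rewrite /cim H. Qed.

Lemma aeqP f g : {ae mu, forall x, `]0, L[%classic x -> cre f x = cre g x} ->
  {ae mu, forall x, `]0, L[%classic x -> cim f x = cim g x} -> aeq f g.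
Proof.
apply: ae_imp2 => x H1 H2 Ix; have := H1 Ix; have := H2 Ix; rewrite /cre /cim.
by case: (f x) => a b; case: (g x) => a' b' /= -> ->.
Qed.

Lemma L2norm_ae f g : L2 L f -> L2 L g -> aeq f g -> L2norm L f = L2norm L g.
Proof.
move=> Lf Lg fg; rewrite -[LHS]ger0_norm ?(N_ge0 Si)// -[RHS]ger0_norm ?(N_ge0 Si)// -!sqrtr_sqr.
have /L2P[[_ f1] [_ f2]] := Lf; have /L2P[[_ g1] [_ g2]] := Lg.
congr Num.sqrt; rewrite !L2norm_sqr//; congr (_ + _).
  apply: (ae_itg (lexx 0) (lexx L) (Rintegrable_oc f1) (Rintegrable_oc g1)).
  by apply: ae_imp (aeq_cre fg) => x H Ix; rewrite H.
apply: (ae_itg (lexx 0) (lexx L) (Rintegrable_oc f2) (Rintegrable_oc g2)).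
by apply: ae_imp (aeq_cim fg) => x H Ix; rewrite H.
Qed.

(** The complement of the compact set K is open and contains 0 and L, which yields the two
    margins. *)
Lemma test_bump phi : test_function L phi -> bumpC1 L (cre phi) /\ bumpC1 L (cim phi).
Proof.
move=> [C1re C1im [K [cK KI Kphi]]].
have clK : closed K by apply: compact_closed => //; exact: norm_hausdorff.
have far (x : R) : ~ K x -> exists2 r : R, 0 < r & forall y, `|x - y| < r -> ~ K y.
  move=> nKx; have : nbhs x (~` K) by apply: open_nbhs_nbhs; split=> //; exact: closed_openC.
  by move=> /nbhs_ballP[r /= r0 H]; exists r => // y xy; exact: H.
have nK x : x <= 0 \/ L <= x -> ~ K x.
  move=> H /KI; rewrite /= in_itv/= => /andP[x0 xL].
  by case: H; rewrite leNgt ?x0 ?xL.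
have [r1 r10 H1] := far 0 (nK 0 (or_introl (lexx 0))).
have [r2 r20 H2] := far L (nK L (or_intror (lexx L))).
have out x : x <= r1 / 2 \/ L - r2 / 2 <= x -> ~ K x.
  move=> [h|h].
    have [x0|x0] := leP x 0; first by apply: nK; left.
    by apply: H1; rewrite sub0r normrN gtr0_norm//; lra.
  have [xL|xL] := leP L x; first by apply: nK; right.
  by apply: H2; rewrite gtr0_norm ?subr_gt0//; lra.
by split; split=> //; exists (r1 / 2), (L - r2 / 2); (split; [lra|lra|move=> x /out/Kphi Ex]);
  rewrite /cre /cim Ex.
Qed.

Lemma bump_test (p q : R -> R) : bumpC1 L p -> bumpC1 L q -> test_function L (fun x => (p x +i* q x)%C).
Proof.
move=> [C1p [a1 [b1 [a10 b1L H1]]]] [C1q [a2 [b2 [a20 b2L H2]]]]; split=> //.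
exists [set` `[Num.min a1 a2, Num.max b1 b2]]; split; first exact: segment_compact.
  move=> x; rewrite /= !in_itv/= ge_min le_max => /andP[h1 h2]; apply/andP; split.
    by case/orP: h1; apply: lt_le_trans.
  by case/orP: h2 => h; apply: le_lt_trans h _.
move=> x /=; rewrite in_itv/= => /negP; rewrite negb_and -!ltNge lt_min gt_max => H.
by rewrite H1 ?H2//; case/orP: H => /andP[/ltW ? /ltW ?]; by [left|right].
Qed.

Lemma cre_cderive phi : cre (cderive phi) = derive1 (cre phi).
Proof. by []. Qed.
Lemma cim_cderive phi : cim (cderive phi) = derive1 (cim phi).
Proof. by []. Qed.

Lemma L2_test phi : test_function L phi -> L2 L phi /\ L2 L (cderive phi).
Proof.
by move=> /test_bump[/(bumpC1_rL2 L0)[p1 p2] /(bumpC1_rL2 L0)[q1 q2]]; split; apply/L2P.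
Qed.

Lemma test_lin (k : R[i]) phi psi : test_function L phi -> test_function L psi ->
  test_function L (fun x => k * phi x + psi x) /\
  cderive (fun x => k * phi x + psi x) = (fun x => k * cderive phi x + cderive psi x).
Proof.
move=> /test_bump[p1 q1] /test_bump[p2 q2].
have [b1 e1] := bumpC1_lin (complex.Re k) (- complex.Im k) p1 q1.
have [b2 e2] := bumpC1_lin 1 1 b1 p2.
have [b3 e3] := bumpC1_lin (complex.Re k) (complex.Im k) q1 p1.
have [b4 e4] := bumpC1_lin 1 1 b3 q2.
have Er : cre (fun x => k * phi x + psi x) =
    (fun x => 1 * (complex.Re k * cre phi x + - complex.Im k * cim phi x) + 1 * cre psi x).
  by apply/funext => x; rewrite /cre ReD ReM !mul1r mulNr.
have Ei : cim (fun x => k * phi x + psi x) =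
    (fun x => 1 * (complex.Re k * cim phi x + complex.Im k * cre phi x) + 1 * cim psi x).
  by apply/funext => x; rewrite /cim ImD ImM !mul1r.
split.
  have -> : (fun x => k * phi x + psi x) =
      (fun x => (cre (fun x => k * phi x + psi x) x +i* cim (fun x => k * phi x + psi x) x)%C).
    by apply/funext => x; rewrite /cre /cim; case: (_ + _).
  by rewrite Er Ei; exact: bump_test.
apply/funext => x; apply/eqP; rewrite eq_complex; apply/andP; split; apply/eqP.
  rewrite -[LHS]/(derive1 (cre (fun x => k * phi x + psi x)) x) Er e2 e1 ReD ReM.
  by rewrite !mul1r mulNr.
rewrite -[LHS]/(derive1 (cim (fun x => k * phi x + psi x)) x) Ei e4 e3 ImD ImM.
by rewrite !mul1r.
Qed.

Lemma Rintegral_rL2_mul (u v : R -> R) : rL2 L u -> rL2 L v ->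
  \int[mu]_(x in `]0, L[) (u x * v x) = itg 0 L (fun x => u x * v x).
Proof. by move=> Lu Lv; rewrite itg_oo//; exact: rL2_mul. Qed.

(** Testing with real functions separates real and imaginary parts; conversely a complex test
    function is expanded into its two real parts. *)
Lemma weak_derivativeP f g : L2 L f -> L2 L g ->
  weak_derivative L f g <-> weakd L (cre f) (cre g) /\ weakd L (cim f) (cim g).
Proof.
move=> /L2P[f1 f2] /L2P[g1 g2]; split.
- move=> W.
  have H p : bumpC1 L p -> itg 0 L (fun x => cre f x * derive1 p x) = - itg 0 L (fun x => cre g x * p x) /\
      itg 0 L (fun x => cim f x * derive1 p x) = - itg 0 L (fun x => cim g x * p x).
    move=> bp; have [Lp Lp'] := bumpC1_rL2 L0 bp.
    pose phi x := (p x +i* 0)%C.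
    have D x : cderive phi x = (derive1 p x +i* 0)%C.
      by rewrite -[0 in RHS](derive1_cst (0 : R) x).
    have := W phi (bump_test bp (bumpC1_cst0 L0)).
    rewrite /cintegral => /eqP; rewrite eq_complex /= => /andP[/eqP h1 /eqP h2].
    rewrite -!Rintegral_rL2_mul//; split.
    + apply: etrans (etrans h1 _); [|congr (- _)]; apply: eq_Rintegral => x _; rewrite ?D ReM /= mulr0 subr0//.
    + apply: etrans (etrans h2 _); [|congr (- _)]; apply: eq_Rintegral => x _; rewrite ?D ImM /= mulr0 add0r//.
  by split=> p bp; have [] := H p bp.
- move=> [W1 W2] phi /test_bump[bp bq].
  have [Lp Lp'] := bumpC1_rL2 L0 bp; have [Lq Lq'] := bumpC1_rL2 L0 bq.
  have h11 := W1 _ bp; have h12 := W1 _ bq; have h21 := W2 _ bp; have h22 := W2 _ bq.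
  rewrite -!Rintegral_rL2_mul// in h11 h12 h21 h22.
  rewrite /cintegral; apply/eqP; rewrite eq_complex /=; apply/andP; split; apply/eqP.
  + rewrite -[RHS]mulN1r.
    rewrite (@eq_Rintegral _ _ _ mu _ (fun x => cre f x * derive1 (cre phi) x - cim f x * derive1 (cim phi) x)); last first.
      by move=> x _; rewrite ReM.
    rewrite (@eq_Rintegral _ _ _ mu _ (fun x => cre g x * cre phi x - cim g x * cim phi x) (fun x => complex.Re (g x * phi x))); last first.
      by move=> x _; rewrite ReM.
    rewrite !RintegralB//; [|exact: rL2_mul|exact: rL2_mul|exact: rL2_mul|exact: rL2_mul].
    by rewrite h11 h22; ring.
  + rewrite -[RHS]mulN1r.
    rewrite (@eq_Rintegral _ _ _ mu _ (fun x => cre f x * derive1 (cim phi) x + cim f x * derive1 (cre phi) x)); last first.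
      by move=> x _; rewrite ImM.
    rewrite (@eq_Rintegral _ _ _ mu _ (fun x => cre g x * cim phi x + cim g x * cre phi x) (fun x => complex.Im (g x * phi x))); last first.
      by move=> x _; rewrite ImM.
    rewrite !RintegralD//; [|exact: rL2_mul|exact: rL2_mul|exact: rL2_mul|exact: rL2_mul].
    by rewrite h12 h21; ring.
Qed.

Lemma wderiv_spec f : has_L2_derivative L f -> L2 L (wderiv L f) /\ weak_derivative L f (wderiv L f).
Proof. by move=> H; exact: (@xgetPex _ (fun=> 0) [set g | L2 L g /\ weak_derivative L f g] H). Qed.

(** [wderiv] is an arbitrary choice among weak derivatives, so it is identified only almost
    everywhere, by uniqueness. *)
Lemma wderiv_ae f g : L2 L f -> L2 L g -> weak_derivative L f g -> aeq (wderiv L f) g.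
Proof.
move=> Lf Lg W; have [Lw Ww] := @wderiv_spec f (ex_intro _ g (conj Lg W)).
have /(weak_derivativeP Lf Lw)[w1 w2] := Ww; have /(weak_derivativeP Lf Lg)[v1 v2] := W.
have [I1 I2] := L2_integrable Lw; have [J1 J2] := L2_integrable Lg.
by apply: aeqP; [exact: (weakd_unique L0 I1 J1 w1 v1)|exact: (weakd_unique L0 I2 J2 w2 v2)].
Qed.

Definition prim g x := (itg 0 x (cre g) +i* itg 0 x (cim g))%C.

Lemma prim_L2 g : L2 L g -> L2 L (prim g) /\ L2norm L (prim g) <= L * L2norm L g.
Proof.
move=> Lg; have /L2P[g1 g2] := Lg.
have [p1 q1] := prim_rL2 L0 g1; have [p2 q2] := prim_rL2 L0 g2.
have Lp : L2 L (prim g) by apply/L2P.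
split=> //; rewrite -(@ler_pXn2r _ 2)// ?nnegrE ?mulr_ge0 ?(N_ge0 Si)//.
by rewrite exprMn !L2norm_sqr// mulrDr; exact: lerD.
Qed.

Lemma prim_lin (k : R[i]) f g : L2 L f -> L2 L g -> forall x, 0 <= x -> x <= L ->
  prim (fun x => k * f x + g x) x = k * prim f x + prim g x.
Proof.
move=> /L2_integrable[f1 f2] /L2_integrable[g1 g2] x x0 xL.
have s : `[0, x] `<=` `[0, L] by exact: sub_itv.
have [F1 F2 G1 G2] : [/\ Rintegrable `[0, x] (cre f), Rintegrable `[0, x] (cim f),
    Rintegrable `[0, x] (cre g) & Rintegrable `[0, x] (cim g)].
  by split; [exact: RintegrableS f1|exact: RintegrableS f2|exact: RintegrableS g1|exact: RintegrableS g2].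
have Z (c : R) u : Rintegrable `[0, x] u -> Rintegrable `[0, x] (fun x => c * u x) by move=> ?; exact: RintegrableZ.
apply/eqP; rewrite eq_complex; apply/andP; split; apply/eqP.
  rewrite ReD ReM /= -!itgZ// -itgB//; [|exact: Z|exact: Z].
  rewrite -itgD//; last by apply: RintegrableB => //; exact: Z.
  by apply: eq_itg => t _ _; rewrite /cre /cim ReD ReM.
rewrite ImD ImM /= -!itgZ// -itgD//; [|exact: Z|exact: Z].
rewrite -itgD//; last by apply: RintegrableD => //; exact: Z.
by apply: eq_itg => t _ _; rewrite /cre /cim ImD ImM.
Qed.

Lemma prim_test phi x : test_function L phi -> 0 <= x -> x <= L -> prim (cderive phi) x = phi x.
Proof.
move=> /test_bump[bp bq] x0 xL.
have [_ A1] := AC_bumpC1 bp; have [_ A2] := AC_bumpC1 bq.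
have [p0 _] := bumpC1_0 bp; have [q0 _] := bumpC1_0 bq.
rewrite /prim cre_cderive cim_cderive -(A1 0 x)// -(A2 0 x)// p0 q0 !subr0 /cre /cim.
by case: (phi x).
Qed.

Lemma weak_derivative_prim f g C : L2 L f -> L2 L g -> aeq f (fun x => C + prim g x) -> weak_derivative L f g.
Proof.
move=> Lf Lg fg; apply/(weak_derivativeP Lf Lg).
have [I1 I2] := L2_integrable Lf; have [J1 J2] := L2_integrable Lg.
have key (u v : R -> R) (c : R) : Rintegrable `[0, L] u -> Rintegrable `[0, L] v ->
    {ae mu, forall x, `]0, L[%classic x -> u x = c + itg 0 x v} -> weakd L u v.
  move=> Iu Iv H.
  have A : AC 0 L (fun x => c + itg 0 x v) v.
    by have := AC_add (AC_cst 0 L c) (AC_prim Iv); apply: AC_eq => // x _ _; rewrite add0r.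
  apply: (weakd_ae_eq L0 _ Iu Iv Iv _ _ (weakd_AC L0' A)).
  - by apply: Rintegrable_continuous; exact: (AC_within_continuous L0' A).
  - by apply: ae_imp H => x Hx Ix; rewrite Hx.
  - by apply: (@ae_imp _ (fun=> True)) => //; exists set0; split=> // x /=; case.
split.
- apply: (key _ _ (complex.Re C)) => //; apply: ae_imp (aeq_cre fg) => x Hx Ix.
  by rewrite Hx// /cre ReD.
- apply: (key _ _ (complex.Im C)) => //; apply: ae_imp (aeq_cim fg) => x Hx Ix.
  by rewrite Hx// /cim ImD.
Qed.

Lemma prim_of_weak_derivative f g : L2 L f -> L2 L g -> weak_derivative L f g ->
  exists C, aeq f (fun x => C + prim g x).
Proof.
move=> Lf Lg /(weak_derivativeP Lf Lg)[w1 w2].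
have [I1 I2] := L2_integrable Lf; have [J1 J2] := L2_integrable Lg.
have [C1 H1] := weakd_ae L0 I1 J1 w1; have [C2 H2] := weakd_ae L0 I2 J2 w2.
exists (C1 +i* C2)%C; apply: aeqP.
- by apply: ae_imp H1 => x Hx Ix; rewrite Hx// /cre ReD.
- by apply: ae_imp H2 => x Hx Ix; rewrite Hx// /cim ImD.
Qed.

End H10Space.

(** * Characterisation of H^1_0 by primitives *)

Section H10Characterization.
Context {R : realType}.
Notation mu := (@lebesgue_measure R).
Variable L : R.
Hypothesis L0 : 0 < L.
Let L0' := ltW L0.
Let Si := L2_semi_inner L.
Implicit Types (f g h phi : R -> R[i]).

(* [g] is a limit in L^2 of derivatives of test functions and [f] is its
   primitive vanishing at 0. *)
Definition h10 f g := [/\ L2 L f, L2 L g, aeq L f (prim g) &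
  forall e : R, 0 < e -> exists2 phi, test_function L phi & L2norm L (g - cderive phi) <= e].

(** The boundary condition at L: derivatives of test functions have zero integral, and they
    approximate g in L^2. *)
Lemma h10_prim_end f g : h10 f g -> prim g L = 0.
Proof.
move=> [Lf Lg fg app].
have key (u : R -> R) (cu : (R -> R[i]) -> R -> R) : rL2 L u ->
    (forall phi, test_function L phi -> bumpC1 L (cu phi)) ->
    (forall e : R, 0 < e -> exists2 phi, test_function L phi &
       itg 0 L (fun x => (u x - derive1 (cu phi) x) ^+ 2) <= e ^+ 2) -> itg 0 L u = 0.
  move=> Lu bu H; apply/eqP; rewrite -sqrf_eq0 eq_le sqr_ge0 andbT.
  apply/ler_addgt0Pl => e e0; rewrite addr0.
  have e1 : 0 < Num.sqrt (e / L) by rewrite sqrtr_gt0 divr_gt0.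
  have [phi Tphi Hphi] := H _ e1.
  have bp := bu _ Tphi; have [Lp Lp'] := bumpC1_rL2 L0 bp.
  have Ld : rL2 L (fun x => u x - derive1 (cu phi) x).
    by apply: rL2_eq (rL2_lin 1 (-1) Lu Lp') => x; ring.
  have := itg_sqr_le L0 Ld L0' (lexx L).
  rewrite itgB; [|exact: Rintegrable_oc (rL2_integrable Lu)|exact: Rintegrable_oc (rL2_integrable Lp')].
  have [_ A] := AC_bumpC1 bp; have [p0 pL] := bumpC1_0 bp.
  rewrite -(A 0 L)// p0 pL !subr0 => /le_trans; apply.
  apply: le_trans (ler_wpM2l L0' Hphi) _.
  rewrite sqr_sqrtr; last by rewrite divr_ge0// ltW.
  by rewrite mulrC divfK// gt_eqF.
have /L2P[g1 g2] := Lg.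
have app2 (e : R) : 0 < e -> exists2 phi, test_function L phi &
    itg 0 L (fun x => (cre g x - derive1 (cre phi) x) ^+ 2) <= e ^+ 2 /\
    itg 0 L (fun x => (cim g x - derive1 (cim phi) x) ^+ 2) <= e ^+ 2.
  move=> e0; have [phi Tphi Hphi] := app e e0; exists phi => //.
  have [_ Lp'] := L2_test L0 Tphi.
  have := lerXn2r 2 (N_ge0 Si _) (ltW e0) Hphi.
  rewrite L2norm_sqr; last exact: (XB Si Lg Lp').
  have P1 : 0 <= itg 0 L (fun x => cre (g - cderive phi) x ^+ 2) by apply: itg_ge0 => x _ _; exact: sqr_ge0.
  have P2 : 0 <= itg 0 L (fun x => cim (g - cderive phi) x ^+ 2) by apply: itg_ge0 => x _ _; exact: sqr_ge0.
  have E1 : itg 0 L (fun x => cre (g - cderive phi) x ^+ 2) = itg 0 L (fun x => (cre g x - derive1 (cre phi) x) ^+ 2).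
    by apply: eq_itg => x _ _; rewrite creB.
  have E2 : itg 0 L (fun x => cim (g - cderive phi) x ^+ 2) = itg 0 L (fun x => (cim g x - derive1 (cim phi) x) ^+ 2).
    by apply: eq_itg => x _ _; rewrite cimB.
  by rewrite -E1 -E2 => Hs; split; apply: le_trans Hs; [rewrite lerDl|rewrite lerDr].
rewrite /prim (key _ _ g1 (fun phi T => (test_bump T).1)); last first.
  by move=> e /app2[phi T [H _]]; exists phi.
rewrite (key _ _ g2 (fun phi T => (test_bump T).2))//.
by move=> e /app2[phi T [_ H]]; exists phi.
Qed.

(** For every test function phi, the constant of integration C equals almost everywhere f - phi
    minus the primitive of g - phi'. Both have arbitrarily small L^2 norm for suitable phi, so C =
    0. *)
Lemma h10_of_H10 f : H10 L f -> h10 f (wderiv L f).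
Proof.
move=> [[Lf Df] app]; have [Lw Ww] := wderiv_spec Df; set g := wderiv L f in Lw Ww *.
have [C HC] := prim_of_weak_derivative L0 Lf Lw Ww.
have app' (e : R) : 0 < e -> exists phi, [/\ test_function L phi, L2norm L (f - phi) <= e &
    L2norm L (g - cderive phi) <= e].
  move=> e0; have [phi T Hphi] := app e e0; exists phi.
  have [Lp Lp'] := L2_test L0 T.
  have Lfp : L2 L (f - phi) := XB Si Lf Lp.
  have Lgp : L2 L (g - cderive phi) := XB Si Lw Lp'.
  have W : weak_derivative L (f - phi) (g - cderive phi).
    apply: (@weak_derivative_prim R L L0 _ _ C) => //.
    apply: aeq_trans (aeqB HC (aeq_refl L phi)) _.
    have : {ae mu, forall x : R, True} by exists set0; split=> // x /=; case.
    apply: ae_imp => x _ /=; rewrite in_itv/= => /andP[/ltW x0 /ltW xL].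
    rewrite -[LHS]/(C + prim g x - phi x) -(prim_test T x0 xL).
    have -> : g - cderive phi = (fun x => -1 * cderive phi x + g x).
      by apply/funext => t; rewrite mulN1r addrC.
    by rewrite (prim_lin (-1) Lp' Lw x0 xL); ring.
  have Ha := wderiv_ae L0 Lfp Lgp W.
  have [Lw2 _] := @wderiv_spec _ L (f - phi) (ex_intro _ _ (conj Lgp W)).
  have N0 h : 0 <= L2norm L h := N_ge0 Si h.
  have P : L2norm L (f \- phi) ^+ 2 + L2norm L (wderiv L (f \- phi)) ^+ 2 < e ^+ 2.
    rewrite -[X in X < _]sqr_sqrtr; last by rewrite addr_ge0 ?sqr_ge0.
    by rewrite ltrXn2r// ?nnegrE ?sqrtr_ge0 ?ltW.
  split=> //; rewrite -(@ler_pXn2r _ 2)// ?nnegrE ?N0 ?(ltW e0)//.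
    have := sqr_ge0 (L2norm L (wderiv L (f \- phi))); rewrite -[f - phi]/(f \- phi); lra.
  rewrite -(L2norm_ae Lw2 Lgp Ha).
  have := sqr_ge0 (L2norm L (f \- phi)); rewrite -[f - phi]/(f \- phi); lra.
have C0 : C = 0.
  have Lc : L2 L (fun=> C) by apply/L2P; split; exact: rL2_cst.
  have NC : L2norm L (fun=> C) = 0.
    apply/eqP; rewrite eq_le (N_ge0 Si) andbT; apply/ler_addgt0Pl => e e0; rewrite addr0.
    have e1 : 0 < e / (1 + L) by rewrite divr_gt0// addr_gt0.
    have [phi [T H1 H2]] := app' _ e1.
    have [Lp Lp'] := L2_test L0 T.
    have Lfp : L2 L (f - phi) := XB Si Lf Lp.
    have Lgp : L2 L (g - cderive phi) := XB Si Lw Lp'.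
    have [Lpr Npr] := prim_L2 L0 Lgp.
    have Hae : aeq L (fun=> C) ((f - phi) - prim (g - cderive phi)).
      apply: aeq_sym; apply: ae_imp HC => x Hx Ix.
      have [x0 xL] : 0 <= x /\ x <= L by move: Ix; rewrite /= in_itv/= => /andP[/ltW ? /ltW ?].
      rewrite -[LHS]/(f x - phi x - prim (g - cderive phi) x) (Hx Ix) -(prim_test T x0 xL).
      have -> : g - cderive phi = (fun x => -1 * cderive phi x + g x).
        by apply/funext => t; rewrite mulN1r addrC.
      by rewrite (prim_lin (-1) Lp' Lw x0 xL); ring.
    rewrite (L2norm_ae Lc (XB Si Lfp Lpr) Hae).
    apply: le_trans (NB Si Lfp Lpr) _; apply: le_trans (lerD H1 (le_trans Npr (ler_wpM2l L0' H2))) _.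
    rewrite -[X in X + _]mul1r -mulrDl mulrC divfK// gt_eqF// addr_gt0//.
  have : L2norm L (fun=> C) ^+ 2 = 0 by rewrite NC expr0n.
  rewrite L2norm_sqr// -[itg 0 L (fun x => cre _ x ^+ 2)]/(itg 0 L (fun=> complex.Re C ^+ 2))
    -[itg 0 L (fun x => cim _ x ^+ 2)]/(itg 0 L (fun=> complex.Im C ^+ 2)) !itg_cst// subr0 => /eqP.
  rewrite -mulrDl mulf_eq0 (gt_eqF L0) orbF paddr_eq0 ?sqr_ge0// !sqrf_eq0 => /andP[/eqP h1 /eqP h2].
  by apply/eqP; rewrite eq_complex; apply/andP; split; apply/eqP.
split=> //.
  by apply: ae_imp HC => x Hx Ix; rewrite Hx// C0 add0r.
by move=> e e0; have [phi [T _ H]] := app' e e0; exists phi.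
Qed.

(** A primitive is bounded in L^2 by L times its derivative, so approximating the derivative alone
    already approximates f in H^1. *)
Lemma H10_of_h10 f g : h10 f g -> H10 L f /\ aeq L (wderiv L f) g.
Proof.
move=> [Lf Lg fg app].
have W : weak_derivative L f g.
  by apply: (@weak_derivative_prim R L L0 _ _ 0) => //; apply: ae_imp fg => x H Ix; rewrite add0r H.
split; last exact: wderiv_ae.
split; first by split=> //; exists g.
(* The factor 1 + L covers the function and its derivative together; the factor 2 makes the final
   inequality strict. *)
move=> e e0; pose e' := e / (2 * (1 + L)).
have l1 : 0 < 1 + L by rewrite addr_gt0.
have e'0 : 0 < e' by rewrite divr_gt0// mulr_gt0.
have [phi T Hphi] := app e' e'0; exists phi => //.
have [Lp Lp'] := L2_test L0 T.
have Lfp : L2 L (f - phi) := XB Si Lf Lp.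
have Lgp : L2 L (g - cderive phi) := XB Si Lg Lp'.
have [Lpr Npr] := prim_L2 L0 Lgp.
have Hae : aeq L (f - phi) (prim (g - cderive phi)).
  apply: ae_imp fg => x Hx Ix.
  have [x0 xL] : 0 <= x /\ x <= L by move: Ix; rewrite /= in_itv/= => /andP[/ltW ? /ltW ?].
  rewrite -[LHS]/(f x - phi x) (Hx Ix) -(prim_test T x0 xL).
  have -> : g - cderive phi = (fun x => -1 * cderive phi x + g x).
    by apply/funext => t; rewrite mulN1r addrC.
  by rewrite (prim_lin (-1) Lp' Lg x0 xL); ring.
have W2 : weak_derivative L (f - phi) (g - cderive phi).
  by apply: (@weak_derivative_prim R L L0 _ _ 0) => //; apply: ae_imp Hae => x H Ix; rewrite add0r H.
have Ha := wderiv_ae L0 Lfp Lgp W2.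
have [Lw2 _] := @wderiv_spec _ L (f - phi) (ex_intro _ _ (conj Lgp W2)).
rewrite /H1norm -[f \- phi]/(f - phi) (L2norm_ae Lw2 Lgp Ha) (L2norm_ae Lfp Lpr Hae).
set n1 := L2norm L (prim _) in Npr *; set n2 := L2norm L _ in Hphi Npr *.
have n10 : 0 <= n1 := N_ge0 Si _; have n20 : 0 <= n2 := N_ge0 Si _.
apply: (@le_lt_trans _ _ (n1 + n2)).
  rewrite -[leRHS]ger0_norm ?addr_ge0// -sqrtr_sqr ler_wsqrtr//.
  by have := mulr_ge0 n10 n20; lra.
apply: (@le_lt_trans _ _ (e' * (1 + L))).
  by have := ler_wpM2l L0' Hphi; move: Npr Hphi; move: (L * n2) => w; lra.
rewrite /e' invfM mulrA -mulrA mulVf ?gt_eqF// mulr1; lra.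
Qed.

Lemma h10_lin (k : R[i]) f g f' g' : h10 f g -> h10 f' g' ->
  h10 (fun x => k * f x + f' x) (fun x => k * g x + g' x).
Proof.
move=> [Lf Lg fg app] [Lf' Lg' fg' app']; split; [exact: L2_lin|exact: L2_lin| |].
  apply: ae_imp (aeq_lin k fg fg') => x H Ix; rewrite H//.
  have [x0 xL] : 0 <= x /\ x <= L by move: Ix; rewrite /= in_itv/= => /andP[/ltW ? /ltW ?].
  by rewrite (prim_lin k Lg Lg' x0 xL).
move=> e e0; pose n := Normc.normc k.
have n0 : 0 <= n by exact: normc_ge0.
have n1 : 0 < n + 1 by rewrite ltr_wpDl.
have e1 : 0 < e / (n + 1) / 2 by rewrite !divr_gt0.
have e2 : 0 < e / 2 by rewrite divr_gt0.
have [phi T H] := app _ e1; have [psi T' H'] := app' _ e2.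
have [Tk Dk] := test_lin k T T'; exists (fun x => k * phi x + psi x) => //.
have [_ Lp'] := L2_test L0 T; have [_ Lq'] := L2_test L0 T'.
have Lgp : L2 L (g - cderive phi) := XB Si Lg Lp'.
have Lgq : L2 L (g' - cderive psi) := XB Si Lg' Lq'.
have -> : (fun x => k * g x + g' x) - cderive (fun x => k * phi x + psi x) =
    k *: (g - cderive phi) + (g' - cderive psi).
  rewrite Dk; apply/funext => x.
  by rewrite -[LHS]/(k * g x + g' x - (k * cderive phi x + cderive psi x))
    -[RHS]/(k * (g x - cderive phi x) + (g' x - cderive psi x)); ring.
apply: le_trans (ND Si (XZ Si k Lgp) Lgq) _; rewrite (NZ Si)// -/n.
have h1 := ler_wpM2l n0 H; have h2 : n * (e / (n + 1) / 2) <= e / 2.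
  rewrite (_ : n * _ = e / 2 * (n / (n + 1))); last by field; rewrite gt_eqF.
  by rewrite ler_piMr ?(ltW e2)// ler_pdivrMr// mul1r lerDl.
by rewrite [leRHS]splitr; apply: lerD H'; exact: le_trans h1 h2.
Qed.

Lemma H10_lin (k : R[i]) f f' : H10 L f -> H10 L f' -> H10 L (fun x => k * f x + f' x) /\
  aeq L (wderiv L (fun x => k * f x + f' x)) (fun x => k * wderiv L f x + wderiv L f' x).
Proof. by move=> /h10_of_H10 h /h10_of_H10 h'; exact: H10_of_h10 (h10_lin k h h'). Qed.

Lemma H10_0 : H10 L (fun=> 0).
Proof.
have z : h10 (fun=> 0) (fun=> 0).
  split; [exact: L2_0|exact: L2_0| |].
    have : {ae mu, forall x : R, True} by exists set0; split=> // x /=; case.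
    by apply: ae_imp => x _ Ix; rewrite /prim !itg0.
  move=> e e0; exists (fun=> 0).
    have := bump_test (bumpC1_cst0 L0) (bumpC1_cst0 L0).
    by [].
  have -> : (fun=> 0 : R[i]) - cderive (fun=> 0 : R[i]) = 0 :> (R -> R[i]).
    apply/funext => x; rewrite -[LHS]/(0 - cderive (fun=> 0 : R[i]) x) sub0r /cderive.
    have -> : derive1 (@complex.Re R \o (fun=> 0 : R[i])) x = 0 by exact: derive1_cst.
    by apply/eqP; rewrite eq_complex /= oppr0 eqxx.
  by rewrite (N0 Si) ltW.
by have [] := H10_of_h10 z.
Qed.

End H10Characterization.

(** * The energy space and the wave operator *)

Section EnergySpace.
Context {R : realType}.
Notation mu := (@lebesgue_measure R).
Variables L a : R.
Hypotheses (L0 : 0 < L) (a0 : 0 < a).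
Let L0' := ltW L0.
Let Si := L2_semi_inner L.
Implicit Types (f g h u v y z : R -> R[i]).

Lemma state_lin (k : R[i]) (u v y z u' v' y' z' : R -> R[i]) :
  k *: ((u, v, y, z) : state R) + (u', v', y', z') = (k *: u + u', k *: v + v', k *: y + y', k *: z + z') :> state R.
Proof. by []. Qed.
Lemma state_sub  (u v y z u' v' y' z' : R -> R[i]) :
  ((u, v, y, z) : state R) - (u', v', y', z') = (u - u', v - v', y - y', z - z') :> state R.
Proof. by []. Qed.

Definition l2ip f g := cintegral L (fun x => f x * (g x)^*%C).

Lemma l2ip_ae f f' g : L2 L f -> L2 L f' -> L2 L g -> aeq L f f' -> l2ip f g = l2ip f' g.
Proof.
move=> Lf Lf' Lg ff; apply: ae_cintegral; [exact: L2_ip|exact: L2_ip|].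
by apply: ae_imp ff => x H Ix; rewrite H.
Qed.

Lemma energy_innerE u v y z u1 v1 y1 z1 : energy_inner L a (u, v, y, z) (u1, v1, y1, z1) =
  l2ip v v1 + a%:C%C * l2ip (wderiv L u) (wderiv L u1) + l2ip z z1 + l2ip (wderiv L y) (wderiv L y1).
Proof. by []. Qed.

Lemma H10_L2 f : H10 L f -> L2 L f /\ L2 L (wderiv L f).
Proof. by move=> [[Lf Df] _]; split=> //; have [] := wderiv_spec Df. Qed.

(** [wderiv] is linear only almost everywhere, so linearity of the form goes through [l2ip_ae]. *)
Lemma energy_semi_inner : semi_inner_space (energy_space L) (energy_inner L a) (energy_norm L a).
Proof.
split.
- by split; [exact: H10_0|exact: L2_0|exact: H10_0|exact: L2_0].
- move=> k [[[u v] y] z] [[[u' v'] y'] z'] [Hu Lv Hy Lz] [Hu' Lv' Hy' Lz'].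
  have h1 : H10 L (k *: u + u') := (H10_lin L0 k Hu Hu').1.
  have h2 : L2 L (k *: v + v') := si_lin Si k Lv Lv'.
  have h3 : H10 L (k *: y + y') := (H10_lin L0 k Hy Hy').1.
  have h4 : L2 L (k *: z + z') := si_lin Si k Lz Lz'.
  exact: And4 h1 h2 h3 h4.
- move=> k [[[u v] y] z] [[[u' v'] y'] z'] [[[u1 v1] y1] z1] [Hu Lv Hy Lz] [Hu' Lv' Hy' Lz'] [Hu1 Lv1 Hy1 Lz1].
  have [Lu Lgu] := H10_L2 Hu; have [Lu' Lgu'] := H10_L2 Hu'; have [Lu1 Lgu1] := H10_L2 Hu1.
  have [Ly Lgy] := H10_L2 Hy; have [Ly' Lgy'] := H10_L2 Hy'; have [Ly1 Lgy1] := H10_L2 Hy1.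
  have [Hku aku] := H10_lin L0 k Hu Hu'; have [Hky aky] := H10_lin L0 k Hy Hy'.
  have e1 : l2ip (k *: v + v') v1 = k * l2ip v v1 + l2ip v' v1 by exact: (si_ipl Si).
  have e2 : l2ip (k *: z + z') z1 = k * l2ip z z1 + l2ip z' z1 by exact: (si_ipl Si).
  have e3 : l2ip (wderiv L (k *: u + u')) (wderiv L u1) =
      k * l2ip (wderiv L u) (wderiv L u1) + l2ip (wderiv L u') (wderiv L u1).
    by rewrite (l2ip_ae (H10_L2 Hku).2 (L2_lin k Lgu Lgu') Lgu1 aku); exact: (si_ipl Si).
  have e4 : l2ip (wderiv L (k *: y + y')) (wderiv L y1) =
      k * l2ip (wderiv L y) (wderiv L y1) + l2ip (wderiv L y') (wderiv L y1).
    by rewrite (l2ip_ae (H10_L2 Hky).2 (L2_lin k Lgy Lgy') Lgy1 aky); exact: (si_ipl Si).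
  rewrite state_lin.
  rewrite !energy_innerE.
  rewrite e1 e2.
  rewrite e3 e4.
  move: (l2ip v v1) (l2ip v' v1) (l2ip z z1) (l2ip z' z1).
  move: (l2ip (wderiv L u) _) (l2ip (wderiv L u') _) (l2ip (wderiv L y) _) (l2ip (wderiv L y') _).
  move=> p1 p2 p3 p4 p5 p6 p7 p8.
  ring.
- move=> [[[u v] y] z] [[[u1 v1] y1] z1] [Hu Lv Hy Lz] [Hu1 Lv1 Hy1 Lz1].
  have [_ Lgu] := H10_L2 Hu; have [_ Lgu1] := H10_L2 Hu1.
  have [_ Lgy] := H10_L2 Hy; have [_ Lgy1] := H10_L2 Hy1.
  rewrite !energy_innerE.
  have e1 : l2ip v1 v = (l2ip v v1)^*%C := si_ipC Si Lv Lv1.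
  have e2 : l2ip (wderiv L u1) (wderiv L u) = (l2ip (wderiv L u) (wderiv L u1))^*%C := si_ipC Si Lgu Lgu1.
  have e3 : l2ip z1 z = (l2ip z z1)^*%C := si_ipC Si Lz Lz1.
  have e4 : l2ip (wderiv L y1) (wderiv L y) = (l2ip (wderiv L y) (wderiv L y1))^*%C := si_ipC Si Lgy Lgy1.
  rewrite e1 e2 e3 e4.
  move: (l2ip v v1) (l2ip z z1) (l2ip (wderiv L u) _) (l2ip (wderiv L y) _) => [p1 q1] [p2 q2] [p3 q3] [p4 q4].
  by apply/eqP; rewrite eq_complex /=; apply/andP; split; apply/eqP; ring.
- move=> [[[u v] y] z] [Hu Lv Hy Lz]; have [_ Lgu] := H10_L2 Hu; have [_ Lgy] := H10_L2 Hy.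
  rewrite energy_innerE !ReD ReZ.
  have p1 : 0 <= complex.Re (l2ip v v) := si_ge0 Si Lv.
  have p2 : 0 <= complex.Re (l2ip (wderiv L u) (wderiv L u)) := si_ge0 Si Lgu.
  have p3 : 0 <= complex.Re (l2ip z z) := si_ge0 Si Lz.
  have p4 : 0 <= complex.Re (l2ip (wderiv L y) (wderiv L y)) := si_ge0 Si Lgy.
  exact: (addr_ge0 (addr_ge0 (addr_ge0 p1 (mulr_ge0 (ltW a0) p2)) p3) p4).
- by [].
Qed.

Lemma energy_norm_sqr u v y z : energy_space L (u, v, y, z) -> energy_norm L a (u, v, y, z) ^+ 2 =
  L2norm L v ^+ 2 + a * L2norm L (wderiv L u) ^+ 2 + L2norm L z ^+ 2 + L2norm L (wderiv L y) ^+ 2.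
Proof.
move=> XU; rewrite (N_sqr energy_semi_inner XU) energy_innerE !ReD ReZ.
have [Hu Lv Hy Lz] := XU; have [_ Lgu] := H10_L2 Hu; have [_ Lgy] := H10_L2 Hy.
have E f : L2 L f -> complex.Re (l2ip f f) = L2norm L f ^+ 2 by move=> Lf; rewrite (N_sqr Si Lf).
by congr (_ + a * _ + _ + _); [exact: E Lv|exact: E Lgu|exact: E Lz|exact: E Lgy].
Qed.

Lemma energy_normB_sqr u v y z u' v' y' z' : energy_space L (u, v, y, z) -> energy_space L (u', v', y', z') ->
  energy_norm L a ((u, v, y, z) - (u', v', y', z')) ^+ 2 =
  L2norm L (v - v') ^+ 2 + a * L2norm L (wderiv L u - wderiv L u') ^+ 2 + L2norm L (z - z') ^+ 2 +
  L2norm L (wderiv L y - wderiv L y') ^+ 2.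
Proof.
move=> XU XU'; have XB' := XB energy_semi_inner XU XU'.
rewrite state_sub in XB' *; rewrite (energy_norm_sqr XB').
have [Hu Lv Hy Lz] := XU; have [Hu' Lv' Hy' Lz'] := XU'.
have D f f' : H10 L f -> H10 L f' -> L2norm L (wderiv L (f - f')) = L2norm L (wderiv L f - wderiv L f').
  move=> Hf Hf'; have [Hl al] := H10_lin L0 (-1) Hf' Hf.
  have E : (fun x => -1 * f' x + f x) = f - f' by apply/funext => x; rewrite mulN1r addrC.
  rewrite E in Hl al; apply: L2norm_ae; [exact: (H10_L2 Hl).2|exact: (XB Si (H10_L2 Hf).2 (H10_L2 Hf').2)|].
  by apply: ae_imp al => x H Ix; rewrite H// mulN1r addrC.
by rewrite (D u u')// (D y y').
Qed.

(** The derivatives converge in L^2 to some g, and the limit is its primitive. Test functions for g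
    are taken from those that approximate a late member of the sequence. *)
Lemma H10_complete (w : nat -> R -> R[i]) : (forall n, H10 L (w n)) ->
  (forall e : R, 0 < e -> exists n0, forall m n, (n0 <= m)%N -> (n0 <= n)%N ->
     L2norm L (wderiv L (w m) - wderiv L (w n)) <= e) ->
  exists2 f, H10 L f & forall e : R, 0 < e -> exists n0, forall n, (n0 <= n)%N ->
     L2norm L (wderiv L (w n) - wderiv L f) <= e.
Proof.
move=> Hw cw; have Lw n := (H10_L2 (Hw n)).2.
have [g Lg Hg] := L2_complete L0 Lw cw.
have [Lp _] := prim_L2 L0 Lg.
have hg : h10 L (prim g) g.
  split=> //; first exact: aeq_refl.
  move=> e e0; have e2 : 0 < e / 2 by rewrite divr_gt0.
  have [n0 Hn] := Hg _ e2; have [_ _ _ app] := h10_of_H10 L0 (Hw n0).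
  have [phi T Hphi] := app _ e2; exists phi => //.
  have [_ Lphi] := L2_test L0 T.
  apply: le_trans (Ntri Si Lg Lphi (Lw n0)) _; rewrite [leRHS]splitr; apply: lerD => //.
  by rewrite (Ndist Si Lg (Lw n0)); exact: Hn.
have [Hf af] := H10_of_h10 L0 hg; exists (prim g) => // e e0.
have [n0 Hn] := Hg e e0; exists n0 => n nn.
have Lf := (H10_L2 Hf).2.
rewrite (L2norm_ae (XB Si (Lw n) Lf) (XB Si (Lw n) Lg)); first exact: Hn.
exact: aeqB (aeq_refl L _) af.
Qed.

Lemma energy_complete (U : nat -> state R) : (forall n, energy_space L (U n)) ->
  (forall e, 0 < e -> exists n0, forall m n, (n0 <= m)%N -> (n0 <= n)%N -> energy_norm L a (U m - U n) <= e) ->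
  exists2 W, energy_space L W & forall e, 0 < e -> exists n0, forall n, (n0 <= n)%N -> energy_norm L a (U n - W) <= e.
Proof.
move=> XU cU.
pose u n := (U n).1.1.1; pose v n := (U n).1.1.2; pose y n := (U n).1.2; pose z n := (U n).2.
have EU n : U n = (u n, v n, y n, z n) by rewrite /u /v /y /z; case: (U n) => [[[? ?] ?] ?].
have XU' n : energy_space L (u n, v n, y n, z n) by rewrite -EU.
have Hu n : H10 L (u n) by have [] := XU' n.
have Lv n : L2 L (v n) by have [] := XU' n.
have Hy n : H10 L (y n) by have [] := XU' n.
have Lz n : L2 L (z n) by have [] := XU' n.
have sa : 0 < Num.sqrt a by rewrite sqrtr_gt0.
have saa : Num.sqrt a ^+ 2 = a by rewrite sqr_sqrtr// ltW.
have ND (f : R -> R[i]) : 0 <= L2norm L f := N_ge0 Si f.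
have NE (W : state R) : 0 <= energy_norm L a W := N_ge0 energy_semi_inner W.
have B m n : [/\ L2norm L (v m - v n) <= energy_norm L a (U m - U n),
    Num.sqrt a * L2norm L (wderiv L (u m) - wderiv L (u n)) <= energy_norm L a (U m - U n),
    L2norm L (z m - z n) <= energy_norm L a (U m - U n) &
    L2norm L (wderiv L (y m) - wderiv L (y n)) <= energy_norm L a (U m - U n)].
  have := energy_normB_sqr (XU' m) (XU' n); rewrite -!EU.
  move: (NE (U m - U n)) (ND (v m - v n)) (ND (wderiv L (u m) - wderiv L (u n)))
    (ND (z m - z n)) (ND (wderiv L (y m) - wderiv L (y n))).
  move: (energy_norm _ _ _) (L2norm L (v m - v n)) (L2norm L (wderiv L (u m) - wderiv L (u n)))
    (L2norm L (z m - z n)) (L2norm L (wderiv L (y m) - wderiv L (y n))) => E n1 n2 n3 n4 E0 h1 h2 h3 h4 H.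
  have sq (t : R) : 0 <= t -> t ^+ 2 <= E ^+ 2 -> t <= E by move=> t0; rewrite ler_pXn2r.
  have := sqr_ge0 n1; have := sqr_ge0 n3; have := sqr_ge0 n4; have := mulr_ge0 (ltW a0) (sqr_ge0 n2) => q2 q4 q3 q1.
  have h5 : 0 <= Num.sqrt a * n2 by exact: mulr_ge0 (ltW sa) h2.
  split; apply: sq => //; rewrite H; last by lra.
  - by lra.
  - by rewrite exprMn saa; lra.
  - by lra.
have [v' Lv' cv] := L2_complete L0 Lv (fun e e0 => let: ex_intro n0 H := cU e e0 in
  ex_intro _ n0 (fun m n mn nn => le_trans (let: And4 h _ _ _ := B m n in h) (H m n mn nn))).
have [z' Lz' cz] := L2_complete L0 Lz (fun e e0 => let: ex_intro n0 H := cU e e0 in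
  ex_intro _ n0 (fun m n mn nn => le_trans (let: And4 _ _ h _ := B m n in h) (H m n mn nn))).
have [y' Hy' cy] := H10_complete Hy (fun e e0 => let: ex_intro n0 H := cU e e0 in
  ex_intro _ n0 (fun m n mn nn => le_trans (let: And4 _ _ _ h := B m n in h) (H m n mn nn))).
have [|u' Hu' cu] := H10_complete Hu.
  move=> e e0; have [n0 H] := cU _ (mulr_gt0 sa e0); exists n0 => m n mn nn.
  by rewrite -(ler_pM2l sa); have [_ h _ _] := B m n; apply: le_trans h (H m n mn nn).
have XW : energy_space L (u', v', y', z') by split.
exists (u', v', y', z') => // e e0.
have e2 : 0 < e / 2 by rewrite divr_gt0.
have e3 : 0 < e / 2 / Num.sqrt a by rewrite divr_gt0.
have [n1 H1] := cu _ e3; have [n2 H2] := cv _ e2; have [n3 H3] := cy _ e2; have [n4 H4] := cz _ e2.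
exists (maxn (maxn n1 n2) (maxn n3 n4)) => n; rewrite !geq_max => /andP[/andP[k1 k2] /andP[k3 k4]].
rewrite -(@ler_pXn2r _ 2)// ?nnegrE ?NE ?(ltW e0)// EU (energy_normB_sqr (XU' n) XW).
have sq (t s : R) : 0 <= t -> t <= s -> t ^+ 2 <= s ^+ 2.
  by move=> t0 ts; rewrite ler_pXn2r// nnegrE (le_trans t0).
have b1 := sq _ _ (ND _) (H1 n k1); have b2 := sq _ _ (ND _) (H2 n k2).
have b3 := sq _ _ (ND _) (H3 n k3); have b4 := sq _ _ (ND _) (H4 n k4).
have b5 : a * L2norm L (wderiv L (u n) - wderiv L u') ^+ 2 <= (e / 2) ^+ 2.
  by apply: le_trans (ler_wpM2l (ltW a0) b1) _; rewrite [X in _ * X]expr_div_n saa mulrC divfK// gt_eqF.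
apply: le_trans (lerD (lerD (lerD b2 b5) b4) b3) _.
by rewrite le_eqVlt; apply/orP; left; apply/eqP; field.
Qed.

Variables b c d : R -> R.
Hypotheses (mb : measurable_fun [set: R] b) (mc : measurable_fun [set: R] c) (md : measurable_fun [set: R] d).

Lemma L2_bmul (k : R -> R) (M : R) f : measurable_fun [set: R] k -> (forall x, `|k x| <= M) -> L2 L f ->
  L2 L (fun x => (k x)%:C%C * f x).
Proof.
move=> mk Hk /L2P[f1 f2]; apply/L2P; split.
  by apply: rL2_eq (rL2_bmul mk Hk f1) => x; rewrite /cre ReM /= mul0r subr0.
by apply: rL2_eq (rL2_bmul mk Hk f2) => x; rewrite /cim ImM /= mul0r addr0.
Qed.

Lemma wave_operator_space M U : (forall x, `|c x| <= M) -> wave_domain L a b d U ->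
  energy_space L U /\ energy_space L (wave_operator L a b c d U).
Proof.
move=> Hc; case: U => [[[u v] y] z] [XU Hv Hz D1 D2]; split=> //.
have [Hu Lv Hy Lz] := XU; have [L1 _] := wderiv_spec D1; have [L2' _] := wderiv_spec D2.
have Lcz := L2_bmul mc Hc Lz; have Lcv := L2_bmul mc Hc Lv.
by split=> //; [exact: (XB Si L1 Lcz)|exact: (XD Si L2' Lcv)].
Qed.

End EnergySpace.

(** * From almost-everywhere equations to pointwise solutions *)

Section Component.
Context {R : realType}.
Notation mu := (@lebesgue_measure R).
Variables (L a lam M : R) (b c : R -> R).
Hypotheses (L0 : 0 < L) (a0 : 0 < a).
Hypotheses (mb : measurable_fun [set: R] b) (mc : measurable_fun [set: R] c).
Hypotheses (b_ge0 : forall x, 0 <= b x) (b_le : forall x, b x <= M) (c_le : forall x, `|c x| <= M).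
Let L0' := ltW L0.
Variables (u gu y gy gv p w r : R -> R[i]).
Let q x := a%:C%C * gu x + (b x)%:C%C * gv x.
Hypotheses (hu : h10 L u gu) (hy : h10 L y gy).
Hypotheses (Lgv : L2 L gv) (Lp : L2 L p) (Lw : L2 L w) (Lr : L2 L r).
Hypothesis Hp : aeq L p (fun x => (0 +i* lam)%C * gu x - gv x).
Hypothesis Wq : weak_derivative L q w.
Hypothesis Hw : aeq L w (fun x => - (lam ^+ 2)%:C%C * u x + (0 +i* lam)%C * ((c x)%:C%C * y x) - r x).

Let b_norm x : `|b x| <= M. Proof. by rewrite ger0_norm. Qed.

(** The inverse of |a + i lam b|^2, by which the derivative is solved from the flux. *)
Lemma measurable_quad_inv : measurable_fun [set: R] (fun x => (a ^+ 2 + lam ^+ 2 * b x ^+ 2)^-1).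
Proof.
have cq : continuous (fun t : R => (a ^+ 2 + lam ^+ 2 * t ^+ 2)^-1).
  move=> t; apply: cvgV.
    by rewrite gt_eqF// ltr_pwDl ?exprn_gt0// mulr_ge0 ?sqr_ge0.
  apply: cvgD; [exact: cvg_cst|apply: cvgM; [exact: cvg_cst|]].
  by rewrite expr2; under eq_fun do rewrite expr2; apply: cvgM; exact: cvg_id.
exact: (measurableT_comp (continuous_measurable_fun cq) mb).
Qed.

(** The weak formulation holds almost everywhere only, while [half_solution] asks for the flux
    relation at every point. So s is taken to be the absolutely continuous representative of the
    flux, and g is defined from s by the algebraic relation; it agrees with [gu] almost everywhere,
    hence has the same primitive. *)
Lemma component_half : exists U : half,
  [/\ hu1 U = cre (prim gu), hu2 U = cim (prim gu),
      itg 0 L (usq U) = L2norm L u ^+ 2, itg 0 L (gsq U) = L2norm L gu ^+ 2 &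
      forall Y S, hu1 Y = cre (prim gy) -> hu2 Y = cim (prim gy) ->
        L2norm L p ^+ 2 + L2norm L r ^+ 2 <= S ->
        itg 0 L (fun x => b x * (cre gv x ^+ 2 + cim gv x ^+ 2)) <= S ->
        half_solution L a lam b c S U Y].
Proof.
have [Lu Lgu ugu _] := hu; have [Ly Lgy ygy _] := hy.
have /L2P[gu1 gu2] := Lgu; have /L2P[gv1 gv2] := Lgv; have /L2P[p1 p2] := Lp.
have /L2P[w1 w2] := Lw; have /L2P[r1 r2] := Lr; have /L2P[u1 u2] := Lu.
have Lq : L2 L q by apply: L2_lin => //; exact: L2_bmul mb b_norm Lgv.
have [C HC] := prim_of_weak_derivative L0 Lq Lw Wq.
pose s x := C + prim w x.
pose D x := (a ^+ 2 + lam ^+ 2 * b x ^+ 2)^-1.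
have Dgt x : 0 < a ^+ 2 + lam ^+ 2 * b x ^+ 2 by rewrite ltr_pwDl ?exprn_gt0// mulr_ge0 ?sqr_ge0.
have Dne x : a ^+ 2 + lam ^+ 2 * b x ^+ 2 != 0 by rewrite gt_eqF.
have Dle x : `|D x| <= (a ^+ 2)^-1.
  rewrite ger0_norm ?invr_ge0 ?(ltW (Dgt x))// lef_pV2 ?posrE ?exprn_gt0//.
  by rewrite lerDl mulr_ge0 ?sqr_ge0.
pose A x := cre s x + b x * cre p x; pose B x := cim s x + b x * cim p x.
(* [g1] and [g2] are the real and imaginary parts of (s + b p) / (a + i lam b). *)
pose g1 x := D x * (a * A x + lam * (b x * B x)).
pose g2 x := D x * (a * B x + - lam * (b x * A x)).
have As1 : AC 0 L (cre s) (cre w).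
  have := AC_add (AC_cst 0 L (complex.Re C)) (AC_prim (Rintegrable_oc (rL2_integrable w1))).
  by apply: AC_eq => x _ _; rewrite ?add0r// /cre ReD.
have As2 : AC 0 L (cim s) (cim w).
  have := AC_add (AC_cst 0 L (complex.Im C)) (AC_prim (Rintegrable_oc (rL2_integrable w2))).
  by apply: AC_eq => x _ _; rewrite ?add0r// /cim ImD.
have rs1 := rL2_continuous (AC_within_continuous L0' As1).
have rs2 := rL2_continuous (AC_within_continuous L0' As2).
have rA : rL2 L A by apply: rL2_eq (rL2_lin 1 1 rs1 (rL2_bmul mb b_norm p1)) => x; rewrite !mul1r.
have rB : rL2 L B by apply: rL2_eq (rL2_lin 1 1 rs2 (rL2_bmul mb b_norm p2)) => x; rewrite !mul1r.
have rg1 : rL2 L g1.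
  exact: rL2_bmul measurable_quad_inv Dle (rL2_lin a lam rA (rL2_bmul mb b_norm rB)).
have rg2 : rL2 L g2.
  exact: rL2_bmul measurable_quad_inv Dle (rL2_lin a (- lam) rB (rL2_bmul mb b_norm rA)).
have aeg : {ae mu, forall x, `]0, L[%classic x -> cre gu x = g1 x /\ cim gu x = g2 x}.
  apply: ae_imp2 HC Hp => x H1 H2 Ix; have := H1 Ix; have := H2 Ix.
  rewrite /g1 /g2 /A /B /s /D /cre /cim /q.
  move: (Dne x) (p x) (C + prim w x) (gu x) (gv x) => dn [px1 px2] [sx1 sx2] [ux1 ux2] [vx1 vx2].
  move=> /eqP; rewrite eq_complex /= => /andP[/eqP -> /eqP ->].
  move=> /eqP; rewrite eq_complex /= => /andP[/eqP <- /eqP <-].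
  have den t : (a ^+ 2 + lam ^+ 2 * b x ^+ 2)^-1 * ((a ^+ 2 + lam ^+ 2 * b x ^+ 2) * t) = t by exact: mulKf.
  by split; [rewrite -[LHS]den|rewrite -[LHS]den]; congr (_ * _); ring.
have ae1 : {ae mu, forall x, `]0, L[%classic x -> cre gu x = g1 x} by apply: ae_imp aeg => x H /H[].
have ae2 : {ae mu, forall x, `]0, L[%classic x -> cim gu x = g2 x} by apply: ae_imp aeg => x H /H[].
have Ip := fun v (H : rL2 L v) => Rintegrable_oc (rL2_integrable H).
have Isq := fun v (H : rL2 L v) => Rintegrable_oc H.2.
have Au1 : AC 0 L (cre (prim gu)) g1 := AC_ae (AC_prim (Ip _ gu1)) (Ip _ rg1) ae1.
have Au2 : AC 0 L (cim (prim gu)) g2 := AC_ae (AC_prim (Ip _ gu2)) (Ip _ rg2) ae2.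
have ru1 := rL2_continuous (AC_within_continuous L0' Au1).
have ru2 := rL2_continuous (AC_within_continuous L0' Au2).
have /L2P[gy1 gy2] := Lgy.
have ry1 := rL2_continuous (AC_within_continuous L0' (AC_prim (Ip _ gy1))).
have ry2 := rL2_continuous (AC_within_continuous L0' (AC_prim (Ip _ gy2))).
have sq_ae (h k : R -> R) : rL2 L h -> rL2 L k -> {ae mu, forall x, `]0, L[%classic x -> h x = k x} ->
    itg 0 L (fun x => h x ^+ 2) = itg 0 L (fun x => k x ^+ 2).
  move=> rh rk hk; apply: (ae_itg (lexx 0) (lexx L) (Isq _ rh) (Isq _ rk)).
  by apply: ae_imp hk => x H Ix; rewrite H.
pose U := Half (cre (prim gu)) (cim (prim gu)) g1 g2 (cre s) (cim s) (cre p) (cim p) (cre r) (cim r).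
exists U; split=> //.
- rewrite L2norm_sqr// /usq itgD; [|exact: Isq ru1|exact: Isq ru2].
  by rewrite (sq_ae _ _ u1 ru1 (aeq_cre ugu)) (sq_ae _ _ u2 ru2 (aeq_cim ugu)).
- rewrite L2norm_sqr// /gsq itgD; [|exact: Isq rg1|exact: Isq rg2].
  by rewrite (sq_ae _ _ gu1 rg1 ae1) (sq_ae _ _ gu2 rg2 ae2).
move=> Y S EY1 EY2 HS1 HS2.
have IF : Rintegrable `[0, L] (forcing U).
  by apply: RintegrableD => //; [apply: RintegrableD => //; [apply: RintegrableD => //|]|];
    [exact: Isq p1|exact: Isq p2|exact: Isq r1|exact: Isq r2].
have rv1 : rL2 L (vx1 lam U) by apply: rL2_eq (rL2_lin (- lam) (-1) rg2 p1) => x; rewrite /vx1/=; ring.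
have rv2 : rL2 L (vx2 lam U) by apply: rL2_eq (rL2_lin lam (-1) rg1 p2) => x; rewrite /vx2/=; ring.
have bI h : Rintegrable `[0, L] h -> Rintegrable `[0, L] (fun x => b x * h x).
  move=> Ih; apply: (@Rintegrable_bmul _ _ _ _ M) => //; exact: (measurable_funS (E := setT)) mb.
have ID : Rintegrable `[0, L] (damping lam b U).
  by apply: bI; apply: RintegrableD => //; [exact: Isq rv1|exact: Isq rv2].
have ry1' : rL2 L (fun x => c x * hu1 Y x) by rewrite EY1; exact: rL2_bmul mc c_le ry1.
have ry2' : rL2 L (fun x => c x * hu2 Y x) by rewrite EY2; exact: rL2_bmul mc c_le ry2.
split=> //.
- apply: (AC_ae As1).
    apply: Ip; apply: rL2_eq (rL2_lin 1 (-1) (rL2_lin (- lam ^+ 2) (- lam) ru1 ry2') r1) => x.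
    by rewrite /U/=; ring.
  apply: ae_imp2 (ae_and Hw ugu) ygy => x [H1 H2] H3 Ix; have h1 := H1 Ix; have h2 := H2 Ix; have h3 := H3 Ix.
  rewrite /U /= EY2 /cre /cim h1 h2 h3; move: (prim gu x) (prim gy x) (r x) => [x1 x2] [x3 x4] [x5 x6] /=; ring.
- apply: (AC_ae As2).
    apply: Ip; apply: rL2_eq (rL2_lin 1 (-1) (rL2_lin (- lam ^+ 2) lam ru2 ry1') r2) => x.
    by rewrite /U/=; ring.
  apply: ae_imp2 (ae_and Hw ugu) ygy => x [H1 H2] H3 Ix; have h1 := H1 Ix; have h2 := H2 Ix; have h3 := H3 Ix.
  rewrite /U /= EY1 /cre /cim h1 h2 h3; move: (prim gu x) (prim gy x) (r x) => [x1 x2] [x3 x4] [x5 x6] /=; ring.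
- move=> x _ _; transitivity (D x * ((a ^+ 2 + lam ^+ 2 * b x ^+ 2) * A x) - b x * cre p x).
    by rewrite /D mulKf// /A addrK.
  by rewrite /vx1 /U /= /g1 /g2; move: (D x) (A x) (B x) => D1 A1 B1; ring.
- move=> x _ _; transitivity (D x * ((a ^+ 2 + lam ^+ 2 * b x ^+ 2) * B x) - b x * cim p x).
    by rewrite /D mulKf// /B addrK.
  by rewrite /vx2 /U /= /g1 /g2; move: (D x) (A x) (B x) => D1 A1 B1; ring.
- by rewrite /U /= /cre /prim /= itg1.
- by rewrite /U /= /cim /prim /= itg1.
- by rewrite /U /= /cre (h10_prim_end L0 hu).
- by rewrite /U /= /cim (h10_prim_end L0 hu).
- apply: le_trans HS1; rewrite !L2norm_sqr// -itgD; [|exact: Isq p1|exact: Isq p2].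
  rewrite -itgD; [|exact: Isq r1|exact: Isq r2].
  rewrite -itgD; [|by apply: RintegrableD => //; [exact: Isq p1|exact: Isq p2]
                  |by apply: RintegrableD => //; [exact: Isq r1|exact: Isq r2]].
  by rewrite le_eqVlt; apply/orP; left; apply/eqP; apply: eq_itg => x _ _; rewrite /forcing /U /=; ring.
- apply: le_trans HS2; rewrite le_eqVlt; apply/orP; left; apply/eqP.
  apply: (ae_itg (lexx 0) (lexx L) ID).
    by apply: bI; apply: RintegrableD => //; [exact: Isq gv1|exact: Isq gv2].
  apply: ae_imp2 Hp aeg => x H1 H2 Ix; have h1 := H1 Ix; have [h2 h3] := H2 Ix.
  rewrite /damping /vx1 /vx2 /U /= -h2 -h3 /cre /cim h1.
  by move: (gu x) (gv x) => [x1 x2] [x3 x4] /=; ring.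
Qed.

End Component.

(** * Integration by parts and the dissipation identity *)

Section Dissipation.
Context {R : realType}.
Notation mu := (@lebesgue_measure R).
Variables (L : R).
Hypothesis L0 : 0 < L.
Let L0' := ltW L0.
Let Si := L2_semi_inner L.
Implicit Types f g h : R -> R[i].

Definition rdot f g x := cre f x * cre g x + cim f x * cim g x.

Lemma rdot_integrable f g : L2 L f -> L2 L g -> Rintegrable `[0, L] (rdot f g).
Proof.
move=> /L2P[f1 f2] /L2P[g1 g2].
by apply: RintegrableD => //; apply: Rintegrable_oc; exact: rL2_mul.
Qed.

Lemma Re_l2ip f g : L2 L f -> L2 L g -> complex.Re (l2ip L f g) = itg 0 L (rdot f g).
Proof.
move=> Lf Lg; rewrite /l2ip cintegral_itg; last exact: L2_ip.
apply: eq_itg => x _ _; rewrite /rdot /cre /cim ReM.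
by case: (f x) (g x) => [f1 f2] [g1 g2] /=; ring.
Qed.

Lemma L2norm_rdot f : L2 L f -> L2norm L f ^+ 2 = itg 0 L (rdot f f).
Proof. by move=> Lf; rewrite (N_sqr Si Lf) -Re_l2ip. Qed.

Lemma ae_itg_rdot f f' g g' : L2 L f -> L2 L f' -> L2 L g -> L2 L g' -> aeq L f f' -> aeq L g g' ->
  itg 0 L (rdot f g) = itg 0 L (rdot f' g').
Proof.
move=> Lf Lf' Lg Lg' ff gg.
apply: (ae_itg (lexx 0) (lexx L) (rdot_integrable Lf Lg) (rdot_integrable Lf' Lg')).
by apply: ae_imp2 ff gg => x H1 H2 Ix; rewrite /rdot /cre /cim H1// H2.
Qed.

(** f is replaced by its absolutely continuous representative and g by the primitive of g', which
    vanishes at both ends and so removes the boundary terms. *)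
Lemma integration_by_parts f w g g' : L2 L f -> L2 L w -> weak_derivative L f w -> h10 L g g' ->
  itg 0 L (rdot w g) = - itg 0 L (rdot f g').
Proof.
move=> Lf Lw W hg; have [Lg Lg' gg' _] := hg.
have [C HC] := prim_of_weak_derivative L0 Lf Lw W.
pose s x := C + prim w x.
have [w1 w2] := L2_integrable Lw; have [g1 g2] := L2_integrable Lg'.
have As1 : AC 0 L (cre s) (cre w).
  have := AC_add (AC_cst 0 L (complex.Re C)) (AC_prim w1).
  by apply: AC_eq => x _ _; rewrite ?add0r// /cre ReD.
have As2 : AC 0 L (cim s) (cim w).
  have := AC_add (AC_cst 0 L (complex.Im C)) (AC_prim w2).
  by apply: AC_eq => x _ _; rewrite ?add0r// /cim ImD.
have Ls : L2 L s by apply/L2P; split; apply: rL2_continuous; [exact: (AC_within_continuous L0' As1)|exact: (AC_within_continuous L0' As2)].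
have [Lpg _] := prim_L2 L0 Lg'.
have [_ H] := AC_add (AC_mul L0' As1 (AC_prim g1)) (AC_mul L0' As2 (AC_prim g2)).
have e1 : itg 0 L (cre g') = 0 by have := h10_prim_end L0 hg => /eqP; rewrite eq_complex => /andP[/eqP].
have e2 : itg 0 L (cim g') = 0 by have := h10_prim_end L0 hg => /eqP; rewrite eq_complex => /andP[_ /eqP].
have := H 0 L (lexx _) L0' (lexx _); rewrite e1 e2 !itg1 !mulr0 addr0 subrr.
rewrite (@eq_itg _ _ _ _ (fun x => rdot w (prim g') x + rdot s g' x)); last first.
  by move=> x _ _; rewrite /rdot /cre /cim /=; ring.
rewrite itgD; [|exact: rdot_integrable|exact: rdot_integrable].
rewrite (ae_itg_rdot Lw Lw Lg Lpg (aeq_refl L w) gg') (ae_itg_rdot Lf Ls Lg' Lg' HC (aeq_refl L g')).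
by move=> /esym/eqP; rewrite addr_eq0 => /eqP.
Qed.

Lemma L2norm_bmul (k : R -> R) (M : R) f : measurable_fun [set: R] k -> (forall x, `|k x| <= M) -> L2 L f ->
  L2norm L (fun x => (k x)%:C%C * f x) ^+ 2 <= M ^+ 2 * L2norm L f ^+ 2.
Proof.
move=> mk Hk Lf; have Lkf := L2_bmul mk Hk Lf.
rewrite !L2norm_rdot// -itgZ; last exact: rdot_integrable.
apply: itg_le; [exact: rdot_integrable|by apply: RintegrableZ => //; exact: rdot_integrable|].
move=> x _ _; have M0 : 0 <= M := le_trans (normr_ge0 _) (Hk 0).
have kM : k x ^+ 2 <= M ^+ 2 by rewrite -[leLHS]real_normK ?num_real// ler_pXn2r ?nnegrE.
have -> : rdot (fun x => (k x)%:C%C * f x) (fun x => (k x)%:C%C * f x) x = k x ^+ 2 * rdot f f x.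
  by rewrite /rdot /cre /cim; case: (f x) => f1 f2 /=; ring.
by apply: ler_wpM2r => //; apply: addr_ge0; rewrite -expr2 sqr_ge0.
Qed.

Variables (a M : R) (b c d : R -> R).
Hypotheses (mb : measurable_fun [set: R] b) (mc : measurable_fun [set: R] c) (md : measurable_fun [set: R] d).
Hypotheses (b_le : forall x, `|b x| <= M) (c_le : forall x, `|c x| <= M) (d_le : forall x, `|d x| <= M).

Lemma flux_dissipation (k : R) (e : R -> R) gu v gv w : measurable_fun [set: R] e -> (forall x, `|e x| <= M) ->
  L2 L gu -> h10 L v gv -> L2 L w ->
  weak_derivative L (fun x => k%:C%C * gu x + (e x)%:C%C * gv x) w ->
  itg 0 L (rdot w v) + k * itg 0 L (rdot gv gu) = - itg 0 L (fun x => e x * (cre gv x ^+ 2 + cim gv x ^+ 2)).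
Proof.
move=> me He Lgu hv Lw W; have [_ Lgv _ _] := hv.
have Lq : L2 L (fun x => k%:C%C * gu x + (e x)%:C%C * gv x) by apply: L2_lin => //; exact: L2_bmul me He Lgv.
have Ie : Rintegrable `[0, L] (fun x => e x * rdot gv gv x).
  apply: (@Rintegrable_bmul _ _ _ _ M) => //; last exact: rdot_integrable.
  exact: (measurable_funS (E := setT)) me.
have Ik : Rintegrable `[0, L] (fun x => k * rdot gv gu x).
  by apply: RintegrableZ => //; exact: rdot_integrable.
rewrite (integration_by_parts Lq Lw W hv).
rewrite (@eq_itg _ _ _ (rdot _ gv) (fun x => k * rdot gv gu x + e x * rdot gv gv x)); last first.
  by move=> x _ _; rewrite /rdot /cre /cim; case: (gu x) (gv x) => [x1 x2] [x3 x4] /=; ring.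
rewrite itgD// itgZ; last exact: rdot_integrable.
by rewrite opprD addrAC addNr add0r.
Qed.

(** The left side is Re (A U, U). Integration by parts cancels the elastic terms against the
    potential energy, and the two coupling terms cancel because Re (z vbar) is symmetric; only the
    damping remains. *)
Lemma energy_dissipation gu v gv gy z gz w1 w2 :
  L2 L gu -> h10 L v gv -> L2 L gy -> h10 L z gz -> L2 L w1 -> L2 L w2 ->
  weak_derivative L (fun x => a%:C%C * gu x + (b x)%:C%C * gv x) w1 ->
  weak_derivative L (fun x => 1%:C%C * gy x + (d x)%:C%C * gz x) w2 ->
  complex.Re (l2ip L (fun x => w1 x - (c x)%:C%C * z x) v) + a * complex.Re (l2ip L gv gu) +
  complex.Re (l2ip L (fun x => w2 x + (c x)%:C%C * v x) z) + complex.Re (l2ip L gz gy) =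
  - (itg 0 L (fun x => b x * (cre gv x ^+ 2 + cim gv x ^+ 2)) + itg 0 L (fun x => d x * (cre gz x ^+ 2 + cim gz x ^+ 2))).
Proof.
move=> Lgu hv Lgy hz Lw1 Lw2 W1 W2; have [Lv Lgv _ _] := hv; have [Lz Lgz _ _] := hz.
have Lcz := L2_bmul mc c_le Lz; have Lcv := L2_bmul mc c_le Lv.
have D1 := flux_dissipation mb b_le Lgu hv Lw1 W1; have D2 := flux_dissipation md d_le Lgy hz Lw2 W2.
rewrite Re_l2ip//; last exact: (XB Si Lw1 Lcz).
rewrite Re_l2ip// Re_l2ip//; last exact: (XD Si Lw2 Lcv).
rewrite Re_l2ip//.
rewrite (@eq_itg _ _ _ _ (fun x => rdot w1 v x - rdot (fun x => (c x)%:C%C * z x) v x)); last first.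
  by move=> x _ _; rewrite /rdot /cre /cim ReB ImB; ring.
rewrite (@eq_itg _ _ _ (rdot (fun x => w2 x + _) z) (fun x => rdot w2 z x + rdot (fun x => (c x)%:C%C * z x) v x)); last first.
  move=> x _ _; rewrite /rdot /cre /cim ReD ImD; case: (v x) (z x) => [x1 x2] [x3 x4] /=; ring.
rewrite itgB; [|exact: rdot_integrable|exact: rdot_integrable].
have -> : itg 0 L (fun x => rdot w2 z x + rdot (fun x => (c x)%:C%C * z x) v x) =
    itg 0 L (rdot w2 z) + itg 0 L (rdot (fun x => (c x)%:C%C * z x) v).
  exact: itgD (rdot_integrable Lw2 Lz) (rdot_integrable Lcz Lv).
rewrite mul1r in D2; rewrite opprD -D1 -D2; ring.
Qed.

End Dissipation.

(** The mixed term is at most half of x^2 plus q^2 y^2 / 2, and half of x^2 is absorbed. *)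
Lemma sqr_le_of_quadratic (R : realFieldType) (x y p q : R) :
  x ^+ 2 <= p * y ^+ 2 + q * (y * x) -> x ^+ 2 <= (2 * p + q ^+ 2) * y ^+ 2.
Proof. by move=> H; have := sqr_ge0 (x - q * y); lra. Qed.

Lemma le_sqr_add1 (R : realFieldType) (x : R) : 0 <= x -> x <= (x + 1) ^+ 2.
Proof. by move=> x0; have := sqr_ge0 x; lra. Qed.

Lemma add_inv_weight_le (R : realFieldType) (a p q r s : R) : 0 < a -> 0 <= p -> 0 <= q -> 0 <= r -> 0 <= s ->
  p + q + r + s <= (1 + a^-1) * (r + a * p + s + q).
Proof.
move=> a0 p0 q0 r0 s0; have -> : (1 + a^-1) * (r + a * p + s + q) = p + q + r + s + (a * p + a^-1 * (r + s + q)).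
  by field; rewrite gt_eqF.
by rewrite lerDl addr_ge0// mulr_ge0 ?invr_ge0 ?addr_ge0// (ltW a0).
Qed.

(** * The resolvent bound of the wave operator *)

Section Resolvent.
Context {R : realType}.
Notation mu := (@lebesgue_measure R).
Variables (L a M lam C : R) (b c d : R -> R).
Hypotheses (L0 : 0 < L) (a0 : 0 < a) (C0 : 0 <= C).
Hypotheses (mb : measurable_fun [set: R] b) (mc : measurable_fun [set: R] c) (md : measurable_fun [set: R] d).
Hypotheses (b_ge0 : forall x, 0 <= b x) (b_le : forall x, b x <= M).
Hypotheses (d_ge0 : forall x, 0 <= d x) (d_le : forall x, d x <= M).
Hypothesis c_le : forall x, `|c x| <= M.
Hypothesis stable : forall S U Y, coupled_solution L a lam b c d S U Y ->
  itg 0 L (usq U) + itg 0 L (gsq U) + (itg 0 L (usq Y) + itg 0 L (gsq Y)) <= C * S.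
Let L0' := ltW L0.
Let Si := L2_semi_inner L.
Implicit Types f g h u v y z : R -> R[i].
Let k : R[i] := (0 +i* lam)%C.

Let sqrD_le (s t w : R) : 0 <= w -> w <= s + t -> w ^+ 2 <= 2 * (s ^+ 2 + t ^+ 2).
Proof.
move=> w0 H; have H1 : w ^+ 2 <= (s + t) ^+ 2 by rewrite ler_pXn2r ?nnegrE ?(le_trans w0).
by have := sqr_ge0 (s - t); lra.
Qed.

Lemma L2norm_sub_sqr_le f g : L2 L f -> L2 L g ->
  L2norm L (f - g) ^+ 2 <= 2 * (L2norm L f ^+ 2 + L2norm L g ^+ 2).
Proof. by move=> Lf Lg; exact: (sqrD_le (N_ge0 Si _) (NB Si Lf Lg)). Qed.

Lemma L2norm_add_sqr_le f g : L2 L f -> L2 L g ->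
  L2norm L (f + g) ^+ 2 <= 2 * (L2norm L f ^+ 2 + L2norm L g ^+ 2).
Proof. by move=> Lf Lg; exact: (sqrD_le (N_ge0 Si _) (ND Si Lf Lg)). Qed.

Lemma L2norm_k_sqr f : L2 L f -> L2norm L (k *: f) ^+ 2 = lam ^+ 2 * L2norm L f ^+ 2.
Proof. by move=> Lf; rewrite (NZ Si k Lf) exprMn normc_Re /= expr0n/= add0r. Qed.

Lemma h10_norm_sqr_le f g : h10 L f g -> L2norm L f ^+ 2 <= L ^+ 2 * L2norm L g ^+ 2.
Proof.
move=> [Lf Lg fg _]; have [Lp Hp] := prim_L2 L0 Lg.
rewrite (L2norm_ae Lf Lp fg) -exprMn ler_pXn2r ?nnegrE ?mulr_ge0 ?(N_ge0 Si)//.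
Qed.

(** [res1] bounds the data of the reduced second-order system by those of the resolvent equation;
    [res2] passes from the L^2 bounds of u, y and their derivatives back to the energy. *)
Definition res1 := 2 + 8 * (L ^+ 2 * lam ^+ 2 + 1 + L ^+ 2 * M ^+ 2).
Definition res2 := (2 * lam ^+ 2 + a + 1) * C.

(** The linear arithmetic of [state_estimate], on variables that stand for squared L^2 norms of the
    velocities, components, derivatives and data, and for the dissipation [D]. *)
Lemma state_estimate_arith (D nV nZ nu ny nGu nGy nP1 nP3 nR1 nR2 nF1 nF2 nF3 nF4 : R) :
  nu + nGu + (ny + nGy) <= C * (nP1 + nR1 + (nP3 + nR2) + D) ->
  nF1 <= L ^+ 2 * nP1 -> nF3 <= L ^+ 2 * nP3 ->
  nV <= 2 * (lam ^+ 2 * nu + nF1) -> nZ <= 2 * (lam ^+ 2 * ny + nF3) ->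
  nR1 <= 2 * (2 * (lam ^+ 2 * nF1 + nF2) + M ^+ 2 * nF3) ->
  nR2 <= 2 * (2 * (lam ^+ 2 * nF3 + nF4) + M ^+ 2 * nF1) ->
  0 <= D -> 0 <= nF1 -> 0 <= nF3 -> 0 <= nF2 -> 0 <= nF4 -> 0 <= nP1 -> 0 <= nP3 ->
  0 <= nu -> 0 <= ny -> 0 <= nGu -> 0 <= nGy ->
  nV + a * nGu + nZ + nGy <= res2 * (res1 * ((1 + a^-1) * (nF2 + a * nP1 + nF4 + nP3)) + D)
    + 4 * L ^+ 2 * ((1 + a^-1) * (nF2 + a * nP1 + nF4 + nP3)).
Proof.
move=> HS n1 n3 nv nz nr1 nr2 diss0 g1 g2 g3 g4 g5 g6 g7 g8 g9 g10.
pose NF := (1 + a^-1) * (nF2 + a * nP1 + nF4 + nP3).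
have m1 : nP1 + nP3 + nF2 + nF4 <= NF by exact: add_inv_weight_le.
have m2 : 0 <= NF by apply: le_trans m1; rewrite !addr_ge0.
have m3 : nP1 + nP3 <= NF by apply: le_trans m1; rewrite -[leRHS]addrA lerDl addr_ge0.
have l2 : 0 <= lam ^+ 2 := sqr_ge0 _; have M2 : 0 <= M ^+ 2 := sqr_ge0 _; have LL2 : 0 <= L ^+ 2 := sqr_ge0 _.
have c1 : nF1 + nF3 <= L ^+ 2 * NF by have := ler_wpM2l LL2 m3; lra.
have c2 := ler_wpM2l l2 c1; have c3 := ler_wpM2l M2 c1.
have SS : nP1 + nR1 + (nP3 + nR2) + D <= res1 * NF + D.
  rewrite lerD2r /res1.
  have t1 : 0 <= lam ^+ 2 * (L ^+ 2 * NF) by rewrite mulr_ge0// mulr_ge0.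
  have t2 : 0 <= M ^+ 2 * (L ^+ 2 * NF) by rewrite mulr_ge0// mulr_ge0.
  lra.
have H2 := le_trans HS (ler_wpM2l C0 SS).
have K0 : 0 <= 2 * lam ^+ 2 + a + 1 by apply: addr_ge0 => //; apply: addr_ge0; [exact: mulr_ge0|exact: ltW].
have H3 := ler_wpM2l K0 H2; rewrite mulrA -/res2 in H3.
have ag : 0 <= a * (nu + ny + nGy) by rewrite mulr_ge0 ?(ltW a0) ?addr_ge0.
have lg : 0 <= lam ^+ 2 * (nGu + nGy) by rewrite mulr_ge0 ?addr_ge0.
rewrite -/NF; apply: le_trans (lerD H3 (lexx _)); lra.
Qed.

Section Estimate.
Variables (u gu v gv y gy z gz f1 p1 f2 f3 p3 f4 w1 w2 : R -> R[i]).
Hypotheses (hu : h10 L u gu) (hv : h10 L v gv) (hy : h10 L y gy) (hz : h10 L z gz).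
Hypotheses (h1 : h10 L f1 p1) (h3 : h10 L f3 p3).
Hypotheses (L2f : L2 L f2) (L4f : L2 L f4) (Lw1 : L2 L w1) (Lw2 : L2 L w2).
Hypothesis W1 : weak_derivative L (fun x => a%:C%C * gu x + (b x)%:C%C * gv x) w1.
Hypothesis W2 : weak_derivative L (fun x => 1%:C%C * gy x + (d x)%:C%C * gz x) w2.
Hypothesis E1 : forall x, f1 x = k * u x - v x.
Hypothesis E2 : forall x, f2 x = k * v x - (w1 x - (c x)%:C%C * z x).
Hypothesis E3 : forall x, f3 x = k * y x - z x.
Hypothesis E4 : forall x, f4 x = k * z x - (w2 x + (c x)%:C%C * v x).
Hypothesis P1 : aeq L p1 (fun x => k * gu x - gv x).
Hypothesis P3 : aeq L p3 (fun x => k * gy x - gz x).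

Let diss := itg 0 L (fun x => b x * (cre gv x ^+ 2 + cim gv x ^+ 2)) +
  itg 0 L (fun x => d x * (cre gz x ^+ 2 + cim gz x ^+ 2)).
Let NU2 := L2norm L v ^+ 2 + a * L2norm L gu ^+ 2 + L2norm L z ^+ 2 + L2norm L gy ^+ 2.
Let NF2 := L2norm L f2 ^+ 2 + a * L2norm L p1 ^+ 2 + L2norm L f4 ^+ 2 + L2norm L p3 ^+ 2.

(** The velocities are eliminated through v = i lam u - f1 and z = i lam y - f3. This leaves the
    second-order system for u and y with the data r1 = i lam f1 + f2 + c f3 and r2 = i lam f3 + f4 -
    c f1, to which the stability estimate applies. *)
Lemma state_estimate : NU2 <= res2 * (res1 * ((1 + a^-1) * NF2) + diss) + 4 * L ^+ 2 * ((1 + a^-1) * NF2).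
Proof.
have [Lu Lgu _ _] := hu; have [Lv Lgv _ _] := hv; have [Ly Lgy _ _] := hy; have [Lz Lgz _ _] := hz.
have [L1f Lp1 _ _] := h1; have [L3f Lp3 _ _] := h3.
have Lk f : L2 L f -> L2 L (k *: f) := fun H => XZ Si k H.
pose cf f x := (c x)%:C%C * f x.
have Lc f : L2 L f -> L2 L (cf f) := fun H => L2_bmul mc c_le H.
have Nc f : L2 L f -> L2norm L (cf f) ^+ 2 <= M ^+ 2 * L2norm L f ^+ 2 := fun H => L2norm_bmul mc c_le H.
pose r1 := (k *: f1 + f2) + cf f3; pose r2 := (k *: f3 + f4) - cf f1.
have Lr1 : L2 L r1 := XD Si (XD Si (Lk _ L1f) L2f) (Lc _ L3f).
have Lr2 : L2 L r2 := XB Si (XD Si (Lk _ L3f) L4f) (Lc _ L1f).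
have kk (t : R[i]) : k * (k * t) = - (lam ^+ 2)%:C%C * t.
  by rewrite /k; case: t => t1 t2; apply/eqP; rewrite eq_complex /=; apply/andP; split; apply/eqP; ring.
have Hw1 : aeq L w1 (fun x => - (lam ^+ 2)%:C%C * u x + (0 +i* lam)%C * ((c x)%:C%C * y x) - r1 x).
  have : {ae mu, forall x : R, True} by exists set0; split=> // x /=; case.
  apply: ae_imp => x _ _; rewrite -kk -[r1 x]/(k * f1 x + f2 x + (c x)%:C%C * f3 x) E2 E1 E3 -/k; ring.
have Hw2 : aeq L w2 (fun x => - (lam ^+ 2)%:C%C * y x + (0 +i* lam)%C * ((- c x)%:C%C * u x) - r2 x).
  have : {ae mu, forall x : R, True} by exists set0; split=> // x /=; case.
  apply: ae_imp => x _ _; rewrite -kk -[r2 x]/(k * f3 x + f4 x - (c x)%:C%C * f1 x) E4 E1 E3 -/k.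
  by rewrite (_ : (- c x)%:C%C = - (c x)%:C%C); [ring|apply/eqP; rewrite eq_complex /= oppr0 !eqxx].
have mc' : measurable_fun [set: R] (fun x => - c x) by exact: measurableT_comp.
have c_le' x : `|- c x| <= M by rewrite normrN.
have [U [U1 U2 Uu Ug HU]] := component_half L0 a0 mb mc b_ge0 b_le c_le hu hy Lgv Lp1 Lw1 Lr1 P1 W1 Hw1.
have [Y [Y1 Y2 Yu Yg HY]] := component_half L0 ltr01 md mc' d_ge0 d_le c_le' hy hu Lgz Lp3 Lw2 Lr2 P3 W2 Hw2.
have Q (f : R -> R[i]) : 0 <= L2norm L f ^+ 2 := sqr_ge0 _.
have D1 : 0 <= itg 0 L (fun x => b x * (cre gv x ^+ 2 + cim gv x ^+ 2)).
  by apply: itg_ge0 => x _ _; rewrite mulr_ge0// addr_ge0 ?sqr_ge0.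
have D2 : 0 <= itg 0 L (fun x => d x * (cre gz x ^+ 2 + cim gz x ^+ 2)).
  by apply: itg_ge0 => x _ _; rewrite mulr_ge0// addr_ge0 ?sqr_ge0.
pose S := L2norm L p1 ^+ 2 + L2norm L r1 ^+ 2 + (L2norm L p3 ^+ 2 + L2norm L r2 ^+ 2) + diss.
have sol : coupled_solution L a lam b c d S U Y.
  have qq1 := Q p1; have qq2 := Q p3; have qq3 := Q r1; have qq4 := Q r2.
  split; [apply: HU|apply: HY] => //; rewrite /S /diss; move: D1 D2 qq1 qq2 qq3 qq4;
    move: (itg 0 L (fun x => b x * _)) (itg 0 L (fun x => d x * _)) (L2norm L p1 ^+ 2) (L2norm L p3 ^+ 2)
     (L2norm L r1 ^+ 2) (L2norm L r2 ^+ 2) => t1 t2 t3 t4 t5 t6 *; lra.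
have HS := stable sol; rewrite Uu Ug Yu Yg in HS.
have n1 := h10_norm_sqr_le h1; have n3 := h10_norm_sqr_le h3.
have nv : L2norm L v ^+ 2 <= 2 * (lam ^+ 2 * L2norm L u ^+ 2 + L2norm L f1 ^+ 2).
  rewrite -(L2norm_k_sqr Lu); have -> : v = k *: u - f1.
    by apply/funext => x; rewrite -[RHS]/(k * u x - f1 x) E1; ring.
  exact: L2norm_sub_sqr_le (Lk _ Lu) L1f.
have nz : L2norm L z ^+ 2 <= 2 * (lam ^+ 2 * L2norm L y ^+ 2 + L2norm L f3 ^+ 2).
  rewrite -(L2norm_k_sqr Ly); have -> : z = k *: y - f3.
    by apply/funext => x; rewrite -[RHS]/(k * y x - f3 x) E3; ring.
  exact: L2norm_sub_sqr_le (Lk _ Ly) L3f.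
have nr1 : L2norm L r1 ^+ 2 <= 2 * (2 * (lam ^+ 2 * L2norm L f1 ^+ 2 + L2norm L f2 ^+ 2) + M ^+ 2 * L2norm L f3 ^+ 2).
  apply: le_trans (L2norm_add_sqr_le (XD Si (Lk _ L1f) L2f) (Lc _ L3f)) _; apply: ler_wpM2l => //.
  apply: lerD; last exact: Nc.
  by rewrite -(L2norm_k_sqr L1f); exact: L2norm_add_sqr_le (Lk _ L1f) L2f.
have nr2 : L2norm L r2 ^+ 2 <= 2 * (2 * (lam ^+ 2 * L2norm L f3 ^+ 2 + L2norm L f4 ^+ 2) + M ^+ 2 * L2norm L f1 ^+ 2).
  apply: le_trans (L2norm_sub_sqr_le (XD Si (Lk _ L3f) L4f) (Lc _ L1f)) _; apply: ler_wpM2l => //.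
  apply: lerD; last exact: Nc.
  by rewrite -(L2norm_k_sqr L3f); exact: L2norm_add_sqr_le (Lk _ L3f) L4f.
have diss0 : 0 <= diss by exact: addr_ge0.
exact: (state_estimate_arith HS n1 n3 nv nz nr1 nr2 diss0 (Q f1) (Q f3) (Q f2) (Q f4)
  (Q p1) (Q p3) (Q u) (Q y) (Q gu) (Q gy)).
Qed.

End Estimate.

(** One more than the constant that bounds the squared norms: since x <= (x + 1)^2 for x >= 0, no
    square root is needed in the bound of the norms. *)
Definition resC := 2 * (res2 * res1 * (1 + a^-1) + 4 * L ^+ 2 * (1 + a^-1)) + res2 ^+ 2 + 1.

(** The dissipation in [state_estimate] is bounded by the product of the norms of F = i lam U - A U
    and U. The squared norm of U is then at most quadratic in the two norms, with the mixed term
    absorbed. *)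
Lemma resolvent_bound_wave : resolvent_bound (energy_norm L a) (wave_domain L a b d) (wave_operator L a b c d) lam resC.
Proof.
move=> U DU; have Ei := energy_semi_inner L0 a0.
have [XU XAU] := wave_operator_space mc c_le DU.
have XF := XB Ei (XZ Ei k XU) XAU.
case: U DU XU XAU XF => [[[u v] y] z] DU XU XAU XF.
have [_ Hv Hz D1 D2] := DU; have [Hu Lv Hy Lz] := XU.
have [Lw1 W1] := wderiv_spec D1; have [Lw2 W2] := wderiv_spec D2.
set w1 := wderiv L (flux1 L a b u v) in Lw1 W1; set w2 := wderiv L (flux2 L d y z) in Lw2 W2.
pose f2 x := k * v x - (w1 x - (c x)%:C%C * z x).
pose f4 x := k * z x - (w2 x + (c x)%:C%C * v x).
have EF : k *: ((u, v, y, z) : state R) - wave_operator L a b c d (u, v, y, z) = (k *: u - v, f2, k *: y - z, f4) by [].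
rewrite EF in XF *; have [Hf1 L2f Hf3 L4f] := XF.
have W2' : weak_derivative L (fun x => 1%:C%C * wderiv L y x + (d x)%:C%C * wderiv L z x) w2.
  by rewrite (_ : (fun x => 1%:C%C * wderiv L y x + (d x)%:C%C * wderiv L z x) = flux2 L d y z)//;
    apply/funext => x; rewrite /flux2 mul1r.
have P f g : H10 L f -> H10 L g -> aeq L (wderiv L (k *: f - g)) (fun x => k * wderiv L f x - wderiv L g x).
  move=> Hf Hg; have [Hfg afg] := H10_lin L0 k Hf Hg.
  (* [H10_lin] covers k f + g, so the difference k f - g is reached by subtracting 2 g from it. *)
  have [H2 a2] := H10_lin L0 (- 2%:R) Hg Hfg.
  have -> : k *: f - g = (fun x => - 2%:R * g x + (k * f x + g x)).
    by apply/funext => x; rewrite -[LHS]/(k * f x - g x); ring.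
  by apply: ae_imp2 a2 afg => x h1 h2 Ix; rewrite (h1 Ix) (h2 Ix); ring.
have h1 := h10_of_H10 L0 Hf1; have h3 := h10_of_H10 L0 Hf3.
have hu := h10_of_H10 L0 Hu; have hv := h10_of_H10 L0 Hv; have hy := h10_of_H10 L0 Hy; have hz := h10_of_H10 L0 Hz.
have est := @state_estimate u (wderiv L u) v (wderiv L v) y (wderiv L y) z (wderiv L z) (k *: u - v) (wderiv L (k *: u - v))
  f2 (k *: y - z) (wderiv L (k *: y - z)) f4 w1 w2 hu hv hy hz h1 h3 L2f L4f Lw1 Lw2 W1 W2'
  (fun=> erefl) (fun=> erefl) (fun=> erefl) (fun=> erefl) (P _ _ Hu Hv) (P _ _ Hy Hz).
have NU := energy_norm_sqr L0 a0 XU; have NF := energy_norm_sqr L0 a0 XF.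
have b_le' x : `|b x| <= M by rewrite ger0_norm.
have d_le' x : `|d x| <= M by rewrite ger0_norm.
have [_ Lgu _ _] := hu; have [_ Lgy _ _] := hy.
have dis := energy_dissipation L0 mb mc md b_le' c_le d_le' Lgu hv Lgy hz Lw1 Lw2 W1 W2'.
set diss := itg 0 L _ + itg 0 L _ in est dis.
(* Re (i lam U, U) = 0, because Hermitian symmetry makes (U, U) real; so Re (F, U) is the
   dissipation, and Cauchy-Schwarz applies. *)
have CS : diss <= energy_norm L a (k *: u - v, f2, k *: y - z, f4) * energy_norm L a (u, v, y, z).
  apply: le_trans _ (N_CS Ei XF XU); rewrite -EF.
  have XkU := XZ Ei k XU.
  rewrite (si_ipl Ei k XU (XN Ei XAU) XU) -scaleN1r (ipZl Ei (-1) XAU XU).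
  have sym := si_ipC Ei XU XU.
  have dis' : complex.Re (energy_inner L a (wave_operator L a b c d (u, v, y, z)) (u, v, y, z)) = - diss.
    by rewrite -dis /wave_operator energy_innerE !ReD ReZ.
  move: dis' sym; move: (energy_inner L a (wave_operator _ _ _ _ _ _) _) (energy_inner L a (u, v, y, z) (u, v, y, z)).
  move=> [r1 r2] [s1 s2] /= dis' /eqP; rewrite eq_complex /= => /andP[_ /eqP s20].
  have s0 : s2 = 0 by move/eqP: s20; rewrite -subr_eq0 opprK -mulr2n mulrn_eq0 /= => /eqP.
  by rewrite dis' s0 mulr0 ?mul0r ?oppr0 ?mul0r ?subr0 ?oppr0 ?addr0 ?add0r mulN1r opprK.
clear dis; move: est CS; rewrite -NU -NF.
have : 0 <= energy_norm L a (u, v, y, z) := N_ge0 Ei _.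
have : 0 <= energy_norm L a (k *: u - v, f2, k *: y - z, f4) := N_ge0 Ei _.
move: diss (energy_norm L a (u, v, y, z)) (energy_norm L a (k *: u - v, f2, k *: y - z, f4)) => D nU nF F0 U0 est CS.
have ai : 0 < a^-1 by rewrite invr_gt0.
have r20 : 0 <= res2.
  by apply: mulr_ge0 => //; apply: addr_ge0 => //; apply: addr_ge0; [apply: mulr_ge0 => //; exact: sqr_ge0|exact: ltW].
have q0 (t s : R) : 0 <= t ^+ 2 * s ^+ 2 by apply: mulr_ge0; exact: sqr_ge0.
have r10 : 0 <= res1.
  by apply: addr_ge0 => //; apply: mulr_ge0 => //; apply: addr_ge0 => //; apply: addr_ge0.
pose P0 := res2 * res1 * (1 + a^-1) + 4 * L ^+ 2 * (1 + a^-1).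
have P00 : 0 <= P0.
  have h : 0 <= 1 + a^-1 by apply: addr_ge0 => //; exact: ltW.
  by apply: addr_ge0; apply: mulr_ge0 => //; apply: mulr_ge0 => //; exact: sqr_ge0.
have c1 : res2 * D <= res2 * (nF * nU) by exact: ler_wpM2l.
have c2 : nU ^+ 2 <= P0 * nF ^+ 2 + res2 * (nF * nU).
  refine (le_trans est _); rewrite /P0 [res2 * (_ + D)]mulrDr; move: c1; move: (res2 * D) (res2 * (nF * nU)) => e1 e2 c1.
  by rewrite -subr_ge0 (_ : _ - _ = e2 - e1) ?subr_ge0//; ring.
have c3 : nU ^+ 2 <= (2 * P0 + res2 ^+ 2) * nF ^+ 2 by exact: sqr_le_of_quadratic.
have rC : resC = 2 * P0 + res2 ^+ 2 + 1 by [].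
rewrite -(@ler_pXn2r _ 2)// ?nnegrE ?mulr_ge0// rC.
  have e0 : 0 <= 2 * P0 + res2 ^+ 2 by apply: addr_ge0; [exact: mulr_ge0|exact: sqr_ge0].
  apply: le_trans c3 _; rewrite [leRHS]exprMn; apply: ler_wpM2r; first exact: sqr_ge0.
  exact: le_sqr_add1.
by apply: addr_ge0 => //; apply: addr_ge0; [exact: mulr_ge0|exact: sqr_ge0].
Qed.

End Resolvent.

Theorem theorem2p3 (R : realType) (L a b0 c0 d0 b1 b2 c1 c2 d1 d2 : R)
    (b c d : R -> R) (T : R -> state R -> state R)
    (L_gt0 : 0 < L) (a_gt0 : 0 < a)
    (b0_gt0 : 0 < b0) (c0_neq0 : c0 != 0) (d0_gt0 : 0 < d0)
    (cases : [\/ SSC1 L a b c d b0 c0 d0 b1 b2 c1 c2 d1 d2,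
                 caseC2 L b c d b0 c0 d0 b1 b2 c1 c2 d1 d2 |
                 SSC3 L a b c d b0 c0 b1 b2 c1 c2])
    (T_sg : C0_semigroup_of_contractions
              (energy_space (R := R) L) (energy_norm L a) T)
    (T_gen : generated_by (energy_space (R := R) L) (energy_norm L a) T
               (wave_domain L a b d) (wave_operator L a b c d)) :
  strongly_stable (energy_space (R := R) L) (energy_norm L a) T.
Proof.
have [[[Mb Hb] [Mc Hc] [Md Hd]] [mb mc md]] := admissible_coefs_of_cases b0_gt0 d0_gt0 cases.
apply: (strongly_stable_of_resolvent_bounds (energy_semi_inner L_gt0 a_gt0) T_sg T_gen).
- by move=> U /(wave_operator_space mc Hc)[].
- by move=> U /(wave_operator_space mc Hc)[].
- exact: energy_complete.
move=> lam; have [C C0 HC] := L2_stable_of_cases L_gt0 a_gt0 b0_gt0 c0_neq0 d0_gt0 cases lam.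
pose M := `|Mb| + `|Mc| + `|Md|.
have hM : [/\ Mb <= M, Mc <= M & Md <= M].
  have := ler_norm Mb; have := ler_norm Mc; have := ler_norm Md.
  have := normr_ge0 Mb; have := normr_ge0 Mc; have := normr_ge0 Md.
  by rewrite /M; split; lra.
have [hb hc hd] := hM.
exists (resC L a M lam C); apply: resolvent_bound_wave => //.
- by move=> x; case/andP: (Hb x).
- by move=> x; case/andP: (Hb x) => _ /le_trans; apply.
- by move=> x; case/andP: (Hd x).
- by move=> x; case/andP: (Hd x) => _ /le_trans; apply.
- by move=> x; exact: le_trans (Hc x) hc.
Qed.
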